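(* Let $H\in\mathcal C[0,\infty)$, and assume that the half line $m$ function of $H$ has a holomorphic continuation to a neighborhood of $z=\infty$ with values in $\overline{\mathbb C^+}$, that is, there are $r>0$ and a holomorphic function $M:\{w\in\mathbb C:|w|<r\}\to\overline{\mathbb C^+}$ such that $m_+(z;H)=M(-1/z)$ for all $z\in\mathbb C^+$ with $|z|>1/r$. Then either $H\equiv P_\alpha$ on $[0,\infty)$ for some $\alpha\in[0,\pi)$, or $\det H(x)=1$ for all $x\ge 0$, for a suitably normalized version of $H$. In the second case, this version $H(x)$, $x\ge 0$, has the following additional properties. $H(x)$ is real analytic; more precisely, there is an $h>0$ such that $H$ has a holomorphic continuation $H(z)$ to $$\{z\in\mathbb C: |z-x|<h \text{ for some } x>0\}.$$ Moreover, there is a constant $C>0$ such that $$\|H^{-1/2}(x)H'(x)H^{-1/2}(x)\|\le C\quad\text{for all } x\ge 0 .$$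
   Context: $\mathbb C^{+}=\{z\in\mathbb C:\operatorname{Im} z>0\}$, $\overline{\mathbb C^+}=\mathbb C^+\cup\mathbb R\cup\{\infty\}$ (a subset of the Riemann sphere $\mathbb C_\infty$). A canonical system on $[0,\infty)$ is an equation $Ju'(x)=-zH(x)u(x)$, $J=\begin{pmatrix}0&-1\\1&0\end{pmatrix}$, with $H(x)\in\mathbb R^{2\times2}$ locally integrable, $H(x)\ge 0$ (symmetric positive semidefinite), normalized by $\operatorname{tr}H(x)=1$. $\mathcal C[0,\infty)$ denotes the collection of canonical systems on $[0,\infty)$. Coefficient functions that are equal almost everywhere are identified. Other normalizations are also allowed: a change of variable replaces $H$ by $\phi'(x)H(\phi(x))$, with $\phi$ an increasing bijection of $[0,\infty)$, $\phi$ and $\phi^{-1}$ locally absolutely continuous; this does not change the $m$ function, and differently normalized coefficient functions with the same $m$ function are viewed as versions of the same element of $\mathcal C[0,\infty)$. For $z\in\mathbb C^+$, let $f_+(\cdot,z)$ be the (unique up to a constant factor) nontrivial solution of the canonical system with $\int_0^\infty f_+^*Hf_+\,dx<\infty$. The half line $m$ function is $m_+(z;H)=f_+(0,z)$, where a vector $(f_1,f_2)^t\in\mathbb C^2\setminus\{0\}$ is identified with the point $f_1/f_2\in\mathbb C_\infty$. It is a holomorphic map $\mathbb C^+\to\overline{\mathbb C^+}$. $P_\alpha$ denotes the orthogonal projection of $\mathbb R^2$ onto the span of $e_\alpha=(\cos\alpha,\sin\alpha)^t$. $\|\cdot\|$ is the operator norm. *)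

(* Defs.v *)
From HB Require Import structures.
From mathcomp Require Import all_boot all_order all_algebra.
From mathcomp Require Import complex.
From mathcomp Require Import all_classical all_reals all_analysis.

Set Implicit Arguments.
Unset Strict Implicit.
Unset Printing Implicit Defensive.

Import Order.TTheory GRing.Theory Num.Theory.
Import numFieldNormedType.Exports.

Local Open Scope classical_set_scope.
Local Open Scope ring_scope.
Local Open Scope complex_scope.

(* The topology and norm of R[i] are those of the library on the numFieldType
   R[i], given by `|z|; the library only puts them on the regular algebra. *)
HB.instance Definition _ (R : realType) := PseudoPointedMetric.copy R[i] R[i]^o.
HB.instance Definition _ (R : realType) := GRing.ComAlgebra.copy R[i] R[i]^o.
HB.instance Definition _ (R : realType) := Vector.copy R[i] R[i]^o.
HB.instance Definition _ (R : realType) := NormedModule.copy R[i] R[i]^o.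

(* A function on the half line [0, oo) is represented by a function on R whose
   values at negative arguments are irrelevant: every definition below only
   looks at its values on [0, oo). *)

(** * Absolute continuity *)

(* [s] lists the end points of finitely many subintervals [p.1, p.2]. *)
Definition abs_continuous_on (R : realType) (a b : R) (f : R -> R) : Prop :=
  forall e : R, 0 < e -> exists2 d : R, 0 < d &
    forall s : seq (R * R),
      (forall p, p \in s -> a <= p.1 /\ p.1 <= p.2 /\ p.2 <= b) ->
      pairwise (fun p q => (p.2 <= q.1) || (q.2 <= p.1)) s ->
      \sum_(p <- s) (p.2 - p.1) < d ->
      \sum_(p <- s) `|f p.2 - f p.1| < e.

Definition loc_abs_continuous (R : realType) (f : R -> R) : Prop :=
  forall L : R, 0 < L -> abs_continuous_on 0 L f.

(** * Canonical systems on the half line *)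

Definition psdmx (R : realType) n (A : 'M[R]_n) : Prop :=
  A^T = A /\ forall v : 'cV[R]_n, 0 <= (v^T *m A *m v) 0 0.

Definition canonical_system (R : realType) (H : R -> 'M[R]_2) : Prop :=
  [/\ forall (i j : 'I_2) (L : R),
        (@lebesgue_measure R).-integrable `[0, L] (fun x : R => (H x i j)%:E),
      {ae @lebesgue_measure R, forall x : R, 0 <= x -> psdmx (H x)} &
      {ae @lebesgue_measure R, forall x : R, 0 <= x -> \tr (H x) = 1}].

Definition Jmx (R : realType) : 'M[R[i]]_2 :=
  block_mx 0 (- 1%:M) 1%:M 0 : 'M[R[i]]_(1 + 1).

Definition toC (R : realType) n (A : 'M[R]_n) : 'M[R[i]]_n :=
  map_mx (fun t : R => t%:C) A.

(* [v] is the derivative at [x] of the vector function [u] of a real variable. *)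
Definition is_cvderive (R : realType) (u : R -> 'cV[R[i]]_2) (x : R)
    (v : 'cV[R[i]]_2) : Prop :=
  forall k : 'I_2,
    is_derive x (1 : R) (fun t => complex.Re (u t k 0)) (complex.Re (v k 0)) /\
    is_derive x (1 : R) (fun t => complex.Im (u t k 0)) (complex.Im (v k 0)).

Definition is_solution (R : realType) (H : R -> 'M[R]_2) (z : R[i])
    (u : R -> 'cV[R[i]]_2) : Prop :=
  (forall k : 'I_2, loc_abs_continuous (fun t => complex.Re (u t k 0)) /\
                    loc_abs_continuous (fun t => complex.Im (u t k 0))) /\
  {ae @lebesgue_measure R, forall x : R, 0 < x ->
     exists2 v, is_cvderive u x v &
       Jmx R *m v = - z *: (toC (H x) *m u x)}.

(* The integrand u^* H u is real and nonnegative almost everywhere. *)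
Definition sqnormH (R : realType) (H : R -> 'M[R]_2) (u : R -> 'cV[R[i]]_2)
    : \bar R :=
  (\int[@lebesgue_measure R]_(x in `[0%R, +oo[)
     (complex.Re (((map_mx conjc (u x))^T *m toC (H x) *m u x) 0 0))%:E)%E.

(** * The Riemann sphere and the m function *)

(* [None] is the point at infinity. *)
Definition sphere (R : realType) : Type := one_point_compactification R[i].

Definition sphere_pt (R : realType) (v : 'cV[R[i]]_2) : sphere R :=
  if v 1 0 == 0 then None else Some (v 0 0 / v 1 0).

Definition sphere_inv (R : realType) (p : sphere R) : sphere R :=
  if p is Some z then (if z == 0 then None else Some z^-1) else Some 0.

Definition closed_upper (R : realType) (p : sphere R) : Prop :=
  if p is Some z then 0 <= complex.Im z else True.

(* [is_mplus H z p] reads m_+(z; H) = p.  It is stated as a relation because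
   m_+(z; H) is specified by a solution f_+ of which the existence, and the
   uniqueness up to a constant factor, are theorems. *)
Definition is_mplus (R : realType) (H : R -> 'M[R]_2) (z : R[i])
    (p : sphere R) : Prop :=
  exists f : R -> 'cV[R[i]]_2,
    [/\ is_solution H z f,
        exists2 x : R, 0 <= x & f x != 0,
        (sqnormH H f < +oo)%E &
        p = sphere_pt (f 0)].

(* Near [w], the map is holomorphic in one of the charts p, 1/p. *)
Definition sphere_holomorphic_at (R : realType) (M : R[i] -> sphere R)
    (w : R[i]) : Prop :=
  exists2 f : R[i] -> R[i],
    (\forall v \near w, derivable f v 1) &
    (\forall v \near w, M v = Some (f v)) \/
    (\forall v \near w, sphere_inv (M v) = Some (f v)).

(** * Normalizations *)

Definition change_of_variable (R : realType) (phi : R -> R) : Prop :=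
  [/\ set_bij `[0, +oo[ `[0, +oo[ phi,
      {in `[0, +oo[ &, {homo phi : x y / x < y}},
      loc_abs_continuous phi &
      exists2 psi : R -> R,
        {in `[0, +oo[, cancel phi psi} & loc_abs_continuous psi].

(* [K] is a version of [H]; [K] may be replaced by any function equal to it
   almost everywhere. *)
Definition version_of (R : realType) (H K : R -> 'M[R]_2) : Prop :=
  exists2 phi : R -> R, change_of_variable phi &
    {ae @lebesgue_measure R, forall x : R, 0 < x ->
       derivable phi x 1 /\ K x = phi^`()%classic x *: H (phi x)}.

(** * Matrices *)

Definition evec (R : realType) (alpha : R) : 'cV[R]_2 :=
  \col_k (if k == 0 then cos alpha else sin alpha).

(* e e^T is the orthogonal projection onto the span of the unit vector e. *)
Definition Pmx (R : realType) (alpha : R) : 'M[R]_2 :=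
  evec alpha *m (evec alpha)^T.

(* The norm of the library on matrices is the maximum of the entries. *)
Definition enorm (R : realType) n (v : 'cV[R]_n) : R :=
  Num.sqrt (\sum_k v k 0 ^+ 2).

Definition opnorm (R : realType) n (A : 'M[R]_n) : R :=
  sup [set enorm (A *m v) | v in [set v : 'cV[R]_n | enorm v = 1]].

(* [S] is A^(-1/2). *)
Definition is_invsqrtmx (R : realType) n (A S : 'M[R]_n) : Prop :=
  psdmx S /\ S *m S *m A = 1%:M.

(* The derivative on [0, oo), one-sided at 0. *)
Definition is_halfline_derive (R : realType) (K : R -> 'M[R]_2) (x : R)
    (D : 'M[R]_2) : Prop :=
  (fun y : R => (y - x)^-1 *: (K y - K x)) @
    within (fun y : R => 0 <= y) x^' --> D.

Definition nbhd_halfline (R : realType) (h : R) : set R[i] :=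
  [set z | exists2 x : R, 0 < x & `|z - x%:C| < h%:C].

Definition has_holomorphic_continuation (R : realType) (K : R -> 'M[R]_2)
    (h : R) : Prop :=
  exists2 G : R[i] -> 'M[R[i]]_2,
    (forall z, nbhd_halfline h z ->
       forall k l : 'I_2, derivable (fun w => G w k l) z 1) &
    (forall x : R, 0 <= x -> G x%:C = toC (K x)).

(* Main.v *)
(** The m function M(x, w) of the problem on [x, oo), in the variable w = -1/z,
    solves w M' = p M^2 + 2 q M + 1 - p, where H = (p, q; q, 1 - p). Its Cayley
    transform Phi(x, .) is holomorphic and bounded by 1 on a punctured disc
    around w = 0 that does not depend on x: the Wronskian Im (u1 u2^* ) of the
    underlying solution is nonnegative, for Im z > 0 because it is the Weyl
    solution, for Im z <= 0 because it increases with x. So w = 0 is removable.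

    If |Phi(x, 0)| = 1 for some x, then Phi(x, .) is constant, the Wronskian
    vanishes at x, the solution is constant on [x, oo) for Im z > 0 and on
    [0, x] for Im z < 0, and a fixed vector lies in the kernel of H: this is
    H = P_alpha. Otherwise m = M(x, 0) has positive imaginary part, and letting
    w -> 0 gives H = c (1, - Re m; - Re m, |m|^2). By the Schwarz lemma the
    Taylor coefficients e_0, e_1, ... of (M - m) / (w Im m) are bounded
    uniformly in x. In the variable tau with dtau = c Im m dx they satisfy
    e_n' = 2 i e_{n+1} + sum_{j+l=n} e_j e_l - 2 Re(e_0) e_n and
    m' = 2 i (Im m) e_0. This hierarchy bounds all the derivatives of e_0,
    hence m and K = H / (c Im m) continue analytically to a uniform
    neighborhood; det K = 1, and K' has length a multiple of |e_0| in the
    invariant metric of the upper half plane. *)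
Require Import Defs.
From mathcomp Require Import all_boot all_order all_algebra.
From mathcomp Require Import complex.
From mathcomp Require Import all_classical all_reals all_analysis.
From mathcomp Require Import measurable_realfun ring lra zify.
Set Implicit Arguments.
Unset Strict Implicit.
Unset Printing Implicit Defensive.
Import Order.TTheory GRing.Theory Num.Theory.
Import numFieldNormedType.Exports.
Local Open Scope classical_set_scope.
Local Open Scope ring_scope.
Local Open Scope complex_scope.

(* The norm of R[i] in the library is complex-valued; nc is the real modulus. *)
Local Notation nc := (@Normc.normc _).

(** [H] is only measurable, so the differential equations are kept in integrated form: trace one
    bounds the entries of [H], and every solution is a primitive of a locally bounded function
    ([prim]). The equation in [w] is singular at [w = 0]. Identities are proved for [w <> 0] with
    remainders bounded locally uniformly in [x], the limit [w -> 0] gives the equation of one Taylor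
    coefficient, and the difference divided by [w] is the next identity. For [Im z <= 0] the
    solution is not a Weyl solution. It is the one whose initial value is prescribed by [M], and the
    bound 1 on the Cayley transform of [M] is all that is used at [x = 0]. Two points are global.
    The variable [tau] must exhaust [[0, oo)], or its inverse would not be a change of variable:
    [|e_0|] bounds the hyperbolic speed of [m] with respect to [tau], which excludes a finite total
    [tau]. And the radius of the Taylor series in [tau] must not depend on [x], although each
    derivative in the hierarchy raises the index of the coefficients involved: weights
    [1 / (k + 1)^2] in both indices keep all bounds geometric with one rate. *)

Section Modulus.
Variable R : realType.
Local Notation C := R[i].
Implicit Types (x y : R) (z w : C).

Lemma ncE z : `|z| = (nc z)%:C.
Proof. by rewrite normc_def; case: z. Qed.

Lemma nc_ge0 z : 0 <= nc z.
Proof. by case: z => a b; exact: sqrtr_ge0. Qed.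

Lemma nc0 : nc (0 : C) = 0. Proof. exact: Normc.normc0. Qed.
Lemma nc1 : nc (1 : C) = 1. Proof. exact: Normc.normc1. Qed.
Lemma ncM z w : nc (z * w) = nc z * nc w. Proof. exact: Normc.normcM. Qed.
Lemma ncD z w : nc (z + w) <= nc z + nc w. Proof. exact: le_normcD. Qed.
Lemma ncN z : nc (- z) = nc z. Proof. exact: normcN. Qed.
Lemma ncV z : nc z^-1 = (nc z)^-1. Proof. exact: Normc.normcV. Qed.
Lemma ncf z w : nc (z / w) = nc z / nc w. Proof. by rewrite ncM ncV. Qed.
Lemma ncB z w : nc (z - w) <= nc z + nc w.
Proof. by rewrite -(ncN w); exact: ncD. Qed.
Lemma ncC z w : nc (z - w) = nc (w - z).
Proof. by rewrite -ncN opprB. Qed.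
Lemma nc_eq0 z : (nc z == 0) = (z == 0).
Proof.
by apply/eqP/eqP => [/Normc.eq0_normc//|->]; rewrite nc0.
Qed.
Lemma nc_gt0 z : (0 < nc z) = (z != 0).
Proof. by rewrite lt_def nc_ge0 nc_eq0 andbT. Qed.
Lemma ncX z n : nc (z ^+ n) = nc z ^+ n.
Proof. by elim: n => [|n IH]; rewrite ?expr0 ?nc1// !exprS ncM IH. Qed.
Lemma ncR x : nc (x%:C) = `|x|.
Proof. by rewrite /= expr0n/= addr0 sqrtr_sqr. Qed.
Lemma nci : nc ('i : C) = 1.
Proof. by rewrite /= expr0n/= add0r expr1n sqrtr1. Qed.
Lemma ncJ z : nc (z^*) = nc z.
Proof. by case: z => a b /=; rewrite sqrrN. Qed.
Lemma nc2E z : nc z ^+ 2 = complex.Re z ^+ 2 + complex.Im z ^+ 2.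
Proof. by case: z => a b /=; rewrite sqr_sqrtr// addr_ge0 ?sqr_ge0. Qed.
Lemma nc_Re z : `|complex.Re z| <= nc z.
Proof.
by rewrite -(ger0_norm (nc_ge0 z)) -ler_sqr ?nnegrE// -!normrX
  !ger0_norm ?sqr_ge0// nc2E lerDl sqr_ge0.
Qed.
Lemma nc_Im z : `|complex.Im z| <= nc z.
Proof.
by rewrite -(ger0_norm (nc_ge0 z)) -ler_sqr ?nnegrE// -!normrX
  !ger0_norm ?sqr_ge0// nc2E lerDr sqr_ge0.
Qed.
Lemma Re_le_nc z : complex.Re z <= nc z.
Proof. exact: le_trans (ler_norm _) (nc_Re z). Qed.
Lemma Im_le_nc z : complex.Im z <= nc z.
Proof. exact: le_trans (ler_norm _) (nc_Im z). Qed.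
Lemma nc_le_ReIm z : nc z <= `|complex.Re z| + `|complex.Im z|.
Proof.
rewrite {1}(complexE z) (le_trans (ncD _ _))// ncM nci mul1r.
by rewrite !ncR.
Qed.
Lemma nc_sum (I : Type) (s : seq I) (P : pred I) (F : I -> C) :
  nc (\sum_(i <- s | P i) F i) <= \sum_(i <- s | P i) nc (F i).
Proof.
elim/big_rec2: _ => [|i y1 y2 _ IH]; first by rewrite nc0.
by rewrite (le_trans (ncD _ _))// lerD.
Qed.
Lemma nc_distD u z w : nc (z - w) <= nc (z - u) + nc (u - w).
Proof. by rewrite (_ : z - w = (z - u) + (u - w)) ?ncD//; ring. Qed.
Lemma nc_subl z w : nc z - nc w <= nc (z - w).
Proof. by rewrite lerBlDr -{1}(subrK w z) ncD. Qed.

Lemma cReD z w : complex.Re (z + w) = complex.Re z + complex.Re w.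
Proof. by case: z w => [? ?] [? ?]. Qed.
Lemma cImD z w : complex.Im (z + w) = complex.Im z + complex.Im w.
Proof. by case: z w => [? ?] [? ?]. Qed.
Lemma cReN z : complex.Re (- z) = - complex.Re z.
Proof. by case: z. Qed.
Lemma cImN z : complex.Im (- z) = - complex.Im z.
Proof. by case: z. Qed.
Lemma cReM z w : complex.Re (z * w) =
  complex.Re z * complex.Re w - complex.Im z * complex.Im w.
Proof. by case: z w => [? ?] [? ?]. Qed.
Lemma cImM z w : complex.Im (z * w) =
  complex.Re z * complex.Im w + complex.Im z * complex.Re w.
Proof. by case: z w => [? ?] [? ?]. Qed.
Lemma cReJ z : complex.Re (z^*) = complex.Re z. Proof. by case: z. Qed.
Lemma cImJ z : complex.Im (z^*) = - complex.Im z. Proof. by case: z. Qed.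
Lemma cReB z w : complex.Re (z - w) = complex.Re z - complex.Re w.
Proof. by rewrite cReD cReN. Qed.
Lemma cImB z w : complex.Im (z - w) = complex.Im z - complex.Im w.
Proof. by rewrite cImD cImN. Qed.
Lemma mulJ z : z * z^* = (nc z ^+ 2)%:C.
Proof. by rewrite nc2E; case: z => a b /=; apply/eqP; rewrite eq_complex /=; apply/andP; split; apply/eqP; ring. Qed.
Lemma complex_eq z w : complex.Re z = complex.Re w -> complex.Im z = complex.Im w -> z = w.
Proof. by case: z w => [? ?] [? ?] /= -> ->. Qed.

Lemma cvg_to0_eq z : (forall e, 0 < e -> nc z <= e) -> z = 0.
Proof.
move=> h; apply/eqP; rewrite -nc_eq0; apply/negPn/negP => z0.
have z_gt0 : 0 < nc z by rewrite lt_def z0 nc_ge0.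
by have := h _ (divr_gt0 z_gt0 (ltr0n R 2)); lra.
Qed.

End Modulus.

(** * Integrals of locally bounded functions on the half line *)

Section Integral.
Variable R : realType.
Local Notation C := R[i].
Local Notation mu := (@lebesgue_measure R).

(** Trace one bounds the entries of [H] by 1, so this class contains all coefficients. It is closed
    under products, and every integral below then exists without further conditions. *)
Definition rbm (f : R -> R) := forall L : R, measurable_fun `[0, L] f /\
  exists B : R, forall x : R, 0 <= x <= L -> `|f x| <= B.

Definition cbm (f : R -> C) := rbm (@complex.Re _ \o f) /\ rbm (@complex.Im _ \o f).

(** Continuity relative to [[0, oo)]: values at negative arguments are arbitrary, so continuity on
    the line could fail at 0. *)
Definition hcont (f : R -> C) := forall x : R, 0 <= x -> forall e : R, 0 < e ->
  exists2 d : R, 0 < d & forall y : R, 0 <= y -> `|y - x| < d -> nc (f y - f x) < e.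

Definition cint (a b : R) (f : R -> C) : C :=
  (\int[mu]_(x in `[a, b]) complex.Re (f x)) +i*
  (\int[mu]_(x in `[a, b]) complex.Im (f x)).

Lemma rbm_integrable f (a b : R) : 0 <= a -> rbm f ->
  mu.-integrable `[a, b] (EFin \o f).
Proof.
move=> a0 /(_ b)[mf [B fB]].
have sub : `[a, b] `<=` `[0, b].
  by apply: subset_itvr; rewrite bnd_simp.
apply: measurable_bounded_integrable => //.
- exact: compact_finite_measure (@segment_compact _ _ _).
- exact: measurable_funS mf.
- exists B; split; first exact: num_real.
  move=> M BM x /sub; rewrite /= in_itv/= => /fB /le_trans; apply; exact: ltW.
Qed.

Lemma rbmD f g : rbm f -> rbm g -> rbm (fun x => f x + g x).
Proof.
move=> hf hg L; have [mf [B fB]] := hf L; have [mg [B' gB]] := hg L.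
split; first exact: measurable_funD.
exists (B + B') => x xL; rewrite (le_trans (ler_normD _ _))// lerD ?fB ?gB//.
Qed.
Lemma rbmM f g : rbm f -> rbm g -> rbm (fun x => f x * g x).
Proof.
move=> hf hg L; have [mf [B fB]] := hf L; have [mg [B' gB]] := hg L.
split; first exact: measurable_funM.
exists (B * B') => x xL; rewrite normrM ler_pM ?fB ?gB//.
Qed.
Lemma rbm_cst k : rbm (fun=> k).
Proof. by move=> L; split; [exact: measurable_cst|exists `|k|]. Qed.
Lemma rbmN f : rbm f -> rbm (fun x => - f x).
Proof.
move=> hf; have := rbmM (rbm_cst (-1)) hf.
by under [fun x => _ * _]eq_fun do rewrite mulN1r.
Qed.
Lemma rbmB f g : rbm f -> rbm g -> rbm (fun x => f x - g x).
Proof. by move=> hf /rbmN; exact: rbmD. Qed.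

Lemma eq_rbm f g : f =1 g -> rbm f -> rbm g.
Proof. by move=> /funext ->. Qed.
Lemma eq_cbm f g : f =1 g -> cbm f -> cbm g.
Proof. by move=> /funext ->. Qed.

Lemma cbm_cst k : cbm (fun=> k). Proof. by split; exact: rbm_cst. Qed.
Lemma cbmD f g : cbm f -> cbm g -> cbm (fun x => f x + g x).
Proof.
move=> [f1 f2] [g1 g2]; split.
- by apply: eq_rbm (rbmD f1 g1) => x; rewrite /= cReD.
- by apply: eq_rbm (rbmD f2 g2) => x; rewrite /= cImD.
Qed.
Lemma cbmM f g : cbm f -> cbm g -> cbm (fun x => f x * g x).
Proof.
move=> [f1 f2] [g1 g2]; split.
- by apply: eq_rbm (rbmB (rbmM f1 g1) (rbmM f2 g2)) => x; rewrite /= cReM.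
- by apply: eq_rbm (rbmD (rbmM f1 g2) (rbmM f2 g1)) => x; rewrite /= cImM.
Qed.
Lemma cbmN f : cbm f -> cbm (fun x => - f x).
Proof.
by move=> /(cbmM (cbm_cst (-1))); apply: eq_cbm => x; rewrite mulN1r.
Qed.
Lemma cbmB f g : cbm f -> cbm g -> cbm (fun x => f x - g x).
Proof. by move=> hf /cbmN; exact: cbmD. Qed.
Lemma cbmJ f : cbm f -> cbm (fun x => (f x)^*).
Proof.
move=> [f1 f2]; split; first by apply: eq_rbm f1 => x; rewrite /= cReJ.
by apply: eq_rbm (rbmN f2) => x; rewrite /= cImJ.
Qed.
Lemma cbmR f : rbm f -> cbm (fun x => (f x)%:C).
Proof. by move=> hf; split => //; exact: rbm_cst. Qed.
Lemma cbm_sum (I : Type) (s : seq I) (F : I -> R -> C) :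
  (forall i, cbm (F i)) -> cbm (fun x => \sum_(i <- s) F i x).
Proof.
move=> h; elim: s => [|i s IH].
  by apply: eq_cbm (cbm_cst 0) => x; rewrite big_nil.
by apply: eq_cbm (cbmD (h i) IH) => x; rewrite big_cons.
Qed.

Lemma cbm_bound f (L : R) : cbm f -> exists2 B : R, 0 < B &
  forall x : R, 0 <= x <= L -> nc (f x) <= B.
Proof.
move=> [/(_ L)[_ [B1 h1]] /(_ L)[_ [B2 h2]]].
exists (`|B1| + `|B2| + 1); first by rewrite ltr_wpDl// addr_ge0.
move=> x xL; rewrite (le_trans (nc_le_ReIm _))//.
have := h1 _ xL; have := h2 _ xL => /= h3 h4.
have := ler_norm B1; have := ler_norm B2; lra.
Qed.

(** Composition with [Num.max 0] extends a function to the left by its value at 0, which turns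
    continuity on the half line into continuity on the line. *)
Lemma hcont_rcont f : hcont f -> continuous (fun y : R => complex.Re (f (Num.max 0 y)))
  /\ continuous (fun y : R => complex.Im (f (Num.max 0 y))).
Proof.
move=> hf.
have key (x e : R) : 0 < e -> exists2 d : R, 0 < d & forall y : R, `|x - y| < d ->
    nc (f (Num.max 0 x) - f (Num.max 0 y)) < e.
  move=> e0; have [|d d0 h] := hf (Num.max 0 x) _ e e0; first by rewrite le_max lexx.
  exists d => // y xy; rewrite ncC h ?le_max ?lexx//.
  apply: le_lt_trans xy; rewrite distrC.
  rewrite ler_norml; have := ler_norm (x - y); have := ler_norm (y - x).
  rewrite (distrC y x); move: `|x - y| => t t1 t2.
  by case: (leP 0 x) => x0; case: (leP 0 y) => y0; lra.
split=> x; apply/cvgrPdist_lt => e /(key x)[d d0 h]; near=> y;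
  (have {}h : nc (f (Num.max 0 x) - f (Num.max 0 y)) < e;
    first by apply: h; near: y; exists d).
- by rewrite -cReB; exact: le_lt_trans (nc_Re _) h.
- by rewrite -cImB; exact: le_lt_trans (nc_Im _) h.
Unshelve. all: by end_near. Qed.

Lemma rcont_rbm (f : R -> R) : continuous f -> rbm f.
Proof.
move=> cf L; split; first by apply: measurable_funTS; exact: continuous_measurable_fun.
have [L0|L0] := ltP L 0; first by exists 0 => x /andP[? ?]; lra.
have [c _ hc] := EVT_max L0 (continuous_subspaceT cf).
have [d _ hd] := EVT_min L0 (continuous_subspaceT cf).
exists (`|f c| + `|f d|) => x xL.
have /hc h1 : x \in `[0, L] by rewrite in_itv.
have /hd h2 : x \in `[0, L] by rewrite in_itv.
by case: (ger0P (f x)); case: (ger0P (f c)); case: (ger0P (f d)); lra.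
Qed.

Lemma rbm_ext (f g : R -> R) : (forall x : R, 0 <= x -> f x = g x) -> rbm f -> rbm g.
Proof.
move=> fg hf L; have [mf [B fB]] := hf L; split; last first.
  by exists B => x /[dup] /andP[x0 _] /fB; rewrite fg.
by apply: eq_measurable_fun mf => x; rewrite inE/= in_itv/= => /andP[/fg].
Qed.

Lemma cbm_ext (f g : R -> C) : (forall x : R, 0 <= x -> f x = g x) -> cbm f -> cbm g.
Proof.
by move=> fg [f1 f2]; split; [apply: rbm_ext f1|apply: rbm_ext f2] => x /fg /= ->.
Qed.

Lemma hcont_cbm f : hcont f -> cbm f.
Proof.
move=> /hcont_rcont[c1 c2]; split.
- by apply: rbm_ext (rcont_rbm c1) => x x0 /=; rewrite max_r.
- by apply: rbm_ext (rcont_rbm c2) => x x0 /=; rewrite max_r.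
Qed.

(** Measurability passes to pointwise limits; the bound on [[0, L]] comes from the term [F 0] and
    its distance to the limit. *)
Lemma cbm_lim (F : nat -> R -> C) f : (forall n, cbm (F n)) ->
  (forall L : R, exists2 d : nat -> R, d @ \oo --> 0 &
     forall n (x : R), 0 <= x <= L -> nc (F n x - f x) <= d n) -> cbm f.
Proof.
move=> hF hd.
have bnd L : exists B : R, forall x : R, 0 <= x <= L -> nc (f x) <= B.
  have [d _ h] := hd L; have [B _ hB] := cbm_bound L (hF 0%N).
  exists (B + d 0%N) => x xL; have := h 0%N x xL; have := hB x xL.
  by have := nc_subl (f x) (F 0%N x); rewrite ncC; lra.
have mes (P : C -> R) : (forall z w, `|P z - P w| <= nc (z - w)) ->
    (forall z, `|P z| <= nc z) ->
    (forall n, rbm (fun x => P (F n x))) -> rbm (fun x => P (f x)).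
  move=> Pc Pn hP L; split; last first.
    by have [B hB] := bnd L; exists B => x /hB; exact: le_trans.
  apply: (@measurable_fun_cvg _ _ _ _ (fun n x => P (F n x))).
    by move=> n; have [] := hP n L.
  move=> x; rewrite /= in_itv/= => xL; have [d d0 h] := hd L.
  apply/cvgrPdist_le => e e0; near=> n.
  rewrite distrC (le_trans (Pc _ _))// (le_trans (h _ _ xL))//.
  rewrite (le_trans (ler_norm _))// -[d n]opprK normrN -sub0r.
  by near: n; move/cvgrPdist_le : d0; exact.
split.
- apply: (mes (@complex.Re _)) => [z w|z|n]; rewrite -?cReB ?nc_Re//.
  by have [] := hF n.
- apply: (mes (@complex.Im _)) => [z w|z|n]; rewrite -?cImB ?nc_Im//.
  by have [] := hF n.
Unshelve. all: by end_near. Qed.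

Implicit Types (a b c : R).

Lemma eq_cint a b f g : (forall x : R, a <= x <= b -> f x = g x) ->
  cint a b f = cint a b g.
Proof.
by move=> h; congr (_ +i* _); apply: eq_Rintegral => x;
  rewrite inE/= in_itv/= => /h ->.
Qed.

Lemma cintD a b f g : 0 <= a -> cbm f -> cbm g ->
  cint a b (fun x => f x + g x) = cint a b f + cint a b g.
Proof.
move=> a0 [f1 f2] [g1 g2].
rewrite /cint; apply: complex_eq => /=.
- under eq_Rintegral do rewrite cReD.
  by rewrite RintegralD//; exact: rbm_integrable.
- under eq_Rintegral do rewrite cImD.
  by rewrite RintegralD//; exact: rbm_integrable.
Qed.

Lemma cintZ a b (k : C) f : 0 <= a -> cbm f ->
  cint a b (fun x => k * f x) = k * cint a b f.
Proof.
move=> a0 [f1 f2]; have [i1 i2] := (rbm_integrable b a0 f1, rbm_integrable b a0 f2).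
have kb (t : R) g : rbm g -> mu.-integrable `[a, b] (EFin \o (fun x => t * g x)).
  by move=> hg; apply: rbm_integrable => //; apply: rbmM => //; exact: rbm_cst.
rewrite /cint; apply: complex_eq => /=; rewrite ?cReM ?cImM/=.
- under eq_Rintegral do rewrite cReM.
  rewrite RintegralB ?RintegralZl//; exact: kb.
- under eq_Rintegral do rewrite cImM.
  rewrite RintegralD ?RintegralZl//; exact: kb.
Qed.

Lemma cintN a b f : 0 <= a -> cbm f -> cint a b (fun x => - f x) = - cint a b f.
Proof.
move=> a0 hf; rewrite -mulN1r -cintZ//.
by apply: eq_cint => x _; rewrite mulN1r.
Qed.

Lemma cintB a b f g : 0 <= a -> cbm f -> cbm g ->
  cint a b (fun x => f x - g x) = cint a b f - cint a b g.
Proof. by move=> a0 hf hg; rewrite cintD ?cintN//; exact: cbmN. Qed.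

Lemma cintJ a b f : 0 <= a -> cbm f -> cint a b (fun x => (f x)^*) = (cint a b f)^*.
Proof.
move=> a0 [f1 f2]; rewrite /cint; apply: complex_eq => /=.
- by under eq_Rintegral do rewrite cReJ.
- under eq_Rintegral do rewrite cImJ.
  under eq_Rintegral do rewrite -mulN1r.
  by rewrite RintegralZl ?mulN1r//; exact: rbm_integrable.
Qed.

Lemma cint_cst a b (k : C) : a <= b -> cint a b (fun=> k) = k * (b - a)%:C.
Proof.
move=> ab; have E : fine (mu `[a, b]) = b - a.
  rewrite lebesgue_measure_itv/= lte_fin.
  by case: ltP => //= ba; apply/esym/eqP; rewrite subr_eq0 eq_le ab ba.
rewrite /cint !Rintegral_cst// (_ : fine _ = b - a)//.
by apply: complex_eq; rewrite ?cReM ?cImM /=; ring.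
Qed.

Lemma Rint_itvD (f : R -> R) a b c : 0 <= a -> a <= b -> b <= c -> rbm f ->
  \int[mu]_(x in `[a, c]) f x =
  \int[mu]_(x in `[a, b]) f x + \int[mu]_(x in `[b, c]) f x.
Proof.
move=> a0 ab bc hf; apply/eqP; rewrite addrC -subr_eq; apply/eqP.
rewrite Rintegral_itvB ?bnd_simp//; last exact: rbm_integrable.
rewrite Rintegral_itv_obnd_cbnd//.
apply: integrableS (rbm_integrable c a0 hf) => //.
by apply: subset_itv; rewrite bnd_simp.
Qed.

Lemma cint_itvD a b c f : 0 <= a -> a <= b -> b <= c -> cbm f ->
  cint a c f = cint a b f + cint b c f.
Proof. by move=> a0 ab bc [f1 f2]; apply: complex_eq; exact: Rint_itvD. Qed.

Lemma cint_pt a f : cint a a f = 0.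
Proof. by rewrite /cint set_itv1 !Rintegral_set1. Qed.

Lemma Re_cint a b f : complex.Re (cint a b f) = \int[mu]_(x in `[a, b]) complex.Re (f x).
Proof. by []. Qed.

Lemma Re_cint_le a b f g : 0 <= a -> cbm f -> cbm g ->
  (forall x : R, a <= x <= b -> complex.Re (f x) <= complex.Re (g x)) ->
  complex.Re (cint a b f) <= complex.Re (cint a b g).
Proof.
move=> a0 [f1 _] [g1 _] h; rewrite !Re_cint; apply: le_Rintegral => //.
- exact: (rbm_integrable b a0 f1).
- exact: (rbm_integrable b a0 g1).
Qed.

Lemma nc_cint a b f (g : R -> R) : 0 <= a -> cbm f -> rbm g ->
  (forall x : R, a <= x <= b -> nc (f x) <= g x) ->
  nc (cint a b f) <= complex.Re (cint a b (fun x => (g x)%:C)).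
Proof.
move=> a0 hf hg h; set I := cint a b f.
have [I0|I0] := eqVneq I 0.
  rewrite I0 nc0 (_ : 0 = complex.Re (cint a b (fun=> 0))).
    apply: Re_cint_le => //; [exact: cbm_cst|exact: cbmR|].
    by move=> x /h /=; exact: le_trans (nc_ge0 _).
  by rewrite Re_cint Rintegral_cst//= mul0r.
have nI : 0 < nc I by rewrite nc_gt0.
(* The phase that turns the integral into its modulus; the estimate then concerns real parts
   only. *)
pose k := I^* / (nc I)%:C.
have nk : nc k = 1 by rewrite ncf ncJ ncR ger0_norm ?nc_ge0// divff ?gt_eqF.
have -> : nc I = complex.Re (cint a b (fun x => k * f x)).
  rewrite cintZ// -/I /k mulrAC [_ * I]mulrC mulJ expr2 rmorphM mulfK//.
  by rewrite (inj_eq (@complexI _)) gt_eqF.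
apply: Re_cint_le => //; [by apply: cbmM => //; exact: cbm_cst|exact: cbmR|].
move=> x /h; apply: le_trans; apply: le_trans (Re_le_nc _) _.
by rewrite ncM nk mul1r.
Qed.

Lemma nc_cint_le a b f (B : R) : 0 <= a -> a <= b -> cbm f ->
  (forall x : R, a <= x <= b -> nc (f x) <= B) ->
  nc (cint a b f) <= B * (b - a).
Proof.
move=> a0 ab hf h; apply: le_trans (nc_cint a0 hf (rbm_cst B) h) _.
by rewrite cint_cst// cReM/= mulr0 subr0.
Qed.

End Integral.

(** * Calculus of absolutely continuous functions with locally bounded derivative *)

Section Primitive.
Variable R : realType.
Local Notation C := R[i].
Local Notation mu := (@lebesgue_measure R).
Implicit Types (F G f g : R -> C) (a b x L : R).

(* F is absolutely continuous on [0, oo), with locally bounded derivative f. *)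
Definition prim F f := cbm f /\ forall x : R, 0 <= x -> F x = F 0 + cint 0 x f.

Lemma primE F f a b : prim F f -> 0 <= a -> a <= b -> F b - F a = cint a b f.
Proof.
move=> [hf h] a0 ab; have b0 := le_trans a0 ab.
by rewrite (h b)// (h a)// (cint_itvD _ a0 ab)//; ring.
Qed.

Lemma prim_lip F f L : prim F f -> exists2 B : R, 0 < B &
  forall a b, 0 <= a -> a <= b -> b <= L -> nc (F b - F a) <= B * (b - a).
Proof.
move=> hF; have [B B0 hB] := cbm_bound L hF.1; exists B => // a b a0 ab bL.
rewrite (primE hF)//; apply: nc_cint_le => //; first exact: hF.1.
by move=> x /andP[? ?]; apply: hB; lra.
Qed.

Lemma lip_hcont F : (forall L, exists2 B : R, 0 < B &
  forall a b, 0 <= a -> a <= b -> b <= L -> nc (F b - F a) <= B * (b - a)) -> hcont F.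
Proof.
move=> h x x0 e e0; have [B B0 hB] := h (x + 1).
exists (Num.min 1 (e / B)); first by rewrite lt_min ltr01 divr_gt0.
move=> y y0; rewrite lt_min => /andP[xy1 xye].
have : nc (F y - F x) <= B * `|y - x|.
  have [xy|xy] := leP x y.
    rewrite ger0_norm ?subr_ge0// in xy1 *; apply: hB => //; lra.
  rewrite ltr0_norm ?subr_lt0// opprB in xy1 *; rewrite ncC; apply: hB; lra.
move=> /le_lt_trans; apply; by rewrite mulrC -ltr_pdivlMr.
Qed.

Lemma prim_hcont F f : prim F f -> hcont F.
Proof. by move=> hF; apply: lip_hcont => L; exact: prim_lip hF. Qed.

Lemma prim_cbm F f : prim F f -> cbm F.
Proof. by move=> /prim_hcont/hcont_cbm. Qed.

(** On [n] equal pieces of [[0, L]] the increments add up to at most [|K| L^2 / n], which tends to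
    0. *)
Lemma const2 F : (forall L, exists K : R, forall a b, 0 <= a -> a <= b -> b <= L ->
   nc (F b - F a) <= K * (b - a) ^+ 2) -> forall x, 0 <= x -> F x = F 0.
Proof.
move=> h L L0; apply/eqP; rewrite -subr_eq0; apply/eqP; apply: cvg_to0_eq => e e0.
have [K hK] := h L.
have step n : (0 < n)%N -> nc (F L - F 0) <= `|K| * L ^+ 2 / n%:R.
  move=> n0; have n0' : 0 < n%:R :> R by rewrite ltr0n.
  pose t (k : nat) := L * k%:R / n%:R.
  have ht (k : nat) : (k <= n)%N -> nc (F (t k) - F 0) <= k%:R * (`|K| * (L / n%:R) ^+ 2).
    elim: k => [|k IH] kn.
      by rewrite /t mulr0 mul0r subrr nc0 mul0r.
    have := IH (ltnW kn); have := nc_distD (F (t k)) (F (t k.+1)) (F 0).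
    have dt : t k.+1 - t k = L / n%:R by rewrite /t -mulrBl -mulrBr -natrB// subSnn mulr1.
    have t0 : 0 <= t k by rewrite /t !mulr_ge0// invr_ge0 ltW.
    have Ln : 0 <= L / n%:R by rewrite mulr_ge0// invr_ge0 ltW.
    have tL : t k.+1 <= L by rewrite /t ler_pdivrMr// ler_wpM2l// ler_nat.
    have := hK (t k) (t k.+1) t0 _ tL; rewrite dt -[in X in X -> _]subr_ge0 dt => /(_ Ln) h1.
    have : K * (L / n%:R) ^+ 2 <= `|K| * (L / n%:R) ^+ 2.
      by rewrite ler_wpM2r ?ler_norm// sqr_ge0.
    by rewrite -(natr1 k) mulrDl mul1r; lra.
  have := ht n (leqnn n); rewrite {1}/t mulfK ?gt_eqF// => /le_trans; apply.
  by rewrite le_eqVlt; apply/orP; left; apply/eqP; field; rewrite gt_eqF.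
have [n hn] : exists n : nat, `|K| * L ^+ 2 / e < n%:R.
  exists (Num.bound (`|K| * L ^+ 2 / e)); apply: archi_boundP.
  by rewrite divr_ge0 ?mulr_ge0 ?sqr_ge0// ltW.
have n0 : 0 < n%:R :> R.
  by apply: le_lt_trans hn; rewrite divr_ge0 ?mulr_ge0 ?sqr_ge0// ltW.
have n0N : (0 < n)%N by rewrite -(ltr0n R).
apply: (le_trans (step n n0N)).
by rewrite ler_pdivrMr// -ler_pdivrMl// mulrC ltW.
Qed.

(** A criterion without pointwise derivatives: [F x - cint 0 x f] has increments of second order,
    hence is constant. The product, quotient and exponential rules below rest on it. *)
Lemma prim_of2 F f : cbm f -> (forall L, exists K : R, forall a b, 0 <= a -> a <= b ->
    b <= L -> nc (F b - F a - cint a b f) <= K * (b - a) ^+ 2) -> prim F f.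
Proof.
move=> hf h; split => // x x0.
have /(_ x x0) : forall x, 0 <= x -> F x - cint 0 x f = F 0 - cint 0 0 f.
  apply: (@const2 (fun x => F x - cint 0 x f)) => L.
  have [K hK] := h L; exists K => a b a0 ab bL.
  rewrite (cint_itvD _ a0 ab)//.
  by rewrite (_ : _ - _ = F b - F a - cint a b f) ?hK//; ring.
by rewrite cint_pt subr0 => <-; ring.
Qed.

Lemma prim_ext F G f g : (forall x, 0 <= x -> F x = G x) ->
  (forall x, 0 <= x -> f x = g x) -> prim F f -> prim G g.
Proof.
move=> FG fg [hf h]; split; first exact: cbm_ext fg hf.
move=> x x0; rewrite -!FG// h//; congr (_ + _).
by apply: eq_cint => y /andP[y0 _]; exact: fg.
Qed.

Lemma prim_cst (k : C) : prim (fun=> k) (fun=> 0).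
Proof.
split; first exact: cbm_cst.
by move=> x x0; rewrite cint_cst// mul0r addr0.
Qed.

Lemma primD F f G g : prim F f -> prim G g ->
  prim (fun x => F x + G x) (fun x => f x + g x).
Proof.
move=> [hf h] [hg k]; split; first exact: cbmD.
by move=> x x0; rewrite cintD// h// k//; ring.
Qed.

Lemma primZ F f (k : C) : prim F f -> prim (fun x => k * F x) (fun x => k * f x).
Proof.
move=> [hf h]; split; first by apply: cbmM => //; exact: cbm_cst.
by move=> x x0; rewrite cintZ// h// mulrDr.
Qed.

Lemma primN F f : prim F f -> prim (fun x => - F x) (fun x => - f x).
Proof.
by move=> /(primZ (-1)); apply: prim_ext => x _; rewrite mulN1r.
Qed.

Lemma primB F f G g : prim F f -> prim G g ->
  prim (fun x => F x - G x) (fun x => f x - g x).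
Proof. by move=> hF /primN; exact: primD. Qed.

Lemma primJ F f : prim F f -> prim (fun x => (F x)^*) (fun x => (f x)^*).
Proof.
move=> [hf h]; split; first exact: cbmJ.
by move=> x x0; rewrite cintJ// h// rmorphD.
Qed.

Lemma prim_sum (I : Type) (s : seq I) (F f : I -> R -> C) :
  (forall i, prim (F i) (f i)) ->
  prim (fun x => \sum_(i <- s) F i x) (fun x => \sum_(i <- s) f i x).
Proof.
move=> h; elim: s => [|i s IH].
  by apply: prim_ext (prim_cst 0) => x _; rewrite big_nil.
by apply: prim_ext (primD (h i) IH) => x _; rewrite big_cons.
Qed.

Lemma primM F f G g : prim F f -> prim G g ->
  prim (fun x => F x * G x) (fun x => f x * G x + F x * g x).
Proof.
move=> hF hG; have cF := prim_cbm hF; have cG := prim_cbm hG.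
have [cf cg] := (hF.1, hG.1).
apply: prim_of2; first by apply: cbmD; apply: cbmM.
move=> L; have [BF BF0 lF] := prim_lip L hF; have [BG BG0 lG] := prim_lip L hG.
have [Bf Bf0 bf] := cbm_bound L cf; have [Bg Bg0 bg] := cbm_bound L cg.
exists (Bf * BG + Bg * BF) => a b a0 ab bL.
(* Each integrand on the right is a bounded derivative times an increment over a part of [[a, b]],
   so the error is of second order. *)
have -> : F b * G b - F a * G a - cint a b (fun x => f x * G x + F x * g x) =
    cint a b (fun x => f x * (G b - G x)) + cint a b (fun x => g x * (F a - F x)).
  have -> : cint a b (fun x => f x * (G b - G x)) =
      G b * cint a b f - cint a b (fun x => f x * G x).
    rewrite -cintZ// -cintB//; [|by apply: cbmM => //; exact: cbm_cst|exact: cbmM].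
    by apply: eq_cint => x _; ring.
  have -> : cint a b (fun x => g x * (F a - F x)) =
      F a * cint a b g - cint a b (fun x => F x * g x).
    rewrite -cintZ// -cintB//; [|by apply: cbmM => //; exact: cbm_cst|exact: cbmM].
    by apply: eq_cint => x _; ring.
  rewrite cintD//; try exact: cbmM.
  by rewrite -(primE hF)// -(primE hG)//; ring.
rewrite (le_trans (ncD _ _))// mulrDl lerD//.
- have -> : Bf * BG * (b - a) ^+ 2 = (Bf * (BG * (b - a))) * (b - a) by ring.
  apply: nc_cint_le => //.
    by apply: cbmM => //; apply: cbmB => //; exact: cbm_cst.
  move=> x /andP[ax xb]; rewrite ncM ler_pM ?nc_ge0//; first by apply: bf; lra.
  have x0 : 0 <= x by lra.
  by have := lG x b x0 xb bL => /le_trans; apply; rewrite ler_pM2l//; lra.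
- have -> : Bg * BF * (b - a) ^+ 2 = (Bg * (BF * (b - a))) * (b - a) by ring.
  apply: nc_cint_le => //.
    by apply: cbmM => //; apply: cbmB => //; exact: cbm_cst.
  move=> x /andP[ax xb]; rewrite ncM ler_pM ?nc_ge0//; first by apply: bg; lra.
  have xL : x <= L by lra.
  rewrite ncC.
  by have := lF a x a0 ax xL => /le_trans; apply; rewrite ler_pM2l//; lra.
Qed.

Lemma hcontD f g : hcont f -> hcont g -> hcont (fun x => f x + g x).
Proof.
move=> hf hg x x0 e e0; have e2 : 0 < e / 2 by lra.
have [d d0 h] := hf x x0 _ e2; have [d' d0' h'] := hg x x0 _ e2.
exists (Num.min d d'); first by rewrite lt_min d0.
move=> y y0; rewrite lt_min => /andP[/(h y y0) h1 /(h' y y0) h2].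
have := ncD (f y - f x) (g y - g x).
by rewrite (_ : f y + g y - (f x + g x) = f y - f x + (g y - g x)); [lra|ring].
Qed.

Lemma hcont_near_bound f x : hcont f -> 0 <= x -> exists2 d : R, 0 < d &
  forall y, 0 <= y -> `|y - x| < d -> nc (f y) <= nc (f x) + 1.
Proof.
move=> hf x0; have [d d0 h] := hf x x0 1 ltr01; exists d => // y y0 /(h y y0).
by have := nc_subl (f y) (f x); lra.
Qed.

Lemma hcontM f g : hcont f -> hcont g -> hcont (fun x => f x * g x).
Proof.
move=> hf hg x x0 e e0.
pose K := nc (f x) + nc (g x) + 1.
have K0 : 0 < K by have := nc_ge0 (f x); have := nc_ge0 (g x); rewrite /K; lra.
have e2 : 0 < e / 2 / K by rewrite !divr_gt0.
have [d d0 h] := hf x x0 _ e2; have [d' d0' h'] := hg x x0 _ e2.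
have [d'' d0'' h''] := hcont_near_bound hg x0.
exists (Num.min (Num.min d d') d''); first by rewrite !lt_min d0 d0'.
move=> y y0; rewrite !lt_min => /andP[/andP[/(h y y0) h1 /(h' y y0) h2] /(h'' y y0) h3].
rewrite (_ : _ - _ = (f y - f x) * g y + f x * (g y - g x)); last by ring.
rewrite (le_lt_trans (ncD _ _))// !ncM.
have -> : e = e / 2 / K * K + K * (e / 2 / K) by field; rewrite gt_eqF.
apply: ltr_leD.
- apply: (@le_lt_trans _ _ (nc (f y - f x) * K)).
    rewrite ler_wpM2l ?nc_ge0//; apply: le_trans h3 _.
    by have := nc_ge0 (f x); rewrite /K; lra.
  by rewrite ltr_pM2r.
- rewrite ler_pM ?nc_ge0 ?(ltW h2)//.
  by have := nc_ge0 (g x); rewrite /K; lra.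
Qed.

Lemma hcont_cst (k : C) : hcont (fun=> k).
Proof. by move=> x _ e e0; exists 1 => // y _ _; rewrite subrr nc0. Qed.

Lemma hcontN f : hcont f -> hcont (fun x => - f x).
Proof.
move=> hf x x0 e e0; have [d d0 h] := hf x x0 e e0; exists d => // y y0 /(h y y0).
by rewrite ncC; rewrite (_ : - f y - - f x = f x - f y)//; ring.
Qed.

Lemma hcont_ext f g : (forall x, 0 <= x -> f x = g x) -> hcont f -> hcont g.
Proof.
move=> fg hf x x0 e e0; have [d d0 h] := hf x x0 e e0.
by exists d => // y y0 /(h y y0); rewrite !fg.
Qed.

Lemma hcontV f : hcont f -> (forall x, 0 <= x -> f x != 0) -> hcont (fun x => (f x)^-1).
Proof.
move=> hf fn0 x x0 e e0.
have nx : 0 < nc (f x) by rewrite nc_gt0 fn0.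
have e1 : 0 < Num.min (nc (f x) / 2) (e * (nc (f x)) ^+ 2 / 2).
  by rewrite lt_min !divr_gt0// mulr_gt0// exprn_gt0.
have [d d0 h] := hf x x0 _ e1; exists d => // y y0 /(h y y0).
rewrite lt_min => /andP[h1 h2].
have ny : nc (f x) / 2 < nc (f y) by have := nc_subl (f x) (f y); rewrite ncC; lra.
have ny0 : 0 < nc (f y) by lra.
have -> : (f y)^-1 - (f x)^-1 = (f x - f y) / (f y * f x).
  by field; rewrite !fn0.
rewrite ncf ncM ncC ltr_pdivrMr ?mulr_gt0//.
apply: lt_le_trans h2 _.
have -> : e * nc (f x) ^+ 2 / 2 = e * ((nc (f x) / 2) * nc (f x)) by ring.
by rewrite ler_pM2l// ler_pM2r// ltW.
Qed.

Lemma hcont_lower f L : hcont f -> (forall x, 0 <= x -> f x != 0) ->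
  exists2 B : R, 0 < B & forall x, 0 <= x <= L -> B <= nc (f x).
Proof.
move=> hf fn0; have [B B0 hB] := cbm_bound L (hcont_cbm (hcontV hf fn0)).
exists B^-1; first by rewrite invr_gt0.
move=> x /[dup] /andP[x0 _] /hB; rewrite ncV => h.
by rewrite -[nc (f x)]invrK lef_pV2// posrE invr_gt0 nc_gt0 fn0.
Qed.

Lemma primV F f : prim F f -> (forall x, 0 <= x -> F x != 0) ->
  prim (fun x => (F x)^-1) (fun x => - f x / (F x) ^+ 2).
Proof.
move=> hF F0; have cF := prim_hcont hF; have cV := hcontV cF F0.
have cW : cbm (fun x => - f x / F x ^+ 2).
  apply: (@cbm_ext _ (fun x => - f x * ((F x)^-1 * (F x)^-1))).
    by move=> x x0; rewrite expr2 invfM.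
  apply: cbmM; first by apply: cbmN; exact: hF.1.
  by apply: cbmM; exact: hcont_cbm.
apply: prim_of2 => // L.
have [BF BF0 lF] := prim_lip L hF; have [Bf Bf0 bf] := cbm_bound L hF.1.
have [BV BV0 bV] := cbm_bound L (hcont_cbm cV).
have lV (a b : R) : 0 <= a -> a <= b -> b <= L ->
    nc ((F b)^-1 - (F a)^-1) <= BV * BV * (BF * (b - a)).
  move=> a0 ab bL; have b0 := le_trans a0 ab.
  have -> : (F b)^-1 - (F a)^-1 = (F b)^-1 * (F a)^-1 * (F a - F b).
    by field; rewrite !F0.
  by rewrite !ncM ncC ler_pM ?mulr_ge0 ?nc_ge0 ?lF// ler_pM ?nc_ge0 ?bV ?a0 ?b0//=; lra.
exists (Bf * (2 * (BV * (BV * BV * BF)))) => a b a0 ab bL; have b0 := le_trans a0 ab.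
(* Writing [F b - F a] as the integral of [f] puts the error under the integral sign, where every
   term contains a difference of values of [F^-1] on [[a, b]]. *)
have -> : (F b)^-1 - (F a)^-1 - cint a b (fun x => - f x / F x ^+ 2) =
   cint a b (fun x => f x * ((F x)^-1 * ((F x)^-1 - (F a)^-1)
     + (F a)^-1 * ((F x)^-1 - (F b)^-1))).
  have -> : cint a b (fun x => f x * ((F x)^-1 * ((F x)^-1 - (F a)^-1)
     + (F a)^-1 * ((F x)^-1 - (F b)^-1))) =
    cint a b (fun x => (- ((F a)^-1 * (F b)^-1)) * f x - (- f x / F x ^+ 2)).
    by apply: eq_cint => x /andP[ax _]; field; rewrite !F0//; lra.
  rewrite cintB ?cintZ//; [|exact: hF.1|].
    by rewrite -(primE hF)//; field; rewrite !F0.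
  by apply: cbmM; [exact: cbm_cst|exact: hF.1].
have -> : Bf * (2 * (BV * (BV * BV * BF))) * (b - a) ^+ 2 =
  Bf * (BV * (BV * BV * (BF * (b - a))) + BV * (BV * BV * (BF * (b - a)))) * (b - a) by ring.
have cb k : cbm (fun x => (F x)^-1 - k).
  by apply: cbmB; [exact: hcont_cbm|exact: cbm_cst].
apply: nc_cint_le => //.
  apply: cbmM; first exact: hF.1.
  apply: cbmD; apply: cbmM => //; [exact: hcont_cbm|exact: cbm_cst].
move=> x /andP[ax xb]; have x0 := le_trans a0 ax; have xL := le_trans xb bL.
rewrite ncM ler_pM ?nc_ge0//; first by apply: bf; rewrite x0.
rewrite (le_trans (ncD _ _))// !ncM lerD// ler_pM ?nc_ge0//.
- by apply: bV; rewrite x0.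
- apply: le_trans (lV _ _ a0 ax xL) _; rewrite ler_pM2l ?mulr_gt0//.
  by rewrite ler_pM2l//; lra.
- by apply: bV; rewrite a0; lra.
- rewrite ncC; apply: le_trans (lV _ _ x0 xb bL) _; rewrite ler_pM2l ?mulr_gt0//.
  by rewrite ler_pM2l//; lra.
Qed.

Lemma prim_le F f a b : prim F f -> 0 <= a -> a <= b ->
  (forall x, a <= x <= b -> complex.Re (f x) <= 0) -> complex.Re (F b) <= complex.Re (F a).
Proof.
move=> hF a0 ab h; rewrite -subr_le0 -cReB (primE hF)//.
have -> : 0 = complex.Re (cint a b (fun=> 0)) by rewrite cint_cst// mul0r.
by apply: Re_cint_le => //; [exact: hF.1|exact: cbm_cst].
Qed.

(** Both bounds come from [1 + t <= expR t] at [t = h] and [t = - h]; the absolute value in the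
    exponent covers both signs of [h]. *)
Lemma expR_quad (h : R) : 0 <= expR h - 1 - h <= h ^+ 2 * expR `|h|.
Proof.
have h1 := expR_ge1Dx h; have h2 := expR_ge1Dx (- h).
have e0 := expR_gt0 h.
have h3 : expR h - 1 <= h * expR h.
  have : expR h * (1 - h) <= expR h * expR (- h) by rewrite ler_pM2l.
  by rewrite -expRD subrr expR0; lra.
apply/andP; split; first by lra.
have a0 := expR_gt0 `|h|.
case: (ger0P h) => h0.
- have : h * (expR h - 1) <= h * (h * expR h) by rewrite ler_wpM2l.
  have : h * 1 <= h * (expR h - 1 - h + 1 + h) by nra.
  by nra.
- have : 1 <= expR (- h) by lra.
  by nra.
Qed.

Lemma prim_exp (G g : R -> R) : prim (fun x => (G x)%:C) (fun x => (g x)%:C) ->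
  prim (fun x => (expR (G x))%:C) (fun x => (g x * expR (G x))%:C).
Proof.
move=> hG; have [BG BG0 bG] : exists2 B : R -> R, (forall L, 0 < B L) &
    forall L x, 0 <= x <= L -> `|G x| <= B L.
  have h L : {B : R | 0 < B & forall x, 0 <= x <= L -> `|G x| <= B}.
    apply: cid2; have [B B0 hB] := cbm_bound L (prim_cbm hG).
    by exists B => // x /hB; rewrite ncR.
  by exists (fun L => projT1 (sigT_of_sig (sig_of_sig2 (h L)))) => [L|L x];
    case: (h L) => //= B B0 hB; exact: hB.
have lG L : exists2 B : R, 0 < B & forall a b, 0 <= a -> a <= b -> b <= L ->
    `|G b - G a| <= B * (b - a).
  have [B B0 hB] := prim_lip L hG; exists B => // a b a0 ab bL.
  by have := hB a b a0 ab bL; rewrite -rmorphB ncR.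
have eB L x : 0 <= x <= L -> expR (G x) <= expR (BG L).
  by move=> xL; rewrite ler_expR (le_trans (ler_norm _))// bG.
have quad L : exists2 B : R, 0 < B & forall a b, 0 <= a -> a <= b -> b <= L ->
    `|expR (G b) - expR (G a) - expR (G a) * (G b - G a)| <= B * (b - a) ^+ 2.
  have [B B0 hB] := lG L.
  exists (expR (BG L) * (B ^+ 2 * expR (2 * BG L))).
    by rewrite !mulr_gt0 ?expR_gt0// exprn_gt0.
  move=> a b a0 ab bL; have aL := le_trans ab bL; have b0 := le_trans a0 ab.
  have -> : expR (G b) = expR (G a) * expR (G b - G a) by rewrite -expRD; congr expR; ring.
  have /andP[q0 q1] := expR_quad (G b - G a).
  have -> : expR (G a) * expR (G b - G a) - expR (G a) - expR (G a) * (G b - G a) =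
    expR (G a) * (expR (G b - G a) - 1 - (G b - G a)) by ring.
  rewrite normrM (ger0_norm (ltW (expR_gt0 _))) (ger0_norm q0) -mulrA.
  apply: ler_pM => //; first by apply: eB; rewrite a0.
  apply: le_trans q1 _.
  have h1 := hB a b a0 ab bL.
  rewrite [leRHS](_ : _ = (B * (b - a)) ^+ 2 * expR (2 * BG L)); last by ring.
  apply: ler_pM; [exact: sqr_ge0|by []| |].
    by rewrite -(@ger0_norm _ ((G b - G a) ^+ 2)) ?sqr_ge0// normrX lerXn2r// nnegrE ?normr_ge0// mulr_ge0 ?subr_ge0// ltW.
  rewrite ler_expR (le_trans (ler_normB _ _))//.
  have := bG L a; have := bG L b; rewrite a0 b0 => /(_ bL) ? /(_ aL) ?; lra.
have lip L : exists2 B : R, 0 < B & forall a b, 0 <= a -> a <= b -> b <= L ->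
    `|expR (G b) - expR (G a)| <= B * (b - a).
  have [B B0 hB] := quad L; have [B' B0' hB'] := lG L.
  have [L0|L0] := ltP L 0; first by exists 1 => // *; lra.
  exists (B * L + expR (BG L) * B'); first by rewrite ltr_wpDl ?mulr_ge0 ?mulr_gt0 ?expR_gt0// ltW.
  move=> a b a0 ab bL; have h1 := hB a b a0 ab bL; have h2 := hB' a b a0 ab bL.
  have h3 : expR (G a) <= expR (BG L) by apply: eB; rewrite a0 (le_trans ab bL).
  have -> : expR (G b) - expR (G a) = (expR (G b) - expR (G a) - expR (G a) * (G b - G a))
     + expR (G a) * (G b - G a) by ring.
  rewrite (le_trans (ler_normD _ _))// mulrDl lerD//.
    apply: le_trans h1 _; rewrite expr2 -mulrA ler_pM2l//.
    by rewrite ler_wpM2r ?subr_ge0//; lra.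
  rewrite normrM (ger0_norm (ltW (expR_gt0 _))) -mulrA.
  by apply: ler_pM.
have cE : hcont (fun x => (expR (G x))%:C).
  apply: lip_hcont => L; have [B B0 hB] := lip L; exists B => // a b a0 ab bL.
  by rewrite -rmorphB ncR hB.
have cgE : cbm (fun x => (g x * expR (G x))%:C).
  apply: (@eq_cbm _ (fun x => (g x)%:C * (expR (G x))%:C)) => [x|]; first by rewrite -rmorphM.
  by apply: cbmM; [exact: hG.1|exact: hcont_cbm].
apply: prim_of2 => // L.
have [B B0 hB] := quad L; have [B' B0' hB'] := lip L.
have [Bg Bg0 hBg] := cbm_bound L hG.1.
exists (B + Bg * B') => a b a0 ab bL.
have -> : (expR (G b))%:C - (expR (G a))%:C - cint a b (fun x => (g x * expR (G x))%:C)
  = (expR (G b) - expR (G a) - expR (G a) * (G b - G a))%:C -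
    cint a b (fun x => (g x)%:C * ((expR (G x))%:C - (expR (G a))%:C)).
  have -> : cint a b (fun x => (g x)%:C * ((expR (G x))%:C - (expR (G a))%:C)) =
     cint a b (fun x => (g x * expR (G x))%:C - (expR (G a))%:C * (g x)%:C).
    by apply: eq_cint => x _; rewrite rmorphM; ring.
  rewrite cintB ?cintZ//; [|exact: hG.1|by apply: cbmM; [exact: cbm_cst|exact: hG.1]].
  by rewrite -(primE hG)// !rmorphB rmorphM !rmorphB; ring.
rewrite (le_trans (ncB _ _))// mulrDl lerD//; first by rewrite ncR hB.
have -> : Bg * B' * (b - a) ^+ 2 = (Bg * (B' * (b - a))) * (b - a) by ring.
apply: nc_cint_le => //.
  by apply: cbmM; [exact: hG.1|apply: cbmB; [exact: hcont_cbm|exact: cbm_cst]].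
move=> x /andP[ax xb]; have x0 := le_trans a0 ax; have xL := le_trans xb bL.
rewrite ncM ler_pM ?nc_ge0 ?hBg ?x0//.
rewrite -rmorphB ncR; apply: le_trans (hB' _ _ a0 ax xL) _.
by rewrite ler_pM2l//; lra.
Qed.

(** The product of [Y] with the integrating factor [expR (- G)] is nonincreasing. *)
Lemma gronwall (Y y G g : R -> R) a b : 0 <= a -> a <= b ->
  prim (fun x => (Y x)%:C) (fun x => (y x)%:C) ->
  prim (fun x => (G x)%:C) (fun x => (g x)%:C) ->
  (forall x, a <= x <= b -> y x <= g x * Y x) ->
  Y b <= Y a * expR (G b - G a).
Proof.
move=> a0 ab hY hG h.
have hE : prim (fun x => (expR (- G x))%:C) (fun x => (- g x * expR (- G x))%:C).
  apply: prim_exp; apply: prim_ext (primN hG) => x _; exact/esym/rmorphN.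
have : complex.Re ((Y b)%:C * (expR (- G b))%:C) <= complex.Re ((Y a)%:C * (expR (- G a))%:C).
  apply: (prim_le (primM hY hE) a0 ab) => x /h yx; rewrite -!rmorphM -rmorphD/=.
  have := expR_gt0 (- G x); nra.
rewrite -!rmorphM /=.
rewrite !expRN ler_pdivrMr ?expR_gt0// => /le_trans; apply.
rewrite expRD expRN le_eqVlt; apply/orP; left; apply/eqP; ring.
Qed.

Lemma prim_lim (Fn fn : nat -> R -> C) F f : (forall n, prim (Fn n) (fn n)) ->
  (forall x, 0 <= x -> forall e : R, 0 < e -> \forall n \near \oo, nc (Fn n x - F x) <= e) ->
  cbm f ->
  (forall L e : R, 0 < e -> \forall n \near \oo, forall x, 0 <= x <= L -> nc (fn n x - f x) <= e) ->
  prim F f.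
Proof.
move=> hn hF hf hfn; split => // x x0.
apply/eqP; rewrite -subr_eq0; apply/eqP; apply: cvg_to0_eq => e e0.
(* Two end point errors and an integral over a length [x] amount to [x + 2] multiples of [e']. *)
pose e' := e / (x + 2).
have e'0 : 0 < e' by rewrite divr_gt0//; lra.
near \oo => n.
have h1 : nc (Fn n x - F x) <= e' by near: n; exact: hF.
have h2 : nc (Fn n 0 - F 0) <= e' by near: n; exact: hF.
have h3 : forall y, 0 <= y <= x -> nc (fn n y - f y) <= e' by near: n; exact: hfn.
have -> : F x - (F 0 + cint 0 x f) = (F x - Fn n x) + (Fn n 0 - F 0) + cint 0 x (fun y => fn n y - f y).
  rewrite cintB//; last exact: (hn n).1.
  by rewrite -(primE (hn n))//; ring.
apply: (@le_trans _ _ (e' + e' + e' * (x - 0))).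
  rewrite (le_trans (ncD _ _))// lerD//; last first.
    by apply: nc_cint_le => //; apply: cbmB => //; exact: (hn n).1.
  by rewrite (le_trans (ncD _ _))// lerD// ncC.
rewrite le_eqVlt; apply/orP; left; apply/eqP; rewrite /e'; field; lra.
Unshelve. all: by end_near. Qed.

End Primitive.

(** * Complex differentiability and Goursat's argument *)

Section Goursat.
Variable R : realType.
Local Notation C := R[i].
Local Notation mu := (@lebesgue_measure R).

Lemma prim_of_derive (F f : R -> R) : (forall x, is_derive x (1 : R) F (f x)) ->
  continuous f -> prim (fun x => (F x)%:C) (fun x => (f x)%:C).
Proof.
move=> dF cf; have hf : cbm (fun x => (f x)%:C) by apply: cbmR; exact: rcont_rbm.
split => // x; rewrite le_eqVlt => /predU1P[<-|x0]; first by rewrite cint_pt addr0.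
have cF : continuous F.
  by move=> y; apply: differentiable_continuous; apply/derivable1_diffP; case: (dF y).
have h : (\int[mu]_(t in `[0%R, x]) (f t)%:E = (F x)%:E - (F 0%R)%:E)%E.
  apply: continuous_FTC2 => //.
  - exact: continuous_subspaceT.
  - split; first by move=> y _; case: (dF y).
    + by apply: cvg_at_right_filter; exact: cF.
    + by apply: cvg_at_left_filter; exact: cF.
  - by move=> y _; rewrite derive1E derive_val.
apply: complex_eq => /=; rewrite ?cReD ?cImD/= /Rintegral.
  by rewrite h /= addrCA subrr addr0.
by rewrite integral0/= addr0.
Qed.

Definition cis (t : R) : C := cos t +i* sin t.

Lemma nc_cis t : nc (cis t) = 1.
Proof. by rewrite /= cos2Dsin2 sqrtr1. Qed.

Lemma cis0 : cis 0 = 1.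
Proof. by rewrite /cis cos0 sin0. Qed.

Lemma cis2pi : cis (pi *+ 2) = 1.
Proof. by rewrite /cis cos2pi sin2pi. Qed.

Lemma prim_cis : prim cis (fun t => 'i * cis t).
Proof.
have h1 : prim (fun t => (cos t)%:C) (fun t : R => (- sin t)%:C).
  by apply: prim_of_derive => // t; apply: continuousN; exact: continuous_sin.
have h2 : prim (fun t => (sin t)%:C) (fun t : R => (cos t)%:C).
  by apply: prim_of_derive => //; exact: continuous_cos.
apply: prim_ext (primD h1 (primZ 'i h2)) => t _;
  by apply: complex_eq; rewrite ?cReD ?cImD ?cReM ?cImM/=; ring.
Qed.

Lemma cis_lip a b : 0 <= a -> 0 <= b -> nc (cis b - cis a) <= `|b - a|.
Proof.
wlog ab : a b / a <= b => [hw|].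
  by case: (leP a b) => [|/ltW] ab a0 b0; [exact: hw|rewrite ncC distrC; exact: hw].
move=> a0 b0; rewrite (primE prim_cis)// ger0_norm ?subr_ge0//.
rewrite -[leRHS]mul1r; apply: nc_cint_le => //; first exact: prim_cis.1.
by move=> t _; rewrite ncM nci nc_cis mulr1.
Qed.

(** Complex differentiability through the real modulus [nc], so that estimates stay in [R];
    [cdiff_derivable] identifies it with [derivable]. *)
Definition cdiff (f : C -> C) (w : C) := exists d : C, forall e : R, 0 < e ->
  exists2 del : R, 0 < del & forall v, nc (v - w) < del ->
    nc (f v - f w - d * (v - w)) <= e * nc (v - w).

Lemma cdiff_cont f w : cdiff f w -> forall e : R, 0 < e ->
  exists2 del : R, 0 < del & forall v, nc (v - w) < del -> nc (f v - f w) < e.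
Proof.
move=> [d hd] e e0; have [del del0 h] := hd 1 ltr01.
have K0 : 0 < nc d + 1 by have := nc_ge0 d; lra.
exists (Num.min del (e / (nc d + 1))); first by rewrite lt_min del0 divr_gt0.
move=> v; rewrite lt_min => /andP[/h h1 h2].
rewrite ltr_pdivlMr// in h2.
have := ncD (f v - f w - d * (v - w)) (d * (v - w)).
rewrite subrK ncM; lra.
Qed.

Lemma cdiff_hcont (f : C -> C) (g : R -> C) (K : R) : 0 < K ->
  (forall x y, 0 <= x -> 0 <= y -> nc (g x - g y) <= K * `|x - y|) ->
  (forall x, 0 <= x -> cdiff f (g x)) -> hcont (f \o g).
Proof.
move=> K0 hg hf x x0 e e0; have [d d0 h] := cdiff_cont (hf x x0) e0.
exists (d / K); first by rewrite divr_gt0.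
move=> y y0; rewrite ltr_pdivlMr// => yx; apply: h.
by apply: le_lt_trans (hg _ _ y0 x0) _; rewrite mulrC.
Qed.

Lemma expr2_small (S d : R) : 0 <= S -> 0 < d -> exists n : nat, S / 2 ^+ n < d.
Proof.
move=> S0 d0; exists (Num.bound (S / d)).
rewrite ltr_pdivrMr ?exprn_gt0// mulrC -ltr_pdivrMr//.
have : S / d < (Num.bound (S / d))%:R by apply: archi_boundP; rewrite divr_ge0// ltW.
move=> /lt_trans; apply; rewrite -natrX ltr_nat; exact: ltn_expl.
Qed.

(* Goursat's bisection argument for an additive rectangle function. *)
Lemma rect_null (Psi : R -> R -> R -> R -> C) (a b c d : R) : a <= b -> c <= d ->
  (forall a' m b' c' d', a <= a' -> a' <= m -> m <= b' -> b' <= b ->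
     c <= c' -> c' <= d' -> d' <= d ->
     Psi a' b' c' d' = Psi a' m c' d' + Psi m b' c' d') ->
  (forall a' b' c' m d', a <= a' -> a' <= b' -> b' <= b ->
     c <= c' -> c' <= m -> m <= d' -> d' <= d ->
     Psi a' b' c' d' = Psi a' b' c' m + Psi a' b' m d') ->
  (forall p q, a <= p <= b -> c <= q <= d -> forall e, 0 < e ->
     exists2 del : R, 0 < del & forall a' b' c' d',
       a <= a' -> a' <= p -> p <= b' -> b' <= b ->
       c <= c' -> c' <= q -> q <= d' -> d' <= d ->
       b' - a' < del -> d' - c' < del ->
       nc (Psi a' b' c' d') <= e * ((b' - a') + (d' - c')) ^+ 2) ->
  Psi a b c d = 0.
Proof.
move=> ab cd splitx splity loc; apply/eqP; rewrite -nc_eq0; apply/negPn/negP => P0.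
pose S := (b - a) + (d - c).
have S0 : 0 <= S by rewrite /S; lra.
(* Halving both sides divides the squared size by 4, so one of the four quarters keeps the strict
   inequality of [good]. The [+ 1] covers a rectangle of size 0. *)
pose e0 := nc (Psi a b c d) / (2 * (S ^+ 2 + 1)).
have S21 : 0 < 2 * (S ^+ 2 + 1) by have := sqr_ge0 S; lra.
have nP : 0 < nc (Psi a b c d) by rewrite lt_def P0 nc_ge0.
have e00 : 0 < e0 by rewrite divr_gt0.
pose w n := (b - a) / 2 ^+ n; pose h n := (d - c) / 2 ^+ n.
have w0 n : 0 <= w n by rewrite /w divr_ge0 ?exprn_ge0//; lra.
have h0 n : 0 <= h n by rewrite /h divr_ge0 ?exprn_ge0//; lra.
have w2 n : w n = w n.+1 + w n.+1 by rewrite /w exprS; field; rewrite expf_neq0.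
have h2 n : h n = h n.+1 + h n.+1 by rewrite /h exprS; field; rewrite expf_neq0.
pose good n (x : R * R) := [/\ a <= x.1, x.1 + w n <= b, c <= x.2, x.2 + h n <= d &
  e0 * (w n + h n) ^+ 2 < nc (Psi x.1 (x.1 + w n) x.2 (x.2 + h n))].
have good0 : good 0%N (a, c).
  rewrite /good /w /h expr0 !divr1/= !lexx; split; try lra.
  rewrite !subrKC -/S /e0 mulrAC ltr_pdivrMr// ltr_pM2l//.
  by have := sqr_ge0 S; lra.
have step n x : good n x -> {y | good n.+1 y /\
   (x.1 <= y.1 /\ y.1 + w n.+1 <= x.1 + w n) /\ (x.2 <= y.2 /\ y.2 + h n.+1 <= x.2 + h n)}.
  case: x => p q; rewrite /good/= w2 h2 => -[h1 h1' h3 h3' h5]; apply: cid.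
  move: h1' h3' h5 (w0 n.+1) (h0 n.+1); move: (w n.+1) (h n.+1) => W H h1' h3' h5 W0 H0.
  have : nc (Psi p (p + (W + W)) q (q + (H + H))) <=
    nc (Psi p (p + W) q (q + H)) + nc (Psi p (p + W) (q + H) (q + H + H)) +
    (nc (Psi (p + W) (p + W + W) q (q + H)) + nc (Psi (p + W) (p + W + W) (q + H) (q + H + H))).
    rewrite (addrA p W W) (addrA q H H) (splitx _ (p + W)); try lra.
    rewrite (splity p (p + W) q (q + H)); try lra.
    rewrite (splity (p + W) _ q (q + H)); try lra.
    by apply: le_trans (ncD _ _) _; apply: lerD; exact: ncD.
  set A1 := nc (Psi p _ q (q + H)); set A2 := nc (Psi p _ (q + H) _).
  set A3 := nc (Psi (p + W) _ q (q + H)); set A4 := nc (Psi (p + W) _ (q + H) _) => hle.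
  have hlt := lt_le_trans h5 hle.
  have {hlt} hlt : 4 * (e0 * (W + H) ^+ 2) < A1 + A2 + (A3 + A4).
    by apply: le_lt_trans hlt; rewrite le_eqVlt; apply/orP; left; apply/eqP; ring.
  rewrite addrA in h1'; rewrite addrA in h3'.
  have [k1|k1] := ltP (e0 * (W + H) ^+ 2) A1.
    by exists (p, q); split => /=; [split; first [lra|assumption]|lra].
  have [k2|k2] := ltP (e0 * (W + H) ^+ 2) A2.
    by exists (p, q + H); split => /=; [split; first [lra|assumption]|lra].
  have [k3|k3] := ltP (e0 * (W + H) ^+ 2) A3.
    by exists (p + W, q); split => /=; [split; first [lra|assumption]|lra].
  exists (p + W, q + H); split => /=; last lra.
  by split; rewrite -/A4; lra.

have [x [x0 xS]] : exists x : nat -> R * R, good 0%N (x 0%N) /\ forall n, good n (x n) /\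
   ((x n).1 <= (x n.+1).1 /\ (x n.+1).1 + w n.+1 <= (x n).1 + w n) /\
   ((x n).2 <= (x n.+1).2 /\ (x n.+1).2 + h n.+1 <= (x n).2 + h n).
  pose X := fix X n : {x | good n x} := if n is m.+1 then
    exist _ (projT1 (sigT_of_sig (step m _ (proj2_sig (X m)))))
      (proj2_sig (step m _ (proj2_sig (X m)))).1
    else exist _ (a, c) good0.
  exists (fun n => proj1_sig (X n)); split => [//|n]; split; first exact: (proj2_sig (X n)).
  by rewrite /=; case: (step n _ _) => y [].
have lim (u : nat -> R) (v : nat -> R) : (forall n, 0 <= v n) ->
    (forall n, u n <= u n.+1 /\ u n.+1 + v n.+1 <= u n + v n) ->
    exists p, forall n, u n <= p <= u n + v n.
  move=> v0 uv; have mono m n : u m <= u (m + n)%N /\ u (m + n)%N + v (m + n)%N <= u m + v m.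
    elim: n => [|n [IH1 IH2]]; first by rewrite addn0 !lexx.
    by have := uv (m + n)%N; rewrite addnS => -[]; lra.
  have ub m n : u m <= u n + v n.
    case: (leqP m n) => [/subnKC <-|/ltnW/subnKC <-].
      by have := mono m (n - m)%N; have := v0 (m + (n - m))%N; lra.
    by have := mono n (m - n)%N; have := v0 (n + (m - n))%N; lra.
  exists (sup (range u)) => n; apply/andP; split.
    apply: ub_le_sup; last by exists n.
    by exists (u 0%N + v 0%N) => _ [m _ <-]; exact: ub.
  apply: ge_sup; first by exists (u 0%N); exists 0%N.
  by move=> _ [m _ <-]; exact: ub.
have [p hp] := lim (fun n => (x n).1) w w0 (fun n => (xS n).2.1).
have [q hq] := lim (fun n => (x n).2) h h0 (fun n => (xS n).2.2).
have [[g1 g2 g3 g4 _] _] := xS 0%N.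
have pab : a <= p <= b by have := hp 0%N; lra.
have qcd : c <= q <= d by have := hq 0%N; lra.
have [del del0 hdel] := loc p q pab qcd _ e00.
have [n Sn] := expr2_small S0 del0.
have whn : w n + h n = S / 2 ^+ n by rewrite /w /h /S -mulrDl.
have [[k1 k2 k3 k4 k5] _] := xS n.
have := hdel (x n).1 ((x n).1 + w n) (x n).2 ((x n).2 + h n).
have := hp n; have := hq n; have := w0 n; have := h0 n.
rewrite ![_ + _ - _]addrAC subrr !add0r.
move=> H0 W0 /andP[q1 q2] /andP[p1 p2] /(_ k1 p1 p2 k2 k3 q1 q2 k4) hh.
by have := hh _ _; move=> /(_ ltac:(lra) ltac:(lra)); lra.
Qed.

End Goursat.

(** * Circular means *)

Section CircleMean.
Variable R : realType.
Local Notation C := R[i].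
Local Notation mu := (@lebesgue_measure R).

(** This is the contour integral of [f w dw / (i w)]. The form is closed away from 0 for holomorphic
    [f], hence the independence of [rho]. *)
Definition circ (f : C -> C) (rho : R) : C :=
  cint 0 (pi *+ 2) (fun t => f (rho%:C * cis t)).

Lemma pi2_ge0 : 0 <= pi *+ 2 :> R.
Proof. by rewrite mulrn_wge0// pi_ge0. Qed.

Lemma nc_polar (rho t : R) : 0 <= rho -> nc (rho%:C * cis t) = rho.
Proof. by move=> h; rewrite ncM nc_cis ncR mulr1 ger0_norm. Qed.

Lemma polar_hcont (f : C -> C) (rho : R) : 0 < rho ->
  (forall w, nc w = rho -> cdiff f w) -> hcont (fun t => f (rho%:C * cis t)).
Proof.
move=> rho0 hf; apply: (@cdiff_hcont _ f (fun t => rho%:C * cis t) rho) => //.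
- move=> x y x0 y0; rewrite -mulrBr ncM ncR (gtr0_norm rho0) ler_pM2l//.
  exact: cis_lip.
- by move=> x _; apply: hf; rewrite nc_polar// ltW.
Qed.

(** In polar coordinates [f dw / w] is [f (dx / x + i dt)]. Its integral over the boundary of
    [[r1, r2] x [0, 2 pi]] vanishes by [rect_null], and the two radial sides cancel. *)
Lemma circ_indep (f : C -> C) (r1 r2 : R) : 0 < r1 -> r1 <= r2 ->
  (forall w, r1 <= nc w <= r2 -> cdiff f w) -> circ f r1 = circ f r2.
Proof.
move=> r10 r12 hf; have r20 : 0 < r2 by lra.
(* Clamping the radius to [[r1, r2]] makes the integrands continuous on the whole half line, as
   [hcont] requires. *)
pose cl (x : R) := Num.max r1 (Num.min x r2).
have cl1 x : r1 <= cl x by rewrite /cl le_max lexx.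
have cl2 x : cl x <= r2 by rewrite /cl ge_max r12 ge_min lexx orbT.
have clE x : r1 <= x -> x <= r2 -> cl x = x by move=> h1 h2; rewrite /cl min_l// max_r.
have cl0 x : 0 < cl x by apply: lt_le_trans (cl1 x).
have clip x y : `|cl x - cl y| <= `|x - y|.
  rewrite ler_norml; have := ler_norm (x - y); have := ler_norm (y - x).
  rewrite (distrC y x) /cl; move: `|x - y| => s s1 s2.
  by case: (leP x r2) => xr; case: (leP y r2) => yr; rewrite ?(max_r r12);
    case: (leP r1 x) => k1; case: (leP r1 y) => k2; lra.
pose F (G : C -> C) (x t : R) := G ((cl x)%:C * cis t).
pose adm (G : C -> C) := forall w, r1 <= nc w <= r2 -> cdiff G w.
have adm1 G x : adm G -> cbm (F G x).
  move=> hG; apply: hcont_cbm; apply: polar_hcont => // w wx.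
  by apply: hG; rewrite wx cl1 cl2.
have clC x : (cl x)%:C != 0 by rewrite -nc_gt0 ncR gtr0_norm.
have adm2 G (t : R) : adm G -> 0 <= t -> cbm (fun x => F G x t / (cl x)%:C).
  move=> hG t0; have lipc : forall x y, 0 <= x -> 0 <= y ->
      nc ((cl x)%:C * cis t - (cl y)%:C * cis t) <= 1 * `|x - y|.
    by move=> x y _ _; rewrite -mulrBl -rmorphB ncM nc_cis ncR mulr1 mul1r.
  apply: hcont_cbm; apply: hcontM.
    apply: (@cdiff_hcont _ G (fun x => (cl x)%:C * cis t) 1) => // x _.
    by apply: hG; rewrite nc_polar ?cl1 ?cl2// ltW.
  apply: hcontV => // x x0 e e0; exists e => // y y0 xy.
  by rewrite -rmorphB ncR; exact: le_lt_trans (clip _ _) xy.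
(* The boundary integral of [G dw / w] over a polar rectangle: first the arcs, then the radii. *)
pose Psi (G : C -> C) (a b c d : R) := 'i * (cint c d (F G b) - cint c d (F G a)) -
  (cint a b (fun x => F G x d / (cl x)%:C) - cint a b (fun x => F G x c / (cl x)%:C)).
have P0 : Psi f r1 r2 0 (pi *+ 2) = 0.
  apply: rect_null => //; first exact: pi2_ge0.
  - move=> a m b c d ra am mb br c0 cd dp; rewrite /Psi.
    have a0 : 0 <= a by lra.
    have d0 : 0 <= d by lra.
    rewrite (cint_itvD (a := a) (b := m) (c := b) a0 am mb (adm2 f d hf d0)).
    rewrite (cint_itvD (a := a) (b := m) (c := b) a0 am mb (adm2 f c hf c0)).
    by ring.
  - move=> a b c m d ra ab br c0 cm md dp; rewrite /Psi.
    rewrite (cint_itvD (a := c) (b := m) (c := d) c0 cm md (adm1 f a hf)).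
    rewrite (cint_itvD (a := c) (b := m) (c := d) c0 cm md (adm1 f b hf)).
    by ring.
  move=> p q /andP[p1 p2] /andP[q1 q2] e e0.
  pose w0 := p%:C * cis q.
  have nw0 : nc w0 = p by rewrite nc_polar//; lra.
  have [D hD] : cdiff f w0 by apply: hf; rewrite nw0 p1.
  (* [K] is a Lipschitz constant of the polar map. The other factor in [e1] counts two arcs and two
     radii, the latter with weight [1 / x <= 1 / r1]. *)
  pose K := 1 + r2; have K0 : 0 < K by rewrite /K; lra.
  have r1V : 0 < r1^-1 by rewrite invr_gt0.
  pose e1 := e / (K * (2 + 2 * r1^-1)).
  have KK : 0 < K * (2 + 2 * r1^-1) by rewrite mulr_gt0//; lra.
  have e10 : 0 < e1 by rewrite divr_gt0.
  have [del del0 hdel] := hD _ e10.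
  exists (del / (2 * K)); first by rewrite divr_gt0//; lra.
  move=> a b c d ra ap pb br c0 cq qd dp bd dd.
  have ab : a <= b by lra. have cd : c <= d by lra.
  have a0 : 0 <= a by lra. have d0 : 0 <= d by lra.
  (* [f] is split into its affine part at [w0], whose boundary integral vanishes by computation, and
     an error [E] that is [o(w - w0)]. *)
  pose L (w : C) := f w0 + D * (w - w0).
  have cL w : cdiff L w.
    exists D => e' e'0; exists 1 => // v _; rewrite /L.
    have -> : f w0 + D * (v - w0) - (f w0 + D * (w - w0)) - D * (v - w) = 0 by ring.
    by rewrite nc0 mulr_ge0 ?nc_ge0 ?ltW.
  pose E (w : C) := f w - L w.
  have cE : adm E.
    move=> w /hf[d1 h1]; exists (d1 - D) => e' e'0; have [dl dl0 h2] := h1 _ e'0.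
    exists dl => // v /h2; congr (nc _ <= _); rewrite /E /L; ring.
  have -> : Psi f a b c d = Psi L a b c d + Psi E a b c d.
    have fE x t : F f x t = F L x t + F E x t by rewrite /F /E; ring.
    rewrite /Psi.
    have s1 x : cint c d (F f x) = cint c d (F L x) + cint c d (F E x).
      by rewrite -cintD//; [apply: eq_cint => t _|apply: adm1 => w _|exact: adm1].
    have s2 t : 0 <= t -> cint a b (fun x => F f x t / (cl x)%:C) = 
        cint a b (fun x => F L x t / (cl x)%:C) + cint a b (fun x => F E x t / (cl x)%:C).
      move=> t0; rewrite -cintD//; [|by apply: adm2 => // w _|exact: adm2].
      by apply: eq_cint => x _; rewrite fE mulrDl.
    rewrite (s1 a) (s1 b) (s2 c c0) (s2 d d0); clear; ring.
  have -> : Psi L a b c d = 0.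
    have icis : 'i * cint c d (@cis R) = cis d - cis c.
      by rewrite (primE (prim_cis R))// cintZ//; exact: prim_cbm (prim_cis R).
    have s1 x : r1 <= x -> x <= r2 -> cint c d (F L x) =
        (f w0 - D * w0) * (d - c)%:C + (D * x%:C) * cint c d (@cis R).
      move=> x1 x2; rewrite -cint_cst// -cintZ//; last exact: prim_cbm (prim_cis R).
      rewrite -cintD//; [|exact: cbm_cst|].
        by apply: eq_cint => t _; rewrite /F /L clE//; ring.
      by apply: cbmM; [exact: cbm_cst|exact: prim_cbm (prim_cis R)].
    have ar : a <= r2 by lra.
    have ra1 : r1 <= b by lra.
    have aL : adm L by move=> w _.
    rewrite /Psi (s1 b)// (s1 a)// -cintB//; [|exact: adm2|exact: adm2].
    rewrite (@eq_cint _ a b _ (fun=> D * (cis d - cis c))); last first.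
      move=> x /andP[ax xb]; rewrite /F /L; have := clC x; rewrite clE; [|lra|lra].
      by move=> xn0; field.
    rewrite cint_cst// !rmorphB/=.
    have -> : 'i * ((f w0 - D * w0) * (d%:C - c%:C) + D * b%:C * cint c d (@cis R) -
      ((f w0 - D * w0) * (d%:C - c%:C) + D * a%:C * cint c d (@cis R))) =
      D * (b%:C - a%:C) * ('i * cint c d (@cis R)) by ring.
    by rewrite icis; ring.
  rewrite add0r.
  pose s := (b - a) + (d - c).
  have s0 : 0 <= s by rewrite /s; lra.
  have hE x t : a <= x <= b -> c <= t <= d -> nc (F E x t) <= e1 * (K * s).
    move=> /andP[ax xb] /andP[ct td].
    have hx : nc ((cl x)%:C * cis t - w0) <= K * s.
      rewrite /w0 clE; [|lra|lra].
      rewrite (_ : _ - _ = (x - p)%:C * cis t + p%:C * (cis t - cis q)); last first.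
        by rewrite rmorphB; ring.
      rewrite (le_trans (ncD _ _))// !ncM nc_cis !ncR mulr1 (@ger0_norm _ p); last lra.
      have h1 : `|x - p| <= s by rewrite ler_norml /s; lra.
      have h2 : nc (cis t - cis q) <= s.
        have t0 := le_trans c0 ct; have q0 : 0 <= q by clear - c0 cq; lra.
          apply: le_trans (cis_lip q0 t0) _.
          by rewrite ler_norml /s; clear - ab ct td cq qd; lra.
      rewrite /K mulrDl mul1r lerD// ler_pM ?nc_ge0//; lra.
    have hlt : nc ((cl x)%:C * cis t - w0) < del.
      apply: le_lt_trans hx _; rewrite mulrC -ltr_pdivlMr// /s.
      by rewrite (_ : del / K = del / (2 * K) + del / (2 * K)); [lra|field; rewrite gt_eqF].
    have := hdel _ hlt; rewrite /F /E /L.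
    rewrite (_ : f _ - f w0 - _ = f ((cl x)%:C * cis t) - (f w0 + D * ((cl x)%:C * cis t - w0))); last by ring.
    by move=> /le_trans; apply; rewrite ler_pM2l.
  have i1 x : a <= x <= b -> nc (cint c d (F E x)) <= e1 * (K * s) * (d - c).
    by move=> xab; apply: nc_cint_le => // [|t]; [exact: adm1|exact: hE].
  have i2 t : c <= t <= d -> nc (cint a b (fun x => F E x t / (cl x)%:C)) <= e1 * (K * s) * r1^-1 * (b - a).
    move=> tcd; apply: nc_cint_le => // [|x xab]; first by apply: adm2 => //; lra.
    rewrite ncf ncR (gtr0_norm (cl0 x)) ler_pM ?nc_ge0 ?invr_ge0 ?(ltW (cl0 x)) ?hE//.
    by rewrite lef_pV2 ?posrE.
  have ha : a <= a <= b by rewrite lexx. have hb : a <= b <= b by rewrite lexx andbT.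
  have hc : c <= c <= d by rewrite lexx. have hd : c <= d <= d by rewrite lexx andbT.
  rewrite /Psi (le_trans (ncB _ _))// ncM nci mul1r.
  apply: (@le_trans _ _ (e1 * (K * s) * (d - c) + e1 * (K * s) * (d - c) +
     (e1 * (K * s) * r1^-1 * (b - a) + e1 * (K * s) * r1^-1 * (b - a)))).
    exact: lerD (le_trans (ncB _ _) (lerD (i1 b hb) (i1 a ha)))
      (le_trans (ncB _ _) (lerD (i2 d hd) (i2 c hc))).
  rewrite -/s.
  have -> : e * s ^+ 2 = e1 * (K * s) * ((2 + 2 * r1^-1) * s).
    by rewrite /e1; field; rewrite !gt_eqF//; lra.
  have h3 : 0 <= e1 * (K * s) by rewrite mulr_ge0 ?(ltW e10)// mulr_ge0 ?(ltW K0).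
  have h4 : (d - c) + (d - c) + (r1^-1 * (b - a) + r1^-1 * (b - a)) <= (2 + 2 * r1^-1) * s.
    by rewrite /s; nra.
  by have := ler_wpM2l h3 h4; lra.
have eqF t : F f r1 t = f (r1%:C * cis t) by rewrite /F clE.
have eqF' t : F f r2 t = f (r2%:C * cis t) by rewrite /F clE.
move: P0; rewrite /Psi.
have -> : (fun x => F f x (pi *+ 2) / (cl x)%:C) = (fun x => F f x 0 / (cl x)%:C).
  by apply/funext => x; rewrite /F cis2pi cis0.
rewrite subrr subr0 => /eqP; rewrite mulf_eq0 -nc_eq0 nci oner_eq0/= subr_eq0 => /eqP h.
by rewrite /circ -(eq_cint (fun t _ => eqF t)) -(eq_cint (fun t _ => eqF' t)) h.
Qed.

End CircleMean.

(** * Rules for complex differentiability *)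

Section ComplexDerivative.
Variable R : realType.
Local Notation C := R[i].
Implicit Types (f g : C -> C) (w : C).

Lemma posC_real (e : C) : 0 < e -> exists2 d : R, 0 < d & e = d%:C.
Proof.
case: e => a b; rewrite ltcE/= => /andP[/eqP-> a0]; by exists a.
Qed.

Lemma cdiff_derivable f w : cdiff f w <-> derivable f w 1.
Proof.
split.
  move=> [d hd]; apply/cvg_ex; exists d; apply/cvgrPdist_le => _/posC_real[e e0 ->].
  have [del del0 h] := hd _ e0; near=> v.
  have v0 : v != 0 by near: v; exact: nbhs_dnbhs_neq.
  have vd : nc v < del.
    have : `|v| < del%:C by near: v; apply: dnbhs0_lt; rewrite ltcR.
    by rewrite ncE ltcR.
  have := h (v + w); rewrite addrK => /(_ vd) h1.
  have nv : 0 < nc v by rewrite nc_gt0.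
  rewrite ncE lecR scaler1 -(ler_pM2r nv) -ncM.
  apply: le_trans h1; rewrite le_eqVlt; apply/orP; left; apply/eqP.
  rewrite -ncN; congr nc; rewrite /GRing.scale/=; field; exact: v0.
move=> /cvg_ex[d /cvgrPdist_le hd]; exists d => e e0.
have e0' : 0 < e%:C by rewrite ltcR.
have := hd _ e0'; move=> -[/= _ /posC_real[del del0 ->] h].
exists del => // v vd.
have [->|vw] := eqVneq v w.
  by rewrite !subrr mulr0 subrr nc0 mulr0.
have := h (v - w); rewrite /ball_ /= sub0r normrN ncE ltcR subr_eq0 => /(_ vd vw).
have nv : 0 < nc (v - w) by rewrite nc_gt0 subr_eq0.
rewrite ncE lecR scaler1 subrK -(ler_pM2r nv) -ncM.
apply: le_trans; rewrite le_eqVlt; apply/orP; left; apply/eqP.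
rewrite -ncN; congr nc; rewrite /GRing.scale/=; field; by rewrite subr_eq0.
Unshelve. all: by end_near. Qed.

Lemma cdiff_cst (k : C) w : cdiff (fun=> k) w.
Proof. by apply/cdiff_derivable; exact: derivable_cst. Qed.
Lemma cdiff_id w : cdiff id w.
Proof. by apply/cdiff_derivable; exact: derivable_id. Qed.
Lemma cdiffD f g w : cdiff f w -> cdiff g w -> cdiff (fun v => f v + g v) w.
Proof. by move=> /cdiff_derivable hf /cdiff_derivable hg; apply/cdiff_derivable; exact: derivableD. Qed.
Lemma cdiffM f g w : cdiff f w -> cdiff g w -> cdiff (fun v => f v * g v) w.
Proof.
move=> hf hg; have [d hd] := hf; have [d' hd'] := hg.
exists (d * g w + f w * d') => e e0.
have [a0 b0 c0] : [/\ 0 <= nc (g w), 0 <= nc d & 0 <= nc (f w)] by rewrite !nc_ge0.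
pose K := nc (g w) + nc d + nc (f w) + 1; have K0 : 0 < K by rewrite /K; lra.
have e3 : 0 < e / 3 / K by rewrite !divr_gt0.
have [d1 d10 h1] := hd _ e3; have [d2 d20 h2] := hd' _ e3.
have [d3 d30 h3] := cdiff_cont hg e3; have [d4 d40 h4] := cdiff_cont hg (ltr01 : 0 < 1 :> R).
exists (Num.min (Num.min d1 d2) (Num.min d3 d4)); first by rewrite !lt_min d10 d20 d30.
move=> v; rewrite !lt_min => /andP[/andP[/h1 k1 /h2 k2] /andP[/h3 k3 /h4 k4]].
have -> : f v * g v - f w * g w - (d * g w + f w * d') * (v - w) =
  (f v - f w - d * (v - w)) * g v + d * (g v - g w) * (v - w)
  + f w * (g v - g w - d' * (v - w)) by ring.
have n0 := nc_ge0 (v - w).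
have gv : nc (g v) <= nc (g w) + 1 by have := nc_subl (g v) (g w); clear -k4; lra.
have p1 : nc (f v - f w - d * (v - w)) * nc (g v) <= e / 3 / K * nc (v - w) * (nc (g w) + 1).
  by rewrite ler_pM ?nc_ge0.
have p2 : nc d * nc (g v - g w) * nc (v - w) <= nc d * (e / 3 / K) * nc (v - w).
  by rewrite ler_wpM2r// ler_wpM2l// ltW.
have p3 : nc (f w) * nc (g v - g w - d' * (v - w)) <= nc (f w) * (e / 3 / K * nc (v - w)).
  by rewrite ler_wpM2l.
rewrite (le_trans (ncD _ _))// (le_trans (lerD (ncD _ _) (lexx _)))// !ncM.
apply: le_trans (lerD (lerD p1 p2) p3) _.
have -> : e / 3 / K * nc (v - w) * (nc (g w) + 1) + nc d * (e / 3 / K) * nc (v - w) +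
  nc (f w) * (e / 3 / K * nc (v - w)) = e / 3 * nc (v - w).
  by rewrite /K; field; rewrite gt_eqF.
by rewrite ler_wpM2r//; clear -e0; lra.
Qed.
Lemma cdiffN f w : cdiff f w -> cdiff (fun v => - f v) w.
Proof.
move=> hf; have [d hd] := cdiffM (cdiff_cst (-1) w) hf; exists d => e e0.
have [del del0 h] := hd e e0; exists del => // v /h.
by rewrite !mulN1r.
Qed.
Lemma cdiffB f g w : cdiff f w -> cdiff g w -> cdiff (fun v => f v - g v) w.
Proof. by move=> hf /cdiffN; exact: cdiffD. Qed.
Lemma cdiffV f w : cdiff f w -> f w != 0 -> cdiff (fun v => (f v)^-1) w.
Proof.
move=> hf fw; have [d hd] := hf; exists (- d / f w ^+ 2) => e e0.
have a0 : 0 < nc (f w) by rewrite nc_gt0.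
have d0 := nc_ge0 d.
(* Collects the coefficients of the two error terms, with [1 / nc (f v) <= 2 / nc (f w)] near
   [w]. *)
pose K := 2 / nc (f w) ^+ 2 + 2 * nc d / nc (f w) ^+ 3.
have K0 : 0 < K.
  by apply: ltr_pwDl; [rewrite divr_gt0// exprn_gt0|rewrite divr_ge0 ?mulr_ge0 ?exprn_ge0 ?nc_ge0].
have eK : 0 < e / K by rewrite divr_gt0.
have f2 : 0 < nc (f w) / 2 by rewrite divr_gt0.
have [d1 d10 h1] := hd _ eK; have [d2 d20 h2] := cdiff_cont hf eK.
have [d3 d30 h3] := cdiff_cont hf f2.
exists (Num.min d1 (Num.min d2 d3)); first by rewrite !lt_min d10 d20.
move=> v; rewrite !lt_min => /and3P[/h1 k1 /h2 k2 /h3 k3].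
have fv : nc (f w) / 2 <= nc (f v).
  by have := nc_subl (f w) (f v); rewrite ncC in k3; clear -k3; lra.
have fv0 : 0 < nc (f v) by exact: lt_le_trans fv.
have fvn : f v != 0 by rewrite -nc_gt0.
have -> : (f v)^-1 - (f w)^-1 - - d / f w ^+ 2 * (v - w) =
  - (f v - f w - d * (v - w)) / (f v * f w) + d * (f v - f w) * (v - w) / (f v * f w ^+ 2).
  by field; rewrite fw.
have iv : (nc (f v))^-1 <= 2 / nc (f w).
  by rewrite -[leRHS]invrK lef_pV2 ?posrE ?invr_gt0 ?divr_gt0// invfM invrK mulrC.
have n0 := nc_ge0 (v - w).
rewrite (le_trans (ncD _ _))// !ncf ncN (ncM (f v) (f w ^+ 2)) ncX !ncM.
have p1 : nc (f v - f w - d * (v - w)) / (nc (f v) * nc (f w)) <=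
   e / K * nc (v - w) * (2 / nc (f w) * (nc (f w))^-1).
  rewrite ler_pM ?nc_ge0 ?invr_ge0 ?mulr_ge0 ?nc_ge0// invfM.
  by rewrite ler_wpM2r ?invr_ge0 ?nc_ge0.
have p2 : nc d * nc (f v - f w) * nc (v - w) / (nc (f v) * nc (f w) ^+ 2) <=
   nc d * (e / K) * nc (v - w) * (2 / nc (f w) * (nc (f w) ^+ 2)^-1).
  rewrite ler_pM ?mulr_ge0 ?nc_ge0 ?invr_ge0 ?mulr_ge0 ?exprn_ge0 ?nc_ge0//.
    by rewrite ler_wpM2r// ler_wpM2l// ltW.
  by rewrite invfM ler_wpM2r ?invr_ge0 ?exprn_ge0 ?nc_ge0.
apply: le_trans (lerD p1 p2) _; rewrite le_eqVlt; apply/orP; left; apply/eqP.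
have KE : 2 / nc (f w) * (nc (f w))^-1 + nc d * (2 / nc (f w) * (nc (f w) ^+ 2)^-1) = K.
  by rewrite /K; field; rewrite gt_eqF.
transitivity (e / K * K * nc (v - w)); last by rewrite divfK ?gt_eqF.
rewrite (_ : e / K * K = e / K * (2 / nc (f w) * (nc (f w))^-1 +
  nc d * (2 / nc (f w) * (nc (f w) ^+ 2)^-1))); [by ring|by rewrite KE].
Qed.
Lemma cdiffX f n w : cdiff f w -> cdiff (fun v => f v ^+ n) w.
Proof.
move=> hf; elim: n => [|n IH]; first exact: cdiff_cst.
by under eq_fun do rewrite exprS; exact: cdiffM.
Qed.
Lemma cdiff_ext f g w (d : R) : 0 < d -> (forall v, nc (v - w) < d -> f v = g v) ->
  cdiff f w -> cdiff g w.
Proof.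
move=> d0 fg [D hD]; exists D => e e0; have [del del0 h] := hD e e0.
exists (Num.min d del); first by rewrite lt_min d0.
move=> v; rewrite lt_min => /andP[/fg <- /h].
by rewrite -(fg w)// subrr nc0.
Qed.

End ComplexDerivative.

(** * Dominated convergence for complex integrals *)

Section Cauchy.
Variable R : realType.
Local Notation C := R[i].
Local Notation mu := (@lebesgue_measure R).

(** Serves in [cauchy_formula], where circles approach the one that passes through the singular
    point. *)
Lemma cint_dominated0 (a b K : R) (F : nat -> R -> C) : 0 <= a ->
  (forall n, cbm (F n)) -> (forall n t, a <= t <= b -> nc (F n t) <= K) ->
  (forall t, a <= t <= b -> forall e, 0 < e -> \forall n \near \oo, nc (F n t) <= e) ->
  forall e, 0 < e -> \forall n \near \oo, nc (cint a b (F n)) <= e.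
Proof.
move=> a0 hF hK h0.
have real (P : C -> R) : (forall z, `|P z| <= nc z) -> (forall n, rbm (P \o F n)) ->
    (\int[mu]_(x in `[a, b]) P (F n x)) @[n --> \oo] --> (0 : R).
  move=> hP mP.
  pose Fe n x := (P (F n x))%:E.
  have H1 n : measurable_fun `[a, b] (Fe n).
    apply/measurable_EFinP; have [m _] := mP n b.
    by apply: measurable_funS m => //; apply: subset_itvr; rewrite bnd_simp.
  have H2 : {ae mu, forall x, `[a, b]%classic x -> Fe ^~ x @ \oo --> (cst (0 : R)%:E) x}.
    apply/aeW => x; rewrite /= in_itv/= => xab.
    apply/fine_cvgP; split; first by apply: nearW.
    apply/cvgrPdist_le => e e0 /=; have := h0 _ xab e e0; apply: filterS => n.
    by rewrite sub0r normrN; exact: le_trans.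
  have H3 : {ae mu, forall x n, `[a, b]%classic x -> (`|Fe n x| <= cst K%:E x)%E}.
    apply/aeW => x n; rewrite /= in_itv/= => xab.
    by rewrite lee_fin (le_trans (hP _))// hK.
  have [_ _] := @dominated_convergence _ _ _ mu `[a, b]%classic (measurable_itv _)
    Fe (cst (0 : R)%:E) (cst K%:E) H1 (measurable_cst _) H2
    (rbm_integrable b a0 (rbm_cst K)) H3.
  rewrite integral0 => /fine_cvgP[_ h]; exact: h.
move=> e e0; have e2 : 0 < e / 2 by lra.
have /cvgrPdist_le/(_ _ e2) h1 := real (@complex.Re _) (@nc_Re _) (fun n => (hF n).1).
have /cvgrPdist_le/(_ _ e2) h2 := real (@complex.Im _) (@nc_Im _) (fun n => (hF n).2).
near=> n; rewrite (le_trans (nc_le_ReIm _))// [leRHS]splitr lerD//=.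
  by near: n; apply: filterS h1 => n; rewrite sub0r normrN.
by near: n; apply: filterS h2 => n; rewrite sub0r normrN.
Unshelve. all: by end_near. Qed.

End Cauchy.

(** * Cauchy's formula on a punctured disc *)

Section Removable.
Variable R : realType.
Local Notation C := R[i].

Definition pholo (r : R) (f : C -> C) := forall w, 0 < nc w -> nc w < r -> cdiff f w.

Lemma nc_circ (f : C -> C) (rho B : R) : 0 < rho -> (forall w, nc w = rho -> cdiff f w) ->
  (forall w, nc w = rho -> nc (f w) <= B) -> nc (circ f rho) <= B * (pi *+ 2).
Proof.
move=> rho0 hf hB; rewrite -[pi *+ 2]subr0; apply: nc_cint_le => //; first exact: pi2_ge0.
  by apply: hcont_cbm; exact: polar_hcont.
by move=> t _; apply: hB; rewrite nc_polar// ltW.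
Qed.

Lemma circB f g (rho : R) : 0 < rho -> (forall w, nc w = rho -> cdiff f w) ->
  (forall w, nc w = rho -> cdiff g w) ->
  circ (fun w => f w - g w) rho = circ f rho - circ g rho :> C.
Proof. by move=> rho0 hf hg; apply: cintB => //; apply: hcont_cbm; exact: polar_hcont. Qed.

Lemma circD f g (rho : R) : 0 < rho -> (forall w, nc w = rho -> cdiff f w) ->
  (forall w, nc w = rho -> cdiff g w) ->
  circ (fun w => f w + g w) rho = circ f rho + circ g rho :> C.
Proof. by move=> rho0 hf hg; apply: cintD => //; apply: hcont_cbm; exact: polar_hcont. Qed.

Lemma circZ f (k : C) (rho : R) : 0 < rho -> (forall w, nc w = rho -> cdiff f w) ->
  circ (fun w => k * f w) rho = k * circ f rho.
Proof. by move=> rho0 hf; apply: cintZ => //; apply: hcont_cbm; exact: polar_hcont. Qed.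

Lemma circ_cst (k : C) (rho : R) : circ (fun=> k) rho = k * (pi *+ 2)%:C.
Proof. by rewrite /circ cint_cst ?subr0// pi2_ge0. Qed.

Lemma eq_circ f g (rho : R) : 0 < rho -> (forall w, nc w = rho -> f w = g w) ->
  circ f rho = circ g rho :> C.
Proof. by move=> r0 h; apply: eq_cint => t _; apply: h; rewrite nc_polar// ltW. Qed.

Lemma sub_neq0 (w w0 : C) : nc w <> nc w0 -> w - w0 != 0.
Proof. by move=> h; rewrite subr_eq0; apply: contra_not_neq h => ->. Qed.

Lemma gap_le (w w0 : C) (rho : R) : nc w = rho -> rho - nc w0 <= nc (w - w0).
Proof. by move=> <-; exact: nc_subl. Qed.

(** Write [w / (w - w0) = 1 + w0 / (w - w0)]. The mean of the second term does not depend on the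
    radius, as long as it exceeds [nc w0], and tends to 0 for large radii. *)
Lemma circ_kernel (w0 : C) (rho : R) : nc w0 < rho ->
  circ (fun w => w / (w - w0)) rho = (pi *+ 2)%:C.
Proof.
move=> h; have r0 : 0 < rho by apply: le_lt_trans h; exact: nc_ge0.
have dq w : nc w0 < nc w -> cdiff (fun w => w0 / (w - w0)) w.
  move=> hw; apply: cdiffM; first exact: cdiff_cst.
  apply: (@cdiffV _ (fun w => w - w0)); first by apply: cdiffB; [exact: cdiff_id|exact: cdiff_cst].
  by apply: sub_neq0 => hE; rewrite hE ltxx in hw.
rewrite (@eq_circ _ (fun w => 1 + w0 / (w - w0))) //; last first.
  move=> w hw; have : w - w0 != 0 by apply: sub_neq0 => hE; rewrite -hE hw ltxx in h.
  by move=> wn; field.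
rewrite circD//; [|by move=> w _; exact: cdiff_cst|by move=> w hw; apply: dq; rewrite hw].
rewrite circ_cst mul1r -[RHS]addr0; congr (_ + _).
apply: cvg_to0_eq => e e0.
have p0 : 0 < pi *+ 2 :> R by rewrite mulrn_wgt0// pi_gt0.
(* So large that the bound [2 pi |w0| / (r' - |w0|)] is at most [e]. *)
pose r' := rho + nc w0 + nc w0 * (pi *+ 2) / e.
have n0 := nc_ge0 w0.
have k0 : 0 <= nc w0 * (pi *+ 2) / e by rewrite divr_ge0 ?mulr_ge0// ltW.
have r'0 : 0 < r' by rewrite /r'; lra.
rewrite (@circ_indep _ _ rho r')//; last first.
  - by move=> w /andP[hw _]; apply: dq; lra.
  - by rewrite /r'; lra.
have gap : 0 < r' - nc w0 by rewrite /r'; lra.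
apply: le_trans (_ : nc w0 / (r' - nc w0) * (pi *+ 2) <= e).
  apply: nc_circ => // w hw; first by apply: dq; lra.
  rewrite ncf ler_pM ?invr_ge0 ?nc_ge0// lef_pV2 ?posrE//; first exact: gap_le.
  by apply: lt_le_trans gap _; exact: gap_le.
rewrite mulrAC ler_pdivrMr// -ler_pdivrMl// mulrC /r'; lra.
Qed.

Definition pbounded (r B : R) (f : C -> C) := forall w, 0 < nc w -> nc w < r -> nc (f w) <= B.

(** The puncture at 0 does no harm because the kernel contains the factor [w]: with [f] bounded,
    small circles contribute nothing. Hence the mean of [q] vanishes, and [circ_kernel] evaluates
    the rest. *)
Lemma cauchy_formula (r B : R) (f : C -> C) (w0 : C) (rho : R) :
  pholo r f -> pbounded r B f -> 0 < nc w0 -> nc w0 < rho -> rho < r ->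
  circ (fun w => f w * (w / (w - w0))) rho = f w0 * (pi *+ 2)%:C.
Proof.
move=> hf hB w00 w0rho rhor; have w0r := lt_trans w0rho rhor.
have r0 := lt_trans w00 w0rho; have B_ge0 := le_trans (nc_ge0 _) (hB _ w00 w0r).
have [D hD] := hf _ w00 w0r.
have p0 : 0 < pi *+ 2 :> R by rewrite mulrn_wgt0// pi_gt0.
(* [q] is continuous at [w0] but not known to be differentiable there, so the circle through [w0]
   has to be crossed by a limit. *)
pose q w := if w == w0 then w0 * D else (f w - f w0) / (w - w0) * w.
have dq w : 0 < nc w -> nc w < r -> w != w0 -> cdiff q w.
  move=> h1 h2 h3; have n3 : 0 < nc (w - w0) by rewrite nc_gt0 subr_eq0.
  apply: (cdiff_ext n3 (f := fun w => (f w - f w0) / (w - w0) * w)) => [v|].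
    rewrite /q; case: eqVneq => // ->; by rewrite ncC ltxx.
  apply: cdiffM; last exact: cdiff_id.
  apply: cdiffM; first by apply: cdiffB; [exact: hf|exact: cdiff_cst].
  apply: (@cdiffV _ (fun w => w - w0)); first by apply: cdiffB; [exact: cdiff_id|exact: cdiff_cst].
  by rewrite subr_eq0.
have cq w : 0 < nc w -> nc w < r -> forall e : R, 0 < e ->
    exists2 del : R, 0 < del & forall v, nc (v - w) < del -> nc (q v - q w) < e.
  move=> h1 h2 e e0; have [->|ww0] := eqVneq w w0; last exact: (cdiff_cont (dq w h1 h2 ww0)).
  pose K := nc w0 + 1 + nc D.
  have K0 : 0 < K by rewrite /K; have := nc_ge0 w0; have := nc_ge0 D; lra.
  have e2 : 0 < e / 2 / K by rewrite !divr_gt0.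
  have [del del0 h] := hD _ e2.
  exists (Num.min del (Num.min 1 (e / 2 / K))); first by rewrite !lt_min del0 ltr01.
  move=> v; rewrite !lt_min => /and3P[/h h3 h4 h5].
  rewrite /q eqxx; case: eqVneq => [_|vw0]; first by rewrite subrr nc0.
  have nv : 0 < nc (v - w0) by rewrite nc_gt0 subr_eq0.
  have vn : v - w0 != 0 by rewrite subr_eq0.
  rewrite (_ : _ - _ = (f v - f w0 - D * (v - w0)) / (v - w0) * v + D * (v - w0)); last first.
    by field.
  rewrite (le_lt_trans (ncD _ _))// !ncM ncV.
  have h6 : nc (f v - f w0 - D * (v - w0)) / nc (v - w0) <= e / 2 / K.
    by rewrite ler_pdivrMr.
  have h7 : nc v <= nc w0 + 1 by have := nc_subl v w0; lra.
  have h8 : nc (f v - f w0 - D * (v - w0)) / nc (v - w0) * nc v <= e / 2 / K * (nc w0 + 1).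
    by rewrite ler_pM ?divr_ge0 ?nc_ge0.
  have h9 : nc D * nc (v - w0) <= nc D * (e / 2 / K) by rewrite ler_wpM2l ?nc_ge0 ?ltW.
  have h10 : e / 2 / K * (nc w0 + 1) + nc D * (e / 2 / K) = e / 2.
    by rewrite /K; field; rewrite gt_eqF.
  by clear - h8 h9 h10 e0; lra.
have same a : 0 < a -> a < nc w0 -> circ q a = circ q rho.
  move=> a0 aw.
  have ar : a < r := lt_trans aw w0r.
  pose s0 := Num.min (nc w0 - a) (rho - nc w0).
  have s00 : 0 < s0 by rewrite lt_min !subr_gt0 aw.
  (* Radii on both sides of [nc w0], approaching it within [[a, rho]]. *)
  pose s n : R := s0 / n.+1%:R.
  have s_gt0 n : 0 < s n by rewrite divr_gt0// ltr0n.
  have s_le n : s n <= s0 by rewrite ler_pdivrMr ?ltr0n// ler_peMr ?(ltW s00)// ler1n.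
  have s0a : s0 <= nc w0 - a by rewrite /s0 ge_min lexx.
  have s0b : s0 <= rho - nc w0 by rewrite /s0 ge_min lexx orbT.
  have lo n : a <= nc w0 - s n by have := s_le n; clear - s0a; lra.
  have hi n : nc w0 + s n <= rho by have := s_le n; clear - s0b; lra.
  have lo0 n : 0 < nc w0 - s n by exact: lt_le_trans a0 (lo n).
  have hi0 n : 0 < nc w0 + s n by exact: addr_gt0.
  have loq n w : nc w = nc w0 - s n -> cdiff q w.
    move=> hw; apply: dq; rewrite ?hw//; first by have := s_gt0 n; clear -w0r; lra.
    by apply/eqP => h; rewrite h in hw; have := s_gt0 n; clear -hw; lra.
  have hiq n w : nc w = nc w0 + s n -> cdiff q w.
    move=> hw; apply: dq; rewrite ?hw//; first by have := hi n; clear -rhor; lra.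
    by apply/eqP => h; rewrite h in hw; have := s_gt0 n; clear -hw; lra.
  have E n : circ q rho - circ q a = cint 0 (pi *+ 2) (fun t =>
      q ((nc w0 + s n)%:C * cis t) - q ((nc w0 - s n)%:C * cis t)).
    rewrite (circ_indep (f := q) a0 (lo n)); last first.
      move=> w /andP[w1 w2]; apply: dq; first exact: lt_le_trans w1.
        by have := s_gt0 n; clear -w0r w2; lra.
      by apply/eqP => h; rewrite h in w2; have := s_gt0 n; clear -w2; lra.
    rewrite -(circ_indep (f := q) (hi0 n) (hi n)); last first.
      move=> w /andP[w1 w2]; apply: dq; [exact: lt_le_trans w1|exact: le_lt_trans rhor|].
      by apply/eqP => h; rewrite h in w1; have := s_gt0 n; clear -w1; lra.
    by rewrite /circ cintB//; apply: hcont_cbm; apply: polar_hcont => //;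
      [exact: hiq|exact: loq].
  (* Near [w0] the bound is continuity of [q]; elsewhere the denominator is at least [del]. *)
  have [K hK] : exists K, forall w, a <= nc w -> nc w <= rho -> nc (q w) <= K.
    have [del del0 h] := cq w0 w00 w0r 1 ltr01.
    exists (nc (q w0) + 1 + (B + B) / del * rho) => w w1 w2.
    have w3 : 0 < nc w := lt_le_trans a0 w1. have w4 : nc w < r := le_lt_trans w2 rhor.
    have t1 : 0 <= (B + B) / del * rho by rewrite mulr_ge0 ?divr_ge0 ?addr_ge0// ltW.
    have [/h h3|h3] := ltP (nc (w - w0)) del.
      by have := nc_subl (q w) (q w0); clear -h3 t1; lra.
    have n3 : 0 < nc (w - w0) := lt_le_trans del0 h3.
    rewrite -[leLHS]add0r lerD//; first by have := nc_ge0 (q w0); clear; lra.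
    rewrite /q; case: eqVneq => [E1|_]; first by rewrite E1 subrr nc0 ltxx in n3.
    rewrite ncM ncf; apply: ler_pM; [by rewrite divr_ge0 ?nc_ge0|exact: nc_ge0| |exact: w2].
    apply: ler_pM; [exact: nc_ge0|by rewrite invr_ge0 nc_ge0| |by rewrite lef_pV2 ?posrE].
    exact: le_trans (ncB _ _) (lerD (hB _ w3 w4) (hB _ w00 w0r)).
  have lim := @cint_dominated0 R 0 (pi *+ 2) (K + K) (fun n t =>
      q ((nc w0 + s n)%:C * cis t) - q ((nc w0 - s n)%:C * cis t)) (lexx _) _ _ _.
  apply/esym/eqP; rewrite -subr_eq0; apply/eqP; apply: cvg_to0_eq => e e0.
  have : \forall n \near \oo, nc (cint 0 (pi *+ 2) (fun t =>
      q ((nc w0 + s n)%:C * cis t) - q ((nc w0 - s n)%:C * cis t))) <= e.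
    apply: lim => //.
    - move=> n; apply: cbmB; apply: hcont_cbm; apply: polar_hcont => //;
        [exact: hiq|exact: loq].
    - move=> n t _; rewrite (le_trans (ncB _ _))// lerD// hK ?nc_polar ?lo ?hi ?(ltW (lo0 n)) ?(ltW (hi0 n))//.
        by have := lo n; have := s_gt0 n; clear; lra.
      by have := hi n; have := s_gt0 n; clear; lra.
    - move=> t _ e1 e10.
      have e12 : 0 < e1 / 2 by rewrite divr_gt0.
      have nt : nc ((nc w0)%:C * cis t) = nc w0 by rewrite nc_polar// nc_ge0.
      have [del del0 h] := cq ((nc w0)%:C * cis t) ltac:(by rewrite nt) ltac:(by rewrite nt) _ e12.
      near=> n.
      have sn : s n < del.
        rewrite /s ltr_pdivrMr ?ltr0n// mulrC -ltr_pdivrMr//.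
        apply: (@lt_trans _ _ n%:R); last by rewrite ltr_nat.
        by near: n; exact: nbhs_infty_gtr.
      have h1 : nc (q ((nc w0 + s n)%:C * cis t) - q ((nc w0)%:C * cis t)) < e1 / 2.
        by apply: h; rewrite -mulrBl -rmorphB ncM nc_cis ncR mulr1 addrAC subrr add0r gtr0_norm.
      have h2 : nc (q ((nc w0 - s n)%:C * cis t) - q ((nc w0)%:C * cis t)) < e1 / 2.
        by apply: h; rewrite ncC -mulrBl -rmorphB ncM nc_cis ncR mulr1 subKr gtr0_norm.
      have := nc_distD (q ((nc w0)%:C * cis t)) (q ((nc w0 + s n)%:C * cis t)) (q ((nc w0 - s n)%:C * cis t)).
      by rewrite ncC in h2; clear -h1 h2; lra.
  by move=> [n _ /(_ n (leqnn n))]; rewrite -E.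
(* On the circle of radius [a] the factor [w] of [q] gives a bound proportional to [a]. *)
have z0 : circ q rho = 0.
  apply: cvg_to0_eq => e e0.
  pose K := (B + B) * 2 / nc w0 * (pi *+ 2).
  have K0 : 0 <= K by rewrite mulr_ge0 ?(ltW p0)// divr_ge0 ?nc_ge0// mulr_ge0// addr_ge0.
  pose a := Num.min (nc w0 / 2) (e / (K + 1)).
  have K1 : 0 < K + 1 by clear -K0; lra.
  have a0 : 0 < a by rewrite lt_min !divr_gt0.
  have a1 : a <= nc w0 / 2 by rewrite /a ge_min lexx.
  have a2 : a <= e / (K + 1) by rewrite /a ge_min lexx orbT.
  have aw : a < nc w0 by clear -a1 w00; lra.
  rewrite -(same a)//.
  apply: le_trans (_ : (B + B) / (nc w0 / 2) * a * (pi *+ 2) <= e).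
    apply: nc_circ => // w hw.
      apply: dq; rewrite ?hw//; first exact: lt_trans w0r.
      by apply/eqP => h; rewrite h in hw; clear -hw aw; lra.
    rewrite /q; case: eqVneq => [h|_]; first by rewrite h in hw; clear -hw aw; lra.
    have gap : nc w0 / 2 <= nc (w - w0).
      by rewrite ncC; have := nc_subl w0 w; rewrite hw; clear -a1; lra.
    have g0 : 0 < nc (w - w0) by clear -gap w00; lra.
    rewrite ncM ncf hw ler_pM2r//.
    have w1 : 0 < nc w by rewrite hw.
    have w2 : nc w < r by rewrite hw; exact: lt_trans w0r.
    apply: ler_pM; [exact: nc_ge0|by rewrite invr_ge0 nc_ge0| |by rewrite lef_pV2 ?posrE ?divr_gt0].
    exact: le_trans (ncB _ _) (lerD (hB _ w1 w2) (hB _ w00 w0r)).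
  rewrite (_ : _ * a * _ = K * a); last by rewrite /K; field; rewrite gt_eqF.
  apply: (@le_trans _ _ (K * (e / (K + 1)))); first by rewrite ler_wpM2l.
  by rewrite mulrA ler_pdivrMr// mulrC ler_pM2l//; clear; lra.
have nw w : nc w = rho -> w - w0 != 0.
  by move=> hw; apply: sub_neq0 => h; rewrite -h hw ltxx in w0rho.
have dk w : nc w = rho -> cdiff (fun w => w / (w - w0)) w.
  move=> hw; apply: cdiffM; first exact: cdiff_id.
  apply: (@cdiffV _ (fun w => w - w0)); last exact: nw.
  by apply: cdiffB; [exact: cdiff_id|exact: cdiff_cst].
have dfk w : nc w = rho -> cdiff (fun w => f w * (w / (w - w0))) w.
  by move=> hw; apply: cdiffM; [apply: hf; rewrite hw|exact: dk].
have : circ q rho = circ (fun w => f w * (w / (w - w0)) - f w0 * (w / (w - w0))) rho.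
  apply: eq_circ => // w hw; have := nw _ hw; rewrite subr_eq0 /q => /negbTE ->.
  by rewrite mulrBl mulrBl; congr (_ - _); rewrite -mulrA (mulrC w).
rewrite z0 circB//; last by move=> w hw; apply: cdiffM; [exact: cdiff_cst|exact: dk].
rewrite (@circZ (fun w => w / (w - w0)))// circ_kernel// => /esym/eqP.
by rewrite subr_eq0 => /eqP.
Unshelve. all: by end_near. Qed.

End Removable.

(** * Removable singularities and the equality case of the mean value bound *)

Section Taylor.
Variable R : realType.
Local Notation C := R[i].

Lemma pi2_gt0 : 0 < pi *+ 2 :> R.
Proof. by rewrite mulrn_wgt0// pi_gt0. Qed.

Lemma nc_pi2 : nc ((pi *+ 2 : R)%:C) = pi *+ 2.
Proof. by rewrite ncR ger0_norm// pi2_ge0. Qed.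

Lemma cauchy_le (r B rho : R) (f g : C -> C) (w0 : C) : pholo r f -> pbounded r B f ->
  0 < nc w0 -> nc w0 < rho -> rho < r -> (forall w, nc w = rho -> cdiff g w) ->
  forall K, (forall w, nc w = rho -> nc (g w) <= K) ->
  nc (circ (fun w => g w * (w / (w - w0))) rho) <= K * (rho / (rho - nc w0)) * (pi *+ 2).
Proof.
move=> hf hB w00 w0r rr dg K hK; have r0 := lt_trans w00 w0r.
have gap : 0 < rho - nc w0 by rewrite subr_gt0.
have ww w : nc w = rho -> w - w0 != 0.
  by move=> hw; apply: sub_neq0 => h; rewrite -h hw ltxx in w0r.
apply: nc_circ => // w hw.
  apply: cdiffM; first exact: dg.
  apply: cdiffM; first exact: cdiff_id.
  apply: (@cdiffV _ (fun w => w - w0)); last exact: ww.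
  by apply: cdiffB; [exact: cdiff_id|exact: cdiff_cst].
rewrite ncM ncf; apply: ler_pM; [exact: nc_ge0|by rewrite divr_ge0 ?nc_ge0|exact: hK|].
rewrite hw ler_pM2l// lef_pV2 ?posrE ?nc_gt0 ?ww//; exact: gap_le.
Qed.

(** The kernel of Cauchy's formula is expanded in powers of [w0 / w], with a remainder that carries
    [(w0 / w)^n]; [nc w0 <= rho / 2] bounds [rho / (rho - nc w0)] by 2. Explicit remainders for
    [w <> 0] replace an extension of [f] to 0. *)
Lemma removable (r B rho : R) (f : C -> C) : pholo r f -> pbounded r B f ->
  0 < rho -> rho < r -> exists b : nat -> C,
  [/\ b 0%N = circ f rho / (pi *+ 2)%:C, forall n, nc (b n) <= B / rho ^+ n &
   forall n w, 0 < nc w -> nc w <= rho / 2 ->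
     nc (f w - \sum_(k < n) b k * w ^+ k) <= 2 * B * (nc w / rho) ^+ n].
Proof.
move=> hf hB rho0 rhor.
have wn w : nc w = rho -> w != 0 by move=> h; rewrite -nc_gt0 h.
have d1 n w : nc w = rho -> cdiff (fun w => f w / w ^+ n) w.
  move=> hw; apply: cdiffM; first by apply: hf; rewrite hw.
  by apply: (@cdiffV _ (fun w => w ^+ n)); [apply: cdiffX; exact: cdiff_id|rewrite expf_neq0// wn].
have b1 n w : nc w = rho -> nc (f w / w ^+ n) <= B / rho ^+ n.
  by move=> hw; rewrite ncf ncX hw ler_pM2r ?invr_gt0 ?exprn_gt0// hB ?hw.
exists (fun n => circ (fun w => f w / w ^+ n) rho / (pi *+ 2)%:C); split.
- by congr (_ / _); apply: eq_circ => // w _; rewrite expr0 divr1.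
- move=> n; rewrite ncf nc_pi2 ler_pdivrMr ?pi2_gt0//.
  by apply: nc_circ => // w; [exact: d1|exact: b1].
move=> n w0 w00 w0r; have w0rho : nc w0 < rho by lra.
have p0 : (pi *+ 2)%:C != 0 :> C by rewrite -nc_gt0 nc_pi2 pi2_gt0.
have ww w : nc w = rho -> w - w0 != 0.
  by move=> hw; apply: sub_neq0 => h; rewrite -h hw ltxx in w0rho.
have E : (f w0 - \sum_(k < n) circ (fun w => f w / w ^+ k) rho / (pi *+ 2)%:C * w0 ^+ k)
   * (pi *+ 2)%:C = circ (fun w => f w * (w0 / w) ^+ n * (w / (w - w0))) rho.
  rewrite mulrBl -(cauchy_formula hf hB w00 w0rho rhor) mulr_suml.
  under eq_bigr do rewrite mulrAC divfK//.
  elim: n => [|n IH].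
    rewrite big_ord0 subr0; apply: eq_circ => // w _.
    by rewrite expr0 mulr1.
  rewrite big_ord_recr/= opprD addrA IH.
  rewrite mulrC -circZ; [|exact: rho0|exact: d1].
  have dk w : nc w = rho -> cdiff (fun w => w / (w - w0)) w.
    move=> hw; apply: cdiffM; first exact: cdiff_id.
    apply: (@cdiffV _ (fun w => w - w0)); last exact: ww.
    by apply: cdiffB; [exact: cdiff_id|exact: cdiff_cst].
  rewrite -circB//.
  - apply: eq_circ => // w hw; have w1 := ww w hw; have w2 := wn w hw.
    rewrite exprS !expr_div_n; field; by rewrite w1 expf_neq0 w2.
  - move=> w hw; apply: cdiffM; last exact: dk.
    apply: cdiffM; first by apply: hf; rewrite hw.
    apply: (@cdiffX _ (fun w => w0 / w)).
    by apply: cdiffM; [exact: cdiff_cst|apply: (@cdiffV _ id); [exact: cdiff_id|exact: wn]].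
  - by move=> w hw; apply: cdiffM; [exact: cdiff_cst|exact: d1].
have h : nc (circ (fun w => f w * (w0 / w) ^+ n * (w / (w - w0))) rho) <=
   B * (nc w0 / rho) ^+ n * (rho / (rho - nc w0)) * (pi *+ 2).
  apply: (cauchy_le hf hB w00 w0rho rhor) => w hw.
    apply: cdiffM; first by apply: hf; rewrite hw.
    apply: (@cdiffX _ (fun w => w0 / w)).
    by apply: cdiffM; [exact: cdiff_cst|apply: (@cdiffV _ id); [exact: cdiff_id|exact: wn]].
  by rewrite ncM ncX ncf hw ler_wpM2r ?exprn_ge0 ?divr_ge0 ?nc_ge0 ?(ltW rho0)// hB ?hw.
move: h; rewrite -E ncM nc_pi2 ler_pM2r ?pi2_gt0// => /le_trans; apply.
have B0 : 0 <= B by apply: le_trans (hB w0 w00 (lt_trans w0rho rhor)); exact: nc_ge0.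
rewrite mulrC mulrA ler_wpM2r ?exprn_ge0 ?divr_ge0 ?nc_ge0 ?(ltW rho0)//.
by rewrite ler_wpM2r// ler_pdivrMr ?subr_gt0//; lra.
Qed.

(** For [|u| <= 1 = |b|] one has [|u - b|^2 <= 2 - 2 Re (conj b u)], and the right side has mean 0
    if [b] is the mean of [u]. So [f - b] vanishes in the mean on the circle, and Cauchy's formula
    for [f - b] carries this inside. *)
Lemma unimodular_center (r rho : R) (f : C -> C) : pholo r f -> pbounded r 1 f ->
  0 < rho -> rho < r -> nc (circ f rho / (pi *+ 2)%:C) = 1 ->
  forall w, 0 < nc w -> nc w < rho -> f w = circ f rho / (pi *+ 2)%:C.
Proof.
move=> hf hB rho0 rhor hb w0 w00 w0rho; set b := circ f rho / _ in hb *.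
have p0 : (pi *+ 2)%:C != 0 :> C by rewrite -nc_gt0 nc_pi2 pi2_gt0.
have bE : circ f rho = b * (pi *+ 2)%:C by rewrite /b divfK.
have ww w : nc w = rho -> w - w0 != 0.
  by move=> hw; apply: sub_neq0 => h; rewrite -h hw ltxx in w0rho.
have hfr w : nc w = rho -> cdiff f w by move=> hw; apply: hf; rewrite hw.
have dk w : nc w = rho -> cdiff (fun w => w / (w - w0)) w.
  move=> hw; apply: cdiffM; first exact: cdiff_id.
  apply: (@cdiffV _ (fun w => w - w0)); last exact: ww.
  by apply: cdiffB; [exact: cdiff_id|exact: cdiff_cst].
have gap : 0 < rho - nc w0 by rewrite subr_gt0.
have E : (f w0 - b) * (pi *+ 2)%:C = circ (fun w => (f w - b) * (w / (w - w0))) rho.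
  rewrite mulrBl -(cauchy_formula hf hB w00 w0rho rhor) -(circ_kernel w0rho) -circZ// -circB//.
  - by apply: eq_circ => // w _; rewrite mulrBl.
  - by move=> w hw; apply: cdiffM; [exact: hfr|exact: dk].
  - by move=> w hw; apply: cdiffM; [exact: cdiff_cst|exact: dk].
apply/eqP; rewrite -subr_eq0 -(mulIr_eq0 _ (mulIf p0)); apply/eqP.
apply: cvg_to0_eq => e e0; rewrite E.
pose K := rho / (rho - nc w0); have K0 : 0 < K by rewrite divr_gt0.
pose e1 := e / (K * (pi *+ 2)); have e10 : 0 < e1 by rewrite divr_gt0// mulr_gt0// pi2_gt0.
pose u t := f (rho%:C * cis t).
have ucbm : cbm u by apply: hcont_cbm; exact: polar_hcont.
pose v t := 2 - 2 * complex.Re (b^* * u t).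
have hpt t : nc (u t - b) ^+ 2 <= v t.
  have h1 : nc (u t) <= 1 by apply: hB; rewrite nc_polar// ltW.
  have h2 : nc (u t) ^+ 2 <= 1 by rewrite expr_le1// nc_ge0.
  have h3 : nc b ^+ 2 = 1 by rewrite hb expr1n.
  rewrite /v; move: h2 h3; rewrite !nc2E; case: (u t) => x y; case: (b) => x' y' /=.
  by clear; lra.
(* Trades the square for the first power, in place of the Cauchy-Schwarz inequality: [v] has
   integral 0, so only the small [e1] remains. *)
have hpt2 t : nc (u t - b) <= e1 + e1^-1 * v t.
  have [h|h] := leP (nc (u t - b)) e1.
    rewrite -[leLHS]addr0 lerD// mulr_ge0 ?invr_ge0 ?(ltW e10)//.
    by apply: le_trans (hpt t); exact: sqr_ge0.
  have : nc (u t - b) <= e1^-1 * nc (u t - b) ^+ 2.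
    by rewrite mulrC ler_pdivlMr// expr2 ler_wpM2l ?nc_ge0// ltW.
  have : e1^-1 * nc (u t - b) ^+ 2 <= e1^-1 * v t by rewrite ler_pM2l ?invr_gt0.
  by clear -e10; lra.
have rv : cbm (fun t => (v t)%:C).
  have [q1 q2] : cbm (fun t => b^* * u t) by apply: cbmM => //; exact: cbm_cst.
  by apply: cbmR; apply: rbmB; [exact: rbm_cst|apply: rbmM; [exact: rbm_cst|exact: q1]].
have rg : cbm (fun t => (K * (e1 + e1^-1 * v t))%:C).
  apply: cbmR; apply: rbmM; first exact: rbm_cst.
  by apply: rbmD; [exact: rbm_cst|apply: rbmM; [exact: rbm_cst|exact: rv.1]].
have cb : cbm (fun t => (u t - b) * ((rho%:C * cis t) / (rho%:C * cis t - w0))).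
  apply: hcont_cbm; apply: (@polar_hcont _ (fun w => (f w - b) * (w / (w - w0)))) => // w hw.
  by apply: cdiffM; [apply: cdiffB; [exact: hfr|exact: cdiff_cst]|exact: dk].
have h1 := @nc_cint R 0 (pi *+ 2) _ (fun t => K * (e1 + e1^-1 * v t)) (lexx _) cb rg.1.
apply: le_trans (h1 _) _ => [t _|].
  rewrite mulrC ncM ncf; apply: ler_pM; [by rewrite divr_ge0 ?nc_ge0|exact: nc_ge0| |exact: hpt2].
  have np := @nc_polar R rho t (ltW rho0).
  rewrite np ler_pM2l// lef_pV2 ?posrE ?nc_gt0 ?ww//; exact: gap_le.
have -> : cint 0 (pi *+ 2) (fun t => (K * (e1 + e1^-1 * v t))%:C) = e%:C + (K / e1)%:C *
    cint 0 (pi *+ 2) (fun t => (v t)%:C).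
  have p1 := pi2_ge0 R.
  rewrite -[LHS]/(cint _ _ _) (@eq_cint _ _ _ _ (fun t => (K * e1)%:C + (K / e1)%:C * (v t)%:C)).
    rewrite cintD// ?cintZ//; [|exact: cbm_cst|by apply: cbmM => //; exact: cbm_cst].
    rewrite cint_cst// subr0 -rmorphM; congr ((_)%:C + _).
    have := gt_eqF pi2_gt0; rewrite /e1; move: (pi *+ 2) => P P0.
    by field; rewrite (gt_eqF K0) P0.
  by move=> t _; rewrite -rmorphM -rmorphD; congr (_%:C); ring.
suff h0 : complex.Re (cint 0 (pi *+ 2) (fun t => (v t)%:C)) = 0.
  by rewrite cReD cReM h0 mul0r subr0 mulr0 addr0.
rewrite Re_cint/=.
have -> : \int[lebesgue_measure]_(x in `[0, pi *+ 2]) v x =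
   complex.Re (cint 0 (pi *+ 2) (fun t => 2 - 2 * (b^* * u t))).
  by rewrite Re_cint; apply: eq_Rintegral => t _; rewrite /v; case: (b^* * u t) => x y /=; ring.
have cbb : cbm (fun t => b^* * u t) by apply: cbmM => //; exact: cbm_cst.
rewrite cintB//; [|exact: cbm_cst|by apply: cbmM => //; exact: cbm_cst].
rewrite cint_cst ?pi2_ge0// cintZ// cintZ// subr0.
rewrite (_ : cint _ _ u = circ f rho)// bE.
have -> : 2 * (b^* * (b * (pi *+ 2)%:C)) = 2 * (b * b^*) * (pi *+ 2)%:C by ring.
by rewrite mulJ hb expr1n mulr1 subrr.
Qed.

End Taylor.

(** * The canonical system in components; Wronskian and energy *)

Section System.
Variable R : realType.
Local Notation C := R[i].
Implicit Types (p q : R -> R) (z : C) (u v : R -> C).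

Lemma cint_real (a b : R) (f : R -> R) :
  cint a b (fun x => (f x)%:C) = (complex.Re (cint a b (fun x => (f x)%:C)))%:C.
Proof. by apply: complex_eq => //=; rewrite /Rintegral integral0. Qed.

Lemma prim_Re u v : prim u v ->
  prim (fun x => (complex.Re (u x))%:C) (fun x => (complex.Re (v x))%:C).
Proof.
move=> [hv h]; split; first by apply: cbmR; exact: hv.1.
by move=> x x0; rewrite h// cint_real !Re_cint cReD rmorphD.
Qed.

Lemma prim_Im u v : prim u v ->
  prim (fun x => (complex.Im (u x))%:C) (fun x => (complex.Im (v x))%:C).
Proof.
move=> [hv h]; split; first by apply: cbmR; exact: hv.2.
by move=> x x0; rewrite h// cint_real Re_cint cImD rmorphD.
Qed.

Lemma prim_lin (k : R) : prim (fun x : R => (k * x)%:C) (fun=> k%:C).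
Proof.
split; first exact: cbm_cst.
by move=> x x0; rewrite cint_cst// mulr0 add0r subr0 rmorphM.
Qed.

(* H = [[p, q], [q, 1 - p]], normalized by trace one. *)
Definition ham p q := [/\ rbm p, rbm q &
  forall x, 0 <= x -> [/\ 0 <= p x, p x <= 1 & q x ^+ 2 <= p x * (1 - p x)]].

(** [J u' = - z H u] in components, with the derivative read through [prim]. *)
Definition sol p q z u1 u2 :=
  prim u1 (fun x => - z * ((q x)%:C * u1 x + (1 - p x)%:C * u2 x)) /\
  prim u2 (fun x => z * ((p x)%:C * u1 x + (q x)%:C * u2 x)).

(** Divided by [nc (u2 x) ^+ 2] this is the imaginary part of [u1 / u2], so its sign tells whether
    the quotient lies in the upper half plane. *)
Definition wronsk (u1 u2 : R -> C) (x : R) := complex.Im (u1 x * (u2 x)^*).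

(** The quadratic form [u^* H u], which is the integrand of [sqnormH]. *)
Definition energy p q (u1 u2 : R -> C) (x : R) := p x * nc (u1 x) ^+ 2 +
  2 * q x * complex.Re (u1 x * (u2 x)^*) + (1 - p x) * nc (u2 x) ^+ 2.

Definition nrm2 (u1 u2 : R -> C) (x : R) := nc (u1 x) ^+ 2 + nc (u2 x) ^+ 2.

(** Completing the square in [p f] and in [(1 - p) f] and adding the two avoids a division by [p],
    which may vanish. *)
Lemma psd2 (p q s t : R) : 0 <= p -> p <= 1 -> q ^+ 2 <= p * (1 - p) ->
  0 <= p * s ^+ 2 + 2 * q * (s * t) + (1 - p) * t ^+ 2.
Proof.
move=> p0 p1 pq; set f := (X in _ <= X).
have h1 : 0 <= p * f.
  have -> : p * f = (p * s + q * t) ^+ 2 + (p * (1 - p) - q ^+ 2) * t ^+ 2 by rewrite /f; ring.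
  by apply: addr_ge0; [exact: sqr_ge0|apply: mulr_ge0; [rewrite subr_ge0|exact: sqr_ge0]].
have h2 : 0 <= (1 - p) * f.
  have -> : (1 - p) * f = ((1 - p) * t + q * s) ^+ 2 + (p * (1 - p) - q ^+ 2) * s ^+ 2 by rewrite /f; ring.
  by apply: addr_ge0; [exact: sqr_ge0|apply: mulr_ge0; [rewrite subr_ge0|exact: sqr_ge0]].
have -> : f = p * f + (1 - p) * f by ring.
exact: addr_ge0.
Qed.

Section Pointwise.
Variables (p q : R) (u1 u2 : C).
Hypotheses (p0 : 0 <= p) (p1 : p <= 1) (pq : q ^+ 2 <= p * (1 - p)).
Let k := p * nc u1 ^+ 2 + 2 * q * complex.Re (u1 * u2^*) + (1 - p) * nc u2 ^+ 2.
Let y := nc u1 ^+ 2 + nc u2 ^+ 2.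

Lemma energy_pt_ge0 : 0 <= k.
Proof.
rewrite /k !nc2E; case: u1 => a b; case: u2 => c d /=.
have := psd2 a c p0 p1 pq; have := psd2 b d p0 p1 pq => h1 h2.
have := addr_ge0 h1 h2; congr (_ <= _); ring.
Qed.

(** This is [psd2] for [1 - H], which has trace one and the determinant of [H]. *)
Lemma energy_pt_le : k <= y.
Proof.
rewrite /k /y !nc2E; case: u1 => a b; case: u2 => c d /=.
have p2 : 0 <= 1 - p by rewrite subr_ge0.
have p3 : 1 - p <= 1 by rewrite gerBl.
have pq' : (- q) ^+ 2 <= (1 - p) * (1 - (1 - p)) by rewrite sqrrN subKr mulrC.
have := psd2 a c p2 p3 pq'; have := psd2 b d p2 p3 pq' => h1 h2.
rewrite -subr_ge0; have := addr_ge0 h1 h2; congr (_ <= _); ring.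
Qed.

(* Cayley-Hamilton for H: H^2 = H - det H. *)
Lemma energy_pt_sqr : nc (q%:C * u1 + (1 - p)%:C * u2) ^+ 2 +
  nc (p%:C * u1 + q%:C * u2) ^+ 2 <= k.
Proof.
have : 0 <= (p * (1 - p) - q ^+ 2) * y.
  by apply: mulr_ge0; [rewrite subr_ge0|apply: addr_ge0; exact: sqr_ge0].
rewrite -subr_ge0 => h; rewrite -subr_ge0; move: h.
rewrite /y /k !nc2E; case: u1 => a b; case: u2 => c d /=.
rewrite subr0; congr (_ <= _); ring.
Qed.

(* With u = a + ib and S = a a^T + b b^T, the difference is tr (S H S). *)
Lemma energy_pt_lower : complex.Im (u1 * u2^*) ^+ 2 <= y * k.
Proof.
rewrite /y /k !nc2E -subr_ge0; case: u1 => a b; case: u2 => c d /=.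
pose s11 := a ^+ 2 + b ^+ 2; pose s12 := a * c + b * d; pose s22 := c ^+ 2 + d ^+ 2.
have := psd2 s11 s12 p0 p1 pq; have := psd2 s12 s22 p0 p1 pq => h1 h2.
have := addr_ge0 h1 h2; congr (_ <= _); rewrite /s11 /s12 /s22; ring.
Qed.
End Pointwise.

Section Solution.
Variables (p q : R -> R) (z : C) (u1 u2 : R -> C).
Hypotheses (hH : ham p q) (hu : sol p q z u1 u2).

(** Lagrange's identity. It makes the Wronskian monotone, in the direction given by the sign of
    [Im z]. *)
Lemma prim_wronsk : prim (fun x => (wronsk u1 u2 x)%:C)
  (fun x => (- complex.Im z * energy p q u1 u2 x)%:C).
Proof.
have [h1 h2] := hu; have := prim_Im (primM h1 (primJ h2)).
apply: prim_ext => // x _; congr (_%:C).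
rewrite /energy !nc2E; case: (z) => zr zi; case: (u1 x) => a b; case: (u2 x) => c d /=; ring.
Qed.

Lemma prim_nrm2 : prim (fun x => (nrm2 u1 u2 x)%:C) (fun x => (2 * complex.Re (
  (u1 x)^* * (- z * ((q x)%:C * u1 x + (1 - p x)%:C * u2 x)) +
  (u2 x)^* * (z * ((p x)%:C * u1 x + (q x)%:C * u2 x))))%:C).
Proof.
have [h1 h2] := hu.
have := prim_Re (primD (primM h1 (primJ h1)) (primM h2 (primJ h2))).
apply: prim_ext => // x _; congr (_%:C).
  by rewrite /nrm2 !nc2E; case: (u1 x) => a b; case: (u2 x) => c d /=; ring.
case: (z) => zr zi; case: (u1 x) => a b; case: (u2 x) => c d /=; ring.
Qed.

(** The weight [e] of the arithmetic-geometric inequality is left free: a constant gives exponential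
    growth, a multiple of the energy at [x] gives the sharper bound used in [sol_wronsk_ge0]. *)
Lemma nrm2_deriv_le (e x : R) : 0 < e -> 0 <= x -> 2 * complex.Re (
  (u1 x)^* * (- z * ((q x)%:C * u1 x + (1 - p x)%:C * u2 x)) +
  (u2 x)^* * (z * ((p x)%:C * u1 x + (q x)%:C * u2 x))) <=
  e * nrm2 u1 u2 x + nc z ^+ 2 * energy p q u1 u2 x / e.
Proof.
move=> e0 x0; have [_ _ /(_ x x0)[p0 p1 pq]] := hH.
have amgm (a b : C) : 2 * complex.Re (a^* * b) <= e * nc a ^+ 2 + nc b ^+ 2 / e.
  have : 0 <= nc (e%:C * a - b) ^+ 2 / e by rewrite divr_ge0 ?sqr_ge0 ?ltW.
  move=> h; rewrite -subr_ge0; move: h; congr (_ <= _); rewrite !nc2E.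
  by case: a => a1 a2; case: b => b1 b2 /=; field; rewrite gt_eqF.
rewrite cReD mulrDr; apply: le_trans (lerD (amgm _ _) (amgm _ _)) _.
rewrite /nrm2 !ncM ncN.
have := energy_pt_sqr (u1 x) (u2 x) pq; rewrite -/(energy p q u1 u2 x) => h.
have : (nc z * nc ((q x)%:C * u1 x + (1 - p x)%:C * u2 x)) ^+ 2 / e +
   (nc z * nc ((p x)%:C * u1 x + (q x)%:C * u2 x)) ^+ 2 / e <= nc z ^+ 2 * energy p q u1 u2 x / e.
  rewrite -mulrDl ler_pM2r ?invr_gt0// !exprMn -mulrDr ler_wpM2l ?sqr_ge0//.
by clear -hH hu; lra.
Qed.

Lemma nrm2_growth (a b : R) : 0 <= a -> a <= b ->
  nrm2 u1 u2 b <= nrm2 u1 u2 a * expR (2 * (nc z + 1) * b - 2 * (nc z + 1) * a).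
Proof.
move=> a0 ab.
have nz := nc_ge0 z.
apply: (gronwall (G := fun x => 2 * (nc z + 1) * x) (g := fun=> 2 * (nc z + 1)) a0 ab prim_nrm2).
  exact: prim_lin.
move=> x /andP[ax _]; have x0 := le_trans a0 ax.
have z1 : 0 < nc z + 1 by clear -hH hu nz; lra.
apply: le_trans (nrm2_deriv_le z1 x0) _.
have [_ _ /(_ x x0)[p0 p1 pq]] := hH.
have := energy_pt_le (u1 x) (u2 x) p0 p1 pq.
have := energy_pt_ge0 (u1 x) (u2 x) p0 p1 pq.
rewrite -/(energy p q u1 u2 x) -/(nrm2 u1 u2 x) => k0 ky.
have : nc z ^+ 2 * energy p q u1 u2 x / (nc z + 1) <= (nc z + 1) * nrm2 u1 u2 x.
  rewrite ler_pdivrMr//; nra.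
by clear -hH hu; lra.
Qed.

(** Suppose the Wronskian is [- c < 0] at [x0]. It stays below [- c], so [c^2 <= y k] by
    [energy_pt_lower]. Its lower bound makes the energy [k] integrable, hence
    [y' <= (2 |z| / c) k y] keeps [y] bounded. Then [k] is bounded below and the Wronskian falls
    below every bound. *)
Lemma sol_wronsk_ge0 : 0 < complex.Im z -> (exists K, forall x, 0 <= x -> - K <= wronsk u1 u2 x) ->
  forall x, 0 <= x -> 0 <= wronsk u1 u2 x.
Proof.
move=> z0 [K hK] x0 x00; rewrite leNgt; apply/negP => g0.
pose g := wronsk u1 u2; pose k := energy p q u1 u2; pose y := nrm2 u1 u2.
have kpos x : 0 <= x -> 0 <= k x.
  by move=> xx; have [_ _ /(_ x xx)[p0 p1 pq]] := hH; exact: energy_pt_ge0.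
pose c := - g x0; have c0 : 0 < c by rewrite oppr_gt0.
have gc x : x0 <= x -> g x <= - c.
  move=> xx; rewrite /c opprK.
  apply: (prim_le prim_wronsk x00 xx) => t /andP[t1 _] /=.
  by rewrite mulNr oppr_le0 mulr_ge0 ?(ltW z0)// kpos// (le_trans x00).
have ky x : x0 <= x -> c ^+ 2 <= y x * k x.
  move=> xx; have x1 := le_trans x00 xx; have [_ _ /(_ x x1)[p0 p1 pq]] := hH.
  apply: le_trans (energy_pt_lower (u1 x) (u2 x) p0 p1 pq).
  rewrite -[leRHS]sqrrN lerXn2r ?nnegrE ?(ltW c0)//; have := gc x xx; rewrite /g/wronsk; clear -hH hu c0; lra.
have ypos x : 0 <= y x by rewrite addr_ge0 ?sqr_ge0.
have k0 x : x0 <= x -> 0 < k x.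
  move=> xx; rewrite lt_def kpos ?(le_trans x00)// andbT; apply/negP => /eqP h.
  by have := ky x xx; rewrite h mulr0 leNgt exprn_gt0.
have nz : 0 < nc z.
  by apply: lt_le_trans z0 _; exact: Im_le_nc.
(* Makes [- L g] a primitive of the growth rate [2 |z| k / c] of [y]. *)
pose L := 2 * nc z / (c * complex.Im z).
have L0 : 0 < L by rewrite divr_gt0 ?mulr_gt0.
have hG : prim (fun x => (- L * g x)%:C) (fun x => (2 * nc z / c * k x)%:C).
  apply: prim_ext (primZ (- L)%:C prim_wronsk) => x _; rewrite -rmorphM//.
  congr (_%:C); rewrite /L /k; field; by rewrite !gt_eqF.
pose Y := y x0 * expR (L * (K - c)).
have hY x : x0 <= x -> y x <= Y.
  move=> xx; apply: le_trans (gronwall x00 xx prim_nrm2 hG _) _.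
    move=> t /andP[t1 _]; have t0 := le_trans x00 t1.
    (* With this weight both terms of [nrm2_deriv_le] are at most [(|z| / c) k y], the second one by
       [ky]. *)
    have e0 : 0 < nc z * k t / c by rewrite divr_gt0 ?mulr_gt0 ?k0.
    apply: le_trans (nrm2_deriv_le e0 t0) _; rewrite -/(y t) -/(k t).
    have -> : nc z ^+ 2 * k t / (nc z * k t / c) = nc z * c.
      by field; rewrite !gt_eqF ?k0.
    have : nc z / c * (c ^+ 2) <= nc z / c * (y t * k t) by rewrite ler_wpM2l ?ky ?divr_ge0 ?(ltW nz) ?(ltW c0).
    have -> : nc z / c * (c ^+ 2) = nc z * c by field; rewrite gt_eqF.
    have -> : 2 * nc z / c * k t * y t = nc z / c * (y t * k t) + nc z * k t / c * y t by ring.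
    by clear -hH hu; lra.
  rewrite ler_wpM2l// ler_expR.
  have -> : - L * g x - - L * g x0 = L * (- g x - c) by rewrite /c; ring.
  by rewrite ler_pM2l// lerD2r lerNl; apply: hK; exact: le_trans xx.
have Y0 : 0 < Y.
  rewrite mulr_gt0 ?expR_gt0// lt_def ypos andbT; apply/negP => /eqP h.
  by have := ky x0 (lexx _); rewrite h mul0r leNgt exprn_gt0.
pose d := complex.Im z * (c ^+ 2 / Y).
have d0 : 0 < d by rewrite mulr_gt0// divr_gt0// exprn_gt0.
(* Up to this point the Wronskian drops by at least [K + 1], that is, below its lower bound
   [- K]. *)
pose x1 := x0 + (K + 1) / d.
have K0 : 0 <= K by have := hK x0 x00; have := gc x0 (lexx _); rewrite /g; clear -hH hu c0; lra.
have x01 : x0 <= x1 by rewrite lerDl divr_ge0 ?(ltW d0)//; clear -hH hu K0; lra.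
have h1 : g x1 + d * x1 <= g x0 + d * x0.
  have hl : prim (fun x : R => (g x + d * x)%:C) (fun x => (- complex.Im z * k x + d)%:C).
    have hx : prim (fun x : R => (d * x)%:C) (fun=> d%:C).
      exact: prim_lin.
    by apply: prim_ext (primD prim_wronsk hx) => x _; rewrite -rmorphD.
  apply: (prim_le hl x00 x01) => t /andP[t1 _] /=.
  have h2 : c ^+ 2 / Y <= k t.
    rewrite ler_pdivrMr// mulrC; apply: le_trans (ky t t1) _.
    by rewrite ler_wpM2r ?hY// ltW// k0.
  have : d <= complex.Im z * k t by rewrite ler_pM2l.
  by clear -hH hu; lra.
have h3 : - K <= g x1 by apply: hK; exact: le_trans x01.
have h4 : d * x1 = d * x0 + (K + 1) by rewrite /x1; field; rewrite gt_eqF.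
have : g x0 = - c by rewrite opprK.
by clear -hH hu h1 h3 h4 c0 K0; lra.
Qed.

End Solution.
End System.

(** * Power series *)

Section Series.
Variable R : realType.
Local Notation C := R[i].

(* The limits are junk unless the series converges; see csumP. *)
Definition csum (c : nat -> C) : C :=
  limn (fun n => complex.Re (\sum_(k < n) c k)) +i*
  limn (fun n => complex.Im (\sum_(k < n) c k)).

Lemma geo_partial (c : nat -> C) (B a : R) : 0 <= a -> a <= 1 / 2 ->
  (forall k, nc (c k) <= B * a ^+ k) -> forall n m, (n <= m)%N ->
  nc (\sum_(k < m) c k - \sum_(k < n) c k) <= 2 * B * a ^+ n.
Proof.
move=> a0 a2 hc n m /subnKC <-; move: (m - n)%N => j.
have B0 : 0 <= B by have := hc 0%N; rewrite expr0 mulr1; apply: le_trans; exact: nc_ge0.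
suff : nc (\sum_(k < n + j) c k - \sum_(k < n) c k) <= 2 * B * (a ^+ n - a ^+ (n + j)).
  move=> /le_trans; apply; rewrite ler_wpM2l ?mulr_ge0// gerBl exprn_ge0//.
elim: j => [|j IH]; first by rewrite addn0 !subrr mulr0 nc0.
rewrite addnS big_ord_recr/= addrAC (le_trans (ncD _ _))//.
apply: le_trans (lerD IH (hc _)) _.
rewrite exprS -subr_ge0.
have -> : 2 * B * (a ^+ n - a * a ^+ (n + j)) - (2 * B * (a ^+ n - a ^+ (n + j)) + B * a ^+ (n + j))
  = B * a ^+ (n + j) * (1 - 2 * a) by ring.
rewrite !mulr_ge0 ?exprn_ge0//; lra.
Qed.

Lemma half_small (K e : R) : 0 <= K -> 0 < e -> exists n : nat, K * (1 / 2) ^+ n <= e.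
Proof.
move=> K0 e0; have [n hn] := expr2_small K0 e0; exists n.
by rewrite expr_div_n expr1n mul1r ltW.
Qed.

(** Completeness is used for the real and imaginary parts separately; the ratio [1 / 2] bounds a
    tail by twice the bound of its first term. *)
Lemma csumP (c : nat -> C) (B a : R) : 0 <= a -> a <= 1 / 2 ->
  (forall k, nc (c k) <= B * a ^+ k) -> forall n,
  nc (csum c - \sum_(k < n) c k) <= 2 * B * a ^+ n.
Proof.
move=> a0 a2 hc n; have gp := geo_partial a0 a2 hc.
have B0 : 0 <= B by have := hc 0%N; rewrite expr0 mulr1; apply: le_trans; exact: nc_ge0.
have cv (P : C -> R) : (forall x y, `|P x - P y| <= nc (x - y)) ->
    cvgn (fun n => P (\sum_(k < n) c k)).
  move=> hP; apply/cauchy_cvgP; apply/cauchyP => e /= e0.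
  have [N hN] := half_small (mulr_ge0 (ler0n R 2) B0) (divr_gt0 e0 (ltr0n R 2)).
  exists (P (\sum_(k < N) c k)); near=> m; rewrite /ball/=.
  apply: le_lt_trans (hP _ _) _; rewrite ncC.
  have Nm : (N <= m)%N by near: m; exact: nbhs_infty_ge.
  apply: le_lt_trans (gp _ _ Nm) _.
  apply: le_lt_trans (_ : e / 2 < e); last by lra.
  apply: le_trans hN; rewrite ler_wpM2l ?mulr_ge0// lerXn2r ?nnegrE//; lra.
have h1 : cvgn (fun n => complex.Re (\sum_(k < n) c k)).
  by apply: cv => x y; rewrite -cReB; exact: nc_Re.
have h2 : cvgn (fun n => complex.Im (\sum_(k < n) c k)).
  by apply: cv => x y; rewrite -cImB; exact: nc_Im.
apply/ler_addgt0Pr => e e0; have e2 : 0 < e / 2 by lra.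
have /cvgrPdist_le/(_ _ e2) k1 := h1; have /cvgrPdist_le/(_ _ e2) k2 := h2.
near \oo => m.
apply: le_trans (nc_distD (\sum_(k < m) c k) _ _) _; rewrite addrC lerD//.
  by apply: gp; near: m; exact: nbhs_infty_ge.
rewrite (le_trans (nc_le_ReIm _))// [leRHS]splitr lerD//.
  by rewrite cReB; near: m.
by rewrite cImB; near: m.
Unshelve. all: by end_near. Qed.

Lemma csum_lim0 (K : R) (x : C) : 0 <= K ->
  (forall n, nc x <= K * (1 / 2) ^+ n) -> x = 0.
Proof.
move=> K0 h; apply: cvg_to0_eq => e e0; have [n hn] := half_small K0 e0.
exact: le_trans (h n) hn.
Qed.

(** The second order Taylor remainder of the [k]-th power; the factor [rho ^+ 2] on the left avoids
    the exponent [k - 2]. *)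
Lemma expr_quad (x y : C) (rho : R) (k : nat) : nc x <= rho -> nc y <= rho ->
  rho ^+ 2 * nc (x ^+ k - y ^+ k - k%:R * y ^+ k.-1 * (x - y)) <=
  k%:R ^+ 2 * rho ^+ k * nc (x - y) ^+ 2.
Proof.
move=> xr yr; have r0 : 0 <= rho by apply: le_trans xr; exact: nc_ge0.
case: k => [|k]; first by rewrite !expr0 subrr !mul0r subr0 nc0 mulr0 expr0n/= !mul0r.
move=> /=.
elim: k => [|k IH].
  have -> : x ^+ 1 - y ^+ 1 - 1%:R * y ^+ 0 * (x - y) = 0 by rewrite !expr1 expr0; ring.
  by rewrite nc0 mulr0 mulr_ge0 ?sqr_ge0// mulr_ge0 ?exprn_ge0.
have -> : x ^+ k.+2 - y ^+ k.+2 - k.+2%:R * y ^+ k.+1 * (x - y) =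
  x * (x ^+ k.+1 - y ^+ k.+1 - k.+1%:R * y ^+ k * (x - y)) +
  k.+1%:R * y ^+ k * (x - y) ^+ 2.
  by rewrite -(natr1 k.+1) !exprS; ring.
apply: (@le_trans _ _ (rho ^+ 2 * (nc x * nc (x ^+ k.+1 - y ^+ k.+1 - k.+1%:R * y ^+ k * (x - y))
    + k.+1%:R * nc y ^+ k * nc (x - y) ^+ 2))).
  rewrite ler_wpM2l ?sqr_ge0// (le_trans (ncD _ _))// !ncM !ncX.
  rewrite lerD// ler_wpM2r ?sqr_ge0// ler_wpM2r ?exprn_ge0 ?nc_ge0//.
  by rewrite -[k.+1%:R in leLHS](rmorph_nat (real_complex R)) ncR normr_nat.
have h1 : rho ^+ 2 * (nc x * nc (x ^+ k.+1 - y ^+ k.+1 - k.+1%:R * y ^+ k * (x - y))) <=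
   rho * (k.+1%:R ^+ 2 * rho ^+ k.+1 * nc (x - y) ^+ 2).
  by rewrite mulrCA ler_pM ?mulr_ge0 ?sqr_ge0 ?nc_ge0.
have h2 : rho ^+ 2 * (k.+1%:R * nc y ^+ k * nc (x - y) ^+ 2) <=
   rho ^+ 2 * (k.+1%:R * rho ^+ k * nc (x - y) ^+ 2).
  by rewrite ler_wpM2l ?sqr_ge0// ler_wpM2r ?sqr_ge0// ler_wpM2l// lerXn2r// nnegrE// nc_ge0.
rewrite mulrDr; apply: le_trans (lerD h1 h2) _.
rewrite -(natr1 k.+1) -subr_ge0.
set m := k.+1%:R : R; have m0 : 0 <= m by [].
have -> : (m + 1) ^+ 2 * rho ^+ k.+2 * nc (x - y) ^+ 2 - (rho * (m ^+ 2 * rho ^+ k.+1 * nc (x - y) ^+ 2) +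
   rho ^+ 2 * (m * rho ^+ k * nc (x - y) ^+ 2)) = (m + 1) * (rho ^+ k.+2 * nc (x - y) ^+ 2).
  by rewrite !exprS; ring.
by rewrite mulr_ge0 ?addr_ge0// mulr_ge0 ?sqr_ge0// exprn_ge0.
Qed.

(** Unlike in [cdiff] the derivative [d] is named, because its value on the real axis is needed for
    [K']. *)
Definition cderiv (f : C -> C) (w d : C) := forall e : R, 0 < e ->
  exists2 del : R, 0 < del & forall v, nc (v - w) < del ->
    nc (f v - f w - d * (v - w)) <= e * nc (v - w).

Lemma succ_le_exp2 k : (k.+1 <= 2 ^ k)%N.
Proof. exact: ltn_expl. Qed.

Lemma sqr_le_exp2 k : (k ^ 2 <= 3 * 2 ^ k)%N.
Proof.
elim: k => // k IH; case: k IH => // -[|[|k]] // IH.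
rewrite (expnS 2 k.+3) mulnCA; apply: (@leq_trans (2 * k.+3 ^ 2)).
  by rewrite !expnS !expn0; nia.
by rewrite leq_pmul2l.
Qed.

Lemma half_quarter (k : nat) : (1 / 2) ^+ k = (1 / 4) ^+ k * 2 ^+ k :> R.
Proof. by rewrite -exprMn (_ : 1 / 4 * 2 = 1 / 2 :> R)//; field. Qed.

Lemma half_geo_sum n : \sum_(k < n) (1 / 2) ^+ k <= 2 :> R.
Proof.
have -> : \sum_(k < n) (1 / 2) ^+ k = 2 - 2 * (1 / 2) ^+ n :> R.
  by elim: n => [|m IH]; [rewrite big_ord0 expr0; lra|rewrite big_ord_recr/= IH exprS; lra].
have q2 : 0 <= 1 / 2 :> R by lra.
by have := exprn_ge0 n q2; lra.
Qed.

Lemma diff_est (S1 S2 S3 P1 P2 P3 d : C) (a b c e : R) :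
  nc (S1 - P1) <= a -> nc (S2 - P2) <= b -> nc (S3 - P3) <= c ->
  nc (P1 - P2 - P3 * d) <= e -> nc (S1 - S2 - S3 * d) <= e + (a + b + c * nc d).
Proof.
move=> h1 h2 h3 he.
have -> : S1 - S2 - S3 * d = (P1 - P2 - P3 * d) + ((S1 - P1) - (S2 - P2) - (S3 - P3) * d) by ring.
apply: le_trans (ncD _ _) _; apply: lerD => //.
apply: le_trans (ncB _ _) _; apply: lerD; last by rewrite ncM ler_wpM2r ?nc_ge0.
exact: le_trans (ncB _ _) (lerD h1 h2).
Qed.

(** For [A rho = 1 / 4] and [nc v <= rho] the terms are [O(4^-k)], which leaves a factor [2^-k] to
    absorb the [k] of the derivative and the [k^2] of the remainder. *)
Lemma psum_cderiv (c : nat -> C) (B A : R) (z : C) : 0 < A ->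
  (forall k, nc (c k) <= B * A ^+ k) -> nc z < 1 / (4 * A) ->
  cderiv (fun v => csum (fun k => c k * v ^+ k)) z
    (csum (fun k => k.+1%:R * c k.+1 * z ^+ k)).
Proof.
move=> A0 hc zA.
have [rho [r0 Ar zr]] : exists rho : R, [/\ 0 < rho, A * rho = 1 / 4 & nc z < rho].
  exists (1 / (4 * A)); split => //; first by rewrite divr_gt0// mulr_gt0.
  by field; rewrite gt_eqF.
have B0 : 0 <= B by have := hc 0%N; rewrite expr0 mulr1; apply: le_trans; exact: nc_ge0.
have nN (k : nat) : nc (k%:R : C) = k%:R.
  by rewrite -(rmorph_nat (real_complex R)) ncR normr_nat.
have bc v k : nc v <= rho -> nc (c k * v ^+ k) <= B * (1 / 4) ^+ k.
  move=> vr; rewrite ncM ncX -Ar exprMn mulrA ler_pM ?nc_ge0 ?exprn_ge0 ?nc_ge0//.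
  by rewrite lerXn2r ?nnegrE ?nc_ge0// ltW.
have bd k : nc (k.+1%:R * c k.+1 * z ^+ k) <= B * A * (1 / 2) ^+ k.
  rewrite !ncM nN ncX.
  have h1 : k.+1%:R <= 2 ^+ k :> R by rewrite -natrX ler_nat succ_le_exp2.
  have h2 : nc z ^+ k <= rho ^+ k by rewrite lerXn2r ?nnegrE ?nc_ge0 ?(ltW r0)// ltW.
  apply: (@le_trans _ _ (2 ^+ k * (B * A ^+ k.+1) * rho ^+ k)).
    by rewrite ler_pM ?mulr_ge0 ?nc_ge0 ?exprn_ge0 ?nc_ge0// ler_pM ?nc_ge0.
  rewrite le_eqVlt; apply/orP; left; apply/eqP.
  have -> : (1 / 2) ^+ k = 2 ^+ k * (A * rho) ^+ k :> R by rewrite half_quarter Ar mulrC.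
  by rewrite exprMn exprS; move: (2 ^+ k) (A ^+ k) (rho ^+ k) => t1 t2 t3; ring.
have q4 : 0 <= 1 / 4 :> R by lra. have q42 : 1 / 4 <= 1 / 2 :> R by lra.
have q2 : 0 <= 1 / 2 :> R by lra.
have key v : nc v <= rho -> nc (csum (fun k => c k * v ^+ k) - csum (fun k => c k * z ^+ k) -
   csum (fun k => k.+1%:R * c k.+1 * z ^+ k) * (v - z)) <= 6 * B / rho ^+ 2 * nc (v - z) ^+ 2.
  move=> vr; apply/ler_addgt0Pr => e e0.
  (* Bounds the three tails after [n] terms, up to the factor [(1 / 2) ^+ n]. *)
  pose K := 4 * B + 2 * (B * A) * nc (v - z).
  have K0 : 0 <= K by rewrite addr_ge0 ?mulr_ge0 ?nc_ge0// ltW.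
  have [n hn] := half_small K0 e0.
  have h1 := csumP q4 q42 (fun k => bc v k vr) n.+1.
  have h2 := csumP q4 q42 (fun k => bc z k (ltW zr)) n.+1.
  have h3 := csumP q2 (lexx _) bd n.
  have hP : nc (\sum_(k < n.+1) c k * v ^+ k - \sum_(k < n.+1) c k * z ^+ k -
    (\sum_(k < n) k.+1%:R * c k.+1 * z ^+ k) * (v - z)) <= 6 * B / rho ^+ 2 * nc (v - z) ^+ 2.
    have -> : \sum_(k < n.+1) c k * v ^+ k - \sum_(k < n.+1) c k * z ^+ k -
    (\sum_(k < n) k.+1%:R * c k.+1 * z ^+ k) * (v - z) = \sum_(k < n.+1) c k * (v ^+ k - z ^+ k - k%:R * z ^+ k.-1 * (v - z)).
      transitivity (\sum_(k < n) (c k.+1 * v ^+ k.+1 - c k.+1 * z ^+ k.+1 -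
          k.+1%:R * c k.+1 * z ^+ k * (v - z))).
        rewrite !sumrB -mulr_suml !big_ord_recl /= !expr0.
        rewrite -[X in c 0%N * 1 + X - _ - _]/(\sum_(i < n) c i.+1 * v ^+ i.+1).
        rewrite -[X in _ - (c 0%N * 1 + X) - _]/(\sum_(i < n) c i.+1 * z ^+ i.+1).
        by ring.
      rewrite big_ord_recl /= expr0 subrr mul0r mul0r subrr mulr0 add0r.
      by apply: eq_bigr => k _; rewrite /bump/=; ring.
    apply: le_trans (nc_sum _ _ _) _.
    apply: (@le_trans _ _ (\sum_(k < n.+1) 3 * B / rho ^+ 2 * nc (v - z) ^+ 2 * (1 / 2) ^+ k)).
      apply: ler_sum => k _; rewrite ncM.
      have h4 := expr_quad k vr (ltW zr).
      rewrite -ler_pdivlMl ?exprn_gt0// in h4.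
      apply: le_trans (ler_pM (nc_ge0 _) (nc_ge0 _) (hc k) h4) _.
      have h5 : k%:R ^+ 2 <= 3 * 2 ^+ k :> R by rewrite -!natrX -natrM ler_nat sqr_le_exp2.
      have -> : B * A ^+ k * ((rho ^+ 2)^-1 * (k%:R ^+ 2 * rho ^+ k * nc (v - z) ^+ 2)) =
        B / rho ^+ 2 * nc (v - z) ^+ 2 * (A * rho) ^+ k * k%:R ^+ 2 by rewrite exprMn; ring.
      rewrite Ar half_quarter.
      rewrite [leRHS](_ : _ = B / rho ^+ 2 * nc (v - z) ^+ 2 * (1 / 4) ^+ k * (3 * 2 ^+ k)); last by ring.
      by rewrite ler_wpM2l// mulr_ge0 ?exprn_ge0// mulr_ge0 ?sqr_ge0// divr_ge0// sqr_ge0.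
    rewrite -mulr_sumr.
    have h6 := half_geo_sum n.+1.
    have -> : 6 * B / rho ^+ 2 * nc (v - z) ^+ 2 = 3 * B / rho ^+ 2 * nc (v - z) ^+ 2 * 2 by ring.
    by rewrite ler_wpM2l// mulr_ge0 ?sqr_ge0// divr_ge0 ?sqr_ge0// mulr_ge0.
  apply: le_trans (diff_est h1 h2 h3 hP) _; apply: lerD => //; apply: le_trans _ hn.
  have h8 : (1 / 4) ^+ n.+1 <= (1 / 2) ^+ n :> R.
    have : (1 / 4) ^+ n <= (1 / 2) ^+ n :> R by rewrite lerXn2r ?nnegrE.
    by have := exprn_ge0 n q4; clear; rewrite exprS; lra.
  have h9 : 2 * B * (1 / 4) ^+ n.+1 <= 2 * B * (1 / 2) ^+ n by rewrite ler_wpM2l ?mulr_ge0.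
  rewrite /K; move: h9; move: ((1 / 4) ^+ n.+1) ((1 / 2) ^+ n) (nc (v - z)) => t1 t2 t3.
  by clear; lra.
move=> e e0; pose K := 6 * B / rho ^+ 2 + 1.
have K0 : 0 < K by rewrite ltr_wpDl// divr_ge0 ?sqr_ge0// mulr_ge0.
exists (Num.min (rho - nc z) (e / K)); first by rewrite lt_min subr_gt0 zr divr_gt0.
move=> v; rewrite lt_min => /andP[v1 v2].
have vr : nc v <= rho by have := nc_subl v z; clear -v1; lra.
apply: le_trans (key v vr) _; rewrite expr2 mulrA ler_wpM2r ?nc_ge0//.
apply: (@le_trans _ _ (K * nc (v - z))).
  by rewrite ler_wpM2r ?nc_ge0// lerDl.
by rewrite mulrC -ler_pdivlMr// ltW.
Qed.

End Series.

(** * Uniqueness of solutions, and the transfer matrix by Picard iteration *)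

Section Transfer.
Variable R : realType.
Local Notation C := R[i].
Implicit Types (p q : R -> R) (z : C) (u v : R -> C).

Lemma sol_lin p q z (k l : C) u1 u2 v1 v2 : sol p q z u1 u2 -> sol p q z v1 v2 ->
  sol p q z (fun x => k * u1 x + l * v1 x) (fun x => k * u2 x + l * v2 x).
Proof.
move=> [h1 h2] [k1 k2]; split.
  by apply: prim_ext (primD (primZ k h1) (primZ l k1)) => // x _; ring.
by apply: prim_ext (primD (primZ k h2) (primZ l k2)) => // x _; ring.
Qed.

Lemma nrm2_eq0 u1 u2 (x : R) : nrm2 u1 u2 x <= 0 -> u1 x = 0 /\ u2 x = 0.
Proof.
move=> h; have : nrm2 u1 u2 x == 0.
  by rewrite eq_le h addr_ge0 ?sqr_ge0.
by rewrite paddr_eq0 ?sqr_ge0// !sqrf_eq0 !nc_eq0 => /andP[/eqP-> /eqP->].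
Qed.

Lemma sol_zero p q z u1 u2 (a : R) : ham p q -> sol p q z u1 u2 -> 0 <= a ->
  u1 a = 0 -> u2 a = 0 -> forall x, a <= x -> u1 x = 0 /\ u2 x = 0.
Proof.
move=> hH hu a0 h1 h2 x ax; apply: nrm2_eq0.
have := nrm2_growth hH hu a0 ax; rewrite {2}/nrm2 h1 h2 nc0 expr0n/= addr0 mul0r.
exact.
Qed.

Lemma sol_uniq p q z u1 u2 v1 v2 : ham p q -> sol p q z u1 u2 -> sol p q z v1 v2 ->
  u1 0 = v1 0 -> u2 0 = v2 0 -> forall x, 0 <= x -> u1 x = v1 x /\ u2 x = v2 x.
Proof.
move=> hH hu hv h1 h2 x x0.
have [] := sol_zero hH (sol_lin 1 (-1) hu hv) (lexx _) _ _ x0.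
- by rewrite h1; ring.
- by rewrite h2; ring.
by rewrite !mul1r !mulN1r => /subr0_eq -> /subr0_eq ->.
Qed.

(* Where the Wronskian is constant the energy vanishes, hence H u = 0. *)
Lemma sol_const p q z u1 u2 (a b : R) : ham p q -> sol p q z u1 u2 ->
  complex.Im z != 0 -> 0 <= a -> a <= b -> wronsk u1 u2 a = wronsk u1 u2 b ->
  forall x, a <= x <= b -> u1 x = u1 a /\ u2 x = u2 a.
Proof.
move=> hH hu z0 a0 ab gab x /andP[ax xb]; have x0 := le_trans a0 ax.
have pw := prim_wronsk hu; pose k := energy p q u1 u2.
have kpos t : 0 <= t -> 0 <= k t.
  by move=> t0; have [_ _ /(_ t t0)[p0 p1 pq]] := hH; exact: energy_pt_ge0.
have rk : rbm k.
  have := (cbmM (cbm_cst (- (complex.Im z)^-1)%:C) pw.1).1.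
  apply: eq_rbm => t /=; rewrite /k mul0r subr0; field; exact: z0.
have ik : complex.Re (cint a x (fun t => (k t)%:C)) = 0.
  have hle c d : 0 <= c -> c <= d -> 0 <= complex.Re (cint c d (fun t => (k t)%:C)).
    move=> c0 cd; have -> : 0 = complex.Re (cint c d (fun=> 0)) by rewrite cint_cst// mul0r.
    apply: Re_cint_le => //; [exact: cbm_cst|exact: cbmR|].
    by move=> t /andP[ct _] /=; apply: kpos; exact: le_trans ct.
  have : complex.Re (cint a b (fun t => (k t)%:C)) = 0.
    have := primE pw a0 ab; rewrite gab subrr => /esym.
    rewrite (@eq_cint _ _ _ _ (fun t => (- complex.Im z)%:C * (k t)%:C)); last first.
      by move=> t _; rewrite -rmorphM.
    rewrite cintZ//; last exact: cbmR.
    by move=> /eqP; rewrite mulf_eq0 (inj_eq (@complexI _)) oppr_eq0 (negbTE z0) orFb => /eqP/(congr1 (@complex.Re R)).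
  rewrite (cint_itvD a0 ax xb (cbmR rk)) cReD.
  have := hle _ _ a0 ax; have := hle _ _ x0 xb; clear; lra.
(* [v] is a component of [H u] up to sign, with square at most [k]. Since [k] has integral 0, the
   bound [nc v <= e1 + k / e1] makes the integral of [v] arbitrarily small. *)
have main (w v : R -> C) : prim w (fun t => z * v t) -> cbm v ->
    (forall t, 0 <= t -> nc (v t) ^+ 2 <= k t) -> w x = w a.
  move=> pwv cv hv; apply/eqP; rewrite -subr_eq0 (primE pwv)// cintZ//.
  rewrite mulf_eq0; apply/orP; right; apply/eqP; apply: cvg_to0_eq => e e0.
  pose e1 := e / (x - a + 1).
  have e10 : 0 < e1 by rewrite divr_gt0//; clear -ax; lra.
  have rg : rbm (fun t => e1 + e1^-1 * k t).
    by apply: rbmD; [exact: rbm_cst|apply: rbmM => //; exact: rbm_cst].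
  apply: le_trans (nc_cint (g := fun t => e1 + e1^-1 * k t) a0 cv rg _) _.
    move=> t /andP[t1 _]; have t0 := le_trans a0 t1.
    have [h|h] := leP (nc (v t)) e1.
      by rewrite -[leLHS]addr0 lerD// mulr_ge0 ?invr_ge0 ?(ltW e10)// kpos.
    have : nc (v t) <= e1^-1 * nc (v t) ^+ 2.
      by rewrite mulrC ler_pdivlMr// expr2 ler_wpM2l ?nc_ge0// ltW.
    have : e1^-1 * nc (v t) ^+ 2 <= e1^-1 * k t by rewrite ler_pM2l ?invr_gt0// hv.
    by clear -e10; lra.
  rewrite (@eq_cint _ _ _ _ (fun t => e1%:C + (e1^-1)%:C * (k t)%:C)); last first.
    by move=> t _; rewrite -rmorphM -rmorphD.
  rewrite cintD//; [|exact: cbm_cst|by apply: cbmM; [exact: cbm_cst|exact: cbmR]].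
  rewrite cintZ//; last exact: cbmR.
  rewrite cint_cst// cReD !cReM ik/= !mul0r !mulr0 !subr0 addr0.
  rewrite /e1 mulrAC ler_pdivrMr; last by clear -ax; lra.
  by rewrite ler_pM2l//; clear; lra.
have [rp rq _] := hH; have [h1 h2] := hu.
have c1 := prim_cbm h1; have c2 := prim_cbm h2.
split.
  apply: (main _ (fun t => - ((q t)%:C * u1 t + (1 - p t)%:C * u2 t))).
  - by apply: prim_ext h1 => // t _; rewrite mulrN mulNr.
  - apply: cbmN; apply: cbmD; apply: cbmM => //; apply: cbmR => //.
    by apply: rbmB => //; exact: rbm_cst.
  - move=> t t0; have [_ _ /(_ t t0)[p0 p1 pq]] := hH.
    rewrite ncN; apply: le_trans (energy_pt_sqr (u1 t) (u2 t) pq).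
    by rewrite lerDl sqr_ge0.
apply: (main _ (fun t => (p t)%:C * u1 t + (q t)%:C * u2 t)) => //.
- by apply: cbmD; apply: cbmM => //; apply: cbmR.
- move=> t t0; have [_ _ /(_ t t0)[p0 p1 pq]] := hH.
  by apply: le_trans (energy_pt_sqr (u1 t) (u2 t) pq); rewrite lerDr sqr_ge0.
Qed.

Section Picard.
Variables (p q : R -> R) (e1 e2 : C).
Hypothesis hH : ham p q.

(** [picard n] is the coefficient of [z ^+ n] of the solution with initial value [(e1, e2)]; the
    series is entire in [z], which yields holomorphy in the spectral parameter. *)
Fixpoint picard (n : nat) : (R -> C) * (R -> C) :=
  if n is m.+1 then
    ((fun x => - cint 0 x (fun t => (q t)%:C * (picard m).1 t + (1 - p t)%:C * (picard m).2 t)),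
     (fun x => cint 0 x (fun t => (p t)%:C * (picard m).1 t + (q t)%:C * (picard m).2 t)))
  else ((fun=> e1), (fun=> e2)).

Lemma picard_prim n : cbm (picard n).1 /\ cbm (picard n).2 /\
  prim (picard n.+1).1 (fun t => - ((q t)%:C * (picard n).1 t + (1 - p t)%:C * (picard n).2 t)) /\
  prim (picard n.+1).2 (fun t => (p t)%:C * (picard n).1 t + (q t)%:C * (picard n).2 t).
Proof.
have [rp rq _] := hH.
have rp1 : rbm (fun t => 1 - p t) by apply: rbmB => //; exact: rbm_cst.
have next m : cbm (picard m).1 -> cbm (picard m).2 ->
  prim (picard m.+1).1 (fun t => - ((q t)%:C * (picard m).1 t + (1 - p t)%:C * (picard m).2 t)) /\
  prim (picard m.+1).2 (fun t => (p t)%:C * (picard m).1 t + (q t)%:C * (picard m).2 t).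
  move=> c1 c2; split; split.
  - by apply: cbmN; apply: cbmD; apply: cbmM => //; exact: cbmR.
  - move=> x x0; rewrite /= cint_pt oppr0 add0r cintN//.
    by apply: cbmD; apply: cbmM => //; exact: cbmR.
  - by apply: cbmD; apply: cbmM => //; exact: cbmR.
  - by move=> x x0; rewrite /= cint_pt add0r.
elim: n => [|n [c1 [c2 [h1 h2]]]].
  have [c1 c2] : cbm (picard 0).1 /\ cbm (picard 0).2 by split; exact: cbm_cst.
  by do 2 split => //; exact: next.
have k1 := prim_cbm h1; have k2 := prim_cbm h2.
by split; [exact: k1|split; [exact: k2|exact: next]].
Qed.

(** In the norm weighted by [expR (lam * x)] one integration gains [1 / lam], and the two terms in
    each component cost the factor 2. *)
Lemma picard_le (lam E : R) n : 0 < lam -> nc e1 <= E -> nc e2 <= E -> forall x, 0 <= x ->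
  nc ((picard n).1 x) <= E * (2 / lam) ^+ n * expR (lam * x) /\
  nc ((picard n).2 x) <= E * (2 / lam) ^+ n * expR (lam * x).
Proof.
move=> l0 h1 h2; have E0 : 0 <= E := le_trans (nc_ge0 _) h1.
have pe : prim (fun x : R => (expR (lam * x))%:C) (fun x => (lam * expR (lam * x))%:C).
  by apply: prim_exp; exact: prim_lin.
have ie (x : R) : 0 <= x -> complex.Re (cint 0 x (fun t => (expR (lam * t))%:C)) <= expR (lam * x) / lam.
  move=> x0; have : cint 0 x (fun t => (expR (lam * t))%:C) = (lam^-1)%:C * cint 0 x (fun t => (lam * expR (lam * t))%:C).
    rewrite -cintZ//; last exact: pe.1.
    by apply: eq_cint => t _; rewrite -rmorphM; congr (_%:C); field; rewrite gt_eqF.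
  move=> ->; rewrite -(primE pe)// -rmorphB -rmorphM/= mulrC ler_wpM2r ?invr_ge0 ?(ltW l0)//.
  by have := expR_gt0 (lam * 0); clear -hH; lra.
have re : rbm (fun t => expR (lam * t)) := (prim_cbm pe).1.
elim: n => [|n IH] x x0.
  rewrite !expr0 !mulr1 /=.
  have h : 1 <= expR (lam * x) by rewrite -[leLHS]expR0 ler_expR mulr_ge0// ltW.
  by split; apply: le_trans (_ : E <= _) => //; rewrite ler_peMr.
have [c1 [c2 [k1 k2]]] := picard_prim n.
pose K := E * (2 / lam) ^+ n; have K0 : 0 <= K by rewrite mulr_ge0// exprn_ge0// divr_ge0// ltW.
have rg : rbm (fun t => 2 * K * expR (lam * t)) by apply: rbmM => //; exact: rbm_cst.
have fin (f : R -> C) : cbm f -> (forall t, 0 <= t -> nc (f t) <= 2 * K * expR (lam * t)) ->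
    nc (cint 0 x f) <= E * (2 / lam) ^+ n.+1 * expR (lam * x).
  move=> cf hf; apply: le_trans (nc_cint (lexx _) cf rg _) _.
    by move=> t /andP[t0 _]; exact: hf.
  rewrite (@eq_cint _ _ _ _ (fun t => (2 * K)%:C * (expR (lam * t))%:C)); last first.
    by move=> t _; rewrite -rmorphM.
  rewrite cintZ//; last exact: cbmR.
  rewrite cReM/= mul0r subr0; apply: le_trans (ler_wpM2l _ (ie x x0)) _; first by rewrite mulr_ge0.
  by rewrite le_eqVlt; apply/orP; left; apply/eqP; rewrite exprS /K; field; rewrite gt_eqF.
have bd (a b : R) (s t : C) y : `|a| <= 1 -> `|b| <= 1 -> nc s <= K * y -> nc t <= K * y ->
    nc (a%:C * s + b%:C * t) <= 2 * K * y.
  move=> a1 b1 s1 t1; rewrite (le_trans (ncD _ _))// !ncM !ncR.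
  have := ler_pM (normr_ge0 a) (nc_ge0 s) a1 s1; have := ler_pM (normr_ge0 b) (nc_ge0 t) b1 t1.
  by clear -hH; lra.
have hpq t : 0 <= t -> [/\ `|p t| <= 1, `|q t| <= 1 & `|1 - p t| <= 1].
  move=> t0; have [_ _ /(_ t t0)[p0 p1 pq]] := hH.
  have q1 : `|q t| <= 1.
    rewrite -(@ler_pXn2r _ 2)// ?nnegrE// expr1n real_normK ?num_real//; clear -hH p0 p1 pq; nra.
  by split => //; rewrite ler_norml; clear -hH p0 p1; lra.
split.
  have -> : (picard n.+1).1 x = - cint 0 x (fun t => (q t)%:C * (picard n).1 t + (1 - p t)%:C * (picard n).2 t) by [].
  rewrite ncN; apply: fin => [|t t0]; first by have := cbmN k1.1; apply: eq_cbm => t; rewrite opprK.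
  have [b1 b2 b3] := hpq t t0; have [i1 i2] := IH t t0.
  exact: bd.
apply: fin => [|t t0]; first exact: k2.1.
have [b1 b2 b3] := hpq t t0; have [i1 i2] := IH t t0.
exact: bd.
Qed.

Definition transfer1 (z : C) (x : R) := csum (fun n => (picard n).1 x * z ^+ n).
Definition transfer2 (z : C) (x : R) := csum (fun n => (picard n).2 x * z ^+ n).

(* Any geometric rate is available by taking lam large. *)
Lemma picard_rate (A L : R) : 0 < A -> exists B : R, 0 <= B /\ forall n x, 0 <= x <= L ->
  nc ((picard n).1 x) <= B * A ^+ n /\ nc ((picard n).2 x) <= B * A ^+ n.
Proof.
move=> A0; pose E := nc e1 + nc e2; pose lam := 2 / A.
have l0 : 0 < lam by rewrite divr_gt0.
have [n1 n2] := (nc_ge0 e1, nc_ge0 e2).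
exists (E * expR (lam * L)); split; first by rewrite mulr_ge0 ?expR_ge0// addr_ge0.
move=> n x /andP[x0 xL].
have h1 : nc e1 <= E by rewrite lerDl. have h2 : nc e2 <= E by rewrite lerDr.
have := picard_le n l0 h1 h2 x0.
have -> : 2 / lam = A by rewrite /lam; field; rewrite gt_eqF.
have h3 : E * A ^+ n * expR (lam * x) <= E * expR (lam * L) * A ^+ n.
  rewrite mulrAC ler_wpM2r ?exprn_ge0 ?(ltW A0)// ler_wpM2l ?addr_ge0// ler_expR ler_pM2l//.
by move=> [k1 k2]; split; [exact: le_trans k1 h3|exact: le_trans k2 h3].
Qed.

Lemma transfer_cdiff (x : R) (z : C) : 0 <= x ->
  cdiff (fun z => transfer1 z x) z /\ cdiff (fun z => transfer2 z x) z.
Proof.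
(* Chosen so that [1 / (4 * A) = nc z + 1] exceeds [nc z]. *)
move=> x0; pose A := 1 / (4 * (nc z + 1)).
have z1 : 0 < nc z + 1 by have := nc_ge0 z; lra.
have A0 : 0 < A by rewrite divr_gt0// mulr_gt0.
have zA : nc z < 1 / (4 * A).
  by rewrite (_ : 1 / (4 * A) = nc z + 1); [lra|rewrite /A; field; rewrite gt_eqF].
have [B [B0 hB]] := picard_rate x A0.
have xx : 0 <= x <= x by rewrite x0 lexx.
split; (eexists; apply: (@psum_cderiv _ _ B A z A0 _ zA) => n).
- exact: (hB n x xx).1.
- exact: (hB n x xx).2.
Qed.

Lemma transfer_sol z : sol p q z (transfer1 z) (transfer2 z).
Proof.
have [rp rq _] := hH.
have rp1 : rbm (fun t => 1 - p t) by apply: rbmB => //; exact: rbm_cst.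
pose S1 n x := \sum_(k < n) (picard k).1 x * z ^+ k.
pose S2 n x := \sum_(k < n) (picard k).2 x * z ^+ k.
(* With [A * nc z <= 1 / 2] the partial sums converge geometrically, uniformly on [[0, L]]. *)
pose A := 1 / (2 * (nc z + 1)).
have z1 : 0 < nc z + 1 by have := nc_ge0 z; lra.
have A0 : 0 < A by rewrite divr_gt0// mulr_gt0.
have Az : A * nc z <= 1 / 2.
  rewrite /A mulrAC mul1r ler_pdivrMr ?mulr_gt0//; have := nc_ge0 z; lra.
have Az0 : 0 <= A * nc z by rewrite mulr_ge0 ?nc_ge0// ltW.
have unif L : exists B : R, 0 <= B /\ forall n x, 0 <= x <= L ->
    nc (transfer1 z x - S1 n x) <= 2 * B * (1 / 2) ^+ n /\
    nc (transfer2 z x - S2 n x) <= 2 * B * (1 / 2) ^+ n.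
  have [B [B0 hB]] := picard_rate L A0; exists B; split => // n x xL.
  have Bn : 2 * B * (A * nc z) ^+ n <= 2 * B * (1 / 2) ^+ n.
    by rewrite ler_wpM2l ?mulr_ge0// lerXn2r ?nnegrE.
  split; apply: le_trans Bn; apply: csumP => // k;
    rewrite ncM ncX exprMn mulrA ler_wpM2r ?exprn_ge0 ?nc_ge0//.
  - exact: (hB k x xL).1.
  - exact: (hB k x xL).2.
have small L e : 0 < e -> \forall n \near \oo, forall x, 0 <= x <= L ->
    nc (S1 n x - transfer1 z x) <= e /\ nc (S2 n x - transfer2 z x) <= e.
  move=> e0; have [B [B0 hB]] := unif L.
  have [N hN] := half_small (mulr_ge0 (ler0n R 2) B0) e0.
  near=> n => x xL; have [h1 h2] := hB n x xL.
  have hn : 2 * B * (1 / 2) ^+ n <= e.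
    apply: le_trans hN; rewrite ler_wpM2l ?mulr_ge0//.
    by apply: ler_wiXn2l; [lra|lra|near: n; exact: nbhs_infty_ge].
  by rewrite !(ncC (_ n x)); split; apply: le_trans hn.
have pS1 n : cbm (S1 n) by apply: cbm_sum => k; apply: cbmM; [exact: (picard_prim k).1|exact: cbm_cst].
have pS2 n : cbm (S2 n) by apply: cbm_sum => k; apply: cbmM; [exact: (picard_prim k).2.1|exact: cbm_cst].
have dz : (fun n : nat => 1 / n.+1%:R : R) @ \oo --> 0.
  by under eq_fun do rewrite div1r; exact: cvg_harmonic.
have cT : cbm (transfer1 z) /\ cbm (transfer2 z).
  have dd (B : R) : (fun n : nat => 2 * B * (1 / 2) ^+ n) @ \oo --> 0.
    rewrite -[X in _ --> X](mulr0 (2 * B)); apply: cvgMr.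
    by apply: cvg_expr; rewrite ger0_norm; lra.
  split.
  - apply: (cbm_lim pS1) => L; have [B [B0 hB]] := unif L.
    exists (fun n => 2 * B * (1 / 2) ^+ n); first exact: dd.
    by move=> n x xL; rewrite ncC; exact: (hB n x xL).1.
  - apply: (cbm_lim pS2) => L; have [B [B0 hB]] := unif L.
    exists (fun n => 2 * B * (1 / 2) ^+ n); first exact: dd.
    by move=> n x xL; rewrite ncC; exact: (hB n x xL).2.
have prS1 n : prim (S1 n.+1) (fun t => - z * ((q t)%:C * S1 n t + (1 - p t)%:C * S2 n t)).
  have := primD (prim_cst (e1 * z ^+ 0)) (prim_sum (index_enum 'I_n) (fun k : 'I_n =>
    primZ (z ^+ k.+1) (picard_prim k).2.2.1)).
  apply: prim_ext => x _.
    by rewrite /S1 big_ord_recl; congr (_ + _); apply: eq_bigr => k _; rewrite mulrC.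
  rewrite add0r /S1 /S2 !mulr_sumr -big_split/= mulr_sumr.
  by apply: eq_bigr => k _; rewrite exprS; ring.
have prS2 n : prim (S2 n.+1) (fun t => z * ((p t)%:C * S1 n t + (q t)%:C * S2 n t)).
  have := primD (prim_cst (e2 * z ^+ 0)) (prim_sum (index_enum 'I_n) (fun k : 'I_n =>
    primZ (z ^+ k.+1) (picard_prim k).2.2.2)).
  apply: prim_ext => x _.
    by rewrite /S2 big_ord_recl; congr (_ + _); apply: eq_bigr => k _; rewrite mulrC.
  rewrite add0r /S1 /S2 !mulr_sumr -big_split/= mulr_sumr.
  by apply: eq_bigr => k _; rewrite exprS; ring.
have comb (a b : R -> R) : rbm a -> rbm b -> forall k L e, 0 < e -> \forall n \near \oo, forall x, 0 <= x <= L ->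
   nc (k * ((a x)%:C * S1 n x + (b x)%:C * S2 n x) - k * ((a x)%:C * transfer1 z x + (b x)%:C * transfer2 z x)) <= e.
  move=> ra rb k L e e0.
  have [Ba Ba0 hBa] := cbm_bound L (cbmR ra); have [Bb Bb0 hBb] := cbm_bound L (cbmR rb).
  pose K := (nc k + 1) * (Ba + Bb); have k1 : 0 < nc k + 1 by have := nc_ge0 k; lra.
  have K0 : 0 < K by rewrite mulr_gt0// addr_gt0.
  have := small L _ (divr_gt0 e0 K0); apply: filterS => n h x xL; have [h1 h2] := h x xL.
  rewrite (_ : _ - _ = k * ((a x)%:C * (S1 n x - transfer1 z x) + (b x)%:C * (S2 n x - transfer2 z x))); last by ring.
  rewrite ncM; apply: (@le_trans _ _ ((nc k + 1) * ((Ba + Bb) * (e / K)))); last first.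
    by rewrite mulrA -/K mulrC divfK ?gt_eqF.
  apply: ler_pM; [exact: nc_ge0|exact: nc_ge0|by rewrite lerDl|].
  rewrite (le_trans (ncD _ _))// mulrDl !ncM lerD// ler_pM ?nc_ge0// ?hBa ?hBb//.
split.
  apply: (prim_lim prS1) => [x x0 e e0| |L e e0].
  - have := small x e e0 => -[N _ hN]; exists N => // n Nn; apply: (hN n.+1 _ x _).1; last by rewrite x0 lexx.
    exact: leqW.
  - apply: cbmM; first exact: cbm_cst.
    by apply: cbmD; apply: cbmM; [exact: cbmR|exact: cT.1|exact: cbmR|exact: cT.2].
  - exact: comb.
apply: (prim_lim prS2) => [x x0 e e0| |L e e0].
- have := small x e e0 => -[N _ hN]; exists N => // n Nn; apply: (hN n.+1 _ x _).2; last by rewrite x0 lexx.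
  exact: leqW.
- apply: cbmM; first exact: cbm_cst.
  by apply: cbmD; apply: cbmM; [exact: cbmR|exact: cT.1|exact: cbmR|exact: cT.2].
- exact: comb.
Unshelve. all: by end_near. Qed.

Lemma transfer_0 z : transfer1 z 0 = e1 /\ transfer2 z 0 = e2.
Proof.
have h (f : nat -> C) : (forall n, f n.+1 = 0) -> csum (fun n => f n * z ^+ n) = f 0%N.
  move=> f0; have := @csumP _ (fun n => f n * z ^+ n) (nc (f 0%N)) 0 (lexx _).
  move=> /(_ _ _ 1%N); rewrite big_ord_recl big_ord0 expr0 mulr1 addr0 expr1 mulr0.
  move=> H; apply/eqP; rewrite -subr_eq0 -nc_eq0 eq_le nc_ge0 andbT; apply: H; first by lra.
  by case=> [|k]; [rewrite expr0 !mulr1|rewrite f0 mul0r nc0 expr0n/= mulr0].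
by rewrite /transfer1 /transfer2 !h// => n /=; rewrite cint_pt ?oppr0.
Qed.

End Picard.
End Transfer.

(** * Absolute continuity and the fundamental theorem of calculus *)

Section AbsoluteContinuity.
Variable R : realType.
Local Notation C := R[i].
Local Notation mu := (@lebesgue_measure R).

(** Continuous induction: the supremum of the points reached from [a] is itself reached, by the
    local property there, and can be passed unless it is [b]. *)
Lemma cousin (P : R -> R -> Prop) (a b : R) : a <= b ->
  (forall x y z, a <= x -> x <= y -> y <= z -> z <= b -> P x y -> P y z -> P x z) ->
  (forall x, a <= x -> x <= b -> exists2 d : R, 0 < d & forall y z,
     a <= y -> y <= x -> x <= z -> z <= b -> z - y < d -> P y z) -> P a b.
Proof.
move=> ab add loc; pose S := [set x : R | a <= x <= b /\ P a x].
have Sa : S a.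
  split; first by rewrite lexx.
  by have [d d0 h] := loc a (lexx _) ab; apply: h; rewrite ?subrr.
have ubS : ubound S b by move=> x [/andP[]].
have hsS : has_sup S by split; [exists a|exists b].
set s := sup S.
have as_ : a <= s by apply: ub_le_sup => //; exists b.
have sb : s <= b by apply: ge_sup => //; exists a.
have [d d0 h] := loc s as_ sb.
have [x [/andP[ax xb] Px] xs] := sup_adherent d0 hsS.
have xs' : x <= s by apply: ub_le_sup => //; [exists b|split => //; rewrite ax].
have Ps : P a s by apply: (add _ x) => //; apply: h => //; rewrite -/s in xs; clear -xs; lra.
have [sb'|] := ltP s b; last by move=> bs; rewrite (_ : b = s)//; apply/eqP; rewrite eq_le bs.
pose z := Num.min b (s + d / 2).
have zb : z <= b by rewrite /z ge_min lexx.
have zd : z <= s + d / 2 by rewrite /z ge_min lexx orbT.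
have sz : s < z by rewrite lt_min sb' ltrDl divr_gt0.
have Sz : S z.
  split; first by rewrite zb (le_trans as_ (ltW sz)).
  apply: (add _ s) => //; first exact: ltW.
  by apply: h => //; [exact: ltW|clear -zd d0; lra].
have : z <= s by apply: ub_le_sup => //; exists b.
by rewrite leNgt sz.
Qed.

(** Lebesgue differentiation for [f] cut off outside [[0, n]], for all [n] at once. *)
Lemma rbm_ae_derive (f : R -> R) : rbm f -> {ae mu, forall x : R, 0 < x ->
  is_derive x (1 : R) (fun y => \int[mu]_(t in `[0, y]) f t) (f x)}.
Proof.
move=> hf.
have loc n : locally_integrable [set: R] (f \_ `[0, n%:R]).
  by apply: integrable_locally => //; exact: rbm_integrable.
have : \forall x \ae mu, forall n : nat, lebesgue_pt (f \_ `[0, n%:R]) x.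
  by apply: ae_foralln => n; exact: lebesgue_differentiation (loc n).
apply: (@filterS _ _ (ae_filter_ringOfSetsType mu)) => x h x0.
pose n := (Num.bound x).+1.
have xn : x < n%:R.
  have : x < (Num.bound x)%:R by apply: archi_boundP; exact: ltW.
  by move=> /lt_trans; apply; rewrite ltr_nat.
have ii : mu.-integrable `[0, n%:R] (EFin \o (f \_ `[0, n%:R])).
  apply: eq_integrable (rbm_integrable n%:R (lexx 0) hf) => // y.
  by rewrite inE => yn /=; rewrite patchE mem_set.
have FT := @FTC1_lebesgue_pt R (f \_ `[0, n%:R]) (BLeft 0) x n%:R xn ii.
have [|d1 d2] := FT _ (h n); first by rewrite (@lte_fin R).
have fx : (f \_ `[0, n%:R]) x = f x.
  by rewrite patchE mem_set//= in_itv/= (ltW x0) (ltW xn).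
have E : is_derive (x : R) (1 : R) (fun y : R => \int[mu]_(t in `[0, y]) (f \_ `[0, n%:R]) t) (f x).
  by apply: DeriveDef => //; rewrite -derive1E d2.
apply: near_eq_is_derive E; near=> y; apply: eq_Rintegral => t; rewrite inE/= in_itv/= => /andP[t0 ty].
rewrite patchE mem_set//= in_itv/= t0 (le_trans ty)// ltW//.
by near: y; exact: lt_nbhsl.
Unshelve. all: by end_near. Qed.

Lemma ae_zero (f : R -> R) : rbm f ->
  (forall x : R, 0 <= x -> \int[mu]_(t in `[0, x]) f t = 0) ->
  {ae mu, forall x : R, 0 < x -> f x = 0}.
Proof.
move=> hf h0; have := rbm_ae_derive hf; apply: (@filterS _ _ (ae_filter_ringOfSetsType mu)) => x h x0.
have hx := h x0; have : is_derive x (1 : R) (fun y : R => \int[mu]_(t in `[0, y]) f t) 0.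
  apply: (near_eq_is_derive _ (is_derive_cst (0 : R) (x : R) (1 : R))).
  by near=> y; rewrite h0//; apply: ltW; near: y; exact: lt_nbhsr.
by move=> [_ E1]; case: hx => _ E2; exact: etrans (esym E2) E1.
Unshelve. all: by end_near. Qed.

Lemma null_open_cover (N : set R) (e : R) : measurable N -> mu N = 0%E -> 0 < e ->
  exists U : set R, [/\ open U, N `<=` U & (mu U < e%:E)%E].
Proof.
move=> mN N0 e0; have Noo : (mu N < +oo)%E by rewrite N0 ltry.
have [U [oU NU h]] := lebesgue_regularity_outer mN Noo e0.
exists U; split => //; apply: le_lt_trans h.
have mU := open_measurable oU.
have -> : mu U = (mu (U `&` N) + mu (U `\` N))%E by rewrite [RHS]addeC -measureDI.
rewrite (_ : U `&` N = N) ?N0 ?add0e//.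
by apply/seteqP; split => [x []//|x Nx]; split => //; exact: NU.
Qed.

(** Half-open intervals make this length exactly additive in []x, y]], as [cousin] requires. *)
Definition len (U : set R) (x y : R) := fine (mu (U `&` `]x, y])).

Lemma len_le (U : set R) (x y e : R) : open U -> (mu U < e%:E)%E -> len U x y < e.
Proof.
move=> oU h; have mU := open_measurable oU.
have hle : (mu (U `&` `]x, y]) <= mu U)%E.
  by apply: le_measure; [rewrite inE; exact: measurableI|rewrite inE|exact: subIsetl].
have fn : mu (U `&` `]x, y]) \is a fin_num.
  by rewrite ge0_fin_numE// (le_lt_trans hle)// (lt_trans h)// ltry.
by rewrite -lte_fin /len fineK// (le_lt_trans hle).
Qed.

Lemma len_fin (U : set R) (x y : R) : open U -> mu (U `&` `]x, y]) \is a fin_num.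
Proof.
move=> oU; have mU := open_measurable oU; rewrite ge0_fin_numE//.
apply: le_lt_trans (_ : (mu `]x, y] < +oo)%E).
  by apply: le_measure; [rewrite inE; exact: measurableI|rewrite inE|exact: subIsetr].
by rewrite lebesgue_measure_itv/=; case: ifP => _; rewrite ?ltry// -EFinB ltry.
Qed.

Lemma len_add (U : set R) (x y z : R) : open U -> x <= y -> y <= z ->
  len U x z = len U x y + len U y z.
Proof.
move=> oU xy yz; have mU := open_measurable oU.
rewrite /len -fineD ?len_fin// -measureU//; try exact: measurableI.
  congr (fine (mu _)); rewrite -setIUr; congr (_ `&` _).
  apply/seteqP; split => t /=; rewrite !in_itv/=.
    by move=> /andP[xt tz]; case: (leP t y) => ty; [left; rewrite xt|right; rewrite tz].
  by move=> [/andP[xt ty]|/andP[yt tz]]; rewrite ?xt ?(le_trans ty)// tz (le_lt_trans xy).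
apply/seteqP; split => // t /= [[_]] /=; rewrite !in_itv/= => /andP[_ ty] [_ /andP[yt _]].
by rewrite ltNge ty in yt.
Qed.

Lemma len_full (U : set R) (x y : R) : x <= y -> `[x, y] `<=` U -> len U x y = y - x.
Proof.
move=> xy h; rewrite /len (_ : U `&` `]x, y] = `]x, y]%classic); last first.
  apply/seteqP; split => [t []//|t tt]; split => //; apply: h; move: tt.
  by rewrite /= !in_itv/= => /andP[/ltW-> ->].
rewrite lebesgue_measure_itv/= lte_fin; case: ltP => //= yx.
by apply/esym/eqP; rewrite subr_eq0 eq_le xy yx.
Qed.

Lemma len_ge0 (U : set R) (x y : R) : 0 <= len U x y.
Proof. by rewrite fine_ge0. Qed.

Lemma open_itv_sub (U : set R) (x : R) : open U -> U x -> exists2 d : R, 0 < d &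
  forall y z, y <= x -> x <= z -> z - y < d -> `[y, z] `<=` U.
Proof.
move=> oU Ux; have /nbhs_ballP[d /= d0 h] := open_nbhs_nbhs (conj oU Ux).
exists d => // y z yx xz zy t; rewrite /= in_itv/= => /andP[yt tz].
by apply: h; rewrite /ball/= ltr_norml; apply/andP; split; clear -yx xz zy yt tz; lra.
Qed.

Lemma is_derive_diff (D : R -> R) (x d e : R) : is_derive x (1 : R) D d -> 0 < e ->
  exists2 del : R, 0 < del & forall y, `|y - x| < del ->
    `|D y - D x - d * (y - x)| <= e * `|y - x|.
Proof.
move=> [dD Dd] e0; have : h^-1 *: (D (h *: (1 : R) + x) - D x) @[h --> 0^'] --> d by rewrite -Dd.
move=> /cvgrPdist_le/(_ _ e0) [/= del del0 h]; exists del => // y yd.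
have [->|yx] := eqVneq y x; first by rewrite !subrr mulr0 subrr normr0 mulr0.
have := h (y - x); rewrite /ball_ /= sub0r normrN subr_eq0 => /(_ yd yx).
have ny : 0 < `|y - x| by rewrite normr_gt0 subr_eq0.
rewrite -(ler_pM2r ny) -normrM; congr (_ <= _).
rewrite -normrN; congr `|_|; rewrite /GRing.scale/= mulr1 subrK; field.
by rewrite subr_eq0.
Qed.

(** Exceptional points lie in an open set [U] of measure below the [d] of absolute continuity; the
    intervals chosen there go into the list [s]. At all other points increments are controlled by a
    slope of order [e / L]. [cousin] joins both kinds, so that [D L - D 0] is at most [2 e], half of
    its own modulus. *)
Lemma ac_deriv0 (L : R) (D : R -> R) : 0 < L -> abs_continuous_on 0 L D ->
  {ae mu, forall x : R, 0 < x -> is_derive x (1 : R) D 0} -> D L = D 0.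
Proof.
move=> L0 acD [N [mN N0 hN]].
apply/eqP; rewrite -subr_eq0 -normr_eq0; apply/negPn/negP => DL.
have DL0 : 0 < `|D L - D 0| by rewrite lt_def DL normr_ge0.
pose e := `|D L - D 0| / 4; have e0 : 0 < e by rewrite divr_gt0.
have [d d0 hd] := acD e e0.
(* The hypothesis says nothing at 0, so 0 joins the exceptional set. *)
pose N' := N `|` [set 0].
have mN' : measurable N' by apply: measurableU.
have N'0 : mu N' = 0%E.
  have : (mu N' <= mu N + mu [set (0%R : R)])%E by apply: measureU2.
  by rewrite N0 lebesgue_measure_set1 adde0 => h; apply/eqP; rewrite eq_le h measure_ge0.
have [U [oU NU mU]] := null_open_cover mN' N'0 d0.
pose P (x y : R) := exists s : seq (R * R),
  [/\ forall p, p \in s -> x <= p.1 /\ p.1 <= p.2 /\ p.2 <= y,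
      pairwise (fun p q => (p.2 <= q.1) || (q.2 <= p.1)) s,
      \sum_(p <- s) (p.2 - p.1) <= len U x y &
      `|D y - D x| <= e / L * (y - x) + \sum_(p <- s) `|D p.2 - D p.1|].
have eL : 0 < e / L by rewrite divr_gt0.
have [s [s1 s2 s3 s4]] : P 0 L.
  apply: cousin; first exact: ltW.
    move=> x y z x0 xy yz zL [s [h1 h2 h3 h4]] [s' [k1 k2 k3 k4]].
    exists (s ++ s'); split.
    - move=> p; rewrite mem_cat => /orP[/h1|/k1] [q1 [q2 q3]];
        split; [|split| |split] => //; [exact: le_trans yz|exact: le_trans q1].
    - rewrite pairwise_cat h2 k2 !andbT; apply/allrelP => p p' /h1[_ [_ p2]] /k1[p1 _].
      by rewrite (le_trans p2 p1).
    - by rewrite big_cat/= (len_add oU xy yz) lerD.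
    - rewrite big_cat/= (_ : D z - D x = (D y - D x) + (D z - D y)); last by ring.
      apply: le_trans (ler_normD _ _) _; apply: le_trans (lerD h4 k4) _.
      by rewrite le_eqVlt; apply/orP; left; apply/eqP; ring.
  move=> x x0 xL; have [Ux|Ux] := pselect (U x).
    have [r r0 hr] := open_itv_sub oU Ux; exists r => // y z y0 yx xz zL zy.
    have yz := le_trans yx xz.
    exists [:: (y, z)]; split => //.
    - by move=> p; rewrite inE => /eqP->.
    - by rewrite big_seq1/= len_full//; exact: hr.
    - by rewrite big_seq1/= lerDr mulr_ge0 ?(ltW eL)// subr_ge0.
  have [xN xn0] : ~ N x /\ x != 0.
    by split => [Nx|]; [apply/Ux/NU; left|apply/eqP => xE; apply/Ux/NU; right].
  have xgt0 : 0 < x by rewrite lt_def xn0.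
  have dx : is_derive x (1 : R) D 0 by apply: contrapT => h; apply/xN/hN => /(_ xgt0).
  have [r r0 hr] := is_derive_diff dx eL; exists r => // y z y0 yx xz zL zy.
  exists [::]; split => //; first by rewrite big_nil len_ge0.
  rewrite big_nil addr0.
  have yr : `|y - x| < r by rewrite ler0_norm; clear -yx xz zy; lra.
  have zr : `|z - x| < r by rewrite ger0_norm; clear -yx xz zy; lra.
  have := hr _ yr; have := hr _ zr; rewrite !mul0r !subr0.
  rewrite (ger0_norm (_ : 0 <= z - x)) ?subr_ge0// (ler0_norm (_ : y - x <= 0)) ?subr_le0// => k1 k2.
  rewrite (_ : D z - D y = (D z - D x) - (D y - D x)); last by ring.
  apply: le_trans (ler_normB _ _) _; apply: le_trans (lerD k1 k2) _.
  by rewrite le_eqVlt; apply/orP; left; apply/eqP; ring.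
have s5 : \sum_(p <- s) (p.2 - p.1) < d by apply: le_lt_trans s3 (len_le _ _ oU mU).
have s6 := hd s s1 s2 s5; have E : e / L * (L - 0) = e by field; rewrite gt_eqF.
rewrite {}E in s4; move: s4 s6 DL0; rewrite /e; move: `|D L - D 0| => T.
by move: (\sum_(p <- s) _) => S; clear; lra.
Qed.

Lemma ac_cont (L : R) (F : R -> R) : abs_continuous_on 0 L F -> forall e, 0 < e ->
  exists2 d : R, 0 < d & forall x y, 0 <= x -> x <= y -> y <= L -> y - x < d -> `|F y - F x| < e.
Proof.
move=> ac e e0; have [d d0 h] := ac e e0; exists d => // x y x0 xy yL xyd.
have := h [:: (x, y)]; rewrite !big_seq1/=; apply => //.
by move=> p; rewrite inE => /eqP->.
Qed.

Lemma ac_hcont (F : R -> R) : loc_abs_continuous F -> hcont (fun x => (F x)%:C).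
Proof.
move=> ac x x0 e e0; have x1 : 0 < x + 1 by lra.
have [d d0 h] := ac_cont (ac _ x1) e0.
exists (Num.min d 1); first by rewrite lt_min d0 ltr01.
move=> y y0; rewrite lt_min => /andP[yd y1]; rewrite -rmorphB ncR.
have [xy|/ltW yx] := leP x y.
  have E : `|y - x| = y - x by rewrite ger0_norm ?subr_ge0.
  rewrite E in yd y1; apply: h => //; lra.
have E : `|y - x| = x - y by rewrite distrC ger0_norm ?subr_ge0.
by rewrite E in yd y1; rewrite distrC; apply: h => //; lra.
Qed.

Lemma abs_continuous_lip (L B : R) (F : R -> R) : 0 < B ->
  (forall a b, 0 <= a -> a <= b -> b <= L -> `|F b - F a| <= B * (b - a)) ->
  abs_continuous_on 0 L F.
Proof.
move=> B0 h e e0; exists (e / B); first by rewrite divr_gt0.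
move=> s hs _ sd; apply: (@le_lt_trans _ _ (B * \sum_(p <- s) (p.2 - p.1))).
  rewrite mulr_sumr big_seq [leRHS]big_seq; apply: ler_sum => p /hs[p1 [p2 p3]].
  exact: h.
by rewrite mulrC -ltr_pdivlMr.
Qed.

Lemma abs_continuousB (L : R) (F G : R -> R) : abs_continuous_on 0 L F ->
  abs_continuous_on 0 L G -> abs_continuous_on 0 L (fun x => F x - G x).
Proof.
move=> hF hG e e0; have e2 : 0 < e / 2 by lra.
have [d d0 h] := hF _ e2; have [d' d0' h'] := hG _ e2.
exists (Num.min d d'); first by rewrite lt_min d0.
move=> s s1 s2; rewrite lt_min => /andP[/(h s s1 s2) k1 /(h' s s1 s2) k2].
apply: (@le_lt_trans _ _ (\sum_(p <- s) `|F p.2 - F p.1| + \sum_(p <- s) `|G p.2 - G p.1|)).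
  rewrite -big_split; apply: ler_sum => p _ /=.
  rewrite (_ : _ - _ = (F p.2 - F p.1) - (G p.2 - G p.1)); last by ring.
  exact: ler_normB.
by lra.
Qed.

(** The difference of [F] and the integral of [f] is absolutely continuous with derivative 0 almost
    everywhere, hence constant by [ac_deriv0]. *)
Lemma ac_prim (F f : R -> R) : loc_abs_continuous F -> rbm f ->
  {ae mu, forall x : R, 0 < x -> is_derive x (1 : R) F (f x)} ->
  prim (fun x => (F x)%:C) (fun x => (f x)%:C).
Proof.
move=> acF rf dF; split; first exact: cbmR.
move=> L; rewrite le_eqVlt => /predU1P[<-|L0]; first by rewrite cint_pt addr0.
rewrite cint_real -rmorphD; congr (_%:C); rewrite Re_cint/=.
pose I y := \int[mu]_(t in `[0, y]) f t.
have : (fun x => F x - I x) L = (fun x => F x - I x) 0.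
  apply: (@ac_deriv0 L (fun x => F x - I x)) => //; first apply: abs_continuousB.
  - exact: acF.
  - have [B B0 hB] := cbm_bound L (cbmR rf).
    apply: (abs_continuous_lip B0) => a b a0 ab bL.
    rewrite /I (Rint_itvD (lexx 0) a0 ab)// addrAC subrr add0r.
    have := @nc_cint_le R a b (fun x => (f x)%:C) B a0 ab (cbmR rf).
    rewrite cint_real ncR Re_cint/=; apply => x /andP[ax xb]; apply: hB.
    by rewrite (le_trans a0 ax) (le_trans xb bL).
  - have := rbm_ae_derive rf; move: dF; apply: (@filterS2 _ _ (ae_filter_ringOfSetsType mu)) => x h1 h2 x0.
    have h3 := h1 x0; have h4 := h2 x0; have := is_deriveB h3 h4.
    by rewrite subrr.
by rewrite /= /I set_itv1 Rintegral_set1 subr0 => <-; ring.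
Qed.

End AbsoluteContinuity.

(** * From matrix-valued coefficients and solutions to [ham] and [sol] *)

Section Interface.
Variable R : realType.
Local Notation C := R[i].
Local Notation mu := (@lebesgue_measure R).

Lemma ord2P (P : 'I_2 -> Prop) : P 0 -> P 1 -> forall i, P i.
Proof.
move=> P0 P1 [[|[|//]] h]; first by rewrite (_ : Ordinal h = 0)//; apply: val_inj.
by rewrite (_ : Ordinal h = 1)//; apply: val_inj.
Qed.

Lemma sum2 (V : nmodType) (F : 'I_2 -> V) : \sum_i F i = F 0 + F 1.
Proof.
rewrite !big_ord_recl big_ord0 addr0; congr (_ + F _); exact: val_inj.
Qed.

Lemma JmxE (i j : 'I_2) : Jmx R i j = (if i == 0 then (if j == 0 then 0 else -1)
  else (if j == 0 then 1 else 0)).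
Proof.
rewrite /Jmx /block_mx /col_mx /row_mx !mxE.
by case: splitP => i' /= iE; rewrite ?mxE; case: splitP => j' /= jE; rewrite ?mxE;
  rewrite ?ord1 /= in iE jE; rewrite -!val_eqE /= ?iE ?jE ?ord1 ?mxE ?ord1 //= ?mulr1n.
Qed.

Lemma Jmx_mul (v : 'cV[C]_2) : (Jmx R *m v) 0 0 = - v 1 0 /\ (Jmx R *m v) 1 0 = v 0 0.
Proof. by split; rewrite mxE sum2 !JmxE/= ?mul0r ?add0r ?mulN1r ?mul1r ?addr0. Qed.

Lemma psd_entries (A : 'M[R]_2) : psdmx A -> \tr A = 1 ->
  [/\ A 1 0 = A 0 1, A 1 1 = 1 - A 0 0, 0 <= A 0 0, A 0 0 <= 1 & A 0 1 ^+ 2 <= A 0 0 * (1 - A 0 0)].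
Proof.
move=> [AT hA] trA.
have s : A 1 0 = A 0 1 by have := congr1 (fun B : 'M[R]_2 => B 0 1) AT; rewrite mxE.
have t : A 1 1 = 1 - A 0 0 by move: trA; rewrite /mxtrace sum2; lra.
have form (a b : R) : 0 <= A 0 0 * a ^+ 2 + 2 * A 0 1 * a * b + A 1 1 * b ^+ 2.
  have := hA (\col_k (if k == 0 then a else b)).
  by rewrite !mxE sum2 !mxE !sum2 !mxE/= s; congr (_ <= _); ring.
have p0 : 0 <= A 0 0 by have := form 1 0; lra.
have p1 : 0 <= A 1 1 by have := form 0 1; lra.
split => //; first by lra.
(* The values of the form at [(q, - p)] and [(1 - p, - q)] add up to the determinant times the
   trace. *)
have h1 := form (A 0 1) (- A 0 0); have h2 := form (A 1 1) (- A 0 1).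
rewrite -subr_ge0; have := addr_ge0 h1 h2; rewrite t; congr (_ <= _); ring.
Qed.

Lemma canonical_ham (H : R -> 'M[R]_2) : canonical_system H -> exists p q, ham p q /\
  {ae mu, forall x : R, 0 <= x ->
     [/\ H x 0 0 = p x, H x 0 1 = q x, H x 1 0 = q x & H x 1 1 = 1 - p x]}.
Proof.
move=> [iH [N1 [mN1 N10 h1]] [N2 [mN2 N20 h2]]].
pose N := N1 `|` N2.
have mN : measurable N by exact: measurableU.
have N0 : mu N = 0%E.
  have : (mu N <= mu N1 + mu N2)%E by apply: measureU2.
  by rewrite N10 N20 adde0 => h; apply/eqP; rewrite eq_le h measure_ge0.
have good (x : R) : 0 <= x -> ~ N x -> psdmx (H x) /\ \tr (H x) = 1.
  move=> x0 nN; split; apply: contrapT => k; apply: nN.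
    by left; apply: h1 => /(_ x0).
  by right; apply: h2 => /(_ x0).
(* On the exceptional null set the coefficients become [p = q = 0]. This satisfies the inequalities
   of [ham], which therefore hold everywhere. *)
pose cut (i j : 'I_2) := patch (fun=> 0) (setC N) (fun x : R => H x i j).
have mcut (i j : 'I_2) (L : R) : measurable_fun `[0, L] (cut i j).
  apply/(measurable_restrict _ _ _).1 => //; first exact: measurableC.
  have /integrableP[/measurable_EFinP m _] := iH i j L.
  by apply: measurable_funS m => //; exact: subIsetl.
have cutE i j x : ~ N x -> cut i j x = H x i j by move=> nx; rewrite /cut patchE mem_set.
have cut0 i j x : N x -> cut i j x = 0 by move=> nx; rewrite /cut patchE memNset.
have bd (x : R) : 0 <= x -> [/\ 0 <= cut 0 0 x, cut 0 0 x <= 1 & cut 0 1 x ^+ 2 <= cut 0 0 x * (1 - cut 0 0 x)].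
  move=> x0; have [Nx|nx] := pselect (N x); first by rewrite !cut0// expr0n/= mul0r lexx ler01.
  by rewrite !cutE//; have [a b] := good x x0 nx; have [_ _] := psd_entries a b.
exists (cut 0 0), (cut 0 1); split; first split=> //.
- move=> L; split; first exact: mcut.
  exists 1 => x /andP[x0 _]; have [b1 b2 _] := bd x x0; by rewrite ger0_norm.
- move=> L; split; first exact: mcut.
  exists 1 => x /andP[x0 _]; have [b1 b2 b3] := bd x x0.
  rewrite -(@ler_pXn2r _ 2)// ?nnegrE// expr1n real_normK ?num_real//; clear -b1 b2 b3; nra.
exists N; split => // x /= h; apply: contrapT => nx; apply: h => x0; rewrite !cutE//.
by have [a b] := good x x0 nx; have [] := psd_entries a b.
Qed.

Lemma rbm_rhs (p q : R -> R) (z : C) (u1 u2 : R -> C) : rbm p -> rbm q -> cbm u1 -> cbm u2 ->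
  cbm (fun x => z * ((p x)%:C * u1 x + (q x)%:C * u2 x)).
Proof.
move=> rp rq c1 c2; apply: cbmM; first exact: cbm_cst.
by apply: cbmD; apply: cbmM => //; exact: cbmR.
Qed.

Lemma cderive_prim (u v : R -> C) : loc_abs_continuous (fun t => complex.Re (u t)) ->
  loc_abs_continuous (fun t => complex.Im (u t)) -> cbm v ->
  {ae mu, forall x : R, 0 < x -> is_derive x (1 : R) (fun t => complex.Re (u t)) (complex.Re (v x)) /\
     is_derive x (1 : R) (fun t => complex.Im (u t)) (complex.Im (v x))} -> prim u v.
Proof.
move=> a1 a2 [v1 v2] d.
have p1 : prim (fun x => (complex.Re (u x))%:C) (fun x => (complex.Re (v x))%:C).
  apply: ac_prim => //; move: d; apply: (@filterS _ _ (ae_filter_ringOfSetsType mu)) => x h x0.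
  by have [] := h x0.
have p2 : prim (fun x => (complex.Im (u x))%:C) (fun x => (complex.Im (v x))%:C).
  apply: ac_prim => //; move: d; apply: (@filterS _ _ (ae_filter_ringOfSetsType mu)) => x h x0.
  by have [] := h x0.
by apply: prim_ext (primD p1 (primZ 'i p2)) => x _; rewrite [RHS]complexE.
Qed.

Lemma solution_sol (H : R -> 'M[R]_2) (p q : R -> R) (z : C) (f : R -> 'cV[C]_2) :
  ham p q -> {ae mu, forall x : R, 0 <= x ->
     [/\ H x 0 0 = p x, H x 0 1 = q x, H x 1 0 = q x & H x 1 1 = 1 - p x]} ->
  is_solution H z f -> sol p q z (fun x => f x 0 0) (fun x => f x 1 0).
Proof.
move=> [rp rq _] hH [ac hf].
have ucbm (k : 'I_2) : cbm (fun x => f x k 0).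
  have [a1 a2] := ac k; have c1 := hcont_cbm (ac_hcont a1); have c2 := hcont_cbm (ac_hcont a2).
  by split; [exact: c1.1|exact: c2.1].
have rp1 : rbm (fun t => 1 - p t) by apply: rbmB => //; exact: rbm_cst.
have key : {ae mu, forall x : R, 0 < x -> exists2 v, is_cvderive f x v &
    v 0 0 = - z * ((q x)%:C * f x 0 0 + (1 - p x)%:C * f x 1 0) /\
    v 1 0 = z * ((p x)%:C * f x 0 0 + (q x)%:C * f x 1 0)}.
  move: hH hf; apply: (@filterS2 _ _ (ae_filter_ringOfSetsType mu)) => x h1 h2 x0.
  have [e1 e2 e3 e4] := h1 (ltW x0); have [v dv Jv] := h2 x0; exists v => //.
  have [j0 j1] := Jmx_mul v.
  have k0 := congr1 (fun B : 'cV[C]_2 => B 0 0) Jv; have k1 := congr1 (fun B : 'cV[C]_2 => B 1 0) Jv.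
  move: k0 k1; rewrite /= j0 j1 !mxE !sum2 !mxE e1 e2 e3 e4 => k0 k1; split.
    by rewrite k1.
  by apply: oppr_inj; rewrite k0; ring.
split.
- have [a1 a2] := ac 0; apply: cderive_prim => //; first exact: rbm_rhs.
  move: key; apply: (@filterS _ _ (ae_filter_ringOfSetsType mu)) => x h x0.
  by have [v dv [<- _]] := h x0; exact: dv.
- have [a1 a2] := ac 1; apply: cderive_prim => //; first exact: rbm_rhs.
  move: key; apply: (@filterS _ _ (ae_filter_ringOfSetsType mu)) => x h x0.
  by have [v dv [_ <-]] := h x0; exact: dv.
Qed.

Lemma cvec_eq0 (v : 'cV[C]_2) : v 0 0 = 0 -> v 1 0 = 0 -> v = 0.
Proof. by move=> h0 h1; apply/colP; apply: ord2P; rewrite mxE. Qed.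

Lemma measurable_halfline (f : R -> R) : rbm f -> measurable_fun `[(0 : R), +oo[ f.
Proof.
move=> hf; rewrite (_ : `[(0 : R), +oo[%classic = \bigcup_n `[0, n%:R]%classic).
  by apply/measurable_fun_bigcup => // n; have [] := hf n%:R.
apply/seteqP; split => [x|x [n _]]; rewrite /= !in_itv/= ?andbT; last by move=> /andP[].
move=> x0; exists (Num.bound x) => //=; rewrite in_itv/= x0 ltW//.
exact: archi_boundP.
Qed.

(** The integrand of [sqnormH] is the energy almost everywhere; as it is nonnegative, the full
    integral bounds those over [[0, x]]. *)
Lemma sqnorm_energy (H : R -> 'M[R]_2) (p q : R -> R) (z : C) (f : R -> 'cV[C]_2) :
  canonical_system H ->
  ham p q -> {ae mu, forall x : R, 0 <= x ->
     [/\ H x 0 0 = p x, H x 0 1 = q x, H x 1 0 = q x & H x 1 1 = 1 - p x]} ->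
  sol p q z (fun x => f x 0 0) (fun x => f x 1 0) -> (sqnormH H f < +oo)%E ->
  exists K : R, forall x, 0 <= x -> \int[mu]_(t in `[0, x])
    energy p q (fun x => f x 0 0) (fun x => f x 1 0) t <= K.
Proof.
move=> [iH _ _] hH aeH hf fin.
pose k := energy p q (fun x => f x 0 0) (fun x => f x 1 0).
have [rp rq hpq] := hH; have c1 := prim_cbm hf.1; have c2 := prim_cbm hf.2.
have rk : rbm k.
  have h : cbm (fun x => (p x)%:C * (f x 0 0 * (f x 0 0)^*) + (2 * q x)%:C * (f x 0 0 * (f x 1 0)^*)
     + (1 - p x)%:C * (f x 1 0 * (f x 1 0)^*)).
    apply: cbmD; first apply: cbmD.
    - by apply: cbmM; [exact: cbmR|apply: cbmM => //; exact: cbmJ].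
    - apply: cbmM; last by apply: cbmM => //; exact: cbmJ.
      by apply: cbmR; apply: rbmM => //; exact: rbm_cst.
    - apply: cbmM; last by apply: cbmM => //; exact: cbmJ.
      by apply: cbmR; apply: rbmB => //; exact: rbm_cst.
  apply: eq_rbm h.1 => x /=; rewrite /k /energy !nc2E.
  by case: (f x 0 0) => a b; case: (f x 1 0) => c d /=; ring.
have k0 x : 0 <= x -> 0 <= k x.
  by move=> x0; have [p0 p1 pq] := hpq x x0; exact: energy_pt_ge0.
pose s x := complex.Re (((map_mx conjc (f x))^T *m toC (H x) *m f x) 0 0).
have sE x : s x = complex.Re (
    ((f x 0 0)^* * (H x 0 0)%:C + (f x 1 0)^* * (H x 1 0)%:C) * f x 0 0 +
    ((f x 0 0)^* * (H x 0 1)%:C + (f x 1 0)^* * (H x 1 1)%:C) * f x 1 0).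
  by rewrite /s !mxE !sum2 !mxE !sum2 !mxE.
have ms : measurable_fun `[(0 : R), +oo[ s.
  rewrite (_ : `[(0 : R), +oo[%classic = \bigcup_n `[0, n%:R]%classic); last first.
    apply/seteqP; split => [x|x [n _]]; rewrite /= !in_itv/= ?andbT; last by move=> /andP[].
    move=> x0; exists (Num.bound x) => //=; rewrite in_itv/= x0 ltW//; exact: archi_boundP.
  apply/measurable_fun_bigcup => // n.
  have mH (i j : 'I_2) : measurable_fun `[(0 : R), n%:R] (fun x => H x i j).
    by have /integrableP[/measurable_EFinP m _] := iH i j n%:R.
  have mf (i : 'I_2) : measurable_fun `[(0 : R), n%:R] (fun x => complex.Re (f x i 0)) /\
     measurable_fun `[(0 : R), n%:R] (fun x => complex.Im (f x i 0)).
    have ci : cbm (fun x => f x i 0) by move: i; apply: ord2P.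
    by have [h _] := ci.1 n%:R; have [h' _] := ci.2 n%:R.
  have [m0r m0i] := mf 0; have [m1r m1i] := mf 1.
  rewrite (_ : s = fun x => H x 0 0 * (complex.Re (f x 0 0) * complex.Re (f x 0 0) + complex.Im (f x 0 0) * complex.Im (f x 0 0))
     + (H x 0 1 + H x 1 0) * (complex.Re (f x 0 0) * complex.Re (f x 1 0) + complex.Im (f x 0 0) * complex.Im (f x 1 0))
     + H x 1 1 * (complex.Re (f x 1 0) * complex.Re (f x 1 0) + complex.Im (f x 1 0) * complex.Im (f x 1 0))).
    apply: measurable_funD; first apply: measurable_funD.
    - by apply: measurable_funM => //; apply: measurable_funD; apply: measurable_funM.
    - by apply: measurable_funM; [exact: measurable_funD|apply: measurable_funD; apply: measurable_funM].
    - by apply: measurable_funM => //; apply: measurable_funD; apply: measurable_funM.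
  apply/funext => x; rewrite sE; case: (f x 0 0) => a b; case: (f x 1 0) => c d /=; ring.
have mk := measurable_halfline rk.
have E : sqnormH H f = (\int[mu]_(x in `[0%R, +oo[) (k x)%:E)%E.
  apply: ae_eq_integral => //; [exact/measurable_EFinP|exact/measurable_EFinP|].
  move: aeH; apply: (@filterS _ _ (ae_filter_ringOfSetsType mu)) => x h /=.
  rewrite in_itv/= andbT => x0; have [e1 e2 e3 e4] := h x0; congr (_%:E).
  rewrite -/(s x) sE e1 e2 e3 e4 /k /energy !nc2E.
  by case: (f x 0 0) => a b; case: (f x 1 0) => c d /=; ring.
have fn : sqnormH H f \is a fin_num.
  rewrite ge0_fin_numE// E; apply: integral_ge0 => x /=; rewrite in_itv/= andbT lee_fin.
  exact: k0.
exists (fine (sqnormH H f)) => x x0.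
have fk : (\int[mu]_(t in `[0%R, x]) (k t)%:E)%E \is a fin_num.
  by apply: integrable_fin_num => //; exact: (rbm_integrable x (lexx 0) rk).
rewrite /Rintegral -lee_fin !fineK// E; apply: ge0_subset_integral => //.
- exact/measurable_EFinP.
- by move=> t /=; rewrite in_itv/= andbT lee_fin => /k0.
- by move=> t /=; rewrite !in_itv/= andbT => /andP[].
Qed.

(** By Lagrange's identity finite total energy bounds the Wronskian below, which is what
    [sol_wronsk_ge0] asks for. *)
Lemma weyl_wronsk (H : R -> 'M[R]_2) (p q : R -> R) (z : C) (f : R -> 'cV[C]_2) :
  canonical_system H ->
  ham p q -> {ae mu, forall x : R, 0 <= x ->
     [/\ H x 0 0 = p x, H x 0 1 = q x, H x 1 0 = q x & H x 1 1 = 1 - p x]} ->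
  is_solution H z f -> 0 < complex.Im z -> (sqnormH H f < +oo)%E ->
  forall x, 0 <= x -> 0 <= wronsk (fun x => f x 0 0) (fun x => f x 1 0) x.
Proof.
move=> cH hH aeH hs z0 fin; have hf := solution_sol hH aeH hs.
have [K hK] := sqnorm_energy cH hH aeH hf fin.
apply: (sol_wronsk_ge0 hH hf z0).
have pw := prim_wronsk hf; set g := wronsk _ _ in pw *; set k := energy p q _ _ in pw hK.
have rk : rbm k.
  have := (cbmM (cbm_cst (- (complex.Im z)^-1)%:C) pw.1).1.
  apply: eq_rbm => t /=; rewrite mul0r subr0; field; exact: lt0r_neq0.
exists (complex.Im z * K - g 0) => x x0.
have := pw.2 x x0; rewrite (@eq_cint _ _ _ _ (fun t => (- complex.Im z)%:C * (k t)%:C)); last first.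
  by move=> t _; rewrite -rmorphM.
rewrite cintZ//; last exact: cbmR.
rewrite cint_real -rmorphM -rmorphD => /complexI ->.
rewrite Re_cint/=; have := hK x x0; set I := Rintegral _ _ _ => h.
have : complex.Im z * I <= complex.Im z * K by rewrite ler_pM2l.
by clear; lra.
Qed.

End Interface.

(** * Coefficients with a constant kernel vector *)

Section Degenerate.
Variable R : realType.
Local Notation C := R[i].
Local Notation mu := (@lebesgue_measure R).

(** Only the line through [(c, d)] matters, so the sign can be changed to get [0 <= d]. The point
    [(-1, 0)] is treated apart, since [acos] would give the excluded angle [pi]. *)
Lemma unit_angle (c d : R) : c ^+ 2 + d ^+ 2 = 1 -> exists2 a : R, 0 <= a < pi &
  cos a ^+ 2 = c ^+ 2 /\ cos a * sin a = c * d.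
Proof.
have main (c' d' : R) : c' ^+ 2 + d' ^+ 2 = 1 -> 0 <= d' -> c' != -1 ->
    exists2 a : R, 0 <= a < pi & cos a = c' /\ sin a = d'.
  move=> cd d0 c1.
  have cb : -1 <= c' <= 1 by apply/andP; split; nra.
  have cb' : -1 < c' <= 1 by rewrite lt_def c1; move: cb => /andP[-> ->].
  exists (acos c'); first by rewrite acos_ge0//= acos_ltpi.
  split; first by rewrite acosK// in_itv.
  by rewrite sin_acos// (_ : 1 - c' ^+ 2 = d' ^+ 2) ?sqrtr_sqr ?ger0_norm//; lra.
move=> cd; have [d0|d0] := leP 0 d.
  have [c1|c1] := eqVneq c (-1).
    exists 0; first by rewrite lexx pi_gt0.
    have dz : d ^+ 2 = 0 by rewrite c1 in cd; lra.
    move/eqP: dz; rewrite sqrf_eq0 => /eqP->; rewrite cos0 sin0 c1 !mulr0; split => //.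
    by rewrite sqrrN.
  by have [a ha [a1 a2]] := main c d cd d0 c1; exists a => //; rewrite a1 a2.
have cd' : (- c) ^+ 2 + (- d) ^+ 2 = 1 by rewrite !sqrrN.
have d0' : 0 <= - d by lra.
have [c1|c1] := eqVneq (- c) (-1).
  have c2 : c = 1 by lra.
  have dz : d ^+ 2 = 0 by rewrite c2 in cd; lra.
  by move/eqP: dz; rewrite sqrf_eq0 => /eqP dz; rewrite dz ltxx in d0.
have [a ha [a1 a2]] := main (- c) (- d) cd' d0' c1; exists a => //.
by rewrite a1 a2 sqrrN mulrNN.
Qed.

Lemma ae_split (P Q : R -> Prop) : {ae mu, forall x : R, 0 < x -> P x} ->
  (forall x, P x -> Q x) -> {ae mu, forall x : R, 0 < x -> Q x}.
Proof.
move=> h PQ; move: h; apply: (@filterS _ _ (ae_filter_ringOfSetsType mu)) => x h x0.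
exact/PQ/h.
Qed.

(** The real or the imaginary part of [(b, g)] is a nonzero real vector [(A, B)] annihilated by [H]
    almost everywhere. With trace one, [H] is then the projection onto the orthogonal direction
    [(B, - A)]. *)
Lemma kernel_projection (p q : R -> R) (b g : C) : ham p q -> (b != 0) || (g != 0) ->
  (forall y, 0 <= y -> cint 0 y (fun t => (q t)%:C * b + (1 - p t)%:C * g) = 0) ->
  (forall y, 0 <= y -> cint 0 y (fun t => (p t)%:C * b + (q t)%:C * g) = 0) ->
  exists2 a : R, 0 <= a < pi &
    {ae mu, forall x : R, 0 < x -> p x = cos a ^+ 2 /\ q x = cos a * sin a}.
Proof.
move=> [rp rq _] bg h1 h2.
have rp1 : rbm (fun t => 1 - p t) by apply: rbmB => //; exact: rbm_cst.
have real (A B : R) (P : C -> R) : P b = A -> P g = B ->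
    (forall (s t : R) (u v : C), P (s%:C * u + t%:C * v) = s * P u + t * P v) ->
    (forall f y, cint 0 y f = 0 -> \int[mu]_(t in `[0, y]) P (f t) = 0) ->
    {ae mu, forall x : R, 0 < x -> q x * A + (1 - p x) * B = 0 /\ p x * A + q x * B = 0}.
  move=> PA PB Plin Pint.
  have k1 : {ae mu, forall x : R, 0 < x -> q x * A + (1 - p x) * B = 0}.
    apply: ae_zero => [|x x0].
      by apply: rbmD; apply: rbmM => //; exact: rbm_cst.
    by rewrite -[RHS](Pint _ _ (h1 x x0)); apply: eq_Rintegral => t _; rewrite Plin PA PB.
  have k2 : {ae mu, forall x : R, 0 < x -> p x * A + q x * B = 0}.
    apply: ae_zero => [|x x0].
      by apply: rbmD; apply: rbmM => //; exact: rbm_cst.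
    by rewrite -[RHS](Pint _ _ (h2 x x0)); apply: eq_Rintegral => t _; rewrite Plin PA PB.
  by move: k1 k2; apply: (@filterS2 _ _ (ae_filter_ringOfSetsType mu)) => x h h' x0; split; auto.
have [A [B [AB hAB]]] : exists A B : R, (0 < A ^+ 2 + B ^+ 2) /\
    {ae mu, forall x : R, 0 < x -> q x * A + (1 - p x) * B = 0 /\ p x * A + q x * B = 0}.
  have RE := real _ _ (@complex.Re R) erefl erefl.
  have IM := real _ _ (@complex.Im R) erefl erefl.
  have pos (s t : R) : (s != 0) || (t != 0) -> 0 < s ^+ 2 + t ^+ 2.
    move=> st; rewrite lt_def addr_ge0 ?sqr_ge0// andbT paddr_eq0 ?sqr_ge0// !sqrf_eq0.
    by rewrite -negb_and in st.
  have [h|h] := boolP ((complex.Re b != 0) || (complex.Re g != 0)).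
    exists (complex.Re b), (complex.Re g); split; first exact: pos.
    apply: RE => [s t u v|f y /(congr1 (@complex.Re R))//].
    by rewrite cReD !cReM/= !mul0r !subr0.
  exists (complex.Im b), (complex.Im g); split.
    apply: pos; move: h; rewrite negb_or !negbK => /andP[/eqP b0 /eqP g0].
    by move: bg; rewrite !eq_complex b0 g0 /= eqxx.
  apply: IM => [s t u v|f y /(congr1 (@complex.Im R))//].
  by rewrite cImD !cImM/= !mul0r !addr0.
pose s := A ^+ 2 + B ^+ 2; pose N := Num.sqrt s.
have N2 : N ^+ 2 = s by rewrite sqr_sqrtr// ltW.
have N0 : N != 0 by rewrite -sqrf_eq0 N2 gt_eqF.
have cd : (B / N) ^+ 2 + (- A / N) ^+ 2 = 1.
  rewrite !expr_div_n N2 sqrrN -mulrDl addrC -/s divff// gt_eqF//.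
have [a ha [a1 a2]] := unit_angle cd; exists a => //.
apply: ae_split hAB _ => x [k1 k2]; rewrite a1 a2 expr_div_n N2.
have sn : s != 0 by rewrite gt_eqF.
have e1 : p x * s = B ^+ 2.
  have : A * (p x * A + q x * B) - B * (q x * A + (1 - p x) * B) = 0 by rewrite k1 k2; ring.
  by rewrite /s; lra.
have e2 : q x * s = - (A * B).
  have : A * (q x * A + (1 - p x) * B) + B * (p x * A + q x * B) = 0 by rewrite k1 k2; ring.
  by rewrite /s; lra.
split; first by rewrite -e1 mulfK.
rewrite (_ : B / N * (- A / N) = - (A * B) / N ^+ 2); last by field.
by rewrite -e2 N2 mulfK.
Qed.

Lemma projection_H (H : R -> 'M[R]_2) (p q : R -> R) (a : R) :
  {ae mu, forall x : R, 0 <= x ->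
     [/\ H x 0 0 = p x, H x 0 1 = q x, H x 1 0 = q x & H x 1 1 = 1 - p x]} ->
  {ae mu, forall x : R, 0 < x -> p x = cos a ^+ 2 /\ q x = cos a * sin a} ->
  {ae mu, forall x : R, 0 <= x -> H x = Pmx a}.
Proof.
move=> h1 h2.
have h3 : {ae mu, forall x : R, x != 0}.
  exists [set 0]; split => //; first exact: lebesgue_measure_set1.
  by move=> x /= /negP; rewrite negbK => /eqP.
have h12 : {ae mu, forall x : R, 0 < x -> H x = Pmx a}.
  move: h1 h2; apply: (@filterS2 _ _ (ae_filter_ringOfSetsType mu)) => x k1 k2 x0.
  have [e1 e2 e3 e4] := k1 (ltW x0); have [pE qE] := k2 x0.
  apply/matrixP => i j; rewrite mxE big_ord1 !mxE; move: i; apply: ord2P; move: j; apply: ord2P => /=.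
  - by rewrite e1 pE expr2.
  - by rewrite e2 qE.
  - by rewrite e3 qE mulrC.
  - by rewrite e4 pE -expr2 sin2cos2.
move: h12 h3; apply: (@filterS2 _ _ (ae_filter_ringOfSetsType mu)) => x k1 k2 x0.
by apply: k1; rewrite lt_def k2.
Qed.

End Degenerate.

(** * The Cayley transform of a sphere-valued map *)

Section Cayley.
Variable R : realType.
Local Notation C := R[i].
Local Notation mu := (@lebesgue_measure R).

Lemma nearC (w : C) (P : C -> Prop) : (\forall v \near w, P v) ->
  exists2 d : R, 0 < d & forall v, nc (v - w) < d -> P v.
Proof.
move=> /nbhs_ballP[_/= /posC_real[d d0 ->] h]; exists d => // v vw.
by apply: h; rewrite /ball/= -normrN opprB ncE ltcR.
Qed.

(** Infinity goes to 1: the closed upper half plane with infinity lands in the closed unit disc, and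
    poles need no special treatment afterwards. *)
Definition cayley (s : sphere R) : C := if s is Some m then (m - 'i) / (m + 'i) else 1.

Lemma cayley_den (m : C) : 0 <= complex.Im m -> m + 'i != 0.
Proof.
move=> h; apply/eqP => /(congr1 (@complex.Im R)); rewrite cImD/=; lra.
Qed.

Lemma cayley_le1 s : closed_upper s -> nc (cayley s) <= 1.
Proof.
case: s => [m|_]; last by rewrite nc1.
rewrite /closed_upper/cayley => h; have mi := cayley_den h.
rewrite ncf ler_pdivrMr ?nc_gt0// mul1r -(@ler_pXn2r _ 2)// ?nnegrE ?nc_ge0// !nc2E.
by case: m h {mi} => a b /=; lra.
Qed.

(** In the chart [f = 1 / M] the transform is [(1 - i f) / (1 + i f)], which includes the value
    infinity. Values in the closed upper half plane make the denominator nonzero in both charts. *)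
Lemma cayley_cdiff (M : C -> sphere R) (w : C) (r : R) : nc w < r ->
  (forall v, nc v < r -> closed_upper (M v)) -> sphere_holomorphic_at M w ->
  cdiff (cayley \o M) w.
Proof.
move=> wr hM [f df hf].
have [d1 d10 h1] := nearC df.
have dfw : cdiff f w by apply/cdiff_derivable/h1; rewrite subrr nc0.
have rw : 0 < r - nc w by rewrite subr_gt0.
case: hf => /nearC[d2 d20 h2].
  apply: (@cdiff_ext _ (fun v => (f v - 'i) / (f v + 'i)) _ _ d2) => // [v /h2 hv|].
    by rewrite /= hv.
  apply: cdiffM; first by apply: cdiffB => //; exact: cdiff_cst.
  apply: (@cdiffV _ (fun v => f v + 'i)); first by apply: cdiffD => //; exact: cdiff_cst.
  have := hM w wr; rewrite h2 ?subrr ?nc0// => h; exact: cayley_den.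
have form v : nc v < r -> sphere_inv (M v) = Some (f v) ->
    cayley (M v) = (1 - 'i * f v) / (1 + 'i * f v) /\ 1 + 'i * f v != 0.
  move=> vr; have := hM v vr; case: (M v) => [m|] /=; last first.
    by move=> _ [<-]; rewrite mulr0 subr0 addr0 divr1 oner_eq0.
  move=> /cayley_den mi; case: eqVneq => // m0 [<-].
  have h : 1 + 'i / m != 0.
    by rewrite (_ : 1 + 'i / m = (m + 'i) / m) ?mulf_neq0 ?invr_eq0//; field.
  split => //.
  have E1 : 1 + 'i / m = (m + 'i) / m by field.
  have E2 : 1 - 'i / m = (m - 'i) / m by field.
  by rewrite /cayley E1 E2 invf_div mulrA divfK.
apply: (@cdiff_ext _ (fun v => (1 - 'i * f v) / (1 + 'i * f v)) _ _ (Num.min d2 (r - nc w))) => [|v|].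
- by rewrite lt_min d20.
- rewrite lt_min => /andP[/h2 hv vw].
  have vr : nc v < r by have := nc_subl v w; clear -vw; lra.
  by have [k _] := form v vr hv; rewrite /= k.
- have ww : nc (w - w) < d2 by rewrite subrr nc0.
  have [_ k] := form w wr (h2 w ww).
  apply: cdiffM; first by apply: cdiffB; [exact: cdiff_cst|apply: cdiffM => //; exact: cdiff_cst].
  apply: (@cdiffV _ (fun v => 1 + 'i * f v)) => //.
  by apply: cdiffD; [exact: cdiff_cst|apply: cdiffM => //; exact: cdiff_cst].
Qed.

End Cayley.

(** * Evolution of the Cayley transform along the half line *)

Section Flow.
Variable R : realType.
Local Notation C := R[i].
Local Notation mu := (@lebesgue_measure R).
Variables (p q : R -> R).
Hypothesis hH : ham p q.

Lemma sol_det z u1 u2 v1 v2 : sol p q z u1 u2 -> sol p q z v1 v2 ->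
  forall x, 0 <= x -> u1 x * v2 x - u2 x * v1 x = u1 0 * v2 0 - u2 0 * v1 0.
Proof.
move=> [h1 h2] [k1 k2] x x0; have := primB (primM h1 k2) (primM h2 k1).
move=> hp; have {hp}hp : prim (fun x => u1 x * v2 x - u2 x * v1 x) (fun=> 0).
  by apply: prim_ext hp => // y _; ring.
by rewrite hp.2// cint_cst// mul0r addr0.
Qed.

(* The solution at z = -1/w whose initial value has Cayley transform f. *)
Definition zw (w : C) := - 1 / w.
Definition U1 (f : C -> C) (x : R) (w : C) := (f w + 1) * transfer1 p q 1 0 (zw w) x +
  'i * (f w - 1) * transfer1 p q 0 1 (zw w) x.
Definition U2 (f : C -> C) (x : R) (w : C) := (f w + 1) * transfer2 p q 1 0 (zw w) x +
  'i * (f w - 1) * transfer2 p q 0 1 (zw w) x.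

Lemma U_sol f w : sol p q (zw w) (fun x => U1 f x w) (fun x => U2 f x w).
Proof. exact: sol_lin (transfer_sol 1 0 hH _) (transfer_sol 0 1 hH _). Qed.

Lemma U_0 f w : U1 f 0 w = f w + 1 /\ U2 f 0 w = 'i * (f w - 1).
Proof.
rewrite /U1 /U2; have [-> ->] := transfer_0 p q 1 0 (zw w).
by have [-> ->] := transfer_0 p q 0 1 (zw w); rewrite !mulr1 !mulr0 addr0 add0r.
Qed.

(** The transfer matrix has determinant 1, so a common zero would force [f w + 1 = 0] and
    [f w - 1 = 0]. *)
Lemma U_neq0 f w x : 0 <= x -> (U1 f x w != 0) || (U2 f x w != 0).
Proof.
move=> x0; rewrite -negb_and; apply/negP => /andP[/eqP E1 /eqP E2].
have hs := transfer_sol 1 0 hH (zw w); have ht := transfer_sol 0 1 hH (zw w).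
have := sol_det hs ht x0; have [-> ->] := transfer_0 p q 1 0 (zw w).
have [-> ->] := transfer_0 p q 0 1 (zw w); rewrite !mulr1 mul0r subr0.
move: E1 E2; rewrite /U1 /U2.
move: (transfer1 _ _ 1 _ _ _) (transfer1 _ _ 0 _ _ _) (transfer2 _ _ 1 _ _ _) (transfer2 _ _ 0 _ _ _).
move=> s1 t1 s2 t2 E1 E2 det.
have a0 : (f w + 1) = 0.
  rewrite -[LHS]mulr1 -[X in _ * X]det.
  by rewrite (_ : _ * (s1 * t2 - s2 * t1) = ((f w + 1) * s1 + 'i * (f w - 1) * t1) * t2 -
    ((f w + 1) * s2 + 'i * (f w - 1) * t2) * t1) ; [rewrite E1 E2 !mul0r subrr|ring].
have b0 : 'i * (f w - 1) = 0.
  rewrite -[LHS]mulr1 -[X in _ * X]det.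
  by rewrite (_ : _ * (s1 * t2 - s2 * t1) = ((f w + 1) * s2 + 'i * (f w - 1) * t2) * s1 -
    ((f w + 1) * s1 + 'i * (f w - 1) * t1) * s2) ; [rewrite E1 E2 !mul0r subrr|ring].
move/eqP: b0; rewrite mulf_eq0 -nc_eq0 nci oner_eq0/= => /eqP b0.
have : (f w + 1) - (f w - 1) = 0 by rewrite a0 b0 subrr.
rewrite (_ : _ - _ = (2 : R)%:C); last by rewrite rmorph_nat; ring.
by move/eqP; rewrite -nc_eq0 ncR normr_nat pnatr_eq0.
Qed.

Lemma zw_cdiff w : w != 0 -> cdiff zw w.
Proof. by move=> w0; apply: cdiffM; [exact: cdiff_cst|apply: (@cdiffV _ id) => //; exact: cdiff_id]. Qed.

Lemma cdiff_comp (f g : C -> C) w : cdiff g w -> cdiff f (g w) -> cdiff (f \o g) w.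
Proof.
move=> hg hf; have [d hd] := hg; have [d' hd'] := hf; exists (d' * d) => e e0.
pose K := nc d + 1 + nc d' + 1.
have K0 : 0 < K by have := nc_ge0 d; have := nc_ge0 d'; rewrite /K; lra.
have d1 : 0 < nc d + 1 by have := nc_ge0 d; lra.
pose e1 := e / 2 / (nc d + 1); have e10 : 0 < e1 by rewrite !divr_gt0.
pose e2 := Num.min 1 (e / 2 / (nc d' + 1)).
have d'1 : 0 < nc d' + 1 by have := nc_ge0 d'; lra.
have e20 : 0 < e2 by rewrite lt_min ltr01 !divr_gt0.
have [s s0 hs] := hd' _ e10; have [t t0 ht] := hd _ e20.
have [m m0 hm] := cdiff_cont hg s0.
exists (Num.min t m); first by rewrite lt_min t0.
move=> v; rewrite lt_min => /andP[/ht h1 /hm /hs h2].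
have n0 := nc_ge0 (v - w).
have gl : nc (g v - g w) <= (nc d + 1) * nc (v - w).
  have := ncD (g v - g w - d * (v - w)) (d * (v - w)); rewrite subrK ncM.
  have : e2 * nc (v - w) <= 1 * nc (v - w) by rewrite ler_wpM2r// /e2 ge_min lexx.
  by move=> h3 h4; rewrite mulrDl; lra.
rewrite /= (_ : _ - _ - _ = (f (g v) - f (g w) - d' * (g v - g w)) + d' * (g v - g w - d * (v - w))); last by ring.
rewrite (le_trans (ncD _ _))// ncM (_ : e = e / 2 + e / 2) ?mulrDl; last by lra.
apply: lerD.
  apply: le_trans h2 _; apply: le_trans (ler_wpM2l (ltW e10) gl) _.
  by rewrite mulrA /e1 divfK// gt_eqF.
apply: (@le_trans _ _ ((nc d' + 1) * (e / 2 / (nc d' + 1) * nc (v - w)))); last first.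
  by rewrite mulrA mulrCA divff ?gt_eqF// mulr1.
apply: ler_pM; rewrite ?nc_ge0 ?lerDl//; apply: le_trans h1 _.
by rewrite ler_wpM2r// /e2 ge_min lexx orbT.
Qed.

Lemma U_cdiff f x w : 0 <= x -> w != 0 -> cdiff f w -> cdiff (U1 f x) w /\ cdiff (U2 f x) w.
Proof.
move=> x0 w0 hf; have hz := zw_cdiff w0.
have [a1 a2] := transfer_cdiff 1 0 hH (zw w) x0; have [b1 b2] := transfer_cdiff 0 1 hH (zw w) x0.
have fp : cdiff (fun v => f v + 1) w by apply: cdiffD => //; exact: cdiff_cst.
have fm : cdiff (fun v => 'i * (f v - 1)) w.
  by apply: cdiffM; [exact: cdiff_cst|apply: cdiffB => //; exact: cdiff_cst].
split; apply: cdiffD.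
- by apply: cdiffM => //; exact: (cdiff_comp hz a1).
- by apply: cdiffM => //; exact: (cdiff_comp hz b1).
- by apply: cdiffM => //; exact: (cdiff_comp hz a2).
- by apply: cdiffM => //; exact: (cdiff_comp hz b2).
Qed.

(** Hence a nonnegative Wronskian means that [(u1 - i u2) / (u1 + i u2)] lies in the closed unit
    disc. *)
Lemma wronsk_cayley (u1 u2 : C) : 4 * complex.Im (u1 * u2^*) = nc (u1 + 'i * u2) ^+ 2 - nc (u1 - 'i * u2) ^+ 2.
Proof. by rewrite !nc2E; case: u1 => a b; case: u2 => c d /=; ring. Qed.

Lemma Im_zw w : w != 0 -> complex.Im (zw w) = complex.Im w / nc w ^+ 2.
Proof.
move=> w0; rewrite /zw nc2E; case: w w0 => a b w0 /=; ring.
Qed.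

Lemma wronsk_mono z u1 u2 (a b : R) : sol p q z u1 u2 -> complex.Im z <= 0 -> 0 <= a -> a <= b ->
  wronsk u1 u2 a <= wronsk u1 u2 b.
Proof.
move=> hu z0 a0 ab; have := primN (prim_wronsk hu) => /prim_le/(_ a0 ab) h.
rewrite -lerN2; apply: h => x /andP[ax _] /=.
have x0 := le_trans a0 ax; have [_ _ /(_ x x0)[p0 p1 pq]] := hH.
by rewrite mulNr opprK mulr_le0_ge0//; exact: energy_pt_ge0.
Qed.

Lemma wronsk_anti z u1 u2 (a b : R) : sol p q z u1 u2 -> 0 <= complex.Im z -> 0 <= a -> a <= b ->
  wronsk u1 u2 b <= wronsk u1 u2 a.
Proof.
move=> hu z0 a0 ab; have := prim_le (prim_wronsk hu) a0 ab; apply => x /andP[ax _] /=.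
have x0 := le_trans a0 ax; have [_ _ /(_ x x0)[p0 p1 pq]] := hH.
by rewrite mulNr oppr_le0 mulr_ge0//; exact: energy_pt_ge0.
Qed.

(** The factor [k] depends on the spectral parameter. It is divided out so that integrals obtained
    from two parameters on adjacent intervals can be added. *)
Lemma sol_const_cint z k u1 u2 (a b : R) B G : sol p q z u1 u2 -> z != 0 -> k != 0 -> 0 <= a -> a <= b ->
  (forall y, a <= y <= b -> u1 y = k * B /\ u2 y = k * G) ->
  cint a b (fun t => (q t)%:C * B + (1 - p t)%:C * G) = 0 /\
  cint a b (fun t => (p t)%:C * B + (q t)%:C * G) = 0.
Proof.
move=> [h1 h2] z0 k0 a0 ab hc; have [rp rq _] := hH.
have rp1 : rbm (fun t => 1 - p t) by apply: rbmB => //; exact: rbm_cst.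
have cb s t : rbm s -> rbm t -> cbm (fun y => (s y)%:C * B + (t y)%:C * G).
  by move=> hs ht; apply: cbmD; apply: cbmM; rewrite ?cbmR//; (exact: cbmR || exact: cbm_cst).
have go (s t : R -> R) c : c != 0 -> rbm s -> rbm t ->
    cint a b (fun y => c * ((s y)%:C * u1 y + (t y)%:C * u2 y)) = 0 ->
    cint a b (fun y => (s y)%:C * B + (t y)%:C * G) = 0.
  move=> c0 hs ht; rewrite (@eq_cint _ _ _ _ (fun y => c * k * ((s y)%:C * B + (t y)%:C * G))); last first.
    by move=> y /hc[-> ->]; ring.
  by rewrite cintZ//; [move/eqP; rewrite !mulf_eq0 (negPf c0) (negPf k0)/= => /eqP|exact: cb].
have [[a1 a2] [b1 b2]] : (u1 a = k * B /\ u2 a = k * G) /\ (u1 b = k * B /\ u2 b = k * G).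
  by split; apply: hc; rewrite ab lexx.
split; [apply: (go _ _ (- z))|apply: (go _ _ z)] => //; rewrite ?oppr_eq0//.
- by rewrite -(primE h1 a0 ab) a1 b1 subrr.
- by rewrite -(primE h2 a0 ab) a2 b2 subrr.
Qed.

Definition Phi (f : C -> C) (x : R) (w : C) := (U1 f x w - 'i * U2 f x w) / (U1 f x w + 'i * U2 f x w).

Section Positive.
Variables (f : C -> C) (r : R).
Hypothesis r0 : 0 < r.
Hypothesis fd : forall w, nc w < r -> cdiff f w.
Hypothesis Uge0 : forall w x, 0 < nc w -> nc w < r -> 0 <= x ->
  0 <= wronsk (fun x => U1 f x w) (fun x => U2 f x w) x.

(** If the denominator vanished, the nonnegative Wronskian would make the numerator vanish too,
    against [U_neq0]. *)
Lemma Phi_den w x : 0 < nc w -> nc w < r -> 0 <= x -> U1 f x w + 'i * U2 f x w != 0.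
Proof.
move=> w0 wr x0; apply/eqP => h; have := wronsk_cayley (U1 f x w) (U2 f x w).
rewrite h nc0 expr0n sub0r => k.
have g0 := Uge0 w0 wr x0; rewrite /wronsk in g0.
have : nc (U1 f x w - 'i * U2 f x w) ^+ 2 <= 0 by lra.
rewrite le_eqVlt ltNge sqr_ge0 orbF sqrf_eq0 nc_eq0 => /eqP k2.
have u1 : U1 f x w = 0.
  apply: (@mulfI _ 2); first by rewrite pnatr_eq0.
  by rewrite mulr0 -[RHS](addr0 0) -{1}h -k2; ring.
have u2 : U2 f x w = 0.
  by move/eqP: h; rewrite u1 add0r mulf_eq0 -nc_eq0 nci oner_eq0/= => /eqP.
by have := U_neq0 f w x0; rewrite u1 u2 eqxx.
Qed.

Lemma Phi_bound x : 0 <= x -> pbounded r 1 (Phi f x).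
Proof.
move=> x0 w w0 wr; have den := Phi_den w0 wr x0.
rewrite /Phi ncf ler_pdivrMr ?nc_gt0// mul1r -(@ler_pXn2r _ 2)// ?nnegrE ?nc_ge0//.
by have := wronsk_cayley (U1 f x w) (U2 f x w); have := Uge0 w0 wr x0; rewrite /wronsk; lra.
Qed.

Lemma Phi_pholo x : 0 <= x -> pholo r (Phi f x).
Proof.
move=> x0 w w0 wr; have wn : w != 0 by rewrite -nc_gt0.
have [h1 h2] := U_cdiff x0 wn (fd wr); have den := Phi_den w0 wr x0.
have h3 : cdiff (fun w => 'i * U2 f x w) w by apply: cdiffM => //; exact: cdiff_cst.
apply: cdiffM; first exact: cdiffB.
by apply: (@cdiffV _ (fun w => U1 f x w + 'i * U2 f x w)) => //; exact: cdiffD.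
Qed.

(** The value at [w = 0] of the extension of [Phi f x], expressed as a circular mean. *)
Definition center (x : R) := circ (Phi f x) (r / 2) / (pi *+ 2)%:C.

Lemma degenerate x : 0 <= x -> nc (center x) = 1 -> exists2 a : R, 0 <= a < pi &
    {ae mu, forall x : R, 0 < x -> p x = cos a ^+ 2 /\ q x = cos a * sin a}.
Proof.
move=> x0 hc; set b := center x in hc.
have r2 : 0 < r / 2 by rewrite divr_gt0.
have rr : r / 2 < r by lra.
have PhiE w : 0 < nc w -> nc w < r / 2 -> Phi f x w = b.
  exact: unimodular_center (Phi_pholo x0) (Phi_bound x0) r2 rr hc w.
have key w : 0 < nc w -> nc w < r / 2 -> exists2 k : C, k != 0 &
    [/\ U1 f x w = k * (b + 1), U2 f x w = k * ('i * (b - 1)) &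
        wronsk (fun x => U1 f x w) (fun x => U2 f x w) x = 0].
  move=> w0 wr; have wr' := lt_trans wr rr; have den := Phi_den w0 wr' x0.
  exists ((U1 f x w + 'i * U2 f x w) / 2); first by rewrite mulf_neq0// invr_eq0 pnatr_eq0.
  have := PhiE w w0 wr; rewrite /Phi => bE; rewrite -bE; split.
  - by field.
  - have ii : 'i * 'i = -1 :> C by rewrite -expr2 sqr_i.
    rewrite (_ : _ * ('i * _) = - ('i * 'i) * U2 f x w); first by rewrite ii opprK mul1r.
    by field.
  - have := wronsk_cayley (U1 f x w) (U2 f x w); rewrite /wronsk.
    have -> : U1 f x w - 'i * U2 f x w = b * (U1 f x w + 'i * U2 f x w) by rewrite -bE divfK.
    by rewrite ncM hc mul1r subrr => /eqP; rewrite mulf_eq0 pnatr_eq0/= => /eqP.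
pose h := r / 4.
have h0 : 0 < h by rewrite divr_gt0.
(* [zw wp = i / h] and [zw wm = - i / h], one parameter in each half plane. At both the solution at
   [x] is a multiple of [(b + 1, i (b - 1))], so the kernel vector found on [[x, oo)] is the same as
   the one on [[0, x]]. *)
pose wp := h%:C * 'i; pose wm := (- h)%:C * 'i.
have nwp : nc wp = h by rewrite ncM nci ncR mulr1 gtr0_norm.
have nwm : nc wm = h by rewrite ncM nci ncR mulr1 normrN gtr0_norm.
have hr : h < r / 2 by rewrite /h; lra.
have hrr := lt_trans hr rr.
have [wp0 wm0] : wp != 0 /\ wm != 0 by rewrite -!nc_gt0 nwp nwm.
have [kp kp0 [p1 p2 p3]] := key wp ltac:(by rewrite nwp) ltac:(by rewrite nwp).
have [km km0 [m1 m2 m3]] := key wm ltac:(by rewrite nwm) ltac:(by rewrite nwm).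
have zp : 0 < complex.Im (zw wp) by rewrite Im_zw// nwp cImM/= mulr1 mul0r addr0 divr_gt0 ?exprn_gt0.
have zm : complex.Im (zw wm) < 0.
  by rewrite Im_zw// nwm cImM/= mulr1 mul0r addr0 mulNr oppr_lt0 divr_gt0 ?exprn_gt0.
have sp := U_sol f wp; have sm := U_sol f wm.
have np := transfer_0.
have cp y : x <= y -> U1 f y wp = kp * (b + 1) /\ U2 f y wp = kp * ('i * (b - 1)).
  move=> xy; rewrite -p1 -p2; apply: (sol_const hH sp _ x0 xy); last by rewrite xy lexx.
    by rewrite gt_eqF.
  rewrite p3; apply/eqP; rewrite eq_le Uge0 ?nwp ?(le_trans x0 xy)//=.
  by rewrite -p3; apply: wronsk_anti sp (ltW zp) x0 xy.
have cm y : 0 <= y -> y <= x -> U1 f y wm = km * (b + 1) /\ U2 f y wm = km * ('i * (b - 1)).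
  move=> y0 yx.
  have w00 : wronsk (fun x => U1 f x wm) (fun x => U2 f x wm) 0 = wronsk (fun x => U1 f x wm) (fun x => U2 f x wm) x.
    rewrite m3; apply/eqP; rewrite eq_le Uge0 ?nwm ?lexx//= andbT.
    by rewrite -[leRHS]m3; exact: wronsk_mono sm (ltW zm) (lexx _) x0.
  have zm' : complex.Im (zw wm) != 0 by rewrite lt_eqF.
  have H1 := sol_const hH sm zm' (lexx 0) x0 w00.
  have [|-> ->] := H1 y; first by rewrite y0.
  by rewrite -m1 -m2; have [|-> ->] := H1 x; first by rewrite x0 lexx.
pose g := 'i * (b - 1).
have bg : (b + 1 != 0) || (g != 0).
  rewrite -negb_and; apply/negP => /andP[/eqP e1 /eqP e2].
  by have := U_neq0 f wp x0; rewrite p1 p2 e1 -/g e2 mulr0 eqxx.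
have zpn : zw wp != 0 by apply/eqP => E; rewrite E/= ltxx in zp.
have zmn : zw wm != 0 by apply/eqP => E; rewrite E/= ltxx in zm.
have low y : 0 <= y -> y <= x -> cint 0 y (fun t => (q t)%:C * (b + 1) + (1 - p t)%:C * g) = 0 /\
    cint 0 y (fun t => (p t)%:C * (b + 1) + (q t)%:C * g) = 0.
  move=> y0 yx; apply: (sol_const_cint sm zmn km0 (lexx 0) y0) => t /andP[t0 ty].
  by apply: cm => //; exact: le_trans ty yx.
have high y : x <= y -> cint x y (fun t => (q t)%:C * (b + 1) + (1 - p t)%:C * g) = 0 /\
    cint x y (fun t => (p t)%:C * (b + 1) + (q t)%:C * g) = 0.
  by move=> xy; apply: (sol_const_cint sp zpn kp0 x0 xy) => t /andP[t0 ty]; exact: cp.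
have [rp rq _] := hH.
have rp1 : rbm (fun t => 1 - p t) by apply: rbmB => //; exact: rbm_cst.
have cb s t : rbm s -> rbm t -> cbm (fun y => (s y)%:C * (b + 1) + (t y)%:C * g).
  by move=> hs ht; apply: cbmD; apply: cbmM; (exact: cbmR || exact: cbm_cst).
have [l1 l2] := low x x0 (lexx x).
apply: (kernel_projection hH bg) => y y0; have [yx|/ltW xy] := leP y x.
- by have [-> _] := low y y0 yx.
- by rewrite (cint_itvD (lexx 0) x0 xy) ?l1 ?(high y xy).1 ?addr0//; exact: cb.
- by have [_ ->] := low y y0 yx.
- by rewrite (cint_itvD (lexx 0) x0 xy) ?l2 ?(high y xy).2 ?addr0//; exact: cb.
Qed.

End Positive.
End Flow.

(** * Nonnegative Wronskian on the whole punctured disc *)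

Section WeylDisc.
Variable R : realType.
Local Notation C := R[i].
Local Notation mu := (@lebesgue_measure R).
Variables (p q : R -> R).
Hypothesis hH : ham p q.

Lemma wronskZ (k : C) (u1 u2 v1 v2 : R -> C) x : v1 x = k * u1 x -> v2 x = k * u2 x ->
  wronsk v1 v2 x = nc k ^+ 2 * wronsk u1 u2 x.
Proof.
move=> h1 h2; rewrite /wronsk h1 h2 nc2E.
by case: k {h1 h2} => a b; case: (u1 x) => c d; case: (u2 x) => c' d' /=; ring.
Qed.

Lemma i_neq0 : 'i != 0 :> C.
Proof. by rewrite -nc_eq0 nci oner_eq0. Qed.

Lemma ii : 'i * 'i = -1 :> C.
Proof. by rewrite -expr2 sqr_i. Qed.

(** This makes the initial value [(f + 1, i (f - 1))] of [U1], [U2] a multiple of that of the Weyl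
    solution; for [g2 = 0] the sphere value is infinity and the transform is 1. *)
Lemma cayley_solution (s : sphere R) (g1 g2 : C) : closed_upper s ->
  (g1 != 0) || (g2 != 0) -> s = (if g2 == 0 then None else Some (g1 / g2)) ->
  exists k, cayley s + 1 = k * g1 /\ 'i * (cayley s - 1) = k * g2.
Proof.
case: (eqVneq g2 0) => [->|g20] cu; rewrite ?orbF.
  move=> g10 ->; exists (2 / g1); rewrite /= subrr !mulr0.
  by rewrite divfK.
move=> _ sE; rewrite sE in cu *; have mi := cayley_den cu.
exists (2 / ((g1 / g2 + 'i) * g2)); rewrite /cayley; move: mi; set m := g1 / g2 => mi.
have -> : g1 = m * g2 by rewrite /m divfK.
split; first by field; rewrite mi g20.
rewrite (_ : 'i * _ = - ('i * 'i) * 2 / (m + 'i)); last by field.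
by rewrite ii; field; rewrite mi g20.
Qed.

Lemma weyl_disc (H : R -> 'M[R]_2) (r : R) (M : C -> sphere R) :
  canonical_system H ->
  {ae mu, forall x : R, 0 <= x ->
     [/\ H x 0 0 = p x, H x 0 1 = q x, H x 1 0 = q x & H x 1 1 = 1 - p x]} ->
  0 < r -> (forall w : C, `|w| < r%:C -> closed_upper (M w)) ->
  (forall z : C, 0 < complex.Im z -> (1 / r)%:C < `|z| -> is_mplus H z (M (- 1 / z))) ->
  forall (w : C) (x : R), 0 < nc w -> nc w < r -> 0 <= (x : R) ->
  0 <= wronsk (fun x : R => U1 p q (@cayley R \o M) x w) (fun x : R => U2 p q (@cayley R \o M) x w) x.
Proof.
move=> cH aeH r0 hM hm w x w0 wr x0; set f := @cayley R \o M.
have wn : w != 0 by rewrite -nc_gt0.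
have uw : closed_upper (M w) by apply: hM; rewrite ncE ltcR.
have hU := U_sol hH f w; have [u10 u20] := U_0 p q f w.
have [Iw|Iw] := ltP 0 (complex.Im w); last first.
  apply: (@le_trans _ _ (wronsk (fun x => U1 p q f x w) (fun x => U2 p q f x w) 0)); last first.
    apply: (wronsk_mono hH hU _ (lexx 0) x0).
    by rewrite Im_zw// mulr_le0_ge0// invr_ge0 exprn_ge0// nc_ge0.
  (* At [x = 0] four times the Wronskian is [4 - 4 |f w|^2]. *)
  have := wronsk_cayley (f w + 1) ('i * (f w - 1)).
  rewrite mulrA ii mulN1r opprK -u10 -u20 u10 -/(wronsk _ _ 0) => h.
  have e1 : f w + 1 + - (f w - 1) = (2 : R)%:C by rewrite rmorph_nat; ring.
  have e2 : f w + 1 + (f w - 1) = (2 : R)%:C * f w by rewrite rmorph_nat; ring.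
  have c1 : nc (f w) <= 1 by exact: cayley_le1.
  have c2 : nc (f w) ^+ 2 <= 1 by rewrite expr_le1// nc_ge0.
  move: h; rewrite e1 e2 ncM ncR exprMn !normr_nat /wronsk u10 u20 => h.
  by clear -h c2; lra.
have zI : 0 < complex.Im (zw w) by rewrite Im_zw// divr_gt0// exprn_gt0.
have zr : (1 / r)%:C < `|zw w|.
  by rewrite ncE ltcR /zw ncf ncN nc1 ltr_pdivrMr// mulrAC ltr_pdivlMr// !mul1r.
(* In the upper half plane, uniqueness makes [U1], [U2] a multiple of the square integrable solution
   [g]. *)
have [g [gs [y y0 gy] gi]] := hm _ zI zr.
have -> : - 1 / zw w = w by rewrite /zw !mulN1r invrN opprK invrK.
have hg := solution_sol hH aeH gs.
have g0 : (g 0 0 0 != 0) || (g 0 1 0 != 0).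
  rewrite -negb_and; apply/negP => /andP[/eqP g1 /eqP g2].
  have [h1 h2] := sol_zero hH hg (lexx 0) g1 g2 y0.
  by rewrite (cvec_eq0 h1 h2) eqxx in gy.
move=> Mw; have [k [k1 k2]] := cayley_solution uw g0 Mw.
have hkg := sol_lin k 0 hg hg.
have [||v1 v2] := sol_uniq hH hU hkg _ _ x0.
- by rewrite u10 /f /= k1 mul0r addr0.
- by rewrite u20 /f /= k2 mul0r addr0.
rewrite !mul0r !addr0 in v1 v2.
rewrite (@wronskZ k (fun t => g t 0 0) (fun t => g t 1 0) (fun t => U1 p q f t w)
  (fun t => U2 p q f t w) x v1 v2) mulr_ge0 ?exprn_ge0 ?nc_ge0//.
exact: (weyl_wronsk cH hH aeH gs zI gi x0).
Qed.

End WeylDisc.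

(** * Schwarz-Pick estimates *)

Section Nondegenerate.
Variable R : realType.
Local Notation C := R[i].
Local Notation mu := (@lebesgue_measure R).

Lemma hcont_lim (F : R -> C) : (forall L e : R, 0 < e -> exists2 g, hcont g &
    forall x, 0 <= x <= L -> nc (g x - F x) <= e) -> hcont F.
Proof.
move=> h x x0 e e0; have e4 : 0 < e / 4 by lra.
have [g hg hgF] := h (x + 1) _ e4; have [d d0 hd] := hg x x0 _ e4.
exists (Num.min d 1); first by rewrite lt_min d0/=.
move=> y y0; rewrite lt_min => /andP[yd y1].
have h1 := hd y y0 yd; have h2 := hgF x; have h3 := hgF y.
have {}h2 : nc (g x - F x) <= e / 4 by apply: h2; apply/andP; split => //; lra.
have {}h3 : nc (g y - F y) <= e / 4.
  by apply: h3; apply/andP; split => //; move: y1; rewrite ltr_norml; lra.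
rewrite (_ : F y - F x = (g y - g x) + (- (g y - F y) + (g x - F x))); last by ring.
apply: le_lt_trans (ncD _ _) _; have := ncD (- (g y - F y)) (g x - F x); rewrite ncN.
by clear -h1 h2 h3 e0; lra.
Qed.

(** The squared moduli of denominator and numerator differ by [(1 - |u|^2) (1 - |b|^2)]. *)
Lemma schwarz_pick (u b : C) : nc u <= 1 -> nc b < 1 ->
  1 - conjc b * u != 0 /\ nc ((u - b) / (1 - conjc b * u)) <= 1.
Proof.
move=> u1 b1.
have h1 : nc (conjc b * u) < 1.
  by rewrite ncM ncJ; apply: le_lt_trans b1; rewrite -[leRHS]mulr1 ler_wpM2l// nc_ge0.
have h2 : 0 < nc (1 - conjc b * u) by have := nc_subl 1 (1 - conjc b * u); rewrite nc1 subKr; lra.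
split; first by rewrite -nc_gt0.
rewrite ncf ler_pdivrMr// mul1r -(@ler_pXn2r _ 2)// ?nnegrE ?nc_ge0//.
have : 0 <= (1 - nc u ^+ 2) * (1 - nc b ^+ 2).
  by rewrite mulr_ge0// subr_ge0 expr_le1// ?nc_ge0// ltW.
rewrite !nc2E; case: u {u1 h1 h2} => a c; case: b {b1} => a' c' /=; lra.
Qed.

(** Measured in units of the imaginary part of the centre, the deviation is
    [E = 2 i k psi / (1 - k psi)] with [k = (1 - conj b) / (1 - b)] of modulus one, so its bound
    does not depend on [b]. For [|psi| <= 1 / 3] the denominator is at least [2 / 3], whence the
    constants 3 and 1. *)
Lemma mobius_expand (b u psi : C) : 1 - b != 0 -> 1 - conjc b * u != 0 -> nc b < 1 ->
  psi = (u - b) / (1 - conjc b * u) -> nc psi <= 1 / 3 ->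
  1 - u != 0 /\ exists2 E, nc E <= 3 * nc psi /\ nc E <= 1 &
   'i * (1 + u) / (1 - u) = 'i * (1 + b) / (1 - b) +
     (complex.Im ('i * (1 + b) / (1 - b)))%:C * E.
Proof.
move=> b1 den bl psiE hp.
have [k [nk kE]] : exists k, nc k = 1 /\ k * (1 - b) = 1 - conjc b.
  exists ((1 - conjc b) / (1 - b)); split; last by rewrite divfK.
  have -> : 1 - conjc b = conjc (1 - b) by rewrite rmorphB rmorph1.
  by rewrite ncf ncJ divff// nc_eq0.
have d0 : 1 - k * psi != 0.
  rewrite -nc_gt0; have := nc_subl 1 (1 - k * psi).
  by rewrite nc1 subKr ncM nk mul1r; lra.
have d3 : 2 / 3 <= nc (1 - k * psi).
  by have := nc_subl 1 (1 - k * psi); rewrite nc1 subKr ncM nk mul1r; lra.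
have uE : psi * (1 - conjc b * u) = u - b by rewrite psiE divfK.
have dd : (1 + conjc b * psi) != 0.
  have hb : nc (conjc b * psi) <= 1 / 3.
    rewrite ncM ncJ; apply: le_trans hp; rewrite -[leRHS]mul1r ler_wpM2r ?nc_ge0//; exact: ltW.
  rewrite -nc_gt0; have := nc_subl 1 (1 + conjc b * psi).
  by rewrite nc1 opprD addNKr ncN; lra.
have uE2 : u = (psi + b) / (1 + conjc b * psi).
  apply: (mulIf dd); rewrite divfK//; apply/eqP; rewrite -subr_eq0.
  by rewrite (_ : u * (1 + conjc b * psi) - (psi + b) = (u - b) - psi * (1 - conjc b * u)) ; [rewrite uE subrr|ring].
have k0 : k != 0 by rewrite -nc_eq0 nk oner_eq0.
have cE : conjc b = 1 - k * (1 - b) by rewrite kE subKr.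
split.
  rewrite (_ : 1 - u = (1 - b) * (1 - k * psi) / (1 + conjc b * psi)) ?mulf_neq0 ?invr_eq0//.
  rewrite uE2; apply: (mulIf dd); rewrite mulrBl !divfK// mul1r cE; ring.
exists (2 * 'i * k * psi / (1 - k * psi)).
  have : nc (2 * 'i * k * psi / (1 - k * psi)) <= 3 * nc psi.
    have n2 : nc (2 : C) = 2 by rewrite -[2]/((2%:R : C)) -(rmorph_nat (@real_complex R)) ncR normr_nat.
    rewrite ncf !ncM n2 nci nk !mulr1 ler_pdivrMr ?nc_gt0//.
    have := nc_ge0 psi; move: d3 => /[swap] n0 d3.
    have : 0 <= nc psi * (nc (1 - k * psi) - 2 / 3) by rewrite mulr_ge0// subr_ge0.
    by clear; move: (nc _) (nc _) => a c; lra.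
  by move=> h; split => //; move: h hp; clear; move: (nc _) (nc _) => a c; lra.
have b1' : 1 - conjc b != 0 by rewrite -kE mulf_neq0.
have mC : conjc ('i * (1 + b) / (1 - b)) = - 'i * (1 + conjc b) / (1 - conjc b).
  have ci : conjc 'i = - 'i :> C by apply: complex_eq; rewrite ?cReN ?cImN /= ?oppr0.
  by rewrite (rmorphM (@conjc R)) (rmorphM (@conjc R)) (fmorphV (@conjc R)) rmorphB rmorphD rmorph1 [X in X * _ * _]ci.
have ImE (m : C) : (complex.Im m)%:C = (m - conjc m) / (2 * 'i).
  have n2i : 2 * 'i != 0 :> C by rewrite mulf_neq0 ?i_neq0// pnatr_eq0.
  apply: (mulIf n2i); rewrite divfK// -[2]/(1 + 1).
  by case: m => x y; apply: complex_eq; rewrite !(cReM, cImM, cReD, cImD, cReB, cImB) /=; ring.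
have i0 := i_neq0 R.
rewrite ImE mC uE2.
have n1 : 1 + conjc b * psi - (psi + b) != 0.
  rewrite (_ : _ - _ = (1 - b) * (1 - k * psi)) ?mulf_neq0//.
  by rewrite cE; ring.
have -> : 1 + (psi + b) / (1 + conjc b * psi) = (1 + conjc b * psi + (psi + b)) / (1 + conjc b * psi) by field.
have -> : 1 - (psi + b) / (1 + conjc b * psi) = (1 + conjc b * psi - (psi + b)) / (1 + conjc b * psi) by field.
have frac (A B D : C) : D != 0 -> B != 0 -> 'i * (A / D) / (B / D) = 'i * A / B.
  by move=> ? ?; field; apply/andP.
rewrite frac//.
have -> : 1 + conjc b * psi - (psi + b) = (1 - b) * (1 - k * psi) by rewrite cE; ring.
rewrite -kE cE; clear -k0 b1 d0 i0.
by field; rewrite i0 d0 b1 k0.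
Qed.

End Nondegenerate.

(** * Uniform Taylor expansion of the m function at [w = 0] *)

Section Expansion.
Variable R : realType.
Local Notation C := R[i].
Local Notation mu := (@lebesgue_measure R).

(** A linear bound near 0, with any constant [K], forces the coefficient of order 0 to vanish, while
    the estimates obtained do not involve [K]. *)
Lemma removable_zero (r B rho K d : R) (f : C -> C) : pholo r f -> pbounded r B f ->
  0 < rho -> rho < r -> 0 < d ->
  (forall w, 0 < nc w -> nc w <= d -> nc (f w) <= K * nc w) -> exists b : nat -> C,
  [/\ b 0%N = 0, forall n, nc (b n) <= B / rho ^+ n &
   forall n w, 0 < nc w -> nc w <= rho / 2 ->
     nc (f w - \sum_(k < n) b k * w ^+ k) <= 2 * B * (nc w / rho) ^+ n].
Proof.
move=> hf hB rho0 rhor d0 hK; have [b [_ b2 b3]] := removable hf hB rho0 rhor.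
exists b; split => //; apply: cvg_to0_eq => e e0.
pose A := `|K| + `|2 * B / rho| + 1.
have A0 : 0 < A by rewrite ltr_wpDl// addr_ge0.
pose t := Num.min d (Num.min (rho / 2) (e / A)).
have t0 : 0 < t by rewrite !lt_min d0 !divr_gt0.
have nt : nc (t%:C : C) = t by rewrite ncR gtr0_norm.
have td : nc (t%:C : C) <= d by rewrite nt /t ge_min lexx.
have tr : nc (t%:C : C) <= rho / 2 by rewrite nt /t !ge_min lexx/= orbT.
have te : A * t <= e.
  by rewrite mulrC -ler_pdivlMr// /t !ge_min lexx !orbT.
have tt : 0 < nc (t%:C : C) by rewrite nt.
have h1 := hK _ tt td; have h2 := b3 1%N _ tt tr.
rewrite nt in h1; rewrite big_ord1 expr0 mulr1 nt expr1 -[b _]/(b 0%N) in h2.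
have h3 := nc_subl (b 0%N) (f t%:C); rewrite (ncC (b 0%N)) in h3.
have h4 : K * t <= `|K| * t by rewrite ler_wpM2r ?(ltW t0)// ler_norm.
have h5 : 2 * B * (t / rho) <= `|2 * B / rho| * t.
  by rewrite (_ : _ * (t / rho) = (2 * B / rho) * t) ?ler_wpM2r ?(ltW t0) ?ler_norm//; ring.
move: te; rewrite /A (mulrDl (_ + _)) (mulrDl `|K|) mul1r; clear -h1 h2 h3 h4 h5 t0; lra.
Qed.

Lemma Im_mobius (b : C) : 1 - b != 0 ->
  complex.Im ('i * (1 + b) / (1 - b)) = (1 - nc b ^+ 2) / nc (1 - b) ^+ 2.
Proof.
move=> b1; set m := 'i * (1 + b) / (1 - b).
have := wronsk_cayley m 1; rewrite mulr1 (_ : complex.Im (m * _) = complex.Im m); last first.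
  by rewrite cImM/= oppr0 mulr0 add0r mulr1.
have -> : m + 'i = (2 : R)%:C * 'i / (1 - b) by rewrite rmorph_nat /m; field.
have -> : m - 'i = (2 : R)%:C * 'i * b / (1 - b) by rewrite rmorph_nat /m; field.
rewrite !ncf !ncM ncR nci normr_nat !mulr1 !exprMn exprVn => h.
by apply: (@mulfI _ 4); rewrite ?pnatr_eq0// h; ring.
Qed.

Lemma one_sub_neq0 (b : C) : nc b < 1 -> 1 - b != 0.
Proof. by move=> h; rewrite -nc_gt0; apply: lt_le_trans (nc_subl 1 b); rewrite nc1 subr_gt0. Qed.

Variables (p q : R -> R).
Hypothesis hH : ham p q.
Variables (f : C -> C) (r : R).
Hypothesis r0 : 0 < r.
Hypothesis fd : forall w, nc w < r -> cdiff f w.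
Hypothesis Uge0 : forall w x, 0 < nc w -> nc w < r -> 0 <= x ->
  0 <= wronsk (fun x => U1 p q f x w) (fun x => U2 p q f x w) x.
Hypothesis center_lt1 : forall x, 0 <= x -> nc (center p q f r x) < 1.

Local Notation b0 := (center p q f r).
Local Notation m x w := (U1 p q f x w / U2 p q f x w).
(** The inverse Cayley transform of the centre, that is, the value [M(x, 0)]. *)
Definition m_center (x : R) := 'i * (1 + b0 x) / (1 - b0 x).
Definition im_center (x : R) := complex.Im (m_center x).

Lemma im_center_gt0 x : 0 <= x -> 0 < im_center x.
Proof.
move=> x0; have h := center_lt1 x0; have n := one_sub_neq0 h.
by rewrite /im_center Im_mobius// divr_gt0 ?exprn_gt0 ?nc_gt0// subr_gt0 expr_lt1// nc_ge0.
Qed.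

Lemma Phi_center x w : 0 <= x -> 0 < nc w -> nc w <= r / 4 ->
  nc (Phi p q f x w - b0 x) <= 4 / r * nc w.
Proof.
move=> x0 w0 wr; have r2 : 0 < r / 2 by rewrite divr_gt0.
have rr : r / 2 < r by lra.
have [b [b1 b2 b3]] := removable (Phi_pholo hH fd Uge0 x0) (Phi_bound hH Uge0 x0) r2 rr.
have w4 : nc w <= r / 2 / 2 by lra.
have h : nc (Phi p q f x w - b0 x) <= 2 * 1 * (nc w / (r / 2)) ^+ 1.
  by have := b3 1%N w w0 w4; rewrite big_ord1 expr0 -[b _]/(b 0%N) b1 !mulr1.
apply: le_trans h _; rewrite expr1.
by rewrite le_eqVlt; apply/orP; left; apply/eqP; field; rewrite gt_eqF.
Qed.

Lemma Phi_hcont w : 0 < nc w -> nc w < r -> hcont (fun x => Phi p q f x w).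
Proof.
move=> w0 wr; have [s1 s2] := U_sol hH f w; have h1 := prim_hcont s1; have h2 := prim_hcont s2.
have h3 := hcontM (hcont_cst 'i) h2.
by apply: hcontM (hcontD h1 (hcontN h3)) (hcontV (hcontD h1 h3) _) => x x0; exact: (Phi_den hH Uge0 w0 wr x0).
Qed.

(** The centre is the limit of [Phi p q f x w] as [w -> 0], uniformly in [x] by [Phi_center]. *)
Lemma center_hcont : hcont b0.
Proof.
apply: hcont_lim => L e e0; pose t := Num.min (r / 4) (e * r / 4).
have t0 : 0 < t by rewrite lt_min !divr_gt0// mulr_gt0.
have nt : nc (t%:C : C) = t by rewrite ncR gtr0_norm.
have t4 : t <= r / 4 by rewrite /t ge_min lexx.
exists (fun x => Phi p q f x t%:C).
  by apply: Phi_hcont; rewrite nt//; lra.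
move=> x /andP[x0 _]; apply: le_trans (Phi_center x0 _ _) _; rewrite nt//.
rewrite mulrC -ler_pdivlMr ?divr_gt0//.
rewrite (_ : e / (4 / r) = e * r / 4) ?/t ?ge_min ?lexx ?orbT//.
by field; rewrite gt_eqF.
Qed.

Lemma m_center_hcont : hcont m_center.
Proof.
apply: hcontM (hcontM (hcont_cst 'i) (hcontD (hcont_cst 1) center_hcont)) _.
apply: hcontV (hcontD (hcont_cst 1) (hcontN center_hcont)) _ => x x0.
by apply: one_sub_neq0; exact: center_lt1.
Qed.

Definition m_diff x w := (m x w - m_center x) / (im_center x)%:C.

(** For [nc w < r / 12] the bound [4 / r * nc w] on [psi] stays below [1 / 3], as [mobius_expand]
    requires, and the factor 3 there turns it into [12 / r]. *)
Lemma m_diff_spec x w : 0 <= x -> 0 < nc w -> nc w < r / 12 ->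
  [/\ U2 p q f x w != 0, nc (m_diff x w) <= 1 & nc (m_diff x w) <= 12 / r * nc w].
Proof.
move=> x0 w00 wr12.
have wr v : nc v < r / 12 -> nc v < r by lra.
have bl := center_lt1 x0; have b1 := one_sub_neq0 bl.
pose psi v := (Phi p q f x v - b0 x) / (1 - conjc (b0 x) * Phi p q f x v).
have Pb := Phi_bound hH Uge0 x0; have Ph := Phi_pholo hH fd Uge0 x0.
have den v (v0 : 0 < nc v) (vr : nc v < r) := schwarz_pick (Pb v v0 vr) bl.
have psih : pholo r psi.
  move=> v v0 vr; have [d1 _] := den v v0 vr; have Pv := Ph v v0 vr.
  apply: cdiffM; first by apply: cdiffB => //; exact: cdiff_cst.
  apply: (@cdiffV _ (fun v => 1 - conjc (b0 x) * Phi p q f x v)) => //.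
  by apply: cdiffB; [exact: cdiff_cst|apply: cdiffM => //; exact: cdiff_cst].
have psib : pbounded r 1 psi by move=> v v0 vr; have [_] := den v v0 vr.
(* The constant depends on [x] and only serves to see that [psi] vanishes at 0; the bound
   [nc (psi v) <= 1] then yields the uniform constant [4 / r]. *)
have psiK v : 0 < nc v -> nc v <= r / 4 -> nc (psi v) <= (4 / r / (1 - nc (b0 x))) * nc v.
  move=> v0 v4; have vr : nc v < r by lra.
  have h := Phi_center x0 v0 v4; rewrite /psi ncf.
  have bp : 0 < 1 - nc (b0 x) by lra.
  have dl : 1 - nc (b0 x) <= nc (1 - conjc (b0 x) * Phi p q f x v).
    have := nc_subl 1 (1 - conjc (b0 x) * Phi p q f x v); rewrite nc1 subKr ncM ncJ.
    have : nc (b0 x) * nc (Phi p q f x v) <= nc (b0 x) * 1 by rewrite ler_wpM2l ?nc_ge0//; exact: Pb.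
    by lra.
  rewrite mulrAC; apply: ler_pM; rewrite ?nc_ge0 ?invr_ge0 ?nc_ge0//.
  by rewrite lef_pV2// posrE (lt_le_trans bp).
have r2 : 0 < r / 2 by rewrite divr_gt0.
have rr : r / 2 < r by lra.
have r4 : 0 < r / 4 by rewrite divr_gt0.
have [c [c1 _ c3]] := removable_zero psih psib r2 rr r4 psiK.
have psi3 : nc (psi w) <= 4 / r * nc w.
  have w4 : nc w <= r / 2 / 2 by lra.
  have h : nc (psi w) <= 2 * 1 * (nc w / (r / 2)) ^+ 1.
    by have := c3 1%N w w00 w4; rewrite big_ord1 -[c _]/(c 0%N) c1 mul0r subr0.
  apply: le_trans h _; rewrite expr1.
  by rewrite le_eqVlt; apply/orP; left; apply/eqP; field; rewrite gt_eqF.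
have psi13 : nc (psi w) <= 1 / 3.
  apply: le_trans psi3 _; rewrite mulrC mulrA ler_pdivrMr//; lra.
have [d1 _] := den w w00 (wr w wr12).
have [u1 [e [e1 e2] eE]] := mobius_expand b1 d1 bl (erefl _) psi13.
have N0 := Phi_den hH Uge0 w00 (wr _ wr12) x0.
have P1 : 1 - Phi p q f x w = 2 * 'i * U2 p q f x w / (U1 p q f x w + 'i * U2 p q f x w).
  by rewrite /Phi; field.
have U20 : U2 p q f x w != 0.
  by apply: contraNneq u1 => h; rewrite P1 h mulr0 mul0r.
have mE : m x w = 'i * (1 + Phi p q f x w) / (1 - Phi p q f x w).
  rewrite P1 (_ : 1 + Phi p q f x w = 2 * U1 p q f x w / (U1 p q f x w + 'i * U2 p q f x w)); last first.
    by rewrite /Phi; field.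
  by field; rewrite N0 U20 i_neq0.
have yy : (im_center x)%:C != 0 :> C by rewrite -nc_eq0 ncR normr_eq0 gt_eqF// im_center_gt0.
have -> : m_diff x w = e.
  by rewrite /m_diff mE eE -/(m_center x) -/(im_center x) addrC addKr mulrC mulKf.
split => //; apply: le_trans e1 _.
by rewrite (_ : 12 / r * nc w = 3 * (4 / r * nc w)); [lra|ring].
Qed.

Lemma m_diff_pholo x : 0 <= x -> pholo (r / 12) (m_diff x).
Proof.
move=> x0 w w0 wr; have [U20 _ _] := m_diff_spec x0 w0 wr; have wn : w != 0 by rewrite -nc_gt0.
have wr' : nc w < r by lra.
have [h1 h2] := U_cdiff hH x0 wn (fd wr').
apply: cdiffM; last exact: cdiff_cst.
by apply: cdiffB; [apply: cdiffM => //; exact: cdiffV|exact: cdiff_cst].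
Qed.

Lemma expansion : exists rho (e : nat -> R -> C) (rr : nat -> C -> R -> C), 0 < rho /\
  forall x, 0 <= x -> (forall n, nc (e n x) <= (rho ^+ n.+1)^-1) /\
    forall w, 0 < nc w -> nc w <= rho -> [/\ U2 p q f x w != 0,
      m x w = m_center x + (im_center x)%:C * (w * rr 0%N w x),
      forall n, nc (rr n w x) <= 2 / rho ^+ n.+1 &
      forall n, rr n w x = e n x + w * rr n.+1 w x].
Proof.
(* Half the radius [r / 24] of the expansion circle, which lies in the disc of radius [r / 12] where
   [m_diff] is bounded by 1. *)
pose rho := r / 48.
have rho0 : 0 < rho by rewrite divr_gt0.
have r24 : 0 < r / 24 by rewrite divr_gt0.
have rr2 : r / 24 < r / 12 by lra.
have r12 : 0 < r / 13 by rewrite divr_gt0.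
have r1312 : r / 13 < r / 12 by lra.
have [b hb] : {b : R -> nat -> C & forall x, 0 <= x ->
  [/\ b x 0%N = 0, forall n, nc (b x n) <= 1 / (r / 24) ^+ n &
   forall n w, 0 < nc w -> nc w <= r / 24 / 2 ->
     nc (m_diff x w - \sum_(k < n) b x k * w ^+ k) <= 2 * 1 * (nc w / (r / 24)) ^+ n]}.
  apply: (@choice _ _ (fun x b => 0 <= x -> [/\ b 0%N = 0, forall n, nc (b n) <= 1 / (r / 24) ^+ n &
   forall n w, 0 < nc w -> nc w <= r / 24 / 2 ->
     nc (m_diff x w - \sum_(k < n) b k * w ^+ k) <= 2 * 1 * (nc w / (r / 24)) ^+ n])) => x.
  have [x0|x0] := leP 0 x; last by exists (fun=> 0).
  have [w w0 wr|w w0 wr|c hc] := @removable_zero (r / 12) 1 (r / 24) (12 / r) (r / 13) (m_diff x) (m_diff_pholo x0) _ r24 rr2 r12.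
  - by have [] := m_diff_spec x0 w0 wr.
  - have wr' : nc w < r / 12 by exact: le_lt_trans wr r1312.
    by have [] := m_diff_spec x0 w0 wr'.
  - by exists c.
have le_rho n : (r / 24) ^- n <= rho ^- n.
  by rewrite lef_pV2 ?posrE ?exprn_gt0// lerXn2r ?nnegrE ?(ltW r24) ?(ltW rho0)// /rho; lra.
(* [m_diff] vanishes at 0, hence the shift: [e n] is its coefficient of order [n + 1], and [rr n] is
   the quotient of the remainder that starts with [e n]. *)
exists rho, (fun n x => b x n.+1), (fun n w x => (m_diff x w - \sum_(k < n.+1) b x k * w ^+ k) / w ^+ n.+1).
split => // x x0; have [b1 b2 b3] := hb x x0; split => [n|w w0 wr].
  by apply: le_trans (b2 _) _; rewrite mul1r.
have wn : w != 0 by rewrite -nc_gt0.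
have wr12 : nc w < r / 12 by move: wr; rewrite /rho; lra.
have [U20 _ _] := m_diff_spec x0 w0 wr12.
have yy : (im_center x)%:C != 0 :> C by rewrite -nc_eq0 ncR normr_eq0 gt_eqF// im_center_gt0.
split => // [|n|n].
- by rewrite big_ord1 -[b x _]/(b x 0%N) b1 mul0r subr0 expr1 [w * _]mulrC divfK// /m_diff [_ * (_ / _)]mulrC divfK// addrC subrK.
- rewrite ncf ncX ler_pdivrMr ?exprn_gt0//; apply: le_trans (b3 _ _ w0 _) _.
    by move: wr; rewrite /rho; lra.
  by rewrite mulr1 exprMn exprVn mulrA mulrAC ler_wpM2r ?exprn_ge0 ?nc_ge0// ler_wpM2l.
- rewrite [in RHS]big_ord_recr/= opprD addrA; move: (m_diff x w - _) => S.
  have W0 : w ^+ n.+1 != 0 by rewrite expf_neq0.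
  by rewrite [w ^+ n.+2]exprS; move: (w ^+ n.+1) W0 => W W0; field; apply/andP.
Qed.

End Expansion.

(** * The Riccati equation and limits [w -> 0] *)

Section Riccati.
Variable R : realType.
Local Notation C := R[i].
Local Notation mu := (@lebesgue_measure R).

Lemma hcont_Im (F : R -> C) : hcont F -> hcont (fun x => (complex.Im (F x))%:C).
Proof.
move=> h x x0 e e0; have [d d0 hd] := h x x0 e e0; exists d => // y y0 yd.
by rewrite -rmorphB -cImB ncR; apply: le_lt_trans (nc_Im _) (hd y y0 yd).
Qed.

Lemma complexV (x : R) : (x^-1)%:C = (x%:C)^-1 :> C.
Proof.
have [->|x0] := eqVneq x 0; first by rewrite invr0 invr0.
have xc : x%:C != 0 :> C by rewrite -nc_eq0 ncR normr_eq0.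
by apply: (mulIf xc); rewrite mulVf// -rmorphM mulVf.
Qed.

Lemma ae_neq0 : {ae mu, forall x : R, x != 0}.
Proof.
exists [set 0]; split; [exact: measurable_set1|exact: lebesgue_measure_set1|].
by move=> x /= /negP; rewrite negbK => /eqP.
Qed.

Lemma cint_ae (f g : R -> C) b : 0 <= b -> cbm f -> cbm g ->
  {ae mu, forall x : R, 0 < x -> f x = g x} -> cint 0 b f = cint 0 b g.
Proof.
move=> b0 [f1 f2] [g1 g2] h.
have key (u v : R -> R) : rbm u -> rbm v -> {ae mu, forall x : R, 0 < x -> u x = v x} ->
    \int[mu]_(x in `[0, b]) u x = \int[mu]_(x in `[0, b]) v x.
  move=> hu hv uv; congr fine; apply: ae_eq_integral => //.
  - by apply/measurable_EFinP; exact: (hu b).1.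
  - by apply/measurable_EFinP; exact: (hv b).1.
  - apply: (@filterS2 _ _ (ae_filter_ringOfSetsType mu) _ _ _ _ uv ae_neq0) => x /= h1 h2.
    by rewrite in_itv/= => /andP[x0 _]; rewrite h1// lt_def h2.
by congr (_ +i* _); apply: key => //; apply: (@filterS _ _ (ae_filter_ringOfSetsType mu) _ _ _ h) => x hx /hx ->.
Qed.

Lemma prim_ae (F f g : R -> C) : prim F f -> cbm g ->
  {ae mu, forall x : R, 0 < x -> f x = g x} -> prim F g.
Proof. by move=> [hf h] hg fg; split => // x x0; rewrite h// (cint_ae x0 hf hg fg). Qed.

Lemma ratio_prim p q z u1 u2 : ham p q -> sol p q z u1 u2 -> (forall x : R, 0 <= x -> u2 x != 0) ->
  prim (fun x => u1 x / u2 x) (fun x => - z * ((p x)%:C * (u1 x / u2 x) ^+ 2 +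
    (2 * q x)%:C * (u1 x / u2 x) + (1 - p x)%:C)).
Proof.
move=> _ [h1 h2] h0; apply: prim_ext (primM h1 (primV h2 h0)) => // x x0; have n0 := h0 x x0.
by rewrite rmorphM rmorph_nat; field.
Qed.

Variables (rho : R).
Hypothesis rho0 : 0 < rho.

(** Bounds uniform in [w] on the punctured disc and in [x] on compact intervals: a remainder
    [w * A w x] with such an [A] disappears in the limit. *)
Definition ubd (F : C -> R -> C) := forall L : R, exists2 K : R, 0 < K &
  forall w (x : R), 0 < nc w -> nc w <= rho -> 0 <= x -> x <= L -> nc (F w x) <= K.

Lemma ubd_cbm f : cbm f -> ubd (fun _ x => f x).
Proof.
by move=> h L; have [B B0 hB] := cbm_bound L h; exists B => // w x _ _ x0 xL; apply: hB; rewrite x0.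
Qed.

Lemma ubd_w : ubd (fun w _ => w).
Proof. by move=> L; exists rho. Qed.

Lemma ubdD F G : ubd F -> ubd G -> ubd (fun w x => F w x + G w x).
Proof.
move=> hF hG L; have [K K0 hK] := hF L; have [K' K0' hK'] := hG L.
exists (K + K'); first exact: addr_gt0.
move=> w x w0 wr x0 xL; apply: le_trans (ncD _ _) _; exact: lerD (hK w x w0 wr x0 xL) (hK' w x w0 wr x0 xL).
Qed.

Lemma ubdM F G : ubd F -> ubd G -> ubd (fun w x => F w x * G w x).
Proof.
move=> hF hG L; have [K K0 hK] := hF L; have [K' K0' hK'] := hG L.
exists (K * K'); first exact: mulr_gt0.
move=> w x w0 wr x0 xL; rewrite ncM.
exact: ler_pM (nc_ge0 _) (nc_ge0 _) (hK w x w0 wr x0 xL) (hK' w x w0 wr x0 xL).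
Qed.

Lemma ubd_sum (I : Type) (s : seq I) (F : I -> C -> R -> C) : (forall i, ubd (F i)) ->
  ubd (fun w x => \sum_(i <- s) F i w x).
Proof.
move=> h; elim: s => [|i s IH] L.
  by exists 1 => // w x _ _ _ _; rewrite big_nil nc0.
have [K K0 hK] := ubdD (h i) IH L; exists K => // w x w0 wr x0 xL.
by rewrite big_cons; exact: hK.
Qed.

Lemma ubd_ext F G : (forall w x, 0 < nc w -> nc w <= rho -> 0 <= x -> F w x = G w x) -> ubd F -> ubd G.
Proof.
move=> FG hF L; have [K K0 hK] := hF L; exists K => // w x w0 wr x0 xL.
by rewrite -FG//; exact: hK.
Qed.

Let wn (n : nat) : C := (rho * n.+1%:R^-1)%:C.

Let wn_gt0 n : 0 < nc (wn n).
Proof. by rewrite ncR gtr0_norm mulr_gt0// invr_gt0. Qed.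

Let wn_le n : nc (wn n) <= rho.
Proof.
have h : 0 < rho * n.+1%:R^-1 by rewrite mulr_gt0 ?invr_gt0.
by rewrite ncR gtr0_norm// ler_piMr ?(ltW rho0)// invf_le1// ler1n.
Qed.

Let wn_small (K e : R) : 0 < K -> 0 < e -> \forall n \near \oo, nc (wn n) * K <= e.
Proof.
move=> K0 e0; have ek : 0 < e / (rho * K) by rewrite divr_gt0 ?mulr_gt0.
near=> n; have h : 0 < rho * n.+1%:R^-1 by rewrite mulr_gt0 ?invr_gt0.
have : n.+1%:R^-1 < e / (rho * K) by near: n; exact: (near_infty_natSinv_lt (PosNum ek)).
rewrite ltr_pdivlMr ?mulr_gt0// ncR gtr0_norm// => /ltW; apply: le_trans.
by rewrite le_eqVlt; apply/orP; left; apply/eqP; ring.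
Unshelve. all: by end_near. Qed.

Lemma lim_hcont F G A : (forall w, 0 < nc w -> nc w <= rho -> hcont (F w)) -> ubd A ->
  (forall w x, 0 < nc w -> nc w <= rho -> 0 <= x -> F w x - G x = w * A w x) -> hcont G.
Proof.
move=> hF hA FG; apply: hcont_lim => L e e0; have [K K0 hK] := hA L.
have [N _ hN] := wn_small K0 e0; exists (F (wn N)); first exact: hF.
move=> x /andP[x0 xL]; rewrite FG// ncM; apply: le_trans (hN N _); rewrite /= ?leqnn//.
by rewrite ler_wpM2l ?nc_ge0//; exact: hK.
Qed.

(** The equation passes to the term of order 0 in [w]; that [g] is measurable and locally bounded
    comes out of the same limit. *)
Lemma lim_prim F f G g A B : (forall w, 0 < nc w -> nc w <= rho -> prim (F w) (f w)) ->
  ubd A -> ubd B ->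
  (forall w x, 0 < nc w -> nc w <= rho -> 0 <= x -> F w x - G x = w * A w x) ->
  (forall w x, 0 < nc w -> nc w <= rho -> 0 <= x -> f w x - g x = w * B w x) -> prim G g.
Proof.
move=> hF hA hB FG fg.
apply: (@prim_lim _ (fun n => F (wn n)) (fun n => f (wn n))) => [n|x x0 e e0||L e e0].
- exact: hF.
- have [K K0 hK] := hA x; apply: filterS (wn_small K0 e0) => n; apply: le_trans.
  by rewrite FG// ncM ler_wpM2l ?nc_ge0//; exact: hK.
- apply: (@cbm_lim _ (fun n => f (wn n))) => [n|L]; first by have [] := hF (wn n) (wn_gt0 n) (wn_le n).
  have [K K0 hK] := hB L; exists (fun n => nc (wn n) * K).
    apply/cvgrPdist_le => e e0; apply: filterS (wn_small K0 e0) => n.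
    by rewrite sub0r normrN ger0_norm// mulr_ge0 ?nc_ge0 ?(ltW K0).
  by move=> n x /andP[x0 xL]; rewrite fg// ncM ler_wpM2l ?nc_ge0//; exact: hK.
- have [K K0 hK] := hB L; apply: filterS (wn_small K0 e0) => n h x /andP[x0 xL].
  by apply: le_trans h; rewrite fg// ncM ler_wpM2l ?nc_ge0//; exact: hK.
Qed.

End Riccati.

(** * Differential equations for the Taylor coefficients *)

Section Hierarchy.
Variable R : realType.
Local Notation C := R[i].
Local Notation mu := (@lebesgue_measure R).
Variables (p q : R -> R) (rho : R) (V : C -> R -> C) (m : R -> C) (e : nat -> R -> C)
  (rr : nat -> C -> R -> C).
Hypothesis hH : ham p q.
Hypothesis rho0 : 0 < rho.
Hypothesis V_prim : forall w, 0 < nc w -> nc w <= rho -> prim (V w)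
  (fun x => w^-1 * ((p x)%:C * V w x ^+ 2 + (2 * q x)%:C * V w x + (1 - p x)%:C)).
Hypothesis m_hcont : hcont m.
Hypothesis m_gt0 : forall x, 0 <= x -> 0 < complex.Im (m x).
Local Notation y x := (complex.Im (m x))%:C.
Hypothesis V_E : forall w x, 0 < nc w -> nc w <= rho -> 0 <= x ->
  V w x = m x + y x * (w * rr 0%N w x).
Hypothesis rr_bound : forall n w x, 0 < nc w -> nc w <= rho -> 0 <= x ->
  nc (rr n w x) <= 2 / rho ^+ n.+1.
Hypothesis rr_E : forall n w x, 0 < nc w -> nc w <= rho -> 0 <= x ->
  rr n w x = e n x + w * rr n.+1 w x.

Let y_neq0 x : 0 <= x -> y x != 0.
Proof. by move=> x0; rewrite -nc_gt0 ncR normr_gt0 gt_eqF// m_gt0. Qed.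

Let rr_ubd n : ubd rho (rr n).
Proof.
move=> L; exists (2 / rho ^+ n.+1); first by rewrite divr_gt0 ?exprn_gt0.
by move=> w x w0 wr x0 _; exact: rr_bound.
Qed.

Let w_neq0 (w : C) : 0 < nc w -> w != 0. Proof. by rewrite nc_gt0. Qed.

(** The two continuities alternate: that of [rr n] gives [e n] as a limit for [w -> 0], and then
    [rr n.+1 = (rr n - e n) / w]. *)
Lemma e_rr_hcont n : hcont (e n) /\ (forall w, 0 < nc w -> nc w <= rho -> hcont (rr n w)).
Proof.
have eh k : (forall w, 0 < nc w -> nc w <= rho -> hcont (rr k w)) -> hcont (e k).
  move=> h; apply: (lim_hcont rho0 h (rr_ubd k.+1)) => w x w0 wr x0.
  by rewrite rr_E// addrC addKr.
elim: n => [|n [IH1 IH2]].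
  have h0 w : 0 < nc w -> nc w <= rho -> hcont (rr 0 w).
    move=> w0 wr; have h1 := hcontD (prim_hcont (V_prim w0 wr)) (hcontN m_hcont).
    have h2 := hcontM h1 (hcontV (hcont_Im m_hcont) y_neq0).
    apply: hcont_ext (hcontM (hcont_cst w^-1) h2) => x x0.
    have := w_neq0 w0; have := y_neq0 x0; rewrite V_E//; move: (y x) => a a0 wn.
    by field; rewrite a0 wn.
  by split => //; exact: eh.
have hn w : 0 < nc w -> nc w <= rho -> hcont (rr n.+1 w).
  move=> w0 wr; have h1 := hcontD (IH2 w w0 wr) (hcontN IH1).
  apply: hcont_ext (hcontM (hcont_cst w^-1) h1) => x x0.
  by rewrite rr_E// [e n x + _]addrC addrK mulKf// w_neq0.
by split => //; exact: eh.
Qed.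

Let e_cbm n : cbm (e n). Proof. exact: hcont_cbm (e_rr_hcont n).1. Qed.
Let m_cbm : cbm m. Proof. exact: hcont_cbm m_hcont. Qed.
Let y_cbm : cbm (fun x => y x). Proof. exact: hcont_cbm (hcont_Im m_hcont). Qed.

Let V_ubd : ubd rho V.
Proof.
apply: (@ubd_ext _ rho (fun w x => m x + y x * (w * rr 0%N w x))) => [w x w0 wr x0|].
  by rewrite V_E.
apply: ubdD; first exact: ubd_cbm.
apply: ubdM; first exact: (ubd_cbm rho y_cbm).
by apply: ubdM => //; exact: ubd_w.
Qed.

(** The Riccati equation multiplied by [w], in the limit [w -> 0]. *)
Lemma riccati_zero x : 0 <= x ->
  cint 0 x (fun t => (p t)%:C * m t ^+ 2 + (2 * q t)%:C * m t + (1 - p t)%:C) = 0.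
Proof.
move=> x0; have [rp rq _] := hH; pose g t := (p t)%:C * m t ^+ 2 + (2 * q t)%:C * m t + (1 - p t)%:C.
have r2q : rbm (fun t => 2 * q t) by apply: rbmM => //; exact: rbm_cst.
suff : prim (fun _ : R => 0 : C) g by move=> [_ /(_ x x0)]; rewrite add0r.
apply: (@lim_prim _ rho rho0 (fun w x => w * V w x) (fun w t => (p t)%:C * V w t ^+ 2 + (2 * q t)%:C * V w t + (1 - p t)%:C)
  _ g V (fun w t => (y t * rr 0%N w t) * ((p t)%:C * (V w t + m t) + (2 * q t)%:C))) => //.
- move=> w w0 wr; apply: prim_ext (primZ w (V_prim w0 wr)) => // t _.
  by rewrite mulVKf// w_neq0.
- apply: ubdM; first by apply: ubdM => //; exact: (ubd_cbm rho y_cbm).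
  apply: ubdD; last exact: (ubd_cbm rho (cbmR r2q)).
  apply: ubdM; first exact: (ubd_cbm rho (cbmR rp)).
  by apply: ubdD => //; exact: ubd_cbm.
- by move=> w t _ _ _; rewrite subr0.
- by move=> w t w0 wr t0; rewrite /g V_E//; ring.
Qed.

(** The scalar [c] in [H = c (1, - Re m; - Re m, |m|^2)], fixed by trace one. *)
Definition gam (x : R) : R := (1 + nc (m x) ^+ 2)^-1.

Lemma gam_gt0 x : 0 < gam x.
Proof. by rewrite invr_gt0 ltr_pwDl// exprn_ge0// nc_ge0. Qed.

(** By [riccati_zero] the real quadratic polynomial with coefficients [p], [2 q], [1 - p] has the
    nonreal root [m x] for almost every [x]; this determines it up to a factor, and the trace fixes
    the factor. *)
Lemma ham_gam : {ae mu, forall x : R, 0 < x ->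
  [/\ p x = gam x, q x = - gam x * complex.Re (m x) & 1 - p x = gam x * nc (m x) ^+ 2]}.
Proof.
have [rp rq _] := hH; pose g t := (p t)%:C * m t ^+ 2 + (2 * q t)%:C * m t + (1 - p t)%:C.
have gc : cbm g.
  have r2q : rbm (fun t => 2 * q t) by apply: rbmM => //; exact: rbm_cst.
  have r1p : rbm (fun t => 1 - p t) by apply: rbmB => //; exact: rbm_cst.
  apply: cbmD; last exact: cbmR r1p.
  by apply: cbmD; apply: cbmM; rewrite ?(cbmR rp) ?(cbmR r2q)//; (exact: cbmM || exact: cbmR).
have z1 : forall x : R, 0 <= x -> \int[mu]_(t in `[0, x]) complex.Re (g t) = 0.
  by move=> x x0; rewrite -Re_cint riccati_zero.
have z2 : forall x : R, 0 <= x -> \int[mu]_(t in `[0, x]) complex.Im (g t) = 0.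
  by move=> x x0; have := riccati_zero x0 => /(congr1 (@complex.Im R)).
apply: (@filterS2 _ _ (ae_filter_ringOfSetsType mu) _ _ _ _ (ae_zero gc.1 z1) (ae_zero gc.2 z2)) => x /= h1 h2 x0.
have {}h1 := h1 x0; have {}h2 := h2 x0; have y0 := m_gt0 (ltW x0).
have n0 : 1 + nc (m x) ^+ 2 != 0 by rewrite gt_eqF// -invr_gt0 gam_gt0.
move: h1 h2; rewrite /g expr2 !(cReD, cImD, cReM, cImM) /= => h1 h2.
rewrite /gam; move: n0; rewrite nc2E; move: (complex.Re _) (complex.Im _) h1 h2 y0 => a b h1 h2 b0 n0.
have qE : q x = - p x * a.
  apply: (@mulfI _ (2 * b)); first by rewrite mulf_neq0 ?gt_eqF.
  by lra.
have pE : p x * (1 + (a ^+ 2 + b ^+ 2)) = 1.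
  by move: h1; rewrite qE; lra.
have {}pE : p x = (1 + (a ^+ 2 + b ^+ 2))^-1 by apply: (mulIf n0); rewrite pE mulVf.
by split => //; rewrite ?qE pE//; field.
Qed.

(** The density [d tau / dx] of the new variable. *)
Definition sig (x : R) : R := gam x * complex.Im (m x).

Lemma sig_gt0 x : 0 <= x -> 0 < sig x.
Proof. by move=> x0; rewrite mulr_gt0 ?gam_gt0 ?m_gt0. Qed.

Lemma hcont_nc2 (F : R -> C) : hcont F -> hcont (fun x => (nc (F x) ^+ 2)%:C).
Proof.
move=> hF; apply: (@hcont_ext _ (fun x => F x * F x + (- 2 * 'i) * (F x * (complex.Im (F x))%:C) )).
  move=> x _; rewrite nc2E; case: (F x) => a b; apply: complex_eq; rewrite !(cReD, cImD, cReM, cImM, cReN, cImN)/=; ring.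
apply: hcontD; first exact: hcontM.
by apply: hcontM; [exact: hcont_cst|apply: hcontM => //; exact: hcont_Im].
Qed.

Lemma sig_hcont : hcont (fun x => (sig x)%:C).
Proof.
apply: (@hcont_ext _ (fun x => (1 + (nc (m x) ^+ 2)%:C)^-1 * y x)).
  move=> x _; rewrite /sig [RHS]rmorphM; congr (_ * _).
  by apply/esym/(etrans (complexV _)); rewrite rmorphD rmorph1.
apply: hcontM; last exact: hcont_Im.
apply: hcontV; first by apply: hcontD; [exact: hcont_cst|exact: hcont_nc2].
move=> x x0; rewrite -(rmorph1 (@real_complex R)) -rmorphD -nc_gt0 ncR normr_gt0.
by rewrite gt_eqF// -invr_gt0 gam_gt0.
Qed.

Definition cauchy_sum n (x : R) := \sum_(j < n.+1) e j x * e (n - j)%N x.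
(** The remainder of [rr 0 ^+ 2] after [n] Taylor terms, divided by [w ^+ n]; the coefficients are
    the [cauchy_sum]. *)
Definition sq_tail n w (x : R) := rr 0%N w x * rr n w x + \sum_(j < n) e j x * rr (n - j)%N w x.

Lemma sq_tail_E n w x : 0 < nc w -> nc w <= rho -> 0 <= x ->
  sq_tail n w x = cauchy_sum n x + w * sq_tail n.+1 w x.
Proof.
move=> w0 wr x0; rewrite /sq_tail /cauchy_sum !big_ord_recr/= subnn (subSn (leqnn n)) subnn.
have -> : \sum_(j < n) e j x * rr (n - j)%N w x =
    \sum_(j < n) e j x * e (n - j)%N x + w * \sum_(j < n) e j x * rr (n.+1 - j)%N w x.
  rewrite mulr_sumr -big_split/=; apply: eq_bigr => j _.
  by rewrite rr_E// -subSn ?(ltnW (ltn_ord j))// mulrDr; congr (_ + _); rewrite mulrCA.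
rewrite [rr n w x]rr_E// {2}[rr 0%N w x]rr_E//.
move: (\sum_(_ < _) _) (\sum_(_ < _) _) => s1 s2.
rewrite [rr 0%N w x]rr_E//.
ring.
Qed.

(** [m_coef n] is the [n]-th Taylor coefficient of [V] at [w = 0] and [m_tail n] the remainder that
    starts with it. The expressions [m_tail_deriv] and [m_coef_deriv] are what the Riccati equation
    becomes once [H] is expressed by [m]. *)
Definition m_tail n w (x : R) := if n is k.+1 then y x * rr k w x else V w x.
Definition m_coef n (x : R) := if n is k.+1 then y x * e k x else m x.
Definition m_tail_deriv n w (x : R) := (sig x)%:C * y x * (2 * 'i * rr n w x +
  (if n is k.+1 then sq_tail k w x else w * sq_tail 0 w x)).
Definition m_coef_deriv n (x : R) := (sig x)%:C * y x * (2 * 'i * e n x +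
  (if n is k.+1 then cauchy_sum k x else 0)).

Lemma m_tail_E n w x : 0 < nc w -> nc w <= rho -> 0 <= x -> m_tail n w x - m_coef n x = w * m_tail n.+1 w x.
Proof.
move=> w0 wr x0; case: n => [|n] /=; first by rewrite V_E//; ring.
by rewrite [rr n w x]rr_E//; ring.
Qed.

Lemma m_tail_deriv_E n w x : 0 < nc w -> nc w <= rho -> 0 <= x -> m_tail_deriv n w x - m_coef_deriv n x = w * m_tail_deriv n.+1 w x.
Proof.
move=> w0 wr x0; rewrite /m_tail_deriv /m_coef_deriv [rr n w x]rr_E//; case: n => [|n]; first by ring.
by rewrite (sq_tail_E n w0 wr x0); ring.
Qed.

Let sq_tail_ubd n : ubd rho (sq_tail n).
Proof.
apply: ubdD; first exact: ubdM.
by apply: ubd_sum => j; apply: ubdM => //; exact: ubd_cbm.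
Qed.

Let m_tail_deriv_ubd n : ubd rho (m_tail_deriv n).
Proof.
apply: ubdM; first exact: (ubd_cbm rho (cbmM (hcont_cbm sig_hcont) y_cbm)).
apply: ubdD; first by apply: ubdM => //; exact: (ubd_cbm rho (cbm_cst (2 * 'i))).
by case: n => [|n] //; apply: ubdM => //; exact: ubd_w.
Qed.

Let m_tail_ubd n : ubd rho (m_tail n).
Proof. by case: n => [|n] //; apply: ubdM => //; exact: (ubd_cbm rho y_cbm). Qed.

(** Induction on [n]: the equation of [m_tail n] passes to the limit [w -> 0] and gives that of
    [m_coef n]; the difference divided by [w] is [m_tail n.+1]. *)
Lemma m_tail_prim n w : 0 < nc w -> nc w <= rho -> prim (m_tail n w) (m_tail_deriv n w).
Proof.
elim: n w => [|n IH] w w0 wr.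
  have cV := prim_cbm (V_prim w0 wr).
  have cr : cbm (rr 0%N w) by exact: hcont_cbm ((e_rr_hcont 0).2 w w0 wr).
  apply: (prim_ae (V_prim w0 wr)).
    rewrite /m_tail_deriv /sq_tail; apply: cbmM; first exact: cbmM (hcont_cbm sig_hcont) y_cbm.
    apply: cbmD; first by apply: cbmM => //; exact: cbm_cst.
    apply: cbmM; first exact: cbm_cst.
    apply: cbmD; first exact: cbmM.
    by apply: (@cbm_ext _ (fun=> 0)) => [x _|]; [rewrite big_ord0|exact: cbm_cst].
  (* The Riccati polynomial is [gam (V - m) (V - conj m)], and [V - m = y w rr_0] cancels the factor
     [w^-1]. *)
  apply: (@filterS _ _ (ae_filter_ringOfSetsType mu) _ _ _ ham_gam) => x /= h x0.
  have [h1 h2 h3] := h x0; rewrite h3 h2 h1 V_E ?(ltW x0)// /m_tail_deriv /sq_tail big_ord0 addr0 /sig.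
  rewrite nc2E; move: (rr 0%N w x) => e0; move: (gam x) => c.
  have wn := w_neq0 w0; case: (m x) => a b /=.
  have -> : a +i* b = a%:C + 'i * b%:C :> C by apply: complex_eq; rewrite !(cReD, cImD, cReM, cImM)/=; ring.
  have -> : (c * (a ^+ 2 + b ^+ 2))%:C = c%:C * (a%:C ^+ 2 - ('i * b%:C) ^+ 2) :> C.
    by rewrite exprMn sqr_i mulN1r opprK -!rmorphXn -rmorphD -rmorphM.
  have -> : (2 * (- c * a))%:C = - 2 * c%:C * a%:C :> C by rewrite !rmorphM rmorphN rmorph_nat; ring.
  have -> : (c * b)%:C = c%:C * b%:C :> C by exact: rmorphM.
  move: (a%:C) (b%:C) (c%:C) => {}a {}b {}c; field.
  by rewrite wn.
have h := IH w w0 wr; have ha : prim (m_coef n) (m_coef_deriv n).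
  exact: (lim_prim rho0 IH (m_tail_ubd n.+1) (m_tail_deriv_ubd n.+1) (m_tail_E n) (m_tail_deriv_E n)).
have wn := w_neq0 w0.
apply: prim_ext (primZ w^-1 (primB h ha)) => x x0.
  by rewrite m_tail_E// mulKf.
by rewrite m_tail_deriv_E// mulKf.
Qed.

Lemma m_coef_prim n : prim (m_coef n) (m_coef_deriv n).
Proof. exact: (lim_prim rho0 (m_tail_prim n) (m_tail_ubd n.+1) (m_tail_deriv_ubd n.+1) (m_tail_E n) (m_tail_deriv_E n)). Qed.

Lemma y_prim : prim (fun x => y x) (fun x => (2 * sig x * complex.Re (e 0%N x) * complex.Im (m x))%:C).
Proof.
apply: prim_ext (prim_Im (m_coef_prim 0)) => // x x0; congr (_%:C).
by rewrite /m_coef_deriv addr0; case: (e 0%N x) => a b; rewrite !(cReD, cImD, cReM, cImM)/=; ring.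
Qed.

Lemma Re_prim : prim (fun x => (complex.Re (m x))%:C)
  (fun x => (- 2 * sig x * complex.Im (e 0%N x) * complex.Im (m x))%:C).
Proof.
apply: prim_ext (prim_Re (m_coef_prim 0)) => // x x0; congr (_%:C).
by rewrite /m_coef_deriv addr0; case: (e 0%N x) => a b; rewrite !(cReD, cImD, cReM, cImM)/=; ring.
Qed.

(** [e n] is [m_coef n.+1] divided by [y]; the logarithmic derivative [2 sig Re e_0] of [y] produces
    the last term. *)
Lemma e_prim n : prim (e n) (fun x => (sig x)%:C * (2 * 'i * e n.+1 x + cauchy_sum n x -
  2 * (complex.Re (e 0%N x))%:C * e n x)).
Proof.
apply: prim_ext (primM (m_coef_prim n.+1) (primV y_prim y_neq0)) => x x0; have yn := y_neq0 x0.
  by rewrite /= mulrC mulKf.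
rewrite /m_coef /m_coef_deriv; have -> : (2 * sig x * complex.Re (e 0%N x) * complex.Im (m x))%:C =
    2 * (sig x)%:C * (complex.Re (e 0%N x))%:C * y x by rewrite !rmorphM rmorph_nat.
by move: (cauchy_sum n x) (y x) yn => s a a0; field.
Qed.

End Hierarchy.

(** * Null sets under monotone Lipschitz maps *)

Section NullImage.
Variable R : realType.
Local Notation mu := (@lebesgue_measure R).

(** A nondecreasing map that does not increase distances sends an interval into one that is no
    longer, so a cover of [N] of small total length is carried over. *)
Lemma null_image_cover (N : set R) (f : R -> R) (e : R) : measurable N -> mu N = 0%E -> 0 < e ->
  (forall a b, 0 <= a -> a <= b -> f a <= f b /\ f b - f a <= b - a) ->
  exists A : set R, [/\ measurable A, (mu A <= e%:E)%E &
    forall x, 0 <= x -> N x -> A (f x)].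
Proof.
move=> mN N0 e0 hf.
have [F [Fi FN] Fe] : exists2 F : (set R)^nat, open_itv_cover N F &
    (\sum_(0 <= k <oo) (@wlength R idfun) (F k) <= e%:E)%E.
  have N0' : ((@wlength R idfun)^* N)%mu = 0%E by exact: N0.
  have : ((@wlength R idfun)^* N)%mu \is a fin_num by rewrite N0'.
  rewrite outer_measure_open_itv_cover => /lb_ereal_inf_adherent-/(_ _ e0)[_/= [F]] AF <-.
  by rewrite -outer_measure_open_itv_cover N0' add0e => /ltW ?; exists F.
have [ab habE] : {ab : nat -> R * R & forall k, F k = `](ab k).1, (ab k).2[%classic}.
  by apply: (@choice _ _ (fun k ab => F k = `](ab : R * R).1, ab.2[%classic)) => k; have [x hx] := Fi k; exists x.
(* End points are clamped to [[0, oo)], where [f] is controlled. *)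
pose G k := `[f (Num.max 0 (ab k).1), f (Num.max 0 (ab k).2)]%classic.
exists (\bigcup_k G k); split.
- by apply: bigcup_measurable => k _; exact: measurable_itv.
- apply: (le_trans _ Fe); apply: (le_trans (outer_measure_sigma_subadditive mu G)).
  apply: lee_nneseries => // k _.
  suff : (@lebesgue_measure R (G k) <= wlength idfun (F k))%E by [].
  rewrite habE wlength_itv/= lebesgue_measure_itv/=.
  move: (ab k) => -[a b] /=; rewrite !lte_fin.
  have [ba|ab'] := leP b a.
    have m1 : Num.max 0 b <= Num.max 0 a by rewrite ge_max !le_max lexx ba orbT.
    have m0 : 0 <= Num.max 0 b by rewrite le_max lexx.
    by have [h _] := hf _ _ m0 m1; rewrite ltNge h.
  have m1 : Num.max 0 a <= Num.max 0 b by rewrite ge_max !le_max lexx (ltW ab') orbT.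
  have m0 : 0 <= Num.max 0 a by rewrite le_max lexx.
  have [_ h] := hf _ _ m0 m1.
  have h2 : Num.max 0 b - Num.max 0 a <= b - a.
    by clear -ab'; have [h1|h1] := leP 0 a; have [h2|h2] := leP 0 b; lra.
  by case: ifP => _; rewrite -!EFinB lee_fin; clear -h h2 ab'; lra.
- move=> x x0 /FN[k _]; rewrite habE /= in_itv/= => /andP[ax xb]; exists k => //.
  have a0 : 0 <= Num.max 0 (ab k).1 by rewrite le_max lexx.
  have ax' : Num.max 0 (ab k).1 <= x by rewrite ge_max x0 ltW.
  have xb' : x <= Num.max 0 (ab k).2 by rewrite le_max (ltW xb) orbT.
  by rewrite /G/= in_itv/= (hf _ _ a0 ax').1 (hf _ _ x0 xb').1.
Qed.

(** If [g t] lies in the exceptional set, then [t = f (g t)] lies in its image under [f], a null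
    set. It serves with [f = tau] and [g = phi]. *)
Lemma ae_inverse_lip (P : R -> Prop) (f g : R -> R) :
  (forall a b, 0 <= a -> a <= b -> f a <= f b /\ f b - f a <= b - a) ->
  (forall t, 0 < t -> 0 < g t /\ f (g t) = t) ->
  {ae mu, forall x : R, 0 < x -> P x} -> {ae mu, forall t : R, 0 < t -> P (g t)}.
Proof.
move=> hf fg [N [mN N0 hN]].
have [A hA] : {A : nat -> set R & forall n, [/\ measurable (A n), (mu (A n) <= (n.+1%:R^-1)%:E)%E &
    forall x, 0 <= x -> N x -> A n (f x)]}.
  apply: (@choice _ _ (fun n A => [/\ measurable (A : set R), (mu A <= (n.+1%:R^-1)%:E)%E &
    forall x, 0 <= x -> N x -> A (f x)])) => n; apply: null_image_cover => //; rewrite invr_gt0.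
exists (\bigcap_n A n); split.
- by apply: bigcap_measurable => // n _; have [] := hA n.
- apply/eqP; rewrite eq_le measure_ge0 andbT; apply/lee_addgt0Pr => e e0; rewrite add0e.
  have [n hn] : exists n, n.+1%:R^-1 < e.
    by have [n _ h] := near_infty_natSinv_lt (PosNum e0); exists n; apply: (h n) => /=.
  have [mA hA1 _] := hA n; apply: (@le_trans _ _ (mu (A n))); last first.
    by apply: (le_trans hA1); rewrite lee_fin ltW.
  apply: le_measure; rewrite ?inE//; last exact: bigcap_inf.
  by apply: bigcap_measurable => // k _; have [] := hA k.
- move=> t /= ht n _; have [t0|t0] := ltP 0 t; last by exfalso; apply: ht => t1; rewrite ltNge t0 in t1.
  have [g0 gE] := fg t t0; rewrite -gE; have [_ _] := hA n; apply; first exact: ltW.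
  by apply: hN => /= h; apply: ht => _; exact: h.
Qed.

End NullImage.

(** * The new variable [tau] *)

Section Clock.
Variable R : realType.
Local Notation C := R[i].
Local Notation mu := (@lebesgue_measure R).
Variables (m : R -> C) (e0 : R -> C) (A : R).
Hypothesis m_hcont : hcont m.
Hypothesis m_gt0 : forall x, 0 <= x -> 0 < complex.Im (m x).
Hypothesis A_ge0 : 0 <= A.
Hypothesis e0_le : forall x, 0 <= x -> nc (e0 x) <= A.
Local Notation s := (sig m).
Hypothesis y_prim : prim (fun x => (complex.Im (m x))%:C)
  (fun x => (2 * s x * complex.Re (e0 x) * complex.Im (m x))%:C).
Hypothesis x_prim : prim (fun x => (complex.Re (m x))%:C)
  (fun x => (- 2 * s x * complex.Im (e0 x) * complex.Im (m x))%:C).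

Definition tau (x : R) : R := \int[mu]_(t in `[0, x]) s t.

Lemma tau_prim : prim (fun x => (tau x)%:C) (fun x => (s x)%:C).
Proof.
split; first exact: hcont_cbm (sig_hcont m_hcont).
by move=> x x0; rewrite cint_real Re_cint /tau set_itv1 Rintegral_set1 rmorph0 add0r.
Qed.

Lemma tau0 : tau 0 = 0. Proof. by rewrite /tau set_itv1 Rintegral_set1. Qed.

Lemma sig_le1 x : s x <= 1.
Proof.
rewrite /sig /gam mulrC ler_pdivrMr ?mul1r ?ltr_pwDl ?exprn_ge0 ?nc_ge0// nc2E.
by case: (m x) => a b /=; have := sqr_ge0 (b - 1); have := sqr_ge0 a; have := sqr_ge0 b; lra.
Qed.

Lemma tau_lip a b : 0 <= a -> a <= b -> tau a <= tau b /\ tau b - tau a <= b - a.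
Proof.
move=> a0 ab; have := primE tau_prim a0 ab => h.
have cs := hcont_cbm (sig_hcont m_hcont).
have E : tau b - tau a = complex.Re (cint a b (fun x => (s x)%:C)) by rewrite -h cReB.
split.
  rewrite -subr_ge0 E; have -> : 0 = complex.Re (cint a b (fun=> 0)) by rewrite cint_cst// mul0r.
  apply: Re_cint_le => //; first exact: cbm_cst.
  by move=> x /andP[ax _] /=; apply/ltW/(sig_gt0 m_gt0); exact: le_trans ax.
rewrite E; apply: le_trans (_ : complex.Re (cint a b (fun=> 1)) <= _).
  apply: Re_cint_le => //; first exact: cbm_cst.
  by move=> x _ /=; exact: sig_le1.
by rewrite cint_cst// mul1r.
Qed.

Lemma tau_lower L : exists2 d : R, 0 < d & forall a b, 0 <= a -> a <= b -> b <= L ->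
  d * (b - a) <= tau b - tau a.
Proof.
have [|d d0 hd] := hcont_lower L (sig_hcont m_hcont).
  by move=> x x0; rewrite -nc_gt0 ncR normr_gt0 gt_eqF// (sig_gt0 m_gt0).
exists d => // a b a0 ab bL; have cs := hcont_cbm (sig_hcont m_hcont).
have -> : tau b - tau a = complex.Re (cint a b (fun x => (s x)%:C)) by rewrite -(primE tau_prim a0 ab) cReB.
apply: (@le_trans _ _ (complex.Re (cint a b (fun=> d%:C)))).
  by rewrite cint_cst// cReM/= mulr0 subr0.
apply: Re_cint_le => //; first exact: cbm_cst.
move=> x /andP[ax xb] /=; have x0 := le_trans a0 ax.
by have := hd x; rewrite x0 (le_trans xb bL) ncR ger0_norm ?(ltW (sig_gt0 m_gt0 x0)) => // ->.
Qed.

(** If [tau] stayed below [T], the bounded hyperbolic speed would keep [m] in a compact part of the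
    upper half plane; [sig] would be bounded below by a positive constant and [tau] would grow
    linearly. *)
Lemma tau_unbounded T : exists2 x, 0 <= x & T <= tau x.
Proof.
apply: contrapT => hT.
have tT x : 0 <= x -> tau x <= T.
  by move=> x0; rewrite leNgt; apply/negP => /ltW h; apply: hT; exists x.
have T0 : 0 <= T by rewrite -tau0 tT.
have s0 x (x0 : 0 <= x) : 0 < s x := sig_gt0 m_gt0 x0.
have Gp : prim (fun x => (2 * A * tau x)%:C) (fun x => (2 * A * s x)%:C).
  apply: prim_ext (primZ (2 * A)%:C tau_prim) => x _; exact/esym/rmorphM.
have re x : 0 <= x -> - A <= complex.Re (e0 x) <= A.
  by move=> x0; rewrite -ler_norml (le_trans (nc_Re _))// e0_le.
have im x : 0 <= x -> `|complex.Im (e0 x)| <= A.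
  by move=> x0; rewrite (le_trans (nc_Im _))// e0_le.
(* [nc (e0 x) <= A] bounds the logarithmic derivative of [Im m] by [2 A sig], so [Im m] and its
   inverse both grow at most by the factor [K]. *)
pose K := expR (2 * A * T).
have K0 : 0 < K by exact: expR_gt0.
have tK x : 0 <= x -> expR (2 * A * tau x - 2 * A * tau 0) <= K.
  by move=> x0; rewrite tau0 mulr0 subr0 ler_expR ler_wpM2l ?mulr_ge0// tT.
have y00 := m_gt0 (lexx 0).
have yK x : 0 <= x -> complex.Im (m x) <= complex.Im (m 0) * K.
  move=> x0; apply: (le_trans (gronwall (lexx 0) x0 y_prim Gp _)); last first.
    by rewrite ler_wpM2l ?(ltW y00)// tK.
  move=> t /andP[t0 _]; have /andP[_ h] := re t t0.
  by rewrite ler_wpM2r ?(ltW (m_gt0 t0))// mulrAC ler_wpM2r ?(ltW (s0 t t0))// ler_wpM2l.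
have pV : prim (fun x => ((complex.Im (m x))^-1)%:C)
    (fun x => (- (2 * s x * complex.Re (e0 x)) * (complex.Im (m x))^-1)%:C).
  have yn x : 0 <= x -> (complex.Im (m x))%:C != 0 :> C.
    by move=> x0; rewrite -nc_gt0 ncR normr_gt0 gt_eqF// m_gt0.
  apply: prim_ext (primV y_prim yn) => x x0; first by rewrite complexV.
  have y0 := yn x x0; have -> : forall a b : R, (- a * b^-1)%:C = - a%:C * (b%:C)^-1 :> C.
    by move=> a b; rewrite -complexV -rmorphN -rmorphM.
  have -> : forall a b : R, (a * b)%:C = a%:C * b%:C :> C by move=> a b; exact: rmorphM.
  by field.
have yV x : 0 <= x -> (complex.Im (m x))^-1 <= (complex.Im (m 0))^-1 * K.
  move=> x0; apply: (le_trans (gronwall (lexx 0) x0 pV Gp _)); last first.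
    by rewrite ler_wpM2l ?invr_ge0 ?(ltW y00)// tK.
  move=> t /andP[t0 _]; have /andP[h _] := re t t0.
  rewrite ler_wpM2r ?invr_ge0 ?(ltW (m_gt0 t0))// -mulrN mulrAC ler_wpM2r ?(ltW (s0 t t0))//.
  by rewrite ler_wpM2l// lerNl.
pose Y := complex.Im (m 0) * K.
have Y0 : 0 < Y by exact: mulr_gt0.
have xK x : 0 <= x -> `|complex.Re (m x)| <= `|complex.Re (m 0)| + 2 * A * Y * T.
  move=> x0; have hb : rbm (fun t => 2 * A * Y * s t).
    by apply: rbmM; [exact: rbm_cst|exact: (hcont_cbm (sig_hcont m_hcont)).1].
  have : nc (cint 0 x (fun x => (- 2 * s x * complex.Im (e0 x) * complex.Im (m x))%:C)) <= 2 * A * Y * T.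
    apply: (le_trans (nc_cint (lexx 0) x_prim.1 hb _)).
      move=> t /andP[t0 _]; rewrite ncR 3!normrM normrN normr_nat.
      rewrite (gtr0_norm (s0 t t0)) (gtr0_norm (m_gt0 t0)).
      rewrite (_ : 2 * A * Y * s t = 2 * s t * A * Y); last by ring.
      have h1 : 0 <= 2 * s t by rewrite mulr_ge0// ltW// s0.
      have h2 : 2 * s t * `|complex.Im (e0 t)| <= 2 * s t * A by rewrite ler_wpM2l// im.
      exact: ler_pM (mulr_ge0 h1 (normr_ge0 _)) (ltW (m_gt0 t0)) h2 (yK t t0).
    have -> : complex.Re (cint 0 x (fun x => (2 * A * Y * s x)%:C)) = 2 * A * Y * tau x.
      have := primE (primZ (2 * A * Y)%:C tau_prim) (lexx 0) x0.
      rewrite tau0 mulr0 subr0 (@eq_cint _ _ _ _ (fun x => (2 * A * Y * s x)%:C)) => [<-|t _]; last exact/esym/rmorphM.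
      by rewrite cReM/= mulr0 subr0.
    by rewrite ler_wpM2l ?tT// !mulr_ge0// ltW.
  rewrite -(primE x_prim (lexx 0) x0) -rmorphB ncR.
  have := ler_normD (complex.Re (m x) - complex.Re (m 0)) (complex.Re (m 0)).
  by rewrite subrK => h1 h2; rewrite (le_trans h1)// addrC lerD2l.
pose X := `|complex.Re (m 0)| + 2 * A * Y * T.
(* A lower bound for [sig = Im m / (1 + |m|^2)], from the bounds on [1 / Im m], [Re m] and
   [Im m]. *)
pose d := ((complex.Im (m 0))^-1 * K * (1 + X ^+ 2 + Y ^+ 2))^-1.
have Q0 : 0 < 1 + X ^+ 2 + Y ^+ 2 by rewrite -addrA ltr_pwDl// addr_ge0 ?sqr_ge0.
have d0 : 0 < d by rewrite invr_gt0 !mulr_gt0// invr_gt0.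
have sd x : 0 <= x -> d <= s x.
  move=> x0; rewrite /sig /gam -[complex.Im (m x)]invrK -invfM lef_pV2 ?posrE; last first.
  - by rewrite mulr_gt0 ?invr_gt0 ?m_gt0// ltr_pwDl ?exprn_ge0 ?nc_ge0.
  - by rewrite !mulr_gt0// invr_gt0.
  rewrite mulrC; apply: ler_pM; rewrite ?invr_ge0 ?(ltW (m_gt0 x0)) ?addr_ge0 ?exprn_ge0 ?nc_ge0 ?yV//.
  rewrite nc2E -addrA lerD2l lerD//.
    by rewrite -[leLHS]real_normK ?num_real// lerXn2r ?nnegrE// ?(le_trans (normr_ge0 _) (xK x x0))// xK.
  by rewrite lerXn2r ?nnegrE ?(ltW (m_gt0 x0)) ?(ltW Y0)// yK.
have x10 : 0 <= (T + 1) / d by rewrite divr_ge0 ?addr_ge0 ?(ltW d0).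
have := tT _ x10.
have := prim_le (primB (prim_lin d) tau_prim) (lexx 0) x10.
rewrite !cReB tau0 mulr0/= subr0 => h.
have {}h : d * ((T + 1) / d) <= tau ((T + 1) / d).
  rewrite -subr_le0; apply: h => t /andP[t0 _] /=; rewrite subr_le0; exact: sd.
by move: h; rewrite mulrC divfK ?gt_eqF//; lra.
Qed.

End Clock.

(** * The inverse of [tau] and the normalized coefficient *)

Section Inverse.
Variable R : realType.
Local Notation C := R[i].
Local Notation mu := (@lebesgue_measure R).

Lemma is_derive_of_diff (F : R -> R) (x l : R) : (forall e : R, 0 < e ->
  exists2 d : R, 0 < d & forall y, `|y - x| < d -> `|F y - F x - l * (y - x)| <= e * `|y - x|) ->
  is_derive x (1 : R) F l.
Proof.
move=> h; have hc : h^-1 *: (F (h *: (1 : R) + x) - F x) @[h --> 0^'] --> l.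
  apply/cvgrPdist_le => e e0; have [d d0 hd] := h e e0; near=> v.
  have v0 : v != 0 by near: v; exact: nbhs_dnbhs_neq.
  have vd : `|v| < d by near: v; exact: dnbhs0_lt.
  have := hd (v + x); rewrite addrK => /(_ vd) h1.
  rewrite scaler1; have nv : 0 < `|v| by rewrite normr_gt0.
  rewrite -(ler_pM2r nv) -normrM; apply: le_trans h1; rewrite -normrN.
  rewrite le_eqVlt; apply/orP; left; apply/eqP; congr `|_|.
  by rewrite /GRing.scale/=; field.
by apply: DeriveDef; [apply/cvg_ex; exists l|exact: cvg_lim hc].
Unshelve. all: by end_near. Qed.

Variables (s tau : R -> R).
Hypothesis s_hcont : hcont (fun x => (s x)%:C).
Hypothesis s_gt0 : forall x, 0 <= x -> 0 < s x.
Hypothesis tau_prim : prim (fun x => (tau x)%:C) (fun x => (s x)%:C).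
Hypothesis tau0 : tau 0 = 0.
Hypothesis tau_lip : forall a b, 0 <= a -> a <= b -> tau a <= tau b /\ tau b - tau a <= b - a.
Hypothesis tau_lower : forall L, exists2 d : R, 0 < d & forall a b, 0 <= a -> a <= b -> b <= L ->
  d * (b - a) <= tau b - tau a.
Hypothesis tau_unbounded : forall T, exists2 x, 0 <= x & T <= tau x.

Lemma tau_strict a b : 0 <= a -> a < b -> tau a < tau b.
Proof.
move=> a0 ab; have [d d0 h] := tau_lower b; have := h a b a0 (ltW ab) (lexx b).
by rewrite -subr_gt0; apply: lt_le_trans; rewrite mulr_gt0// subr_gt0.
Qed.

Lemma tau_inj a b : 0 <= a -> 0 <= b -> tau a = tau b -> a = b.
Proof.
move=> a0 b0 E; apply/eqP; rewrite eq_le !leNgt; apply/andP; split; apply/negP.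
  by move=> /(tau_strict b0); rewrite E ltxx.
by move=> /(tau_strict a0); rewrite E ltxx.
Qed.

Lemma tau_surj t : 0 <= t -> exists2 x, 0 <= x & tau x = t.
Proof.
move=> t0; have [b b0 hb] := tau_unbounded t.
pose g y := complex.Re (tau (Num.max 0 y))%:C.
have [cg _] := hcont_rcont (prim_hcont tau_prim).
have [|c] := @IVT R g 0 b t b0 (continuous_subspaceT cg).
  have E0 : g 0 = 0 by rewrite /g /= maxxx tau0.
  have Eb : g b = tau b by rewrite /g /= max_r.
  by rewrite E0 Eb ge_min t0 le_max hb orbT.
rewrite in_itv/= => /andP[c0 _]; rewrite /g /= max_r// => E; by exists c.
Qed.

(** The density is continuous, so [tau] is differentiable at every point and not only almost
    everywhere; [phi] inherits this. *)
Lemma tau_diff x (e : R) : 0 <= x -> 0 < e -> exists2 d : R, 0 < d &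
  forall y, 0 <= y -> `|y - x| < d -> `|tau y - tau x - s x * (y - x)| <= e * `|y - x|.
Proof.
move=> x0 e0; have [d d0 hd] := s_hcont x0 e0; exists d => // y y0 yd.
have key a b : 0 <= a -> a <= b -> (forall t, a <= t <= b -> `|t - x| < d) ->
    `|tau b - tau a - s x * (b - a)| <= e * (b - a).
  move=> a0 ab near_x; have p := primB tau_prim (prim_lin (s x)).
  have := nc_cint_le a0 ab p.1 (B := e); rewrite -(primE p a0 ab).
  have -> : (tau b)%:C - (s x * b)%:C - ((tau a)%:C - (s x * a)%:C) = (tau b - tau a - s x * (b - a))%:C :> C.
    by apply: complex_eq; rewrite !(cReB, cImB)/=; ring.
  rewrite ncR; apply => t tab; have /andP[ta _] := tab.
  by apply/ltW/hd; [exact: le_trans ta|exact: near_x].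
have [xy|/ltW yx] := leP x y.
  rewrite (ger0_norm (_ : 0 <= y - x)) ?subr_ge0//; apply: key => // t /andP[xt ty].
  apply: le_lt_trans yd; rewrite !ger0_norm ?subr_ge0//; lra.
rewrite (distrC y) (ger0_norm (_ : 0 <= x - y)) ?subr_ge0//.
rewrite (_ : _ - _ - _ = - (tau x - tau y - s x * (x - y))) ?normrN; last by ring.
apply: key => // t /andP[yt tx]; apply: le_lt_trans yd.
by rewrite distrC (distrC y) !ger0_norm ?subr_ge0//; lra.
Qed.

Variable phi : R -> R.
Hypothesis phi_tau : forall t, 0 <= t -> 0 <= phi t /\ tau (phi t) = t.

Lemma phi_lip L : exists2 B : R, 0 < B & forall a b, 0 <= a -> a <= b -> b <= L ->
  0 <= phi b - phi a /\ phi b - phi a <= B * (b - a).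
Proof.
have [L0|L0] := ltP L 0.
  by exists 1 => // a b a0 ab bL; exfalso; lra.
have [d d0 h] := tau_lower (phi L); exists d^-1; first by rewrite invr_gt0.
move=> a b a0 ab bL; have b0 := le_trans a0 ab.
have mono u v : 0 <= u -> u <= v -> phi u <= phi v.
  move=> u0 uv; have v0 := le_trans u0 uv; rewrite leNgt; apply/negP => vu.
  have [p1 p2] := phi_tau u0; have [q1 q2] := phi_tau v0.
  by have := tau_strict q1 vu; rewrite p2 q2 ltNge uv.
have [p1 p2] := phi_tau a0; have [q1 q2] := phi_tau b0.
split; first by rewrite subr_ge0 mono.
rewrite mulrC ler_pdivlMr// mulrC; have := h _ _ p1 (mono _ _ a0 ab) (mono _ _ b0 bL).
by rewrite p2 q2.
Qed.

Lemma phi_change : change_of_variable phi.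
Proof.
have im t : 0 <= t -> 0 <= phi t by move=> t0; have [] := phi_tau t0.
split.
- split.
  + by move=> t; rewrite /= !in_itv/= !andbT; exact: im.
  + move=> a b; rewrite !inE/= !in_itv/= !andbT => a0 b0 E.
    by have [_ <-] := phi_tau a0; have [_ <-] := phi_tau b0; rewrite E.
  + move=> x; rewrite /= in_itv/= andbT => x0; have t0 : 0 <= tau x by rewrite -tau0; have [] := tau_lip (lexx 0) x0.
    exists (tau x); first by rewrite /= in_itv/= andbT.
    by have [p1 p2] := phi_tau t0; exact: tau_inj.
- move=> a b; rewrite !in_itv/= !andbT => a0 b0 ab; rewrite ltNge; apply/negP => ba.
  have [p1 p2] := phi_tau a0; have [q1 q2] := phi_tau b0.
  by have [] := tau_lip q1 ba; rewrite p2 q2 leNgt ab.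
- move=> L L0; have [B B0 h] := phi_lip L; apply: (abs_continuous_lip B0) => a b a0 ab bL.
  by have [h1 h2] := h a b a0 ab bL; rewrite ger0_norm.
- exists tau; first by move=> t; rewrite in_itv/= andbT => t0; have [_ ] := phi_tau t0.
  move=> L L0; apply: (abs_continuous_lip ltr01) => a b a0 ab bL.
  by have [h1 h2] := tau_lip a0 ab; rewrite ger0_norm ?subr_ge0// mul1r.
Qed.

Lemma phi_derive (t : R) : 0 < t -> is_derive t (1 : R) phi (s (phi t))^-1.
Proof.
move=> t0; apply: is_derive_of_diff => e e0; have [p1 p2] := phi_tau (ltW t0).
have [B B0 hB] := phi_lip (t + 1); have s0 := s_gt0 p1.
(* The factor [s (phi t)] comes from solving for the increment of [phi], and [B] from replacing this
   increment by that of [t]. *)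
have e10 : 0 < e * s (phi t) / B by rewrite divr_gt0 ?mulr_gt0.
have [d d0 hd] := tau_diff p1 e10.
pose del := Num.min t (Num.min 1 (d / B)).
exists del; first by rewrite !lt_min t0 ltr01 divr_gt0.
move=> u; rewrite !lt_min => /and3P[u1 u2 u3].
have u0 : 0 <= u by move: u1; rewrite ltr_norml; lra.
have [q1 q2] := phi_tau u0.
have lip : `|phi u - phi t| <= B * `|u - t|.
  have [ut|/ltW tu] := leP u t.
    rewrite distrC (distrC u); have [|h1 h2] := hB u t u0 ut; first by lra.
    by rewrite (ger0_norm h1) ger0_norm ?subr_ge0.
  have [|h1 h2] := hB t u (ltW t0) tu; first by move: u2; rewrite ltr_norml; lra.
  by rewrite (ger0_norm h1) ger0_norm ?subr_ge0.
have pd : `|phi u - phi t| < d.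
  by apply: le_lt_trans lip _; rewrite mulrC -ltr_pdivlMr.
have := hd _ q1 pd; rewrite p2 q2 => h.
rewrite -(ler_pM2l s0) -{1}(gtr0_norm s0) -normrM.
rewrite (_ : s (phi t) * _ = - (u - t - s (phi t) * (phi u - phi t))) ?normrN; last first.
  by field; rewrite gt_eqF.
apply: (le_trans h); apply: (le_trans (ler_wpM2l (ltW e10) lip)).
by rewrite le_eqVlt; apply/orP; left; apply/eqP; field; rewrite gt_eqF.
Qed.

(** The positive matrix of determinant one that represents the point [m x] of the upper half plane;
    almost everywhere it is [H / sig]. *)
Definition Kx (m : R -> C) (x : R) : 'M[R]_2 := \matrix_(i, j)
  if (i == 0) && (j == 0) then (complex.Im (m x))^-1
  else if (i == 1) && (j == 1) then complex.Re (m x) ^+ 2 / complex.Im (m x) + complex.Im (m x)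
  else - complex.Re (m x) / complex.Im (m x).

(** [K = H / sig] holds for almost every [x]; [ae_inverse_lip] moves this to almost every [t], and
    the factor is [phi' = 1 / sig]. *)
Lemma version_K (H : R -> 'M[R]_2) p q (m : R -> C) :
  {ae mu, forall x : R, 0 <= x ->
     [/\ H x 0 0 = p x, H x 0 1 = q x, H x 1 0 = q x & H x 1 1 = 1 - p x]} ->
  (forall x, 0 <= x -> 0 < complex.Im (m x)) -> (forall x, s x = sig m x) ->
  {ae mu, forall x : R, 0 < x ->
    [/\ p x = gam m x, q x = - gam m x * complex.Re (m x) & 1 - p x = gam m x * nc (m x) ^+ 2]} ->
  version_of H (fun t => Kx m (phi t)).
Proof.
move=> aeH m0 sE aep; exists phi; first exact: phi_change.
have good : {ae mu, forall x : R, 0 < x -> Kx m x = (s x)^-1 *: H x}.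
  apply: (@filterS2 _ _ (ae_filter_ringOfSetsType mu) _ _ _ _ aeH aep) => x /= h1 h2 x0.
  have [h11 h12 h21 h22] := h1 (ltW x0); have [g1 g2 g3] := h2 x0.
  have y0 := m0 _ (ltW x0); have g0 := gam_gt0 m x.
  apply/matrixP => i j; rewrite !mxE sE /sig.
  have N : nc (m x) ^+ 2 = complex.Re (m x) ^+ 2 + complex.Im (m x) ^+ 2 by rewrite nc2E.
  move: i j; apply: ord2P; apply: ord2P => /=.
  - by rewrite h11 g1; field; rewrite !gt_eqF.
  - by rewrite h12 g2; field; rewrite !gt_eqF.
  - by rewrite h21 g2; field; rewrite !gt_eqF.
  - by rewrite h22 g3 N; field; rewrite !gt_eqF.
have := ae_inverse_lip tau_lip _ good => /(_ phi).
have gt t : 0 < t -> 0 < phi t /\ tau (phi t) = t.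
  move=> t0; have [p1 p2] := phi_tau (ltW t0); split => //.
  by rewrite lt_def p1 andbT; apply: contraTneq t0 => E; rewrite -p2 E tau0 ltxx.
move=> /(_ gt); apply: (@filterS _ _ (ae_filter_ringOfSetsType mu)) => t h t0.
by have [d1 d2] := phi_derive t0; split => //; rewrite derive1E d2 h.
Qed.

Lemma det2 (A : 'M[R]_2) : \det A = A 0 0 * A 1 1 - A 0 1 * A 1 0.
Proof.
have l0 : lift 0 0 = 1 :> 'I_2 by apply: val_inj.
have l1 : lift 1 0 = 0 :> 'I_2 by apply: val_inj.
rewrite (expand_det_row _ 0) sum2 /cofactor !det_mx11 !mxE l0 l1 /=.
by rewrite addn0 addn1 expr0 expr1 mul1r mulN1r mulrN.
Qed.

Lemma det_K (m : R -> C) x : 0 < complex.Im (m x) -> \det (Kx m x) = 1.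
Proof. by move=> y0; rewrite det2 !mxE/=; field; rewrite gt_eqF. Qed.

End Inverse.

(** * Taylor coefficients in the variable [tau] *)

Section Chains.
Variable R : realType.
Local Notation C := R[i].

(** A value may depend on all earlier ones: [L k] is a table that is correct up to the index [k]. *)
Lemma course_of_values (T : Type) (a : T) (step : nat -> (nat -> T) -> T) :
  (forall k u v, (forall i, (i <= k)%N -> u i = v i) -> step k u = step k v) ->
  exists2 d : nat -> T, d 0%N = a & forall k, d k.+1 = step k d.
Proof.
move=> hs; pose L := fix L k : nat -> T :=
  if k is k'.+1 then fun i => if (i <= k')%N then L k' i else step k' (L k') else fun=> a.
have LE k i : (i <= k)%N -> L k i = L i i.
  elim: k => [|k IH]; first by rewrite leqn0 => /eqP ->.
  by rewrite leq_eqVlt => /predU1P[->//|]; rewrite ltnS /= => ik; rewrite ik IH.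
exists (fun k => L k k) => // k; rewrite /= ltnn; apply: hs => i ik; exact: LE.
Qed.

(** Summable weights whose convolution with themselves is at most a multiple of them, see
    [beta_conv]. *)
Definition beta (k : nat) : R := (k.+1%:R ^+ 2)^-1.

Lemma beta_gt0 k : 0 < beta k. Proof. by rewrite invr_gt0 exprn_gt0. Qed.

Lemma sum_beta n : \sum_(i < n) beta i <= 2.
Proof.
suff : \sum_(i < n.+1) beta i <= 2 - n.+1%:R^-1.
  have i0 : 0 < n.+1%:R^-1 :> R by rewrite invr_gt0.
  rewrite big_ord_recr [X in X <= _]/=; have := beta_gt0 n; move: (n.+1%:R^-1) i0 => t t0 b0 h.
  by move: h b0 t0; move: (beta n) (\sum_(_ < _) _) => b S; lra.
elim: n => [|n IH]; first by rewrite big_ord1 /beta expr1n invr1; lra.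
rewrite big_ord_recr [X in X <= _]/=; apply: le_trans (lerD IH (lexx _)) _.
have : beta n.+1 <= n.+1%:R^-1 - n.+2%:R^-1.
  rewrite /beta; have h1 : 0 < n.+1%:R :> R by [].
  rewrite -[n.+2%:R]natr1; move: (n.+1%:R) h1 => t t0; rewrite -subr_ge0.
  have t1 : t + 1 != 0 by rewrite gt_eqF// addr_gt0.
  have -> : t^-1 - (t + 1)^-1 - ((t + 1) ^+ 2)^-1 = (t * (t + 1) ^+ 2)^-1.
    by field; rewrite t1 gt_eqF.
  by rewrite invr_ge0 mulr_ge0 ?sqr_ge0 ?(ltW t0).
by move: (beta _) (_^-1) (_^-1) => a b c; lra.
Qed.

(** With [a = i + 1], [b = k - i + 1], the inequality [(a - b)^2 >= 0] gives [1 / (a b)^2 <= 2 / (a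
    + b)^2 (1 / a^2 + 1 / b^2)]. Here [a + b = k + 2] is constant, and each of the two sums of
    weights is at most 2. *)
Lemma beta_conv k : \sum_(i < k.+1) beta i * beta (k - i) <= 8 * beta k.
Proof.
have sym : \sum_(i < k.+1) beta (k - i) = \sum_(i < k.+1) beta i.
  by rewrite (reindex_inj rev_ord_inj); apply: eq_bigr => i _ /=; rewrite subSS subKn// -ltnS.
apply: (@le_trans _ _ (\sum_(i < k.+1) 2 * beta k.+1 * (beta i + beta (k - i)))); last first.
  rewrite -mulr_sumr big_split/= sym.
  have hb := sum_beta k.+1; have h0 : 0 <= beta k.+1 by exact: ltW (beta_gt0 _).
  have hk : beta k.+1 <= beta k.
    by rewrite lef_pV2 ?posrE ?exprn_gt0// lerXn2r ?nnegrE// ler_nat.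
  apply: le_trans (_ : 2 * beta k.+1 * 4 <= _); last by clear -hk; lra.
  by rewrite ler_wpM2l ?mulr_ge0//; clear -hb; lra.
apply: ler_sum => i _; rewrite /beta.
have ik : (i <= k)%N by rewrite -ltnS.
have E : k.+2%:R = i.+1%:R + (k - i).+1%:R :> R by rewrite -natrD addSn addnS subnKC.
rewrite E; have : 0 < i.+1%:R :> R by [].
have : 0 < (k - i).+1%:R :> R by [].
move: (i.+1%:R) ((k - i).+1%:R) => a b b0 a0.
have n0 : a + b != 0 by rewrite gt_eqF// addr_gt0.
rewrite -subr_ge0.
have -> : 2 * ((a + b) ^+ 2)^-1 * ((a ^+ 2)^-1 + (b ^+ 2)^-1) - (a ^+ 2)^-1 * (b ^+ 2)^-1 =
   (a - b) ^+ 2 / ((a + b) ^+ 2 * a ^+ 2 * b ^+ 2).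
  by field; rewrite n0 !gt_eqF.
by rewrite -!exprMn divr_ge0 ?sqr_ge0.
Qed.

Definition conv (u v : nat -> R -> C) k x := \sum_(i < k.+1) u i x * v (k - i)%N x.

(** The Leibniz rule [(a b)' = a' b + a b'] for Taylor coefficients. *)
Lemma conv_deriv (a b : nat -> C) k :
  \sum_(i < k.+1) (i.+1%:R * a i.+1 * b (k - i)%N + a i * ((k - i).+1%:R * b (k - i).+1)) =
  k.+1%:R * \sum_(i < k.+2) a i * b (k.+1 - i)%N.
Proof.
have E : k.+1%:R * \sum_(i < k.+2) a i * b (k.+1 - i)%N =
    \sum_(i < k.+2) i%:R * a i * b (k.+1 - i)%N + \sum_(i < k.+2) a i * ((k.+1 - i)%:R * b (k.+1 - i)%N).
  rewrite mulr_sumr -big_split/=; apply: eq_bigr => i _.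
  have ik : (i <= k.+1)%N by rewrite -ltnS.
  by rewrite -{1}(subnKC ik) natrD; ring.
rewrite E big_split/=; congr (_ + _).
  rewrite [RHS]big_ord_recl/= !mul0r add0r; apply: eq_bigr => i _.
  by rewrite /bump /= add1n subSS.
rewrite [RHS]big_ord_recr/= subnn mul0r mulr0 addr0; apply: eq_bigr => i _.
by rewrite subSn// -ltnS.
Qed.

Variable s : R -> R.

(** With [s = d tau / dx] this says [d c_k / d tau = (k + 1) c_{k+1}]: the [c k] are the Taylor
    coefficients of [c 0] in [tau]. *)
Definition chain_at (c : nat -> R -> C) k := prim (c k) (fun x => (s x)%:C * (k.+1%:R * c k.+1 x)).

Lemma conv_prim u v k : (forall i, (i <= k)%N -> chain_at u i) -> (forall i, (i <= k)%N -> chain_at v i) ->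
  prim (conv u v k) (fun x => (s x)%:C * (k.+1%:R * conv u v k.+1 x)).
Proof.
move=> hu hv.
have := @prim_sum R 'I_k.+1 (index_enum _) (fun i x => u i x * v (k - i)%N x) (fun i x => (s x)%:C * (i.+1%:R * u i.+1 x) * v (k - i)%N x +
    u i x * ((s x)%:C * ((k - i).+1%:R * v (k - i).+1 x))).
move=> /(_ _)[i|h1 h2].
  by apply: primM; [apply: hu; rewrite -ltnS|apply: hv; exact: leq_subr].
apply: prim_ext (conj h1 h2) => // x x0; rewrite /conv -(conv_deriv (u ^~ x) (v ^~ x)) mulr_sumr.
by apply: eq_bigr => i _; ring.
Qed.

Lemma chain_Re c k : chain_at c k -> chain_at (fun i x => (complex.Re (c i x))%:C) k.
Proof.
move=> /prim_Re; apply: prim_ext => // x _.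
have -> : k.+1%:R = (k.+1%:R : R)%:C :> C by rewrite rmorph_nat.
by rewrite -!rmorphM; congr (_%:C); rewrite !cReM/=; ring.
Qed.

Lemma chain_Im c k : chain_at c k -> chain_at (fun i x => (complex.Im (c i x))%:C) k.
Proof.
move=> /prim_Im; apply: prim_ext => // x _.
have -> : k.+1%:R = (k.+1%:R : R)%:C :> C by rewrite rmorph_nat.
by rewrite -!rmorphM; congr (_%:C); rewrite !(cReM, cImM)/=; ring.
Qed.

Lemma nc_sum_beta (F : nat -> C) (M : R) k : 0 <= M ->
  (forall i, (i <= k)%N -> nc (F i) <= M * (beta i * beta (k - i))) ->
  nc (\sum_(i < k.+1) F i) <= M * (8 * beta k).
Proof.
move=> M0 h; apply: (le_trans (nc_sum _ _ _)).
apply: (@le_trans _ _ (\sum_(i < k.+1) M * (beta i * beta (k - i)))).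
  by apply: ler_sum => i _; apply: h; rewrite -ltnS.
by rewrite -mulr_sumr ler_wpM2l// beta_conv.
Qed.

Lemma natC_neq0 k : k.+1%:R != 0 :> C. Proof. by rewrite pnatr_eq0. Qed.

Lemma nc_nat k : nc (k%:R : C) = k%:R.
Proof. by rewrite -(rmorph_nat (@real_complex R)) ncR normr_nat. Qed.

Lemma beta_step k : beta k / k.+1%:R <= 4 * beta k.+1.
Proof.
rewrite /beta -[k.+2%:R]natr1; have : 1 <= k.+1%:R :> R by rewrite ler1n.
move: (k.+1%:R) => t t1; have t0 : 0 < t by lra.
rewrite -subr_ge0; have -> : 4 * ((t + 1) ^+ 2)^-1 - (t ^+ 2)^-1 / t = (4 * t ^+ 3 - (t + 1) ^+ 2) / (t ^+ 3 * (t + 1) ^+ 2).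
  by field; rewrite !gt_eqF//; lra.
have d0 : 0 < t ^+ 3 * (t + 1) ^+ 2 by rewrite mulr_gt0 ?exprn_gt0// addr_gt0.
rewrite divr_ge0 ?(ltW d0)//.
have h1 : 0 <= t ^+ 2 * (t - 1) by rewrite mulr_ge0 ?sqr_ge0 ?subr_ge0.
have h2 : 0 <= (t - 1) * (3 * t + 1) by rewrite mulr_ge0 ?subr_ge0//; lra.
by lra.
Qed.

(* d k is the k-th Taylor coefficient of e 0 in the variable of which the
   derivative is s; the weights beta in both indices absorb the convolutions. *)
Lemma riccati_chain (e : nat -> R -> C) (K del : R) : 0 < K -> 0 < del ->
  (forall n x, 0 <= x -> nc (e n x) <= K / del ^+ n * beta n) ->
  (forall n, prim (e n) (fun x => (s x)%:C * (2 * 'i * e n.+1 x + \sum_(j < n.+1) e j x * e (n - j)%N x -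
     2 * (complex.Re (e 0%N x))%:C * e n x))) ->
  exists2 d : nat -> R -> C, (forall k, chain_at d k) /\ (forall x, d 0%N x = e 0%N x) &
    exists2 A : R, 0 < A & forall k x, 0 <= x -> nc (d k x) <= K * A ^+ k.
Proof.
move=> K0 del0 he pe.
(* [D k n] is the [k]-th Taylor coefficient of [e n]. The hierarchy expresses the derivative of
   [e n] by [e n.+1] and quadratic terms, so row [k + 1] is computed from the rows up to [k]. *)
pose step k (u : nat -> nat -> R -> C) n x := k.+1%:R^-1 * (2 * 'i * u k n.+1 x +
  \sum_(j < n.+1) conv (u ^~ j) (u ^~ (n - j)%N) k x -
  2 * conv (fun i x => (complex.Re (u i 0%N x))%:C) (u ^~ n) k x).
have [|D D0 DS] := @course_of_values _ e step.
  move=> k u v uv; apply/funext => n; apply/funext => x; rewrite /step uv//; congr (_ * (_ + _ - _ * _)).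
    apply: eq_bigr => j _; apply: eq_bigr => i _ /=.
    by rewrite !uv ?leq_subr// -ltnS.
  by apply: eq_bigr => i _ /=; rewrite !uv ?leq_subr// -ltnS.
have DE k n x : k.+1%:R * D k.+1 n x = 2 * 'i * D k n.+1 x +
  \sum_(j < n.+1) conv (D ^~ j) (D ^~ (n - j)%N) k x -
  2 * conv (fun i x => (complex.Re (D i 0%N x))%:C) (D ^~ n) k x.
  by rewrite DS mulrA mulfV ?mul1r// natC_neq0.
have Dc k : forall n, chain_at (D ^~ n) k.
  elim/ltn_ind: k => -[|k] IH n.
    rewrite /chain_at D0; apply: prim_ext (pe n) => // x x0.
    rewrite DE /conv big_ord1 /= subnn !D0; congr (_ * (_ + _ - _)); last by rewrite mulrA.
    by apply: eq_bigr => j _; rewrite big_ord1 /= ?subnn !D0.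
  have h1 := IH k (ltnSn k) n.+1.
  have h2 (j : nat) : prim (conv (D ^~ j) (D ^~ (n - j)%N) k) (fun x => (s x)%:C * (k.+1%:R * conv (D ^~ j) (D ^~ (n - j)%N) k.+1 x)).
    by apply: conv_prim => i ik; apply: IH; rewrite ltnS.
  have h3 : prim (conv (fun i x => (complex.Re (D i 0%N x))%:C) (D ^~ n) k)
      (fun x => (s x)%:C * (k.+1%:R * conv (fun i x => (complex.Re (D i 0%N x))%:C) (D ^~ n) k.+1 x)).
    by apply: conv_prim => i ik; [apply: chain_Re|]; apply: IH; rewrite ltnS.
  have h4 := @prim_sum R 'I_n.+1 (index_enum _) _ _ (fun j : 'I_n.+1 => h2 j).
  have := primZ k.+1%:R^-1 (primB (primD (primZ (2 * 'i) h1) h4) (primZ 2 h3)).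
  apply: prim_ext => x x0; first by rewrite DS.
  rewrite (DE k.+1) -mulr_sumr -mulr_sumr; have := natC_neq0 k; move: (k.+1%:R) => t t0.
  by field.
(* The linear term contributes [2 / del], the double convolution [8 * 8 * K], the last term
   [2 * 8 * K]; the factor 4 is the cost of [beta_step]. *)
pose A := 4 * (2 / del + 80 * K) + 1.
have A0 : 0 < A by rewrite /A ltr_wpDl// mulr_ge0// addr_ge0 ?divr_ge0 ?mulr_ge0 ?ltW.
have Db k : forall n x, 0 <= x -> nc (D k n x) <= K * A ^+ k / del ^+ n * (beta k * beta n).
  elim/ltn_ind: k => -[|k] IH n x x0.
    by rewrite D0 expr0 mulr1 (_ : beta 0 = 1) ?mul1r ?he// /beta expr1n invr1.
  have dn0 j : 0 < del ^+ j by exact: exprn_gt0.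
  have Ak0 j : 0 < A ^+ j by exact: exprn_gt0.
  pose Q := K * A ^+ k / del ^+ n * (beta k * beta n).
  have Q0 : 0 < Q by rewrite !mulr_gt0 ?invr_gt0 ?beta_gt0.
  have t1 : nc (2 * 'i * D k n.+1 x) <= 2 / del * Q.
    rewrite !ncM nc_nat nci mulr1 -mulrA ler_wpM2l//.
    apply: (le_trans (IH k (ltnSn k) n.+1 x x0)).
    have bn : beta n.+1 <= beta n.
      by rewrite lef_pV2 ?posrE ?exprn_gt0// lerXn2r ?nnegrE// ler_nat.
    rewrite exprS invfM /Q.
    have -> : K * A ^+ k * (del^-1 * del ^- n) * (beta k * beta n.+1) = del^-1 * (K * A ^+ k / del ^+ n * beta k) * beta n.+1 by ring.
    have -> : del^-1 * (K * A ^+ k / del ^+ n * (beta k * beta n)) = del^-1 * (K * A ^+ k / del ^+ n * beta k) * beta n by ring.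
    by rewrite ler_wpM2l// ltW// !mulr_gt0 ?invr_gt0 ?beta_gt0.
  have t2 : nc (\sum_(j < n.+1) conv (D ^~ j) (D ^~ (n - j)%N) k x) <= 64 * K * Q.
    apply: (le_trans (@nc_sum_beta (fun j => conv (D ^~ j) (D ^~ (n - j)%N) k x) (8 * K ^+ 2 * A ^+ k / del ^+ n * beta k) n _ _)).
    - by rewrite !mulr_ge0 ?invr_ge0 ?exprn_ge0 ?(ltW A0) ?(ltW K0) ?(ltW del0) ?(ltW (beta_gt0 _)).
    - move=> j jn; apply: (le_trans (@nc_sum_beta (fun i => D i j x * D (k - i)%N (n - j)%N x) (K ^+ 2 * A ^+ k / del ^+ n * (beta j * beta (n - j))) k _ _)).
      + by rewrite !mulr_ge0 ?invr_ge0 ?exprn_ge0 ?(ltW A0) ?(ltW K0) ?(ltW del0) ?(ltW (beta_gt0 _)).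
      + move=> i ik; rewrite ncM.
        have i1 : (i < k.+1)%N by rewrite ltnS.
        have i2 : (k - i < k.+1)%N by rewrite ltnS leq_subr.
        apply: (le_trans (ler_pM (nc_ge0 _) (nc_ge0 _) (IH i i1 j x x0) (IH _ i2 (n - j)%N x x0))).
        have -> : A ^+ k = A ^+ i * A ^+ (k - i) by rewrite -exprD subnKC.
        have -> : del ^+ n = del ^+ j * del ^+ (n - j) by rewrite -exprD subnKC.
        rewrite invfM.
        by rewrite le_eqVlt; apply/orP; left; apply/eqP; ring.
      + by rewrite le_eqVlt; apply/orP; left; apply/eqP; ring.
    - by rewrite le_eqVlt /Q; apply/orP; left; apply/eqP; ring.
  have t3 : nc (2 * conv (fun i x => (complex.Re (D i 0%N x))%:C) (D ^~ n) k x) <= 16 * K * Q.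
    rewrite ncM nc_nat.
    have : nc (conv (fun i x => (complex.Re (D i 0%N x))%:C) (D ^~ n) k x) <= (K ^+ 2 * A ^+ k / del ^+ n * beta n) * (8 * beta k).
      apply: (@nc_sum_beta (fun i => (complex.Re (D i 0%N x))%:C * D (k - i)%N n x)).
        by rewrite !mulr_ge0 ?invr_ge0 ?exprn_ge0 ?(ltW A0) ?(ltW K0) ?(ltW del0) ?(ltW (beta_gt0 _)).
      move=> i ik; rewrite ncM ncR.
      have i1 : (i < k.+1)%N by rewrite ltnS.
      have i2 : (k - i < k.+1)%N by rewrite ltnS leq_subr.
      have r1 := le_trans (nc_Re (D i 0%N x)) (IH i i1 0%N x x0).
      apply: (le_trans (ler_pM (normr_ge0 _) (nc_ge0 _) r1 (IH _ i2 n x x0))).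
      have -> : A ^+ k = A ^+ i * A ^+ (k - i) by rewrite -exprD subnKC.
      rewrite (_ : beta 0 = 1); last by rewrite /beta expr1n invr1.
      by rewrite expr0 invr1 le_eqVlt; apply/orP; left; apply/eqP; ring.
    rewrite /Q; clear; move: (nc _) => t; lra.
  have : nc (k.+1%:R * D k.+1 n x) <= (2 / del + 80 * K) * Q.
    rewrite DE; apply: le_trans (ncB _ _) _; have := ncD (2 * 'i * D k n.+1 x) (\sum_(j < n.+1) conv (D ^~ j) (D ^~ (n - j)%N) k x).
    by clear -t1 t2 t3; move: (nc _) (nc _) (nc _) (nc _) t1 t2 t3 => a b c d; rewrite mulrDl; lra.
  rewrite ncM nc_nat mulrC -ler_pdivlMr// => /le_trans; apply.
  have := beta_step k.
  rewrite /Q (_ : (2 / del + 80 * K) * _ / _ = K * A ^+ k / del ^+ n * beta n * (2 / del + 80 * K) * (beta k / k.+1%:R)); last by ring.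
  rewrite exprS (_ : K * (A * A ^+ k) / _ * _ = K * A ^+ k / del ^+ n * beta n * (A * beta k.+1)); last by ring.
  move=> h; rewrite -!mulrA; do 4 (rewrite ler_wpM2l ?(ltW K0) ?(ltW (Ak0 _)) ?invr_ge0 ?(ltW (dn0 _)) ?(ltW (beta_gt0 _))//).
  have c0 : 0 <= 2 / del + 80 * K by rewrite addr_ge0 ?divr_ge0 ?mulr_ge0 ?ltW.
  apply: (le_trans (ler_wpM2l c0 h)); rewrite mulrA ler_wpM2r ?(ltW (beta_gt0 _))//.
  by rewrite /A; clear -c0; lra.
exists (D ^~ 0%N); first by split => [k|x]; [exact: Dc|rewrite D0].
exists A => // k x x0; apply: le_trans (Db k 0%N x x0) _.
rewrite expr0 divr1 ger_pMr ?mulr_gt0 ?exprn_gt0// mulr_ile1 ?(ltW (beta_gt0 _))//.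
  by rewrite invf_le1 ?exprn_gt0// expr_ge1// ler1n.
by rewrite invf_le1 ?exprn_gt0// expr1n.
Qed.

End Chains.

(** * Holomorphic extension by Taylor series in [tau] *)

Section Analytic.
Variable R : realType.
Local Notation C := R[i].
Variables (s tau phi : R -> R).
Hypothesis s_le1 : forall x, 0 <= x -> 0 <= s x <= 1.
Hypothesis tau_prim : prim (fun x => (tau x)%:C) (fun x => (s x)%:C).
Hypothesis tau_mono : forall a b, 0 <= a -> a <= b -> tau a <= tau b.
Hypothesis tau0 : tau 0 = 0.
Hypothesis phi_tau : forall t, 0 <= t -> 0 <= phi t /\ tau (phi t) = t.

(** The constant may depend on [L], but the rate [A] may not: it determines the width of the strip
    of holomorphy. *)
Definition lbd (A : R) (c : nat -> R -> C) := forall L : R, exists2 B : R, 0 < B &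
  forall k x, 0 <= x -> x <= L -> nc (c k x) <= B * A ^+ k.

Lemma lbd_le A A' c : 0 <= A -> A <= A' -> lbd A c -> lbd A' c.
Proof.
move=> A0 AA h L; have [B B0 hB] := h L; exists B => // k x x0 xL.
by apply: le_trans (hB k x x0 xL) _; rewrite ler_wpM2l ?(ltW B0)// lerXn2r ?nnegrE// (le_trans A0).
Qed.

Definition chain c := forall k, chain_at s c k.

(** The rate doubles because the number [k + 1] of terms is absorbed by [2^k]. *)
Lemma conv_chain A u v : 0 <= A -> chain u -> chain v -> lbd A u -> lbd A v ->
  chain (conv u v) /\ lbd (2 * A) (conv u v).
Proof.
move=> A0 hu hv bu bv; split; first by move=> k; apply: conv_prim.
move=> L; have [B B0 hB] := bu L; have [B' B0' hB'] := bv L.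
exists (B * B'); first exact: mulr_gt0.
move=> k x x0 xL; apply: (le_trans (nc_sum _ _ _)).
apply: (@le_trans _ _ (\sum_(i < k.+1) B * B' * A ^+ k)).
  apply: ler_sum => i _; rewrite ncM.
  apply: (le_trans (ler_pM (nc_ge0 _) (nc_ge0 _) (hB i x x0 xL) (hB' (k - i)%N x x0 xL))).
  have ik : (i <= k)%N by rewrite -ltnS.
  have -> : A ^+ k = A ^+ i * A ^+ (k - i) by rewrite -exprD subnKC.
  by rewrite le_eqVlt; apply/orP; left; apply/eqP; ring.
rewrite sumr_const card_ord -[leLHS]mulr_natr exprMn.
rewrite (_ : B * B' * A ^+ k * k.+1%:R = B * B' * (k.+1%:R * A ^+ k)); last by ring.
rewrite ler_wpM2l ?(ltW (mulr_gt0 B0 B0'))//.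
by rewrite ler_wpM2r ?exprn_ge0// -natrX ler_nat; exact: succ_le_exp2.
Qed.

Lemma chainD A u v : chain u -> chain v -> lbd A u -> lbd A v ->
  chain (fun k x => u k x + v k x) /\ lbd A (fun k x => u k x + v k x).
Proof.
move=> hu hv bu bv; split.
  by move=> k; apply: prim_ext (primD (hu k) (hv k)) => // x _; ring.
move=> L; have [B B0 hB] := bu L; have [B' B0' hB'] := bv L.
exists (B + B'); first exact: addr_gt0.
by move=> k x x0 xL; apply: (le_trans (ncD _ _)); rewrite mulrDl lerD ?hB ?hB'.
Qed.

Lemma chainZ A (z : C) u : chain u -> lbd A u ->
  chain (fun k x => z * u k x) /\ lbd A (fun k x => z * u k x).
Proof.
move=> hu bu; split.
  by move=> k; apply: prim_ext (primZ z (hu k)) => // x _; ring.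
move=> L; have [B B0 hB] := bu L; have z0 := nc_ge0 z.
exists ((nc z + 1) * B); first by rewrite mulr_gt0// ltr_wpDl.
move=> k x x0 xL; rewrite ncM -mulrA; apply: ler_pM; rewrite ?nc_ge0 ?lerDl//; exact: hB.
Qed.

(** The chain of the derivative is shifted by one index and divided by it; [1 <= A] keeps the
    rate. *)
Lemma integral_chain A (X : R -> C) g : 1 <= A -> chain g -> lbd A g -> hcont X ->
  prim X (fun x => (s x)%:C * g 0%N x) ->
  exists2 c, c 0%N = X & [/\ c 1%N = g 0%N, chain c & lbd A c].
Proof.
move=> A1 hg bg cX pX; pose c k x := if k is j.+1 then j.+1%:R^-1 * g j x else X x.
have n0 j : j.+1%:R != 0 :> C by rewrite pnatr_eq0.
exists c => //; split.
- by apply/funext => x; rewrite /c invr1 mul1r.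
- case=> [|k]; first by apply: prim_ext pX => // x _; rewrite /c invr1 !mul1r.
  apply: prim_ext (primZ k.+1%:R^-1 (hg k)) => // x _; rewrite /c.
  by rewrite [k.+2%:R * _]mulVKf// mulrCA mulKf.
- move=> L; have [B B0 hB] := bg L; have [B' B0' hB'] := cbm_bound L (hcont_cbm cX).
  exists (B + B'); first exact: addr_gt0.
  case=> [|k] x x0 xL; first by rewrite expr0 mulr1 (le_trans (hB' x _)) ?x0 ?xL// lerDr ltW.
  rewrite /c ncM ncV nc_nat ler_pdivrMl// exprS.
  apply: (le_trans (hB k x x0 xL)); have A0 := lt_le_trans ltr01 A1.
  rewrite (_ : k.+1%:R * ((B + B') * (A * A ^+ k)) = (k.+1%:R * ((B + B') * A)) * A ^+ k); last by ring.
  rewrite ler_wpM2r ?exprn_ge0 ?(ltW A0)//.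
  have h1 : B <= (B + B') * A by rewrite -[leLHS]mulr1; apply: ler_pM => //; rewrite ?ltW// ltrDl.
  by rewrite (le_trans h1)// ler_peMl ?ler1n// mulr_ge0 ?(ltW A0)// addr_ge0 ?ltW.
Qed.

(** The Taylor coefficients of a solution of [dy / d tau = a y] satisfy
    [(k + 1) c_{k+1} = conv a c k]. Each of the [k + 1] terms is at most [K B (A + K)^k], so the
    division restores the rate [A + K]. *)
Lemma linear_chain A K (y : R -> C) a : 0 < A -> 0 < K -> chain a ->
  (forall k x, 0 <= x -> nc (a k x) <= K * A ^+ k) ->
  prim y (fun x => (s x)%:C * (a 0%N x * y x)) ->
  exists2 c, c 0%N = y & [/\ forall x, c 1%N x = a 0%N x * y x, chain c & lbd (A + K) c].
Proof.
move=> A0 K0 ha ba py.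
pose step k (u : nat -> R -> C) (x : R) := k.+1%:R^-1 * conv a u k x.
have [|c c0 cS] := @course_of_values _ y step.
  move=> k u v uv; apply/funext => x; congr (_ * _); apply: eq_bigr => i _.
  by rewrite uv ?leq_subr.
have n0 j : j.+1%:R != 0 :> C by rewrite pnatr_eq0.
have cE k x : k.+1%:R * c k.+1 x = conv a c k x by rewrite cS mulVKf.
exists c => //; split.
- by move=> x; rewrite cS /step invr1 mul1r /conv big_ord1 c0.
- elim/ltn_ind => -[|k] IH.
    by apply: prim_ext py => x _; rewrite ?c0// cE /conv big_ord1 c0.
  have h : prim (conv a c k) (fun x => (s x)%:C * (k.+1%:R * conv a c k.+1 x)).
    by apply: conv_prim => i ik; [exact: ha|apply: IH; rewrite ltnS].
  apply: prim_ext (primZ k.+1%:R^-1 h) => x _; first by rewrite cS.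
  by rewrite (cE k.+1) mulrCA mulKf.
- move=> L; have [B B0 hB] := cbm_bound L (prim_cbm py); exists B => // k x x0 xL.
  elim/ltn_ind: k => -[|k] IH; first by rewrite expr0 mulr1 c0 hB// x0.
  have AK : 0 < A + K by rewrite addr_gt0.
  rewrite cS ncM ncV nc_nat ler_pdivrMl//; apply: (le_trans (nc_sum _ _ _)).
  apply: (@le_trans _ _ (\sum_(i < k.+1) K * B * (A + K) ^+ k)); last first.
    rewrite sumr_const card_ord -[leLHS]mulr_natl ler_wpM2l// exprS mulrA ler_wpM2r ?exprn_ge0 ?(ltW AK)//.
    by rewrite mulrC ler_wpM2l ?(ltW B0)// lerDr ltW.
  apply: ler_sum => i _; rewrite ncM.
  have ik : (i <= k)%N by rewrite -ltnS.
  have ik2 : (k - i < k.+1)%N by rewrite ltnS leq_subr.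
  apply: (le_trans (ler_pM (nc_ge0 _) (nc_ge0 _) (ba i x x0) (IH _ ik2))).
  have -> : (A + K) ^+ k = (A + K) ^+ i * (A + K) ^+ (k - i) by rewrite -exprD subnKC.
  rewrite (_ : K * B * _ = K * (A + K) ^+ i * (B * (A + K) ^+ (k - i))); last by ring.
  rewrite ler_wpM2r ?mulr_ge0 ?exprn_ge0 ?(ltW B0) ?(ltW AK)//.
  by rewrite ler_wpM2l ?(ltW K0)// lerXn2r ?nnegrE ?(ltW A0) ?(ltW AK)// lerDl ltW.
Qed.

Definition taylor (c : nat -> R -> C) x z := csum (fun k => c k x * (z - (tau x)%:C) ^+ k).

Lemma power_prim z k : prim (fun x => (z - (tau x)%:C) ^+ k)
  (fun x => - (s x)%:C * (k%:R * (z - (tau x)%:C) ^+ k.-1)).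
Proof.
elim: k => [|k IH].
  by apply: prim_ext (prim_cst 1) => x _; rewrite ?expr0// mul0r mulr0.
have h := primB (prim_cst z) tau_prim.
apply: prim_ext (primM h IH) => x _; first by rewrite exprS.
by case: k {IH} => [|k] /=; rewrite ?mul0r ?expr0 ?expr1 -?[k.+2%:R]natr1 ?exprS; ring.
Qed.

(** Differentiation with respect to the centre telescopes, and only the last term survives. *)
Lemma partial_prim c z n : chain c -> prim (fun x => \sum_(k < n) c k x * (z - (tau x)%:C) ^+ k)
  (fun x => (s x)%:C * (n%:R * c n x * (z - (tau x)%:C) ^+ n.-1)).
Proof.
move=> hc; elim: n => [|n IH].
  by apply: prim_ext (prim_cst 0) => x _; rewrite ?big_ord0// !mul0r mulr0.
apply: prim_ext (primD IH (primM (hc n) (power_prim z n))) => x _; first by rewrite big_ord_recr.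
by move: (_ ^+ n.-1) => t; ring.
Qed.

Lemma nc_between (z : C) (a b t : R) : a <= t -> t <= b ->
  nc (z - t%:C) <= Num.max (nc (z - a%:C)) (nc (z - b%:C)).
Proof.
move=> at' tb; case: z => x y; have sq r : nc ((x +i* y) - r%:C) ^+ 2 = (x - r) ^+ 2 + y ^+ 2.
  by rewrite nc2E /= subr0.
have go r : (x - t) ^+ 2 <= (x - r) ^+ 2 -> nc ((x +i* y) - t%:C) <= nc ((x +i* y) - r%:C).
  by move=> h; rewrite -(@ler_pXn2r _ 2)// ?nnegrE ?nc_ge0// !sq lerD2r.
rewrite le_max; have [xt|tx] := leP x t; apply/orP; [right|left]; apply: go.
  rewrite -[leLHS]sqrrN -[leRHS]sqrrN lerXn2r ?nnegrE; lra.
rewrite lerXn2r ?nnegrE; lra.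
Qed.

Lemma four_point (T1 T2 S1 S2 : C) (b d : R) : nc (T1 - S1) <= b -> nc (T2 - S2) <= b ->
  nc (S2 - S1) <= d -> nc (T1 - T2) <= 2 * b + d.
Proof.
move=> h1 h2 h3; have := ncB (T1 - S1) (S2 - S1).
have := ncB (T1 - S1 - (S2 - S1)) (T2 - S2).
by rewrite (_ : T1 - S1 - (S2 - S1) - (T2 - S2) = T1 - T2); [lra|ring].
Qed.

(** By [partial_prim] a change of centre alters the partial sums by a term of order [(n + 1) 4^-n],
    which tends to 0; [nc_between] keeps the intermediate centres within the radius. *)
Lemma taylor_indep_le A c z x x' : 0 < A -> chain c -> lbd A c -> 0 <= x -> x <= x' ->
  nc (z - (tau x)%:C) < 1 / (4 * A) -> nc (z - (tau x')%:C) < 1 / (4 * A) ->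
  taylor c x z = taylor c x' z.
Proof.
move=> A0 hc bc x0 xx z1 z2; have x0' := le_trans x0 xx.
have [B B0 hB] := bc x'.
have zA u : x <= u -> u <= x' -> A * nc (z - (tau u)%:C) <= 1 / 4.
  move=> xu ux; have u0 := le_trans x0 xu.
  have h : nc (z - (tau u)%:C) < 1 / (4 * A).
    apply: le_lt_trans (nc_between z (tau_mono x0 xu) (tau_mono u0 ux)) _.
    by rewrite gt_max z1.
  have : A * nc (z - (tau u)%:C) <= A * (1 / (4 * A)) by rewrite ler_wpM2l ?ltW.
  by rewrite (_ : A * (1 / (4 * A)) = 1 / 4)//; field; rewrite gt_eqF.
have term u k : x <= u -> u <= x' -> nc (c k u * (z - (tau u)%:C) ^+ k) <= B * (1 / 4) ^+ k.
  move=> xu ux; rewrite ncM ncX; have u0 := le_trans x0 xu.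
  apply: (le_trans (ler_wpM2r (exprn_ge0 _ (nc_ge0 _)) (hB k u u0 ux))).
  rewrite -mulrA -exprMn ler_wpM2l ?(ltW B0)// lerXn2r ?nnegrE ?mulr_ge0 ?nc_ge0 ?(ltW A0)//.
  exact: zA.
have q2 : 0 <= 1 / 4 :> R by [].
have q3 : 1 / 4 <= 1 / 2 :> R by lra.
apply/eqP; rewrite -subr_eq0; apply/eqP.
pose D := B * A * (x' - x).
have D0 : 0 <= D by rewrite mulr_ge0 ?subr_ge0// mulr_ge0 ?ltW.
apply: (@csum_lim0 _ (4 * B + D)) => [|n]; first by rewrite addr_ge0// mulr_ge0 ?ltW.
have e1 := csumP q2 q3 (fun k => term x k (lexx x) xx) n.+1.
have e2 := csumP q2 q3 (fun k => term x' k xx (lexx x')) n.+1.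
have pp := partial_prim z n.+1 hc.
have e3 : nc (\sum_(k < n.+1) c k x' * (z - (tau x')%:C) ^+ k - \sum_(k < n.+1) c k x * (z - (tau x)%:C) ^+ k)
    <= n.+1%:R * (B * A) * (1 / 4) ^+ n * (x' - x).
  rewrite (primE pp x0 xx); apply: nc_cint_le => //; first exact: pp.1.
  move=> u /andP[xu ux]; have u0 := le_trans x0 xu; have /andP[s0 s1] := s_le1 u0.
  rewrite !ncM ncR nc_nat ncX /= (ger0_norm s0).
  rewrite -[leRHS]mul1r; apply: ler_pM => //.
    by rewrite !mulr_ge0 ?exprn_ge0 ?nc_ge0.
  rewrite -!mulrA ler_wpM2l//; have h := hB n.+1 u u0 ux.
  apply: (le_trans (ler_wpM2r (exprn_ge0 _ (nc_ge0 _)) h)).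
  rewrite exprS -!mulrA ler_wpM2l ?(ltW B0)// ler_wpM2l ?(ltW A0)// -exprMn.
  by rewrite lerXn2r ?nnegrE ?mulr_ge0 ?nc_ge0 ?(ltW A0)//; exact: zA.
have e4 : n.+1%:R * (B * A) * (1 / 4) ^+ n * (x' - x) <= D * (1 / 2) ^+ n.
  rewrite (_ : n.+1%:R * _ * _ * _ = D * (n.+1%:R * (1 / 4) ^+ n)); last by rewrite /D; ring.
  rewrite ler_wpM2l//; have -> : 1 / 4 = (1 / 2) * (1 / 2) :> R by rewrite mulf_div mulr1 -natrM.
  rewrite exprMn mulrA -[leRHS]mul1r ler_wpM2r ?exprn_ge0//.
  rewrite expr_div_n expr1n mulrA mulr1 ler_pdivrMr ?exprn_gt0// mul1r -natrX ler_nat.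
  exact: succ_le_exp2.
have e5 : (1 / 4) ^+ n.+1 <= (1 / 2) ^+ n :> R.
  rewrite exprS; apply: (@le_trans _ _ (1 * (1 / 4) ^+ n)); first by rewrite ler_wpM2r ?exprn_ge0// ler_pdivrMr// mul1r ler1n.
  by rewrite mul1r lerXn2r ?nnegrE.
have e6 : 2 * B * (1 / 4) ^+ n.+1 <= 2 * B * (1 / 2) ^+ n by rewrite ler_wpM2l// mulr_ge0 ?ltW.
apply: (le_trans (four_point (le_trans e1 e6) (le_trans e2 e6) (le_trans e3 e4))).
by rewrite le_eqVlt; apply/orP; left; apply/eqP; ring.
Qed.

Lemma csum_at0 (c : nat -> C) : csum (fun k => c k * 0 ^+ k) = c 0%N.
Proof.
have := @csumP R (fun k => c k * 0 ^+ k) (nc (c 0%N)) 0 (lexx 0) _ _ 1%N.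
rewrite big_ord1 expr0 mulr1 expr1 mulr0 => h; apply/eqP; rewrite -subr_eq0 -nc_eq0 eq_le nc_ge0 andbT.
by apply: h => // -[|k]; rewrite ?expr0 ?mulr1// !exprS !mul0r !mulr0 nc0.
Qed.

(** For each point of the strip a centre closer than [h] is selected. Any two admissible centres
    give the same series, so near a point [G] is the series of one fixed centre, and no continuation
    along discs is involved. *)
Lemma analytic_ext A c : 0 < A -> chain c -> lbd A c -> exists G : C -> C,
  (forall z, nbhd_halfline (1 / (8 * A)) z -> cdiff G z) /\
  forall t, 0 <= t -> G t%:C = c 0%N (phi t) /\ cderiv G t%:C (c 1%N (phi t)).
Proof.
move=> A0 hc bc; pose h := 1 / (8 * A).
have h0 : 0 < h by rewrite divr_gt0 ?mulr_gt0.
have h4 : h + h = 1 / (4 * A) by rewrite /h; field; rewrite gt_eqF.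
have [pick hp] : {pick : C -> R & forall z, nbhd_halfline h z -> 0 <= pick z /\ nc (z - (tau (pick z))%:C) < h}.
  apply: (@choice _ _ (fun z x => nbhd_halfline h z -> 0 <= x /\ nc (z - (tau x)%:C) < h)) => z.
  have [[x x0]|nz] := pselect (nbhd_halfline h z); last by exists 0.
  rewrite ncE ltcR => zx; have [p1 p2] := phi_tau (ltW x0).
  by exists (phi x) => _; rewrite p2.
have indep z x x' : 0 <= x -> 0 <= x' -> nc (z - (tau x)%:C) < 1 / (4 * A) ->
    nc (z - (tau x')%:C) < 1 / (4 * A) -> taylor c x z = taylor c x' z.
  move=> x0 x0' z1 z2; have [xx|/ltW xx] := leP x x'.
    exact: taylor_indep_le A0 hc bc x0 xx z1 z2.
  exact/esym/(taylor_indep_le A0 hc bc x0' xx z2 z1).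
have hh : h < 1 / (4 * A) by rewrite -h4; lra.
pose G z := taylor c (pick z) z.
have loc z x : 0 <= x -> nc (z - (tau x)%:C) < h -> exists2 d : R, 0 < d &
    forall v, nc (v - z) < d -> G v = taylor c x v.
  move=> x0 zx; exists (h - nc (z - (tau x)%:C)); first by rewrite subr_gt0.
  move=> v vz; have vx : nc (v - (tau x)%:C) < h.
    by apply: le_lt_trans (nc_distD z v _) _; rewrite -ltrBrDr.
  (* [nbhd_halfline] asks for a positive centre but [tau x] may be 0, so the centre is moved to the
     right by [dd]. *)
  have nv : nbhd_halfline h v.
    have tx : 0 <= tau x by rewrite -tau0 tau_mono.
    pose dd := (h - nc (v - (tau x)%:C)) / 2.
    have dd0 : 0 < dd by rewrite divr_gt0 ?subr_gt0.
    exists (tau x + dd); first exact: ltr_wpDl.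
    rewrite ncE ltcR rmorphD opprD addrA; apply: le_lt_trans (ncB _ _) _.
    by rewrite ncR (gtr0_norm dd0) /dd; lra.
  have [k0 k1] := hp v nv; apply: indep => //; [exact: lt_trans hh|exact: lt_trans hh].
have der z x : 0 <= x -> nc (z - (tau x)%:C) < h ->
    cderiv G z (csum (fun k => k.+1%:R * c k.+1 x * (z - (tau x)%:C) ^+ k)).
  move=> x0 zx e e0; have [d d0 hd] := loc z x x0 zx.
  have [B B0 hB] := bc x.
  have [d' d0' hd'] := @psum_cderiv R (c ^~ x) B A (z - (tau x)%:C) A0 (fun k => hB k x x0 (lexx x)) (lt_trans zx hh) e e0.
  exists (Num.min d d'); first by rewrite lt_min d0.
  have Gz : G z = taylor c x z by apply: hd; rewrite subrr nc0.
  move=> v; rewrite lt_min => /andP[vd vd']; rewrite (hd v vd) Gz.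
  have E : v - (tau x)%:C - (z - (tau x)%:C) = v - z by ring.
  by have := hd' (v - (tau x)%:C); rewrite E => /(_ vd').
exists G; split => [z /hp[x0 zx]|t t0]; first by exists (csum (fun k => k.+1%:R * c k.+1 (pick z) * (z - (tau (pick z))%:C) ^+ k)); exact: der.
have [p1 p2] := phi_tau t0; have tt : nc (t%:C - (tau (phi t))%:C : C) < h by rewrite p2 subrr nc0.
split.
  have [d d0 hd] := loc _ _ p1 tt; rewrite hd ?subrr ?nc0// /taylor p2 subrr.
  exact: csum_at0.
have := der _ _ p1 tt; rewrite p2 subrr (csum_at0 (fun k => k.+1%:R * c k.+1 (phi t))).
by rewrite mul1r.
Qed.

End Analytic.

(** * Positive matrices of determinant one *)

Section Matrices.
Variable R : realType.
Local Notation C := R[i].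

Lemma mx2P (V : Type) (A B : 'M[V]_2) : A 0 0 = B 0 0 -> A 0 1 = B 0 1 -> A 1 0 = B 1 0 ->
  A 1 1 = B 1 1 -> A = B.
Proof.
move=> h1 h2 h3 h4; apply/matrixP.
have h i : forall j, A i j = B i j by move: i; apply: ord2P; apply: ord2P.
exact: h.
Qed.

Definition smx (a b d : R) : 'M[R]_2 :=
  \matrix_(i, j) if (i == 0) && (j == 0) then a else if (i == 1) && (j == 1) then d else b.

Lemma smx_sym a b d : (smx a b d)^T = smx a b d.
Proof. by apply: mx2P; rewrite !mxE. Qed.

(** The operator norm is at most the Hilbert-Schmidt norm: for a unit vector the squares differ by a
    sum of two squares. *)
Lemma symmetric_opnorm (N : 'M[R]_2) (F : R) : N^T = N -> \tr (N *m N) <= F -> opnorm N <= Num.sqrt F.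
Proof.
move=> hN hF; apply: ge_sup.
  exists (enorm (N *m (\col_k (k == 0)%:R))) => /=; exists (\col_k (k == 0)%:R) => //=.
  by rewrite /enorm sum2 !mxE /= expr1n expr0n /= addr0 sqrtr1.
move=> _ [v /= hv <-]; rewrite /enorm; apply: ler_wsqrtr.
have v1 : v 0 0 ^+ 2 + v 1 0 ^+ 2 = 1.
  move: hv; rewrite /enorm sum2 => h; have := congr1 (fun x => x ^+ 2) h.
  by rewrite /= sqr_sqrtr ?expr1n// addr_ge0 ?sqr_ge0.
have n10 : N 1 0 = N 0 1 by rewrite -[in LHS]hN mxE.
move: hF; rewrite /mxtrace !sum2 !mxE !sum2 n10 => hF.
apply: le_trans hF; rewrite -[leRHS]mulr1 -v1.
move: (N 0 0) (N 0 1) (N 1 1) (v 0 0) (v 1 0) => a b d s t; rewrite -subr_ge0.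
have -> : (a * a + b * b + (b * b + d * d)) * (s ^+ 2 + t ^+ 2) - ((a * s + b * t) ^+ 2 + (b * s + d * t) ^+ 2) =
  (a * t - b * s) ^+ 2 + (b * t - d * s) ^+ 2 by ring.
by rewrite addr_ge0 ?sqr_ge0.
Qed.

(** For the inverse [N] of the matrix, of determinant one, Cayley-Hamilton gives
    [(N + 1)^2 = (tr N + 2) N], hence [S = (N + 1) / sqrt (tr N + 2)]. *)
Lemma invsqrt_smx (a b d : R) : 0 < a -> a * d - b ^+ 2 = 1 -> exists S : 'M[R]_2,
  [/\ is_invsqrtmx (smx a b d) S, S^T = S & S *m S = smx d (- b) a].
Proof.
move=> a0 det.
have d0 : 0 < d by rewrite -(pmulr_rgt0 _ a0); have := sqr_ge0 b; lra.
have t0 : 0 < a + d + 2 by lra.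
pose c := (Num.sqrt (a + d + 2))^-1.
have c0 : 0 < c by rewrite invr_gt0 sqrtr_gt0.
have cE : c ^+ 2 * (a + d + 2) = 1.
  by rewrite /c exprVn sqr_sqrtr ?(ltW t0)// mulVf// gt_eqF.
have SS : smx (c * (d + 1)) (- (c * b)) (c * (a + 1)) *m smx (c * (d + 1)) (- (c * b)) (c * (a + 1)) = smx d (- b) a.
  have b2 : b ^+ 2 = a * d - 1 by lra.
  apply: mx2P; rewrite !mxE sum2 !mxE /=.
  - transitivity (c ^+ 2 * ((d + 1) ^+ 2 + b ^+ 2)); first by ring.
    by rewrite b2 -[RHS]mulr1 -[X in _ = _ * X]cE; ring.
  - by rewrite -[RHS]mulr1 -[X in _ = _ * X]cE; ring.
  - by rewrite -[RHS]mulr1 -[X in _ = _ * X]cE; ring.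
  - transitivity (c ^+ 2 * ((a + 1) ^+ 2 + b ^+ 2)); first by ring.
    by rewrite b2 -[RHS]mulr1 -[X in _ = _ * X]cE; ring.
exists (smx (c * (d + 1)) (- (c * b)) (c * (a + 1))); split => //; last exact: smx_sym.
split; last first.
  by rewrite SS; apply: mx2P; rewrite !mxE sum2 !mxE /= ?mulr1n ?mulr0n -?[RHS]det; ring.
split; first exact: smx_sym.
move=> v; rewrite !mxE sum2 !mxE !sum2 !mxE /=; move: (v 0 0) (v 1 0) => s t.
have -> : (s * (c * (d + 1)) + t * - (c * b)) * s + (s * - (c * b) + t * (c * (a + 1))) * t =
  c * ((s ^+ 2 + t ^+ 2) + ((d * s - b * t) ^+ 2 + (a * d - b ^+ 2) * t ^+ 2) / d) by field; rewrite gt_eqF.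
rewrite det mul1r mulr_ge0 ?(ltW c0)// addr_ge0 ?addr_ge0 ?sqr_ge0//.
by rewrite divr_ge0 ?(ltW d0)// addr_ge0 ?sqr_ge0.
Qed.

(* In the upper half plane model, K is the point x + iy and D = d/dt K for the
   velocity (x', y') = (- 2 be y, 2 al y); its length in the invariant metric
   is a multiple of |al + i be|. *)
Lemma invariant_bound (x y al be : R) : 0 < y ->
  let K := smx y^-1 (- x / y) (x ^+ 2 / y + y) in
  let D := smx (- 2 * al / y) (2 * be + 2 * al * x / y) (- 4 * be * x - 2 * al * x ^+ 2 / y + 2 * al * y) in
  exists S, is_invsqrtmx K S /\ opnorm (S *m D *m S) <= Num.sqrt (8 * (al ^+ 2 + be ^+ 2)).
Proof.
move=> y0 K D; have yn : y != 0 by rewrite gt_eqF.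
have ai : 0 < y^-1 by rewrite invr_gt0.
have dE : y^-1 * (x ^+ 2 / y + y) - (- x / y) ^+ 2 = 1 by field.
have [S [hS sS SS]] := invsqrt_smx ai dE.
exists S; split => //; apply: symmetric_opnorm; first by rewrite !trmx_mul sS smx_sym mulmxA.
(* The trace becomes that of [(D K^-1)^2], which is twice the squared hyperbolic speed
   [4 (al^2 + be^2)]. *)
have -> : S *m D *m S *m (S *m D *m S) = S *m (D *m (S *m S) *m D *m S) by rewrite !mulmxA.
rewrite mxtrace_mulC -[X in \tr X]mulmxA SS.
rewrite le_eqVlt; apply/orP; left; apply/eqP.
by rewrite /mxtrace !(sum2, mxE) /=; field.
Qed.

Lemma halfline_derive_entries (K : R -> 'M[R]_2) (x : R) (D : 'M[R]_2) :
  (forall i j (e : R), 0 < e -> exists2 d : R, 0 < d & forall y, 0 <= y -> `|y - x| < d ->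
     `|K y i j - K x i j - D i j * (y - x)| <= e * `|y - x|) ->
  is_halfline_derive K x D.
Proof.
move=> h; apply/cvg_ballP => e e0.
have e2 : 0 < e / 2 by rewrite divr_gt0.
have [d1 d10 h1] := h 0 0 _ e2; have [d2 d20 h2] := h 0 1 _ e2.
have [d3 d30 h3] := h 1 0 _ e2; have [d4 d40 h4] := h 1 1 _ e2.
pose d := Num.min (Num.min d1 d2) (Num.min d3 d4).
have d0 : 0 < d by rewrite !lt_min d10 d20 d30 d40.
apply/nbhs_ballP; exists d => // y /=; rewrite /ball/= distrC => yd yx y0.
move: yd; rewrite !lt_min => /andP[/andP[y1 y2] /andP[y3 y4]].
have n0 : 0 < `|y - x| by rewrite normr_gt0 subr_eq0.
have key k (K' K'' : R) : `|K' - K'' - k * (y - x)| <= e / 2 * `|y - x| -> `|k - (y - x)^-1 * (K' - K'')| < e.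
  move=> hk; apply: (@le_lt_trans _ _ (e / 2)); last by rewrite ltr_pdivrMr// mulr_natr mulr2n ltrDl.
  rewrite -(ler_pM2r n0) -normrM; apply: le_trans hk; rewrite -normrN le_eqVlt; apply/orP; left; apply/eqP.
  by congr `|_|; field; rewrite subr_eq0.
have : forall i j, `|D i j - ((y - x)^-1 *: (K y - K x)) i j| < e.
  by apply: ord2P; apply: ord2P; rewrite !mxE; apply: key; [exact: h1|exact: h2|exact: h3|exact: h4].
by move=> hij; split.
Qed.

End Matrices.

(** * The analytic version of [H] *)

Section Assembly.
Variable R : realType.
Local Notation C := R[i].
Local Notation mu := (@lebesgue_measure R).

Lemma conv0 (u v : nat -> R -> C) x : conv u v 0 x = u 0%N x * v 0%N x.
Proof. by rewrite /conv big_ord1. Qed.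

Lemma conv1 (u v : nat -> R -> C) x : conv u v 1 x = u 0%N x * v 1%N x + u 1%N x * v 0%N x.
Proof. by rewrite /conv !big_ord_recl big_ord0 addr0. Qed.

Lemma real_cderiv (G : C -> C) (k : R -> R) (t d : R) : 0 <= t ->
  (forall y, 0 <= y -> G y%:C = (k y)%:C) -> cderiv G t%:C d%:C ->
  forall e : R, 0 < e -> exists2 del : R, 0 < del & forall y, 0 <= y -> `|y - t| < del ->
    `|k y - k t - d * (y - t)| <= e * `|y - t|.
Proof.
move=> t0 hG hd e e0; have [del del0 h] := hd e e0; exists del => // y y0 yt.
by have := h y%:C; rewrite !hG// -rmorphB ncR => /(_ yt); rewrite -rmorphM -!rmorphB ncR.
Qed.

(** Trades the radius [rho] for [rho / 4] to make room for the weight [beta] in the hypothesis of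
    [riccati_chain]. *)
Lemma exp4_beta n : 1 <= 4 ^+ n * beta R n.
Proof.
rewrite /beta ler_pdivlMr ?exprn_gt0// mul1r.
have -> : 4 = 2 ^+ 2 :> R by rewrite -natrX.
rewrite -exprM mulnC exprM lerXn2r ?nnegrE// -natrX ler_nat; exact: succ_le_exp2.
Qed.

Lemma analytic_version (H : R -> 'M[R]_2) (p q : R -> R) (m : R -> C) (e : nat -> R -> C) (rho : R) :
  {ae mu, forall x : R, 0 <= x ->
     [/\ H x 0 0 = p x, H x 0 1 = q x, H x 1 0 = q x & H x 1 1 = 1 - p x]} ->
  {ae mu, forall x : R, 0 < x ->
    [/\ p x = gam m x, q x = - gam m x * complex.Re (m x) & 1 - p x = gam m x * nc (m x) ^+ 2]} ->
  hcont m -> (forall x, 0 <= x -> 0 < complex.Im (m x)) -> 0 < rho ->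
  (forall n x, 0 <= x -> nc (e n x) <= (rho ^+ n.+1)^-1) ->
  prim (fun x => (complex.Im (m x))%:C)
    (fun x => (2 * sig m x * complex.Re (e 0%N x) * complex.Im (m x))%:C) ->
  prim (fun x => (complex.Re (m x))%:C)
    (fun x => (- 2 * sig m x * complex.Im (e 0%N x) * complex.Im (m x))%:C) ->
  (forall n, prim (e n) (fun x => (sig m x)%:C * (2 * 'i * e n.+1 x + cauchy_sum e n x -
     2 * (complex.Re (e 0%N x))%:C * e n x))) ->
  exists K : R -> 'M[R]_2,
     [/\ version_of H K,
         forall x : R, 0 <= x -> \det (K x) = 1,
         exists2 h : R, 0 < h & has_holomorphic_continuation K h &
         exists2 C : R, 0 < C &
           forall x : R, 0 <= x ->
             exists D S : 'M[R]_2,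
               [/\ is_halfline_derive K x D,
                   is_invsqrtmx (K x) S &
                   opnorm (S *m D *m S) <= C]].
Proof.
move=> aeH aep mc m0 rho0 eb py px pe.
have Ka0 : 0 < rho^-1 by rewrite invr_gt0.
have e0b x : 0 <= x -> nc (e 0%N x) <= rho^-1 by move=> x0; have := eb 0%N x x0; rewrite expr1.
have tp := tau_prim mc; have tl := tau_lip mc m0; have tlow := tau_lower mc m0.
have tu := tau_unbounded mc m0 (ltW Ka0) e0b py px.
have sc := sig_hcont mc; have s0 := sig_gt0 m0; have t00 := tau0 m.
have [phi hphi] : {phi : R -> R & forall t, 0 <= t -> 0 <= phi t /\ tau m (phi t) = t}.
  apply: (@choice _ _ (fun t x => 0 <= t -> 0 <= x /\ tau m x = t)) => t.
  have [t0|t0] := leP 0 t; last by exists 0.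
  by have [x x0 xt] := tau_surj tp t00 tu t0; exists x.
have tmono a b : 0 <= a -> a <= b -> tau m a <= tau m b by move=> a0 ab; have [] := tl a b a0 ab.
have s1 x : 0 <= x -> 0 <= sig m x <= 1 by move=> x0; rewrite (ltW (s0 x x0)) sig_le1.
have del0 : 0 < rho / 4 by rewrite divr_gt0.
have eb' n x : 0 <= x -> nc (e n x) <= rho^-1 / (rho / 4) ^+ n * beta R n.
  move=> x0; apply: (le_trans (eb n x x0)); rewrite exprS invfM expr_div_n invf_div -!mulrA ler_wpM2l ?(ltW Ka0)//.
  by rewrite mulrCA -[leLHS]mulr1 ler_wpM2l ?invr_ge0 ?exprn_ge0 ?(ltW rho0)//; exact: exp4_beta.
have [a [ac a0] [A A0 aA]] := riccati_chain Ka0 del0 eb' pe.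
pose aR k x := (complex.Re (a k x))%:C; pose aI k x := (complex.Im (a k x))%:C.
have cR : chain (sig m) aR by move=> k; apply: chain_Re.
have cI : chain (sig m) aI by move=> k; apply: chain_Im.
have bR k x : 0 <= x -> nc (aR k x) <= rho^-1 * A ^+ k.
  by move=> x0; rewrite ncR; apply: le_trans (nc_Re _) (aA k x x0).
have bI k x : 0 <= x -> nc (aI k x) <= rho^-1 * A ^+ k.
  by move=> x0; rewrite ncR; apply: le_trans (nc_Im _) (aA k x x0).
have lR : lbd A aR by move=> L; exists rho^-1 => // k x x0 _; exact: bR.
have lI : lbd A aI by move=> L; exists rho^-1 => // k x x0 _; exact: bI.
have K20 : 0 < 2 * rho^-1 by rewrite mulr_gt0.
have two : 2 = (2 : R)%:C :> C by rewrite rmorph_nat.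
have cM (u v : R) : (u * v)%:C = u%:C * v%:C :> C by exact: rmorphM.
have n2 : nc (2 : C) = 2 by exact: (nc_nat R 2).
have yn x : 0 <= x -> complex.Im (m x) != 0 by move=> x0; rewrite gt_eqF// m0.
(* [Im m] solves [dy / d tau = 2 Re (e_0) y], and its inverse the equation with the opposite
   sign. *)
have [Y Y0 [Y1 Yc Yl]] : exists2 c, c 0%N = (fun x => (complex.Im (m x))%:C) &
    [/\ forall x, c 1%N x = 2 * aR 0%N x * (complex.Im (m x))%:C, chain (sig m) c & lbd (A + 2 * rho^-1) c].
  apply: (linear_chain A0 K20 (chainZ 2 cR lR).1) => [k x x0|].
    by rewrite ncM n2 -mulrA ler_wpM2l// bR.
  apply: prim_ext py => // x _; rewrite /aR a0 !rmorphM rmorph_nat; ring.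
have [P P0 [P1 Pc Pl]] : exists2 c, c 0%N = (fun x => ((complex.Im (m x))^-1)%:C) &
    [/\ forall x, c 1%N x = -2 * aR 0%N x * ((complex.Im (m x))^-1)%:C, chain (sig m) c & lbd (A + 2 * rho^-1) c].
  apply: (linear_chain A0 K20 (chainZ (-2) cR lR).1) => [k x x0|].
    by rewrite ncM ncN n2 -mulrA ler_wpM2l// bR.
  have ync x : 0 <= x -> (complex.Im (m x))%:C != 0 :> C.
    by move=> x0; rewrite -nc_eq0 ncR normr_eq0 yn.
  apply: prim_ext (primV py ync) => x x0; first by rewrite complexV.
  have := ync x x0; rewrite /aR a0 complexV !cM two; move: (complex.Im (m x))%:C => t tn.
  by field.
(* Common rates: [B1] for the factors, [B2] for [X], [Y] and [P], and later [B4], which allows the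
   two successive products in [X^2 P]. *)
pose B1 := A + 2 * rho^-1; have B10 : 0 < B1 by rewrite addr_gt0.
have AB : A <= B1 by rewrite lerDl ltW.
have [gI lgI] := chainZ (-2) cI (lbd_le (ltW A0) AB lI).
have [gc gl] := conv_chain (ltW B10) gI Yc lgI Yl.
pose B2 := 2 * B1 + 1; have B20 : 1 <= B2 by rewrite lerDr mulr_ge0 ?ltW.
have B2p : 0 < B2 by exact: lt_le_trans B20.
have B12 : B1 <= B2 by rewrite /B2; lra.
have B22 : 2 * B1 <= B2 by rewrite /B2; lra.
have Yl2 := lbd_le (ltW B10) B12 Yl; have Pl2 := lbd_le (ltW B10) B12 Pl.
have gl2 := lbd_le (mulr_ge0 (ler0n R 2) (ltW B10)) B22 gl.
(* [Re m] is an integral in [tau] of [- 2 Im (e_0) Im m], a product of chains already at hand. *)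
have [X X0 [X1 Xc Xl]] : exists2 c, c 0%N = (fun x => (complex.Re (m x))%:C) &
    [/\ c 1%N = conv (fun k x => -2 * aI k x) Y 0, chain (sig m) c & lbd B2 c].
  apply: (integral_chain B20 gc gl2 (prim_hcont px)).
  apply: prim_ext px => // x _; rewrite conv0 Y0 /aI a0 !rmorphM rmorphN rmorph_nat; ring.
pose B4 := 2 * (2 * B2); have B40 : 0 < B4 by rewrite !mulr_gt0.
have l24 c : lbd B2 c -> lbd B4 c by apply: lbd_le; rewrite ?(ltW B2p)// /B4; lra.
have l24' c : lbd (2 * B2) c -> lbd B4 c.
  by apply: lbd_le; rewrite ?mulr_ge0 ?(ltW B2p)// /B4; lra.
have [xpc xpl] := conv_chain (ltW B2p) Xc Pc Xl Pl2.
have [c12 l12] := chainZ (-1) xpc (l24' _ xpl).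
have [xxc xxl] := conv_chain (ltW B2p) Xc Xc Xl Xl.
have B22p : 0 <= 2 * B2 by rewrite mulr_ge0 ?ltW.
have B2le : B2 <= 2 * B2 by lra.
have [xxpc xxpl] := conv_chain B22p xxc Pc xxl (lbd_le (ltW B2p) B2le Pl2).
have [c22 l22] := chainD xxpc Yc xxpl (l24 _ Yl2).
(* The entries of [K] are [P = 1 / y], [- X P] and [X^2 P + Y]. *)
have [G11 [h11 v11]] := analytic_ext s1 tp tmono t00 hphi B40 Pc (l24 _ Pl2).
have [G12 [h12 v12]] := analytic_ext s1 tp tmono t00 hphi B40 c12 l12.
have [G22 [h22 v22]] := analytic_ext s1 tp tmono t00 hphi B40 c22 l22.
pose x_ t := complex.Re (m (phi t)); pose y_ t := complex.Im (m (phi t)).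
have KE t : Kx m (phi t) = smx (y_ t)^-1 (- x_ t / y_ t) (x_ t ^+ 2 / y_ t + y_ t).
  by apply: mx2P; rewrite !mxE.
have g11 t : 0 <= t -> G11 t%:C = ((y_ t)^-1)%:C by move=> t0; rewrite (v11 t t0).1 P0.
have g12 t : 0 <= t -> G12 t%:C = (- x_ t / y_ t)%:C.
  by move=> t0; rewrite (v12 t t0).1 conv0 X0 P0 mulN1r -rmorphM -rmorphN mulNr.
have g22 t : 0 <= t -> G22 t%:C = (x_ t ^+ 2 / y_ t + y_ t)%:C.
  by move=> t0; rewrite (v22 t t0).1 !conv0 X0 P0 Y0 -!rmorphM -rmorphD -expr2.
pose al t := complex.Re (e 0%N (phi t)); pose be t := complex.Im (e 0%N (phi t)).
have aRE t : aR 0%N (phi t) = (al t)%:C by rewrite /aR a0.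
have aIE t : aI 0%N (phi t) = (be t)%:C by rewrite /aI a0.
have P1E t : P 1%N (phi t) = (- 2 * al t / y_ t)%:C.
  by rewrite P1 aRE two -rmorphN -!rmorphM.
have Y1E t : Y 1%N (phi t) = (2 * al t * y_ t)%:C.
  by rewrite Y1 aRE two -!rmorphM.
have X1E t : X 1%N (phi t) = (- 2 * be t * y_ t)%:C.
  by rewrite X1 conv0 Y0 aIE two -rmorphN -!rmorphM.
have d11 t : 0 <= t -> cderiv G11 t%:C (- 2 * al t / y_ t)%:C.
  by move=> t0; rewrite -P1E; exact: (v11 t t0).2.
have d12 t : 0 <= t -> cderiv G12 t%:C (2 * be t + 2 * al t * x_ t / y_ t)%:C.
  move=> t0; have := (v12 t t0).2; rewrite conv1 P1E X1E X0 P0 -!rmorphM -rmorphD mulN1r -rmorphN.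
  have yt : y_ t != 0 by apply: yn; have [] := hphi t t0.
  by congr (cderiv _ _ _%:C); rewrite -/(x_ t) -/(y_ t); field.
have d22 t : 0 <= t -> cderiv G22 t%:C (- 4 * be t * x_ t - 2 * al t * x_ t ^+ 2 / y_ t + 2 * al t * y_ t)%:C.
  move=> t0; have := (v22 t t0).2; rewrite !conv1 !conv0 P1E X1E Y1E X0 P0 -!(rmorphM, rmorphD).
  have yt : y_ t != 0 by apply: yn; have [] := hphi t t0.
  by congr (cderiv _ _ _%:C); rewrite -/(x_ t) -/(y_ t); field.
have pt t : 0 <= t -> 0 < y_ t by move=> /hphi[p0 _]; exact: m0.
exists (fun t => Kx m (phi t)); split.
- exact: (version_K sc s0 tp t00 tl tlow hphi aeH m0 (fun x => erefl) aep).
- by move=> t /hphi[p0 _]; apply: det_K; exact: m0.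
- exists (1 / (8 * B4)); first by rewrite divr_gt0 ?mulr_gt0.
  exists (fun z => \matrix_(i, j) if (i == 0) && (j == 0) then G11 z else
    if (i == 1) && (j == 1) then G22 z else G12 z) => [z hz|t t0].
    have ext (F F' : C -> C) : (forall w, F w = F' w) -> derivable F' z 1 -> derivable F z 1.
      by move=> /funext ->.
    have e11 := (cdiff_derivable G11 z).1 (h11 z hz); have e12 := (cdiff_derivable G12 z).1 (h12 z hz).
    have e22 := (cdiff_derivable G22 z).1 (h22 z hz).
    apply: ord2P; apply: ord2P; [apply: ext e11|apply: ext e12|apply: ext e12|apply: ext e22];
      by move=> w; rewrite mxE.
  by rewrite KE; apply: mx2P; rewrite !mxE/= ?g11 ?g12 ?g22.
(* The constant of [invariant_bound] for [al^2 + be^2 = |e_0|^2 <= 1 / rho^2]. *)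
- exists (Num.sqrt (8 * rho^-1 ^+ 2)); first by rewrite sqrtr_gt0 mulr_gt0// exprn_gt0.
  move=> t t0; have [S [hS oS]] := invariant_bound (x_ t) (al t) (be t) (pt t t0).
  eexists; exists S; split; [|by rewrite KE; exact: hS|apply: le_trans oS _]; last first.
    apply: ler_wsqrtr; rewrite ler_wpM2l// -nc2E lerXn2r ?nnegrE ?nc_ge0 ?(ltW Ka0)//.
    by apply: e0b; have [] := hphi t t0.
  have r11 := real_cderiv t0 g11 (d11 t t0); have r12 := real_cderiv t0 g12 (d12 t t0).
  have r22 := real_cderiv t0 g22 (d22 t t0).
  apply: halfline_derive_entries; apply: ord2P; apply: ord2P => e1 e10.
  + by have [d d0 hd] := r11 e1 e10; exists d => // y y0 yd; rewrite !KE !mxE/=; exact: hd.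
  + by have [d d0 hd] := r12 e1 e10; exists d => // y y0 yd; rewrite !KE !mxE/=; exact: hd.
  + by have [d d0 hd] := r12 e1 e10; exists d => // y y0 yd; rewrite !KE !mxE/=; exact: hd.
  + by have [d d0 hd] := r22 e1 e10; exists d => // y y0 yd; rewrite !KE !mxE/=; exact: hd.
Qed.

End Assembly.

Unset Implicit Arguments.

Theorem theorem1p3 (R : realType) (H : R -> 'M[R]_2)
    (H_canonical : canonical_system H)
    (r : R) (r_gt0 : 0 < r) (M : R[i] -> sphere R)
    (M_holomorphic : forall w : R[i], `|w| < r%:C -> sphere_holomorphic_at M w)
    (M_values : forall w : R[i], `|w| < r%:C -> closed_upper (M w))
    (M_mplus : forall z : R[i], 0 < complex.Im z -> (1 / r)%:C < `|z| ->
       is_mplus H z (M (- 1 / z))) :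
  (exists2 alpha : R, 0 <= alpha < pi &
     {ae @lebesgue_measure R, forall x : R, 0 <= x -> H x = Pmx alpha}) \/
  (exists K : R -> 'M[R]_2,
     [/\ version_of H K,
         forall x : R, 0 <= x -> \det (K x) = 1,
         exists2 h : R, 0 < h & has_holomorphic_continuation K h &
         exists2 C : R, 0 < C &
           forall x : R, 0 <= x ->
             exists D S : 'M[R]_2,
               [/\ is_halfline_derive K x D,
                   is_invsqrtmx (K x) S &
                   opnorm (S *m D *m S) <= C]]).
Proof.
have [p [q [hH aeH]]] := canonical_ham H_canonical.
pose f := @cayley R \o M.
have fd (w : R[i]) : nc w < r -> cdiff f w.
  move=> wr; apply: (cayley_cdiff wr) => [v vr|].
    by apply: M_values; rewrite ncE ltcR.
  by apply: M_holomorphic; rewrite ncE ltcR.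
have Uge0 := weyl_disc hH H_canonical aeH r_gt0 M_values M_mplus; rewrite -/f in Uge0.
have r2 : 0 < r / 2 by rewrite divr_gt0.
have rr : r / 2 < r by lra.
(* The centre has modulus at most 1; the alternative is whether 1 is attained at some [x]. *)
have [[x x0 cx]|nc1] := pselect (exists2 x, 0 <= x & nc (center p q f r x) = 1).
  left; have [a a0 ha] := degenerate hH r_gt0 fd Uge0 x0 cx.
  by exists a => //; exact: projection_H aeH ha.
right.
have clt x : 0 <= x -> nc (center p q f r x) < 1.
  move=> x0; rewrite lt_neqAle; apply/andP; split.
    by apply/eqP => h; apply: nc1; exists x.
  have [b [b0 b1 _]] := removable (Phi_pholo hH fd Uge0 x0) (Phi_bound hH Uge0 x0) r2 rr.
  by have := b1 0%N; rewrite b0 expr0 divr1.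
have [rho [e [rm [rho0 hexp]]]] := expansion hH r_gt0 fd Uge0 clt.
have mc := m_center_hcont hH r_gt0 fd Uge0 clt; have mp := im_center_gt0 clt.
pose V w x := U1 p q f x w / U2 p q f x w.
have Vp w : 0 < nc w -> nc w <= rho -> prim (V w) (fun x => w^-1 * ((p x)%:C * V w x ^+ 2 +
    (2 * q x)%:C * V w x + (1 - p x)%:C)).
  move=> w0 wr; have U20 x : 0 <= x -> U2 p q f x w != 0.
    by move=> x0; have [_ /(_ w w0 wr)[]] := hexp x x0.
  apply: prim_ext (ratio_prim hH (U_sol hH f w) U20) => // x x0.
  by rewrite /zw mulN1r opprK.
have VE w x : 0 < nc w -> nc w <= rho -> 0 <= x -> V w x = m_center p q f r x + (im_center p q f r x)%:C * (w * rm 0%N w x).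
  by move=> w0 wr x0; have [_ /(_ w w0 wr)[]] := hexp x x0.
have rb n w x : 0 < nc w -> nc w <= rho -> 0 <= x -> nc (rm n w x) <= 2 / rho ^+ n.+1.
  by move=> w0 wr x0; have [_ /(_ w w0 wr)[]] := hexp x x0.
have rE n w x : 0 < nc w -> nc w <= rho -> 0 <= x -> rm n w x = e n x + w * rm n.+1 w x.
  by move=> w0 wr x0; have [_ /(_ w w0 wr)[]] := hexp x x0.
have eb n x : 0 <= x -> nc (e n x) <= (rho ^+ n.+1)^-1 by move=> x0; have [] := hexp x x0.
apply: (analytic_version aeH (ham_gam hH rho0 Vp mc mp VE rb) mc mp rho0 eb).
- exact: (y_prim hH rho0 Vp mc mp VE rb rE).
- exact: (Re_prim hH rho0 Vp mc mp VE rb rE).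
- exact: (e_prim hH rho0 Vp mc mp VE rb rE).
Qed.
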